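(* Let $\eta$ be a meromorphic two-form on a smooth complex projective surface $S$ such that $-\mathrm{Div}(\eta)$ is equal to a reduced smooth curve $C_S$. Then any rational map $f:S\dashrightarrow S$ that preserves $\eta$ is corrigible.
   Context: All surfaces are smooth complex projective; curves may be reducible (here, disconnected). $f$ preserves $\eta$ if $f^*\eta=\delta\eta$ for some $\delta\in\mathbf{C}^*$. A modification is a composition of finitely many point blowups. A modification $\pi_X:X\to S$ is an elaboration of $\eta$ if $\pi_X^*\eta$ has no zeros; a further elaboration is a modification $\pi:Y\to X$ such that $(\pi_X\circ\pi)^*\eta$ has no zeros. The lift of $f$ to $Y$ is its conjugate by $\pi_X\circ\pi$. A rational self-map $g:Y\dashrightarrow Y$ is algebraically stable if $(g^n)^*=(g^* )^n$ on $\mathrm{Pic}(Y)$ for all $n\in\mathbf{N}$, where for $g=\pi_2\circ\pi_1^{-1}$, with $\pi_1:\Gamma\to Y$ a modification and $\pi_2:\Gamma\to Y$ holomorphic, $g^*=\pi_{1*}\pi_2^*$. $f$ is corrigible if for every elaboration $\pi_X:X\to S$ of $\eta$ there is a further elaboration $\pi:Y\to X$ such that the lift of $f$ to $Y$ is algebraically stable. *)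

(* Defs.v *)
(* Smooth complex projective surfaces up to birational equivalence, in the
   classical language of projective models of a function field.

   K is a field containing C = R[i] through iota. A projective variety with
   function field K is given by the homogeneous coordinates, in K, of its
   generic point; its ideal is generated by the homogeneous polynomials over C
   that vanish at the generic point. A birational morphism pi : X -> S
   identifies C(X) with C(S) by pi^*, so that every modification of S is a
   model of the same field K, pi^* eta is the same two-form over K as eta, and
   a dominant rational self-map and its lifts to the modifications of S all
   have the same comorphism K -> K. Meromorphic objects on a projective
   surface are rational. *)
From HB Require Import structures.
From mathcomp Require Import all_boot all_order all_algebra.
From mathcomp Require Import boolp classical_sets cardinality reals.
From mathcomp Require Import complex mpoly.
From Stdlib Require Import ClassicalEpsilon.

Set Implicit Arguments.
Unset Strict Implicit.
Unset Printing Implicit Defensive.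

Import GRing.Theory Num.Theory.
Local Open Scope ring_scope.

Record model (K : fieldType) := Model { rank : nat; gen : 'rV[K]_rank }.

Section Surfaces.

Variables (R : realType) (K : fieldType) (iota : {rmorphism R[i] -> K}).

Implicit Types (X Y S : model K).

Section Points.

Variable X : model K.

Definition at_gen (F : {mpoly R[i][rank X]}) : K :=
  mmap iota (fun i => gen X 0 i) F.

Definition at_pt (p : 'rV[R[i]]_(rank X)) (F : {mpoly R[i][rank X]}) : R[i] :=
  F.@[fun i => p 0 i].

(* Closed points, given by homogeneous coordinates. *)
Definition point (p : 'rV[R[i]]_(rank X)) : Prop :=
  p != 0 /\
  forall d (F : {mpoly R[i][rank X]}),
    F \is d.-homog -> at_gen F = 0 -> at_pt p F = 0.

(* O_{X,p} and its maximal ideal, as subsets of K. *)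
Definition local_ring (p : 'rV[R[i]]_(rank X)) (a : K) : Prop :=
  exists d (F G : {mpoly R[i][rank X]}),
    [/\ F \is d.-homog, G \is d.-homog, at_pt p G != 0
      & a = at_gen F / at_gen G].

Definition local_ideal (p : 'rV[R[i]]_(rank X)) (a : K) : Prop :=
  exists d (F G : {mpoly R[i][rank X]}),
    [/\ F \is d.-homog, G \is d.-homog, at_pt p G != 0, at_pt p F = 0
      & a = at_gen F / at_gen G].

Definition local_coordinates (p : 'rV[R[i]]_(rank X)) (s t : K) : Prop :=
  [/\ local_ideal p s, local_ideal p t
    & forall a, local_ideal p a ->
        exists b c, [/\ local_ring p b, local_ring p c & a = b * s + c * t]].

Definition has_function_field : Prop :=
  forall a : K, exists d (F G : {mpoly R[i][rank X]}),
    [/\ F \is d.-homog, G \is d.-homog, at_gen G != 0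
      & a = at_gen F / at_gen G].

End Points.

Definition alg_indep n (u : 'I_n -> K) : Prop :=
  forall F : {mpoly R[i][n]}, mmap iota u F = 0 -> F = 0.

Definition trdeg_two : Prop :=
  (exists u : 'I_2 -> K, alg_indep u) /\ (forall u : 'I_3 -> K, ~ alg_indep u).

(* Smoothness: the two-dimensional local rings at the closed points are
   regular. *)
Definition smooth_surface X : Prop :=
  [/\ has_function_field X, trdeg_two
    & forall p : 'rV[R[i]]_(rank X), point p ->
        exists s t, local_coordinates p s t].

(* For X in P^(n-1), the blowup of X at p is the closure in
   P^(n-1) x P(Lambda^2 C^n) of the graph of x |-> p /\ x, the linear
   projection with center p; it is embedded by the Segre map. *)
Definition blowup X (p : 'rV[R[i]]_(rank X)) : model K :=
  let pK := map_mx iota p in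
  Model (mxvec ((gen X)^T *m mxvec (pK^T *m gen X - (gen X)^T *m pK))).

(* modification X Y: Y is obtained from X by finitely many point blowups. *)
Inductive modification X : model K -> Prop :=
| modification_id : modification X X
| modification_blowup Y (p : 'rV[R[i]]_(rank Y)) :
    modification X Y -> point p -> modification X (blowup p).

(* An irreducible curve E on X is represented by the order of vanishing along
   E, a normalized discrete valuation of K. The value at 0, which should be
   infinite, is set to 0 so that equal valuations are equal functions. *)
Definition normalized_valuation (v : K -> int) : Prop :=
  [/\ v 0 = 0,
      forall a b, a != 0 -> b != 0 -> v (a * b) = v a + v b,
      forall a b, a != 0 -> b != 0 -> a + b != 0 ->
        Num.min (v a) (v b) <= v (a + b)
    & exists a, v a = 1].

(* The center of v on X contains p, and is not p: the valuation ring contains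
   O_{X,p}, but the valuation ideal does not contain the maximal ideal. As X is
   a smooth surface, the center is then an irreducible curve E through p, and v
   is the order along E. *)
Definition curve_through X (p : 'rV[R[i]]_(rank X)) (v : K -> int) : Prop :=
  [/\ point p, normalized_valuation v,
      forall a, local_ring p a -> 0 <= v a
    & exists a, [/\ local_ideal p a, a != 0 & v a = 0]].

Definition prime_divisor X (v : K -> int) : Prop :=
  exists p, @curve_through X p v.

(* Divisors assign multiplicities to the irreducible curves, and 0 to the
   functions K -> int that do not represent a curve on X. *)
Definition divisor X (D : (K -> int) -> int) : Prop :=
  finite_set (fun v => D v <> 0) /\ (forall v, D v <> 0 -> prime_divisor X v).

(* Equality of classes in Pic X. *)
Definition lin_equiv X (D D' : (K -> int) -> int) : Prop :=
  exists2 h : K, h != 0 & forall v, prime_divisor X v -> D v - D' v = v h.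

Definition local_equation X (D : (K -> int) -> int)
    (p : 'rV[R[i]]_(rank X)) (h : K) : Prop :=
  h != 0 /\ forall v, curve_through p v -> v h = D v.

(* C is possibly reducible, disconnected or empty; smoothness at p says that
   the local equation of C extends to local coordinates. *)
Definition reduced_smooth_curve X (C : (K -> int) -> int) : Prop :=
  [/\ divisor X C,
      forall v, C v = 0 \/ C v = 1
    & forall p v, @curve_through X p v -> C v = 1 ->
        exists s t, local_coordinates p s t /\ local_equation C p s].

Definition derivation (d : K -> K) : Prop :=
  [/\ forall a b, d (a + b) = d a + d b,
      forall a b, d (a * b) = d a * b + a * d b
    & forall c, d (iota c) = 0].

(* A rational two-form sum_k g_k du_k /\ dw_k is represented by the list of
   the triples (g_k, u_k, w_k). *)
Definition two_form := seq (K * K * K).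

Definition form_eval (eta : two_form) (d1 d2 : K -> K) : K :=
  \sum_(x <- eta)
    let: (g, u, w) := x in g * (d1 u * d2 w - d2 u * d1 w).

(* Equality in Lambda^2 Omega_{K/C}, which is the space of alternating
   K-bilinear forms on Der_C(K), because K is finitely generated over C. *)
Definition form_eq (eta eta' : two_form) : Prop :=
  forall d1 d2, derivation d1 -> derivation d2 ->
    form_eval eta d1 d2 = form_eval eta' d1 d2.

Definition form_scale (c : R[i]) (eta : two_form) : two_form :=
  [seq let: (g, u, w) := x in (iota c * g, u, w) | x <- eta].

Definition form_pullback (phi : K -> K) (eta : two_form) : two_form :=
  [seq let: (g, u, w) := x in (phi g, phi u, phi w) | x <- eta].

Definition form_order X (eta : two_form) (v : K -> int) (m : int) : Prop :=
  exists (p : 'rV[R[i]]_(rank X)) (s t h : K),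
    [/\ curve_through p v, local_coordinates p s t, h != 0,
        form_eq eta [:: (h, s, t)] & m = v h].

(* Div(eta) on X, for a nonzero eta. *)
Definition form_div X (eta : two_form) (v : K -> int) : int :=
  if `[< prime_divisor X v >] then epsilon (inhabits 0) (form_order X eta v)
  else 0.

Definition no_zeros X (eta : two_form) : Prop :=
  forall v, form_div X eta v <= 0.

(* Both the elaborations of eta on S, and the further elaborations when S is
   itself an elaboration. *)
Definition elaboration S (eta : two_form) X : Prop :=
  modification S X /\ no_zeros X eta.

(* The map G --> Y with comorphism phi sends q to p, and is holomorphic at q. *)
Definition regular_at Y G (phi : K -> K)
    (q : 'rV[R[i]]_(rank G)) (p : 'rV[R[i]]_(rank Y)) : Prop :=
  [/\ point q, point p,
      forall a, local_ring p a -> local_ring q (phi a)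
    & forall a, local_ideal p a -> local_ideal q (phi a)].

Definition holomorphic Y G (phi : K -> K) : Prop :=
  forall q : 'rV[R[i]]_(rank G), point q ->
    exists p : 'rV[R[i]]_(rank Y), regular_at phi q p.

Definition pullback_mult Y G (phi : K -> K) (D : (K -> int) -> int)
    (v : K -> int) (m : int) : Prop :=
  exists (q : 'rV[R[i]]_(rank G)) (p : 'rV[R[i]]_(rank Y)) (h : K),
    [/\ curve_through q v, regular_at phi q p, local_equation D p h
      & m = v (phi h)].

(* Pullback of divisors by the holomorphic map G -> Y with comorphism phi. *)
Definition pullback Y G (phi : K -> K) (D : (K -> int) -> int)
    (v : K -> int) : int :=
  if `[< prime_divisor G v >]
  then epsilon (inhabits 0) (pullback_mult Y G phi D v)
  else 0.

(* Pushforward of divisors by a modification onto Y: it forgets the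
   exceptional curves, and maps any other curve birationally to its image,
   which has the same order of vanishing. *)
Definition pushforward Y (D : (K -> int) -> int) (v : K -> int) : int :=
  if `[< prime_divisor Y v >] then D v else 0.

(* A modification pi_1 : G -> Y such that g o pi_1 is holomorphic, for the
   rational self-map g of Y with comorphism phi. *)
Definition resolution Y (phi : K -> K) : model K :=
  epsilon (inhabits Y) (fun G => modification Y G /\ holomorphic Y G phi).

(* g^* = pi_{1*} pi_2^*, which does not depend on the choice of pi_1. *)
Definition rat_pullback Y (phi : K -> K) (D : (K -> int) -> int) :
    (K -> int) -> int :=
  pushforward Y (pullback Y (resolution Y phi) phi D).

(* On Pic Y, the pullback by the n-th iterate of g is the n-th iterate of g^* ;
   the comorphism of the n-th iterate of g is that of phi. *)
Definition algebraically_stable Y (phi : K -> K) : Prop :=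
  forall n D, divisor Y D ->
    lin_equiv Y (rat_pullback Y (iter n phi) D) (iter n (rat_pullback Y phi) D).

(* A rational map S --> S is given by the image of the generic point: a point
   of S with coordinates in K. *)
Definition at_image S (f : 'rV[K]_(rank S)) (F : {mpoly R[i][rank S]}) : K :=
  mmap iota (fun i => f 0 i) F.

Definition rational_map S (f : 'rV[K]_(rank S)) : Prop :=
  f != 0 /\
  forall d (F : {mpoly R[i][rank S]}),
    F \is d.-homog -> at_gen F = 0 -> at_image f F = 0.

(* phi is f^* on rational functions; it exists if and only if f is dominant,
   and is then unique. *)
Definition comorphism S (f : 'rV[K]_(rank S)) (phi : {rmorphism K -> K}) :
    Prop :=
  forall d (F G : {mpoly R[i][rank S]}),
    F \is d.-homog -> G \is d.-homog -> at_gen G != 0 ->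
    at_image f G != 0 /\ phi (at_gen F / at_gen G) = at_image f F / at_image f G.

Definition preserves S (eta : two_form) (f : 'rV[K]_(rank S)) : Prop :=
  exists (phi : {rmorphism K -> K}) (delta : R[i]),
    [/\ comorphism f phi, delta != 0
      & form_eq (form_pullback phi eta) (form_scale delta eta)].

Definition corrigible S (eta : two_form) (f : 'rV[K]_(rank S)) : Prop :=
  exists2 phi : {rmorphism K -> K}, comorphism f phi &
    forall X, elaboration S eta X ->
      exists2 Y, elaboration X eta Y & algebraically_stable Y phi.

End Surfaces.

Arguments point {R K} iota X p.
Arguments local_ring {R K} iota X p a.
Arguments local_ideal {R K} iota X p a.
Arguments local_coordinates {R K} iota X p s t.
Arguments blowup {R K} iota X p.
Arguments curve_through {R K} iota X p v.
Arguments local_equation {R K} iota X D p h.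
Arguments regular_at {R K} iota Y G phi q p.
Arguments rational_map {R K} iota S f.
Arguments comorphism {R K} iota S f phi.
Arguments preserves {R K} iota S eta f.
Arguments corrigible {R K} iota S eta f.

(* Main.v *)
(* Near the polar curve, [eta] is [dx /\ dy / x] up to a unit. Blowing up a point
   off this curve creates a zero of [eta], so an elaboration only blows up points
   of the polar curve and of its strict transforms: over a point q, it is
   described by the number k(q) of these blowups, which leads to the coordinates
   x / y^k, y. In these towers, a map preserving [eta] acts on the polar curve by
   some g and has, from some level on, the monomial form (x, y) -> (x^a y^c, y)
   up to units. It is then regular from the level k over q to the level k' over
   g(q) as soon as k' <= a k + c. For all but finitely many q, this holds from the
   level 0 on, with c = 0.

   A contracted curve lands on the polar curve, because [eta] would vanish along
   it otherwise. So only finitely many orbits of g matter. They are of two kinds.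
   Either levels can be chosen along the orbit such that the lift is regular at
   all of its points; or the orbit ends in a cycle along which the levels
   decrease, and then sufficiently many blowups over its points detach the images
   of all curves from the strict transform of the polar curve, so that no curve is
   contracted to these points. Thus no contracted curve is ever mapped to an
   indeterminacy point, which is algebraic stability. *)

From HB Require Import structures.
From mathcomp Require Import all_boot all_order all_algebra.
From mathcomp Require Import boolp classical_sets cardinality reals.
From mathcomp Require Import complex mpoly ring zify.
From Stdlib Require Import ClassicalEpsilon.
Require Import Defs.

Set Implicit Arguments.
Unset Strict Implicit.
Unset Printing Implicit Defensive.

Import Order.TTheory GRing.Theory Num.Theory.
Local Open Scope ring_scope.
Local Open Scope classical_set_scope.

(** * Noetherian rings *)

(** Points, curves and maps live inside the field [K]: a point is its local ring, a curve is its
    valuation, a point of a blowup is a larger local ring, and a map is regular when its comorphism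
    is a local homomorphism. The local theory is rebuilt for such subsets of [K]. Its engine is the
    form [eta] itself: being nonzero, it provides two independent derivations, hence partial
    derivatives in any local coordinates, and in characteristic zero these show that the associated
    graded ring is a polynomial ring in two variables. Krull's intersection theorem, the
    principality of the ideals of curves and the elimination of indeterminacies follow from this and
    from Noetherianity. The dynamical obstacle is that levels must be chosen along whole orbits at
    once, since blowing up [g q] may destroy regularity at [q]: regularity bounds the level of [g q]
    from above by [a k + c], detaching curves bounds it from below. The least admissible levels
    solve the first problem wherever admissible levels exist. Elsewhere the transported levels stay
    bounded along the orbit, and their maximum over finitely many starting points solves the
    second. *)

Section Span.
Variable A : comNzRingType.
Implicit Types (O I S : A -> Prop) (l : seq A).

(** The recursion makes sense for any subset [O] of coefficients, so that it also describes modules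
    over the image of a ring under a field endomorphism, and combinations with coefficients in a
    maximal ideal. *)
Fixpoint lspan O l (a : A) : Prop :=
  if l is x :: l' then exists c b, [/\ O c, lspan O l' b & a = c * x + b]
  else a = 0.

(** The generators are taken in [S] itself, which need not be an ideal: a finite subfamily can thus
    be extracted from any family. *)
Definition noetherian O := forall S : A -> Prop,
  (forall a, S a -> O a) ->
  exists2 l, (forall x, x \in l -> S x) & forall a, S a -> lspan O l a.

Definition closed_add I := I 0 /\ forall a b, I a -> I b -> I (a + b).
Definition closed_scale O I := forall c a, O c -> I a -> I (c * a).

Lemma lspan_sub O I l :
  closed_add I -> closed_scale O I -> (forall x, x \in l -> I x) ->
  forall a, lspan O l a -> I a.
Proof.
move=> [I0 ID] IZ; elim: l => [|x l IH] lI a /=; first by move=> ->.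
case=> c [b [Oc lb ->]]; apply: ID.
  by apply: IZ => //; apply: lI; rewrite inE eqxx.
by apply: IH => // y ly; apply: lI; rewrite inE ly orbT.
Qed.

Lemma lspan0 O l : O 0 -> lspan O l 0.
Proof.
by move=> O0; elim: l => //= x l IH; exists 0, 0; rewrite mul0r addr0; split.
Qed.

Lemma lspanD O l a b : (forall x y, O x -> O y -> O (x + y)) ->
  lspan O l a -> lspan O l b -> lspan O l (a + b).
Proof.
move=> OD; elim: l a b => [|x l IH] a b /=; first by move=> -> ->; rewrite addr0.
move=> [c [a' [Oc la ->]]] [d [b' [Od lb ->]]].
exists (c + d), (a' + b'); split; [exact: OD|exact: IH|ring].
Qed.

Lemma lspanZ O l c a : (forall x y, O x -> O y -> O (x * y)) ->
  O c -> lspan O l a -> lspan O l (c * a).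
Proof.
move=> OM Oc; elim: l a => [|x l IH] a /=; first by move=> ->; rewrite mulr0.
case=> d [b [Od lb ->]]; exists (c * d), (c * b); split; [exact: OM|exact: IH|ring].
Qed.

Lemma lspan_mem O l x : O 0 -> O 1 -> x \in l -> lspan O l x.
Proof.
move=> O0 O1; elim: l => //= y l IH; rewrite inE => /orP[/eqP->|/IH lx].
  by exists 1, 0; split=> //; [exact: lspan0|ring].
by exists 0, x; split=> //; ring.
Qed.

Lemma lspan_cat O l l' a b :
  lspan O l a -> lspan O l' b -> lspan O (l ++ l') (a + b).
Proof.
elim: l a => [|x l IH] a /=; first by move=> -> ?; rewrite add0r.
by case=> c [d [Oc ld ->]] lb; exists c, (d + b); split=> //; [exact: IH|ring].
Qed.

End Span.

(** * Dickson's lemma *)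

Section Dickson.

Lemma nondecreasing_subsequence (v : nat -> nat) :
  exists2 h : nat -> nat, {homo h : i j / (i < j)%N} &
    {homo (v \o h) : i j / (i <= j)%N}.
Proof.
(* Beyond every [N] some index carries a value that is minimal among all later ones; iterating this
   choice produces the subsequence. *)
have tail N : exists i, (N <= i)%N && `[< forall j, (i <= j)%N -> (v i <= v j)%N >].
  have: exists m, exists2 i, (N <= i)%N & v i = m by exists (v N), N.
  case=> m; elim/ltn_ind: m => m IH [i Ni vi].
  case: (pselect (forall j, (i <= j)%N -> (v i <= v j)%N)) => [H|].
    by exists i; rewrite Ni; apply/asboolP.
  move=> /existsNP[j /not_implyP[ij /negP]]; rewrite -ltnNge => vj.
  by apply: (IH (v j)); [rewrite -vi | exists j => //; apply: leq_trans ij].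
pose s N := xchoose (tail N).
pose h := fix h k := if k is k'.+1 then s (h k').+1 else s 0%N.
have sP N : (N <= s N)%N /\ forall j, (s N <= j)%N -> (v (s N) <= v j)%N.
  by have /andP[? /asboolP] := xchooseP (tail N).
have hS k : (h k < h k.+1)%N by have [+ _] := sP (h k).+1.
have hlt : {homo h : i j / (i < j)%N} by apply: (homo_ltn ltn_trans).
exists h => // i j; rewrite leq_eqVlt => /orP[/eqP->//|/hlt hij] /=.
have: exists N, h i = s N by case: i {hij} => [|i]; [exists 0%N | exists (h i).+1].
by case=> N hN; rewrite hN in hij *; apply: (sP N).2; exact: ltnW.
Qed.

Lemma monomial_sequence n (u : nat -> 'X_{1..n}) :
  exists i j, (i < j)%N /\ (u i <= u j)%MM.
Proof.
have: forall cs : seq 'I_n, exists2 h : nat -> nat,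
    {homo h : i j / (i < j)%N} &
    forall c, c \in cs -> {homo (fun k => u (h k) c) : i j / (i <= j)%N}.
  elim=> [|c cs [h hlt hc]]; first by exists id.
  have [g glt gc] := nondecreasing_subsequence (fun k => u (h k) c).
  exists (h \o g); first by move=> i j /glt /hlt.
  move=> c'; rewrite inE => /orP[/eqP->|c'cs] i j ij; first exact: gc.
  apply: (hc c') => //; move: ij; rewrite leq_eqVlt => /orP[/eqP->//|].
  by move=> /glt/ltnW.
case/(_ (enum 'I_n)) => h hlt hc; exists (h 0%N), (h 1%N); split; first exact: hlt.
by apply/mnm_lepP => c; apply: (hc c) => //; rewrite mem_enum.
Qed.

(** Otherwise one could always pick a further element of [M] that lies above none of the previous
    ones, and this infinite sequence would contradict [monomial_sequence]. *)
Lemma dickson n (M : 'X_{1..n} -> Prop) :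
  exists2 L : seq 'X_{1..n}, (forall m, m \in L -> M m) &
    forall m, M m -> exists2 m', m' \in L & (m' <= m)%MM.
Proof.
apply: contrapT => H.
have next (L : {L : seq 'X_{1..n} | forall m, m \in L -> M m}) :
    {m | M m & forall m', m' \in sval L -> ~~ (m' <= m)%MM}.
  apply: cid2; case: L => L ML /=.
  apply: contrapT => H'; apply: H; exists L => // m Mm; apply: contrapT => H2.
  by apply: H'; exists m => [|m' Lm'] //; apply/negP => le; apply: H2; exists m'.
have nextP (L : {L : seq 'X_{1..n} | forall m, m \in L -> M m}) m :
    m \in s2val (next L) :: sval L -> M m.
  by rewrite inE => /orP[/eqP->|]; [exact: (s2valP (next L)) | exact: (svalP L)].
pose step L := exist (fun L => forall m, m \in L -> M m) _ (@nextP L).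
have M0 : forall m : 'X_{1..n}, m \in [::] -> M m by [].
pose Ls k := iter k step (exist _ [::] M0).
pose u k := s2val (next (Ls k)).
have [i [j [ij uij]]] := monomial_sequence u.
suff: u i \in sval (Ls j).
  by move=> /(s2valP' (next (Ls j))) /negP; apply.
elim: j ij {uij} => // j IH; rewrite ltnS leq_eqVlt => /orP[/eqP->|/IH].
  by rewrite /= inE eqxx.
by rewrite /= inE => ->; rewrite orbT.
Qed.

End Dickson.

(** * Hilbert's basis theorem *)

Section Hilbert.
Variables (F : fieldType) (n : nat).
Implicit Types (p q f g : {mpoly F[n]}).
Let T : {mpoly F[n]} -> Prop := fun=> True.

(** A Groebner basis argument: Dickson's lemma gives finitely many elements [G] of the generated
    ideal whose leading monomials divide all others, the division algorithm terminates because the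
    monomial order is well-founded, and each element of [G] uses only finitely many elements of
    [S]. *)
Lemma hilbert_basis : noetherian T.
Proof.
move=> S _; pose I a := exists2 l, (forall x, x \in l -> S x) & lspan T l a.
have ID a b : I a -> I b -> I (a + b).
  move=> [l lS la] [l' l'S lb]; exists (l ++ l'); last exact: lspan_cat.
  by move=> x; rewrite mem_cat => /orP[/lS|/l'S].
have IZ c a : I a -> I (c * a).
  by move=> [l lS la]; exists l => //; apply: lspanZ.
have [L LM LP] := dickson (fun m => exists f, [/\ I f, f != 0 & mlead f = m]).
have {LM LP} [G GI GP] : exists2 G : seq {mpoly F[n]}, (forall g, g \in G -> I g /\ g != 0) &
    forall f, I f -> f != 0 -> exists2 g, g \in G & (mlead g <= mlead f)%MM.
  have: exists2 G : seq {mpoly F[n]}, (forall g, g \in G -> I g /\ g != 0) &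
      forall m, m \in L -> exists2 g, g \in G & mlead g = m.
    elim: L LM {LP} => [|m L IH] LM; first by exists [::].
    have [|G GI GP] := IH; first by move=> m' Lm'; apply: LM; rewrite inE Lm' orbT.
    have [|f [If f0 fm]] := LM m; first by rewrite inE eqxx.
    exists (f :: G) => [g|m']; first by rewrite inE => /orP[/eqP->|/GI].
    rewrite inE => /orP[/eqP->|/GP[g Gg <-]]; first by exists f; rewrite ?inE ?eqxx.
    by exists g => //; rewrite inE Gg orbT.
  case=> G GI GP; exists G => // f If f0.
  by have [|m' /GP[g Gg <-] le] := LP (mlead f); [exists f | exists g].
have red f : I f -> lspan T G f.
  move: f; suff: forall m f, mlead f = m -> I f -> lspan T G f by move=> H f; exact: H.
  elim/(@ltmwf n) => m IH f fm If; have [->|f0] := eqVneq f 0; first exact: lspan0.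
  have [g Gg le] := GP _ If f0; have [Ig g0] := GI _ Gg.
  pose c : {mpoly F[n]} := (mleadc f / mleadc g) *: 'X_[mlead f - mlead g].
  have lg0 : mleadc g != 0 by rewrite mleadc_eq0.
  have lf0 : mleadc f != 0 by rewrite mleadc_eq0.
  have c0 : mleadc f / mleadc g != 0 by rewrite mulf_neq0 ?invr_eq0.
  have cn0 : c != 0.
    by rewrite scaler_eq0 negb_or c0 -mleadc_eq0 mleadXm mcoeffX eqxx oner_neq0.
  have lc : mlead c = (mlead f - mlead g)%MM by rewrite mleadZ // mleadXm.
  have lcg : mlead (c * g) = mlead f by rewrite mleadM // lc submK.
  have ccg : mleadc (c * g) = mleadc f.
    by rewrite mleadM // mleadcM mleadcZE mleadXm mcoeffX eqxx mulr1 -mulrA mulVf ?mulr1.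
  have -> : f = c * g + (f - c * g) by ring.
  apply: lspanD => //; first by apply: lspanZ => //; apply: lspan_mem.
  have [->|r0] := eqVneq (f - c * g) 0; first exact: lspan0.
  apply: (IH (mlead (f - c * g))) => //; last first.
    by apply: ID => //; rewrite -mulNr; apply: IZ.
  rewrite -fm lt_neqAle; apply/andP; split; last first.
    by apply: le_trans (mleadB_le _ _) _; rewrite lcg joinxx.
  apply/eqP => E; move: r0; rewrite -mleadc_eq0 E mcoeffB -{2}lcg ccg subrr eqxx //.
have : exists2 l, (forall x, x \in l -> S x) & forall g, g \in G -> lspan T l g.
  elim: G GI {red GP} => [|g G IH] GI; first by exists [::].
  have [|l lS lG] := IH; first by move=> g' Gg'; apply: GI; rewrite inE Gg' orbT.
  have [|[l' l'S l'g] _] := GI g; first by rewrite inE eqxx.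
  exists (l' ++ l) => [x|h]; first by rewrite mem_cat => /orP[/l'S|/lS].
  rewrite inE => /orP[/eqP->|/lG lh]; first by rewrite -[g]addr0; apply: lspan_cat => //; apply: lspan0.
  by rewrite -[h]add0r; apply: lspan_cat => //; apply: lspan0.
case=> l lS lG; exists l => // a Sa.
have /red : I a by exists [:: a] => [x|]; [rewrite inE => /eqP-> | apply: lspan_mem; rewrite ?inE ?eqxx].
apply: lspan_sub => //; first by split; [exact: lspan0|move=> *; exact: lspanD].
by move=> c b _ lb; apply: lspanZ.
Qed.

End Hilbert.

(** * Local rings with residue field C *)

Section LocalRings.
Variables (R : realType) (K : fieldType) (iota : {rmorphism R[i] -> K}).
Implicit Types (O W M J : K -> Prop) (a b : K).

(** The nonunits of [O]. Zero is listed apart since its inverse in [K] is 0 by convention. *)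
Definition maxid O a := O a /\ (a = 0 \/ ~ O a^-1).
Definition unit_in O a := [/\ a != 0, O a & O a^-1].

(* A local C-algebra inside K, with residue field C. *)
Record locring O : Prop := LocRing {
  loc_const : forall c, O (iota c);
  loc_add : forall a b, O a -> O b -> O (a + b);
  loc_mul : forall a b, O a -> O b -> O (a * b);
  loc_res : forall a, O a -> exists c, maxid O (a - iota c);
  loc_maxD : forall a b, maxid O a -> maxid O b -> maxid O (a + b) }.

Lemma max_loc O a : maxid O a -> O a. Proof. by case. Qed.

Lemma unit_loc O a : unit_in O a -> O a. Proof. by case. Qed.

Lemma unit_locV O a : unit_in O a -> O a^-1. Proof. by case. Qed.

Section OneRing.
Variables (O : K -> Prop) (HO : locring O).

Lemma loc0 : O 0. Proof. by rewrite -(rmorph0 iota); exact: (loc_const HO). Qed.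

Lemma loc1 : O 1. Proof. by rewrite -(rmorph1 iota); exact: (loc_const HO). Qed.

Lemma loc_opp a : O a -> O (- a).
Proof.
move=> Oa; rewrite -mulN1r -(rmorph1 iota) -rmorphN; apply: (loc_mul HO) => //.
exact: (loc_const HO).
Qed.

Lemma loc_exp a n : O a -> O (a ^+ n).
Proof.
move=> Oa; elim: n => [|n IH]; first by rewrite expr0; exact: loc1.
by rewrite exprS; apply: (loc_mul HO).
Qed.

Lemma loc_nat n : O n%:R.
Proof. by rewrite -(rmorph_nat iota); exact: (loc_const HO). Qed.

Lemma loc_sum (I : Type) (r : seq I) (P : pred I) (F : I -> K) :
  (forall i, P i -> O (F i)) -> O (\sum_(i <- r | P i) F i).
Proof. by move=> H; apply: big_ind => //; [exact: loc0|exact: (loc_add HO)]. Qed.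

Lemma max0 : maxid O 0. Proof. by split; [exact: loc0|left]. Qed.

Lemma not_max1 : ~ maxid O 1.
Proof. by case=> _ [/eqP|]; rewrite ?oner_eq0 // invr1 => /(_ loc1). Qed.

Lemma maxM a b : maxid O a -> O b -> maxid O (a * b).
Proof.
move=> [Oa Ha] Ob; split; first exact: (loc_mul HO).
have [|ab0] := eqVneq (a * b) 0; [by left|right => Oi].
case: Ha => [a0|]; first by move: ab0; rewrite a0 mul0r eqxx.
apply; rewrite (_ : a^-1 = b * (a * b)^-1); first exact: (loc_mul HO).
move: ab0; rewrite mulf_eq0 negb_or => /andP[a0 b0].
by rewrite invfM mulrCA mulfV // mulr1.
Qed.

Lemma maxMl a b : O a -> maxid O b -> maxid O (a * b).
Proof. by move=> ? ?; rewrite mulrC; apply: maxM. Qed.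

Lemma maxN a : maxid O a -> maxid O (- a).
Proof. by move=> ma; rewrite -mulN1r mulrC; apply: maxM => //; apply: loc_opp; exact: loc1. Qed.

Lemma max_exp a n : maxid O a -> (0 < n)%N -> maxid O (a ^+ n).
Proof. by case: n => // n ma _; rewrite exprS; apply: maxM => //; apply: loc_exp; case: ma. Qed.

Lemma max_sum (I : Type) (r : seq I) (P : pred I) (F : I -> K) :
  (forall i, P i -> maxid O (F i)) -> maxid O (\sum_(i <- r | P i) F i).
Proof. by move=> H; apply: big_ind => //; [exact: max0|exact: (loc_maxD HO)]. Qed.

Lemma unit_or_max a : O a -> unit_in O a \/ maxid O a.
Proof.
move=> Oa; have [->|a0] := eqVneq a 0; first by right; exact: max0.
have [Oi|nOi] := pselect (O a^-1); first by left; split.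
by right; split=> //; right.
Qed.

Lemma unit_nmax a : unit_in O a -> ~ maxid O a.
Proof. by move=> [a0 _ Oi] [_ [a0'|//]]; rewrite a0' eqxx in a0. Qed.

Lemma unitP a : O a -> ~ maxid O a -> unit_in O a.
Proof. by move=> Oa; case: (unit_or_max Oa). Qed.

Lemma unit1 : unit_in O 1.
Proof. by split; rewrite ?invr1 ?oner_neq0 //; exact: loc1. Qed.

Lemma unitM a b : unit_in O a -> unit_in O b -> unit_in O (a * b).
Proof.
move=> [a0 Oa Oa'] [b0 Ob Ob']; split; rewrite ?mulf_neq0 //; first exact: (loc_mul HO).
by rewrite invfM; apply: (loc_mul HO).
Qed.

Lemma unitV a : unit_in O a -> unit_in O a^-1.
Proof. by move=> [a0 Oa Oa']; split; rewrite ?invr_eq0 ?invrK. Qed.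

Lemma unitX a n : unit_in O a -> unit_in O (a ^+ n).
Proof.
move=> ua; elim: n => [|n IH]; rewrite ?expr0 ?exprS; first exact: unit1.
exact: unitM.
Qed.

Lemma unitXz a (n : int) : unit_in O a -> unit_in O (a ^ n).
Proof.
case: n => n ua; rewrite ?NegzE ?exprN -?exprnP; first exact: unitX.
by apply: unitV; exact: unitX.
Qed.

Lemma unit_const c : c != 0 -> unit_in O (iota c).
Proof.
move=> c0; split; first by rewrite fmorph_eq0.
  exact: (loc_const HO).
by rewrite -fmorphV; exact: (loc_const HO).
Qed.

Lemma unit_nat n : (0 < n)%N -> unit_in O n%:R.
Proof.
move=> n0; rewrite -(rmorph_nat iota); apply: unit_const.
by rewrite pnatr_eq0 -lt0n.
Qed.

Lemma unitDmax a b : unit_in O a -> maxid O b -> unit_in O (a + b).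
Proof.
move=> ua mb; apply: unitP; first by apply: (loc_add HO); [case: ua|case: mb].
move=> mab; apply: (unit_nmax ua).
by rewrite -[a](addrK b); apply: (loc_maxD HO) => //; exact: maxN.
Qed.

Lemma unitMl a b : O a -> O b -> unit_in O (a * b) -> unit_in O a.
Proof.
by move=> Oa Ob uab; apply: unitP => // ma; apply: (unit_nmax uab); exact: maxM.
Qed.

Definition res a : R[i] := epsilon (inhabits 0) (fun c => maxid O (a - iota c)).

Lemma resP a : O a -> maxid O (a - iota (res a)).
Proof. by move=> /(loc_res HO) H; exact: (epsilon_spec (inhabits 0) _ H). Qed.

Lemma max_const c : maxid O (iota c) -> c = 0.
Proof. by move=> mc; apply/eqP/negPn/negP => /unit_const /unit_nmax; apply. Qed.

Lemma res_uniq a c : maxid O (a - iota c) -> res a = c.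
Proof.
move=> mc; have Oa : O a.
  by rewrite -[a](subrK (iota c)); apply: (loc_add HO) => //; [case: mc|exact: (loc_const HO)].
apply/eqP; rewrite -subr_eq0; apply/eqP/max_const; rewrite rmorphB.
have -> : iota (res a) - iota c = (a - iota c) + - (a - iota (res a)) by ring.
by apply: (loc_maxD HO) => //; apply: maxN; exact: resP.
Qed.

Lemma res_const c : res (iota c) = c.
Proof. by apply: res_uniq; rewrite subrr; exact: max0. Qed.

Lemma res_max a : maxid O a -> res a = 0.
Proof. by move=> ma; apply: res_uniq; rewrite rmorph0 subr0. Qed.

Lemma res_eq0 a : O a -> res a = 0 -> maxid O a.
Proof. by move=> /resP + r0; rewrite r0 rmorph0 subr0. Qed.

Lemma resD a b : O a -> O b -> res (a + b) = res a + res b.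
Proof.
move=> Oa Ob; apply: res_uniq; rewrite rmorphD.
have -> : a + b - (iota (res a) + iota (res b)) = (a - iota (res a)) + (b - iota (res b)).
  by ring.
by apply: (loc_maxD HO) => //; exact: resP.
Qed.

Lemma resM a b : O a -> O b -> res (a * b) = res a * res b.
Proof.
move=> Oa Ob; apply: res_uniq; rewrite rmorphM.
have -> : a * b - iota (res a) * iota (res b) =
  (a - iota (res a)) * b + iota (res a) * (b - iota (res b)) by ring.
apply: (loc_maxD HO) => //; first by apply: maxM => //; exact: resP.
by apply: maxMl; [exact: (loc_const HO)|exact: resP].
Qed.

Lemma resX a n : O a -> res (a ^+ n) = res a ^+ n.
Proof.
move=> Oa; elim: n => [|n IH]; first by rewrite !expr0 -(rmorph1 iota) res_const.
by rewrite !exprS resM ?IH //; exact: loc_exp.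
Qed.

Lemma closed_scale_max : closed_scale O (maxid O).
Proof. by move=> *; exact: maxMl. Qed.

End OneRing.

Section Nakayama.
Variables (O M J : K -> Prop).
Hypotheses
  (MD : forall a b, M a -> M b -> M (a + b))
  (MM : forall a b, M a -> O b -> M (a * b)) (MO : forall a, M a -> O a)
  (inv1 : forall m, M m -> exists2 w, O w & w * (1 - m) = 1).
Hypotheses (JD : closed_add J) (JZ : closed_scale O J).

(** By induction on the generators: [1 - mu] times the first one lies in [J] plus the [M]-span of
    the others, and [1 - mu] is invertible, so this generator can be eliminated. The sets are
    abstract because the lemma is also applied to the images of a ring and of its maximal ideal
    under a comorphism. *)
Lemma nakayama l :
  (forall x, x \in l -> exists j b, [/\ J j, lspan M l b & x = j + b]) ->
  forall x, x \in l -> J x.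
Proof.
have JD' a b : J a -> J b -> J (a + b) by case: JD => _; apply.
have MMZ c b (l' : seq K) : O c -> lspan M l' b -> lspan M l' (c * b).
  move=> Oc; elim: l' b => [|x l' IH] b /=; first by move=> ->; rewrite mulr0.
  case=> d [b' [Md lb' ->]]; exists (c * d), (c * b'); split; [|exact: IH|ring].
  by rewrite mulrC; apply: MM.
elim: l => [//|a l IH] H.
have [j [b0 [Jj [mu [b [Mmu lb b0E]]] aE]]] := H a (mem_head _ _).
have [w Ow wE] := inv1 Mmu.
have aE2 : a = w * j + w * b.
  have E : (1 - mu) * a = j + b by rewrite mulrBl mul1r {1}aE b0E; ring.
  by rewrite -[LHS]mul1r -wE -mulrA E mulrDr.
have lJ x : x \in l -> J x.
  apply: IH => y ly; have [|jy [by0 [Jjy [muy [b' [Mmuy lb' byE]]] yE]]] := H y.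
    by rewrite inE ly orbT.
  exists (jy + muy * (w * j)), (muy * (w * b) + b'); split.
  - by apply: JD' => //; apply: JZ; [exact: MO|exact: JZ].
  - apply: lspanD => //; apply: (MMZ); [exact: MO|exact: (MMZ)].
  - by rewrite yE byE aE2; ring.
move=> x; rewrite inE => /orP[/eqP->|/lJ//].
rewrite aE2; apply: JD'; first exact: JZ.
apply: JZ => //; apply: (lspan_sub JD _ lJ lb) => c d Mc; apply: JZ; exact: MO.
Qed.

End Nakayama.

End LocalRings.

Ltac inO HO :=
  repeat first
    [ assumption
    | apply: (loc0 HO) | apply: (loc1 HO) | apply: (loc_const HO)
    | apply: (loc_nat HO)
    | apply: (loc_add HO) | apply: (loc_mul HO) | apply: (loc_opp HO)
    | apply: (loc_exp HO) | (apply: max_loc; assumption)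
    | (apply: unit_loc; assumption) | (apply: unit_locV; assumption) ].

(** * Regular local rings and their derivations *)

Section RegularRings.
Variables (R : realType) (K : fieldType) (iota : {rmorphism R[i] -> K}).
Implicit Types (O W M J : K -> Prop) (a b : K).

Notation locring := (locring iota).

Definition coords O s t := [/\ maxid O s, maxid O t &
  forall a, maxid O a -> exists b c, [/\ O b, O c & a = b * s + c * t]].

(* [O] is the localization, at its maximal ideal, of the C-algebra generated
   by [z]. *)
Definition gen_by O (z : seq K) := (forall x, x \in z -> O x) /\
  forall B : K -> Prop, (forall c, B (iota c)) ->
    (forall a b, B a -> B b -> B (a + b)) ->
    (forall a b, B a -> B b -> B (a * b)) ->
    (forall a, B a -> unit_in O a -> B a^-1) ->
    (forall x, x \in z -> B x) -> forall a, O a -> B a.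

Record reg O : Prop := Reg {
  reg_loc : locring O;
  reg_frac : forall a, exists b c, [/\ O b, O c, c != 0 & a = b / c];
  reg_noeth : noetherian O;
  reg_gen : exists z, gen_by O z;
  reg_coords : exists s t, coords O s t }.

Lemma coordsC O s t : coords O s t -> coords O t s.
Proof.
move=> [ms mt H]; split=> // a /H[b [c [Ob Oc ->]]].
by exists c, b; split=> //; rewrite addrC.
Qed.

(** Derivations of [K] with values in [K], seen as a module over itself through [psi]. The case of a
    comorphism gives the chain rule for pullbacks of forms. *)
Definition der_along (psi e : K -> K) :=
  [/\ forall a b, e (a + b) = e a + e b,
      forall a b, e (a * b) = e a * psi b + psi a * e b
    & forall c, e (iota c) = 0].

Lemma nakayama_loc O l J : locring O -> closed_add J -> closed_scale O J ->
  (forall x, x \in l -> exists j b, [/\ J j, lspan (maxid O) l b & x = j + b]) ->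
  forall x, x \in l -> J x.
Proof.
move=> HO JD JZ; apply: (@nakayama _ O (maxid O)) => //.
- by move=> *; apply: (loc_maxD HO).
- by move=> *; apply: (maxM HO).
- by move=> a [].
move=> m mm; have [u0 Ou Oi] : unit_in O (1 - m).
  by apply: (unitDmax HO); [exact: unit1 HO|exact: (maxN HO)].
by exists (1 - m)^-1 => //; rewrite mulVf.
Qed.

Lemma lspan_max O l mu b : locring O -> maxid O mu -> lspan O l b ->
  lspan (maxid O) l (mu * b).
Proof.
move=> HO mm; elim: l b => [|x l IH] b /=; first by move=> ->; rewrite mulr0.
case=> c [d [Oc ld ->]]; exists (mu * c), (mu * d); split; [|exact: IH|ring].
exact: (maxM HO).
Qed.

Section Derivations.
Variables (O : K -> Prop) (HO : reg O) (s t : K) (Cst : coords O s t).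
Let LO : locring O := reg_loc HO.

Lemma der_alongV (psi : {rmorphism K -> K}) e a : der_along psi e ->
  a != 0 -> e a^-1 = - (psi a^-1) ^+ 2 * e a.
Proof.
move=> [eD eM ec] a0; have : e (a^-1 * a) = 0 by have := ec 1; rewrite mulVf // rmorph1.
rewrite eM => E.
have -> : e a^-1 = (e a^-1 * psi a) * psi a^-1.
  by rewrite -mulrA -rmorphM mulfV // rmorph1 mulr1.
have -> : e a^-1 * psi a = - (psi a^-1 * e a) by apply/eqP; rewrite -addr_eq0 E.
by rewrite expr2; ring.
Qed.

(** The differentials of [O] are generated by those of [s] and [t]. As [O] is a localization of a
    finitely generated algebra, the values of [e] on [O] lie in a finite module over the image of
    [O]; modulo the maximal ideal, its generators are combinations of [e s] and [e t], and Nakayama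
    concludes. *)
Lemma der_span (psi : {rmorphism K -> K}) e : der_along psi e ->
  forall a, O a -> exists b c, [/\ O b, O c & e a = psi b * e s + psi c * e t].
Proof.
move=> He; case: (He) => eD eM ec.
have [z [zO zB]] := reg_gen HO.
pose O' x := exists2 a, O a & x = psi a.
pose M' x := exists2 a, maxid O a & x = psi a.
pose J x := exists b c, [/\ O b, O c & x = psi b * e s + psi c * e t].
(* Subtracting the residue does not change [e], and moves the generators into the maximal ideal,
   where they are combinations of [s] and [t]. *)
pose zeta x := x - iota (res iota O x).
have ezeta x : e (zeta x) = e x.
  by rewrite /zeta eD -rmorphN ec addr0.
pose l := [seq e (zeta x) | x <- z].
have O'D a b : O' a -> O' b -> O' (a + b).
  by move=> [x Ox ->] [y Oy ->]; exists (x + y); [inO LO|rewrite rmorphD].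
have O'M a b : O' a -> O' b -> O' (a * b).
  by move=> [x Ox ->] [y Oy ->]; exists (x * y); [inO LO|rewrite rmorphM].
have O'0 : O' 0 by exists 0; [inO LO|rewrite rmorph0].
have O'1 : O' 1 by exists 1; [inO LO|rewrite rmorph1].
have el a : O a -> lspan O' l (e a).
  move=> Oa; suff [] : O a /\ lspan O' l (e a) by [].
  apply: (zB (fun a => O a /\ lspan O' l (e a))) => // {a Oa}.
  - by move=> c; split; [inO LO|rewrite ec; exact: lspan0].
  - by move=> a b [Oa la] [Ob lb]; split; [inO LO|rewrite eD; apply: lspanD].
  - move=> a b [Oa la] [Ob lb]; split; first by inO LO.
    rewrite eM mulrC; apply: lspanD => //; apply: lspanZ => //; first by exists b.
    by exists a.
  - move=> a [Oa la] ua; case: (ua) => a0 _ Oi; split=> //.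
    rewrite (der_alongV He) //; apply: lspanZ => //.
    by exists (- a^-1 ^+ 2); [inO LO|rewrite rmorphN rmorphXn].
  - move=> x xz; split; first exact: zO.
    by rewrite -ezeta; apply: lspan_mem => //; apply/mapP; exists x.
have JD : closed_add J.
  split; first by exists 0, 0; split; [inO LO|inO LO|rewrite rmorph0; ring].
  move=> _ _ [b [c [Ob Oc ->]]] [b' [c' [Ob' Oc' ->]]].
  by exists (b + b'), (c + c'); split; [inO LO|inO LO|rewrite !rmorphD; ring].
have JZ : closed_scale O' J.
  move=> _ _ [d Od ->] [b [c [Ob Oc ->]]].
  by exists (d * b), (d * c); split; [inO LO|inO LO|rewrite !rmorphM; ring].
have lM mu b : maxid O mu -> lspan O' l b -> lspan M' l (psi mu * b).
  move=> mm; elim: (l) b => [|x l' IH] b /=; first by move=> ->; rewrite mulr0.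
  case=> c [d [[c' Oc' ->] ld ->]]; exists (psi mu * psi c'), (psi mu * d).
  split; [|exact: IH|ring].
  by exists (mu * c'); [exact: (maxM LO)|rewrite rmorphM].
have M'D a b : M' a -> M' b -> M' (a + b).
  by move=> [x Ox ->] [y Oy ->]; exists (x + y); [exact: (loc_maxD LO)|rewrite rmorphD].
have lJ : forall x, x \in l -> J x.
  apply: (@nakayama _ O' M') => //.
  - move=> _ _ [a ma ->] [b Ob ->].
    by exists (a * b); [exact: (maxM LO)|rewrite rmorphM].
  - by move=> _ [a ma ->]; exists a => //; case: ma.
  - move=> _ [m mm ->]; have [u0 Ou Oi] : unit_in O (1 - m).
      by apply: (unitDmax LO); [exact: unit1 LO|exact: (maxN LO)].
    exists (psi (1 - m)^-1); first by exists (1 - m)^-1.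
    have -> : 1 - psi m = psi (1 - m) by rewrite rmorphB rmorph1.
    by rewrite -rmorphM mulVf // rmorph1.
  move=> _ /mapP[x xz ->].
  have mz : maxid O (zeta x) by apply: (resP LO); exact: zO.
  case: (Cst) => ms mt /(_ _ mz) [b [c [Ob Oc zE]]].
  exists (psi b * e s + psi c * e t), (psi s * e b + psi t * e c); split.
  - by exists b, c.
  - by apply: lspanD => //; apply: lM => //; apply: el.
  - by rewrite zE eD !eM; ring.
move=> a Oa; apply: (lspan_sub JD _ lJ (el a Oa)) => c d [c' Oc' ->] Jd.
by apply: JZ => //; exists c'.
Qed.

Lemma der_along_eq0 (psi : {rmorphism K -> K}) e : der_along psi e ->
  e s = 0 -> e t = 0 -> forall a, e a = 0.
Proof.
move=> He es et a; have eO b : O b -> e b = 0.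
  by move=> /(der_span He)[c [d [_ _ ->]]]; rewrite es et !mulr0 addr0.
have [b [c [Ob Oc c0 ->]]] := reg_frac HO a.
case: (He) => _ eM _; rewrite eM (eO b Ob) (der_alongV He) // (eO c Oc).
by rewrite !mulr0 mul0r addr0.
Qed.

Lemma derivation_along d : derivation iota d <-> der_along (idfun : {rmorphism K -> K}) d.
Proof. by split. Qed.

End Derivations.
End RegularRings.

(** * Jacobians and partial derivatives *)

Section Jacobian.
Variables (R : realType) (K : fieldType) (iota : {rmorphism R[i] -> K}).
Implicit Types (O W M J : K -> Prop) (a b : K).
Notation locring := (locring iota).
Notation reg := (reg iota).

Variables (eta : two_form K) (D1 D2 : K -> K).
Hypotheses (HD1 : derivation iota D1) (HD2 : derivation iota D2).
Let theta := form_eval eta D1 D2.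
Hypothesis theta0 : theta != 0.

(** The value of the two-form [da /\ db] on [D1] and [D2]. *)
Definition jac a b := D1 a * D2 b - D2 a * D1 b.

Lemma derivation_comb d d' (a b : K) : derivation iota d -> derivation iota d' ->
  derivation iota (fun x => a * d x + b * d' x).
Proof.
move=> [dD dM dc] [dD' dM' dc']; split=> [x y|x y|c].
- by rewrite dD dD'; ring.
- by rewrite dM dM'; ring.
- by rewrite dc dc'; ring.
Qed.

Lemma form_evalC (w : two_form K) d d' : form_eval w d d' = - form_eval w d' d.
Proof.
rewrite /form_eval -sumrN; apply: eq_bigr => -[[g u] v] _; ring.
Qed.

Lemma form_evalDl (w : two_form K) d d' d'' (a b : K) :
  form_eval w (fun x => a * d x + b * d' x) d'' =
  a * form_eval w d d'' + b * form_eval w d' d''.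
Proof.
rewrite /form_eval !mulr_sumr -big_split; apply: eq_bigr => -[[g u] v] _ /=; ring.
Qed.

Lemma form_evalDr (w : two_form K) d d' d'' (a b : K) :
  form_eval w d'' (fun x => a * d x + b * d' x) =
  a * form_eval w d'' d + b * form_eval w d'' d'.
Proof. by rewrite form_evalC form_evalDl (form_evalC _ d) (form_evalC _ d'); ring. Qed.

Lemma form_evalNN (w : two_form K) d : form_eval w d d = 0.
Proof. by rewrite /form_eval big1 // => -[[g u] v] _; ring. Qed.

Lemma form_eval_ext (w : two_form K) d d' e e' : d =1 e -> d' =1 e' ->
  form_eval w d d' = form_eval w e e'.
Proof.
by move=> E E'; apply: eq_bigr => -[[g u] v] _; rewrite !E !E'.
Qed.

Section Coordinates.
Variables (O : K -> Prop) (HO : reg O) (s t : K) (Cst : coords O s t).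
Let LO : locring O := reg_loc HO.

Lemma derivation_eq d e : derivation iota d -> derivation iota e ->
  d s = e s -> d t = e t -> d =1 e.
Proof.
move=> Hd He Es Et x; apply/eqP; rewrite -subr_eq0.
have H := derivation_comb 1 (-1) Hd He.
have := @der_along_eq0 _ _ _ _ HO _ _ Cst idfun _ ((derivation_along _ _).1 H).
by rewrite Es Et !mul1r !mulN1r !subrr => /(_ erefl erefl x); rewrite mul1r mulN1r => ->.
Qed.

(** A derivation is determined by its values at [s] and [t], so a vanishing determinant would make
    [D1] and [D2] linearly dependent over [K], and the alternating form [eta] would vanish on
    them. *)
Lemma jac_neq0 : jac s t != 0.
Proof.
apply/eqP => J0; move: theta0; apply/negP/negPn.
have [E|D10] := pselect (D1 s = 0 /\ D1 t = 0).
  have H : D1 =1 (fun x => 0 * D1 x + 0 * D2 x).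
    by apply: derivation_eq; rewrite ?E ?mul0r ?addr0 //; [exact: derivation_comb| case: E..].
  by rewrite /theta (form_eval_ext _ H (frefl D2)) form_evalDl !mul0r addr0.
have [c E] : exists c, D2 =1 (fun x => c * D1 x + 0 * D2 x).
  have [D1s|D1s] := eqVneq (D1 s) 0.
    have D1t : D1 t != 0 by apply/eqP => D1t; apply: D10.
    exists (D2 t / D1 t); apply: derivation_eq => //; first exact: derivation_comb.
      move/eqP: J0; rewrite /jac D1s !mul0r sub0r oppr_eq0 mulf_eq0 (negPf D1t) orbF => /eqP ->.
      by rewrite mulr0 addr0.
    by rewrite mul0r addr0 divfK.
  exists (D2 s / D1 s); apply: derivation_eq => //; first exact: derivation_comb.
    by rewrite mul0r addr0 divfK.
  move/eqP: J0; rewrite /jac subr_eq0 => /eqP E.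
  by apply: (mulfI D1s); rewrite mul0r addr0 E; field.
rewrite /theta (form_eval_ext _ (frefl D1) E) form_evalC form_evalDl form_evalNN.
by rewrite mulr0 mul0r addr0 oppr0.
Qed.

(** Cramer's rule: inverting the matrix of the values of [D1] and [D2] at [s] and [t] yields the
    partial derivatives [dds] and [ddt] with respect to these coordinates. *)
Definition dds x := D2 t / jac s t * D1 x + - D1 t / jac s t * D2 x.
Definition ddt x := - D2 s / jac s t * D1 x + D1 s / jac s t * D2 x.

Lemma dds_der : derivation iota dds. Proof. exact: derivation_comb. Qed.

Lemma ddt_der : derivation iota ddt. Proof. exact: derivation_comb. Qed.

Lemma dds_s : dds s = 1.
Proof. have := jac_neq0; rewrite /dds /jac => ?; by field. Qed.

Lemma dds_t : dds t = 0.
Proof. have := jac_neq0; rewrite /dds /jac => ?; by field. Qed.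

Lemma ddt_s : ddt s = 0.
Proof. have := jac_neq0; rewrite /ddt /jac => ?; by field. Qed.

Lemma ddt_t : ddt t = 1.
Proof. have := jac_neq0; rewrite /ddt /jac => ?; by field. Qed.

Lemma der_basis d a : derivation iota d -> d a = d s * dds a + d t * ddt a.
Proof.
move=> Hd; move: a; apply: derivation_eq => //.
- exact: (derivation_comb _ _ dds_der ddt_der).
- by rewrite dds_s ddt_s; ring.
- by rewrite dds_t ddt_t; ring.
Qed.

Lemma der_loc d a : derivation iota d -> O (d s) -> O (d t) -> O a -> O (d a).
Proof.
move=> Hd Os Ot Oa.
have [b [c [Ob Oc ->]]] := @der_span _ _ _ _ HO _ _ Cst idfun _ ((derivation_along _ _).1 Hd) _ Oa.
by inO LO.
Qed.

Lemma dds_loc a : O a -> O (dds a).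
Proof.
by move=> Oa; apply: der_loc; rewrite ?dds_s ?dds_t //; [exact: dds_der|inO LO|inO LO].
Qed.

Lemma ddt_loc a : O a -> O (ddt a).
Proof.
by move=> Oa; apply: der_loc; rewrite ?ddt_s ?ddt_t //; [exact: ddt_der|inO LO|inO LO].
Qed.

Lemma jacE a b : jac a b = jac s t * (dds a * ddt b - ddt a * dds b).
Proof.
by rewrite /jac (der_basis a HD1) (der_basis a HD2) (der_basis b HD1) (der_basis b HD2); ring.
Qed.

Lemma jac_loc a b : O a -> O b -> O (jac a b / jac s t).
Proof.
move=> Oa Ob; rewrite jacE (mulrC (jac s t)) mulfK; last exact: jac_neq0.
have ? := dds_loc Oa; have ? := dds_loc Ob; have ? := ddt_loc Oa; have ? := ddt_loc Ob; inO LO.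
Qed.

Lemma form_evalE (w : two_form K) d d' : derivation iota d -> derivation iota d' ->
  form_eval w d d' = (d s * d' t - d' s * d t) * (form_eval w D1 D2 / jac s t).
Proof.
move=> Hd Hd'.
have E e e' : derivation iota e -> derivation iota e' ->
    form_eval w e e' = (e s * e' t - e' s * e t) * form_eval w dds ddt.
  move=> He He'.
  rewrite (form_eval_ext _ (fun x => der_basis x He) (fun x => der_basis x He')).
  rewrite (form_evalDl w dds ddt) (form_evalDr w dds ddt dds) (form_evalDr w dds ddt ddt).
  by rewrite (form_evalNN w dds) (form_evalNN w ddt) (form_evalC w ddt dds); ring.
rewrite (E D1 D2) // (E d d') //; have := jac_neq0; rewrite /jac => ?.
by rewrite mulrAC mulfV // mul1r.
Qed.

(** The chain rule expresses [d (phi u)] through [d (phi s)] and [d (phi t)]: the difference [e] of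
    the two sides is a derivation along [phi] that kills [s] and [t], hence zero. *)
Lemma pullback_formE (w : two_form K) (phi : {rmorphism K -> K}) :
  (forall c, phi (iota c) = iota c) ->
  form_eval (form_pullback phi w) D1 D2 =
    phi (form_eval w D1 D2 / jac s t) * jac (phi s) (phi t).
Proof.
move=> phic.
have along d : derivation iota d -> forall u,
    d (phi u) = phi (dds u) * d (phi s) + phi (ddt u) * d (phi t).
  move=> [dD dM dc] u.
  pose e x := d (phi x) - (phi (dds x) * d (phi s) + phi (ddt x) * d (phi t)).
  have [sD sM sc] := dds_der; have [tD tM tc] := ddt_der.
  have He : der_along iota phi e.
    split=> [x y|x y|c]; rewrite /e.
    - by rewrite sD tD !rmorphD dD; ring.
    - by rewrite sM tM !(rmorphM, rmorphD) dM; ring.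
    - by rewrite sc tc phic dc rmorph0; ring.
  apply/eqP; rewrite -subr_eq0; apply/eqP.
  apply: (der_along_eq0 HO Cst He); rewrite /e.
    by rewrite dds_s ddt_s rmorph0 rmorph1; ring.
  by rewrite dds_t ddt_t rmorph0 rmorph1; ring.
have wE : form_eval w D1 D2 / jac s t = form_eval w dds ddt.
  rewrite (form_evalE w dds_der ddt_der) dds_s ddt_t ddt_s dds_t; ring.
rewrite wE /form_eval rmorph_sum mulr_suml /form_pullback big_map.
apply: eq_bigr => -[[g u] v] _ /=.
rewrite /jac (along _ HD1 u) (along _ HD2 u) (along _ HD1 v) (along _ HD2 v).
by rewrite rmorphM rmorphB !rmorphM; ring.
Qed.

End Coordinates.
End Jacobian.

(** * Two-dimensional regular local rings *)

Section RegularRings.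
Variables (R : realType) (K : fieldType) (iota : {rmorphism R[i] -> K}).
Implicit Types (O W M J : K -> Prop) (a b : K).
Notation locring := (locring iota).
Notation reg := (reg iota).

Record regular O : Prop := Regular {
  regular_reg : reg O;
  regular_partials : forall s t, coords O s t -> exists ds dt,
    [/\ derivation iota ds, derivation iota dt, forall a, O a -> O (ds a),
        forall a, O a -> O (dt a) & [/\ ds s = 1, ds t = 0, dt s = 0 & dt t = 1]] }.

Lemma regular_loc O : regular O -> locring O.
Proof. by case=> /reg_loc. Qed.

(** The powers of the maximal ideal. Sums of two products suffice because this ideal has two
    generators, which is how [mpowD] obtains closure under addition. *)
Fixpoint mpow O n a : Prop :=
  if n is k.+1 then exists x b y c, [/\ maxid O x, maxid O y &
    [/\ mpow O k b, mpow O k c & a = x * b + y * c]] else O a.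

Definition hform (s t : K) n (c : nat -> K) := \sum_(i < n.+1) c i * s ^+ (n - i) * t ^+ i.

Lemma derX d a n : derivation iota d -> d (a ^+ n) = n%:R * a ^+ n.-1 * d a.
Proof.
move=> [dD dM dc]; elim: n => [|n IH].
  by rewrite expr0 -(rmorph1 iota) dc rmorph1; ring.
rewrite exprS dM IH /=; case: n {IH} => [|n] /=; first by rewrite expr0; ring.
by rewrite exprS -[n.+2]addn1 natrD; ring.
Qed.

Lemma der_sum d n (F : 'I_n -> K) : derivation iota d ->
  d (\sum_(i < n) F i) = \sum_(i < n) d (F i).
Proof.
move=> [dD dM dc]; have d0 : d 0 = 0 by have := dc 0; rewrite rmorph0.
by apply: (big_morph d).
Qed.

Section OneRing.
Variables (O : K -> Prop) (HO : regular O).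
Let LO : locring O := regular_loc HO.
Lemma mpow_loc n a : mpow O n a -> O a.
Proof.
elim: n a => //= n IH a [x [b [y [c [mx my [Hb Hc ->]]]]]].
by have ? := IH _ Hb; have ? := IH _ Hc; inO LO.
Qed.

Lemma mpow0 n : mpow O n 0.
Proof.
elim: n => [|n IH] /=; first by inO LO.
by exists 0, 0, 0, 0; split; [exact: max0 LO|exact: max0 LO|split=> //; ring].
Qed.

Lemma mpowZ n a b : O a -> mpow O n b -> mpow O n (a * b).
Proof.
elim: n b => [|n IH] b Oa /=; first by move=> Ob; inO LO.
move=> [x [c [y [d [mx my [Hc Hd ->]]]]]].
exists x, (a * c), y, (a * d); split=> //; split; [exact: IH|exact: IH|ring].
Qed.

Lemma mpow1 a : mpow O 1 a <-> maxid O a.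
Proof.
split=> [[x [b [y [c [mx my [Hb Hc ->]]]]]]|ma].
  by apply: (loc_maxD LO); apply: (maxM LO).
exists a, 1, 0, 0; split=> //; first exact: max0 LO.
by split; [inO LO|inO LO|ring].
Qed.

Section Coords.
Variables (s t : K) (Cst : coords O s t).

Lemma mpowD n a b : mpow O n a -> mpow O n b -> mpow O n (a + b).
Proof.
have S m c : (forall a b, mpow O m a -> mpow O m b -> mpow O m (a + b)) ->
    mpow O m.+1 c -> exists x y, [/\ mpow O m x, mpow O m y & c = s * x + t * y].
  move=> D [x [p [y [q [mx my [Hp Hq ->]]]]]]; case: Cst => ms mt H.
  have [b1 [c1 [Ob1 Oc1 ->]]] := H _ mx; have [b2 [c2 [Ob2 Oc2 ->]]] := H _ my.
  exists (b1 * p + b2 * q), (c1 * p + c2 * q).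
  by split; [by apply: D; apply: mpowZ|by apply: D; apply: mpowZ|ring].
elim: n a b => [|n IH] a b /=; first by move=> ? ?; inO LO.
move=> /(S _ _ IH)[x [y [Hx Hy ->]]] /(S _ _ IH)[x' [y' [Hx' Hy' ->]]].
case: Cst => ms mt _.
exists s, (x + x'), t, (y + y'); split=> //; split; [exact: IH|exact: IH|ring].
Qed.

Lemma mpowS n a : mpow O n.+1 a <->
  exists x y, [/\ mpow O n x, mpow O n y & a = s * x + t * y].
Proof.
case: (Cst) => ms mt H; split=> [[x [p [y [q [mx my [Hp Hq ->]]]]]]|[x [y [Hx Hy ->]]]].
  have [b1 [c1 [Ob1 Oc1 ->]]] := H _ mx; have [b2 [c2 [Ob2 Oc2 ->]]] := H _ my.
  exists (b1 * p + b2 * q), (c1 * p + c2 * q).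
  by split; [by apply: mpowD; apply: mpowZ|by apply: mpowD; apply: mpowZ|ring].
by exists s, x, t, y.
Qed.

Lemma mpowN n a : mpow O n a -> mpow O n (- a).
Proof. by move=> H; rewrite -mulN1r; apply: mpowZ => //; inO LO. Qed.

Lemma mpowB n a b : mpow O n a -> mpow O n b -> mpow O n (a - b).
Proof. by move=> Ha Hb; apply: mpowD => //; apply: mpowN. Qed.

Lemma mpow_sum n m (F : 'I_m -> K) : (forall i, mpow O n (F i)) ->
  mpow O n (\sum_(i < m) F i).
Proof. by move=> H; apply: big_ind => //; [exact: mpow0|exact: mpowD]. Qed.

Lemma mpowSW n a : mpow O n.+1 a -> mpow O n a.
Proof.
elim: n a => [|n IH] a; first exact: mpow_loc.
move=> /mpowS[x [y [/IH Hx /IH Hy ->]]]; apply/mpowS.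
by exists x, y.
Qed.

Lemma mpowW n k a : (k <= n)%N -> mpow O n a -> mpow O k a.
Proof.
move=> /subnK <-; elim: (n - k)%N => [//|m IH]; rewrite addSn => /mpowSW; exact: IH.
Qed.

Lemma mpow_mul n k a b : mpow O n a -> mpow O k b -> mpow O (n + k) (a * b).
Proof.
elim: n a => [|n IH] a; first by move=> /= Oa Hb; apply: mpowZ.
move=> /mpowS[x [y [Hx Hy ->]]] Hb; rewrite addSn; apply/mpowS.
by exists (x * b), (y * b); split; [exact: IH|exact: IH|ring].
Qed.

Lemma mpow_max n a b : maxid O a -> mpow O n b -> mpow O n.+1 (a * b).
Proof. by move=> ma Hb; rewrite -add1n; apply: mpow_mul => //; apply/mpow1. Qed.

Lemma mpowX n a : maxid O a -> mpow O n (a ^+ n).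
Proof.
move=> ma; elim: n => [|n IH]; first by rewrite expr0 /=; inO LO.
by rewrite exprS; apply: mpow_max.
Qed.

Lemma mpow_mon n i : (i <= n)%N -> mpow O n (s ^+ (n - i) * t ^+ i).
Proof.
case: Cst => ms mt _ le; rewrite -[n in mpow _ n _](subnK le).
by apply: mpow_mul; apply: mpowX.
Qed.

Lemma hform_mpow n c : (forall i, O (c i)) -> mpow O n (hform s t n c).
Proof.
move=> Oc; apply: mpow_sum => i; rewrite -mulrA; apply: mpowZ => //.
by apply: mpow_mon; rewrite -ltnS.
Qed.

Lemma mpow_hform n a : mpow O n a -> exists2 c, (forall i, O (c i)) & a = hform s t n c.
Proof.
elim: n a => [|n IH] a.
  move=> /= Oa; exists (fun=> a) => //; rewrite /hform big_ord1 /=; ring.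
move=> /mpowS[x [y [/IH[c Oc ->] /IH[d Od ->] ->]]].
exists (fun i => (if (i <= n)%N then c i else 0) + (if i is j.+1 then d j else 0)).
  by move=> i; case: (i <= n)%N; case: i => [|i]; inO LO.
rewrite /hform !mulr_sumr.
under [RHS]eq_bigr do rewrite !mulrDl; rewrite big_split /=; congr (_ + _).
  rewrite [RHS]big_ord_recr /= ltnn !mul0r addr0; apply: eq_bigr => i _.
  by rewrite leq_ord subSn ?leq_ord // exprS; ring.
rewrite [RHS]big_ord_recl /= !mul0r add0r; apply: eq_bigr => i _.
by rewrite /bump /= add1n subSS exprS; ring.
Qed.

Lemma mpow_der d n a : derivation iota d -> (forall a, O a -> O (d a)) ->
  mpow O n.+1 a -> mpow O n (d a).
Proof.
move=> Hd dO; case: (Hd) => dD dM _; elim: n a => [|n IH] a.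
  by move=> /mpow_loc/dO.
move=> /mpowS[x [y [Hx Hy ->]]]; rewrite dD !dM; case: (Cst) => ms mt _.
have H u v : maxid O u -> mpow O n.+1 v -> mpow O n.+1 (d u * v + u * d v).
  move=> mu Hv; apply: mpowD; first by apply: mpowZ => //; apply: dO; case: mu.
  by apply: mpow_max => //; apply: IH.
by apply: mpowD; exact: H.
Qed.

(** The associated graded ring is a polynomial ring in two variables over the residue field.
    Differentiating in [s] or [t] lowers the degree and multiplies the coefficients by positive
    integers, which are units in characteristic zero; the derivatives of the coefficients only
    contribute terms of higher order. *)
Lemma hform_max n c : (forall i, O (c i)) -> mpow O n.+1 (hform s t n c) ->
  forall i, (i <= n)%N -> maxid O (c i).
Proof.
have [ds [dt [Hds Hdt dsO dtO [ss st ts tt]]]] := regular_partials HO Cst.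
have lead d n' c' : derivation iota d -> (forall a, O a -> O (d a)) ->
    (forall i, O (c' i)) -> mpow O n'.+2 (hform s t n'.+1 c') ->
    mpow O n'.+1 (\sum_(i < n'.+2) c' i * d (s ^+ (n'.+1 - i) * t ^+ i)).
  move=> Hd dO Oc /(mpow_der Hd dO); rewrite /hform der_sum // => H.
  have -> : \sum_(i < n'.+2) c' i * d (s ^+ (n'.+1 - i) * t ^+ i) =
      \sum_(i < n'.+2) d (c' i * s ^+ (n'.+1 - i) * t ^+ i) -
      \sum_(i < n'.+2) d (c' i) * (s ^+ (n'.+1 - i) * t ^+ i).
    rewrite -sumrB; apply: eq_bigr => i _; case: (Hd) => _ dM _.
    by rewrite -(mulrA (c' i)) (dM (c' i)); ring.
  apply: mpowB => //; apply: mpow_sum => i; apply: mpowZ; first exact: dO.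
  by apply: mpow_mon; rewrite -ltnS.
elim: n c => [|n IH] c Oc.
  move=> H i; rewrite leqn0 => /eqP ->; apply/mpow1; move: H.
  by rewrite /hform big_ord1 /= subnn !expr0 !mulr1.
move=> H.
have Hs : mpow O n.+1 (hform s t n (fun i => (n.+1 - i)%:R * c i)).
  have := lead _ _ _ Hds dsO Oc H; rewrite big_ord_recr /=.
  have -> : ds (s ^+ (n.+1 - n.+1) * t ^+ n.+1) = 0.
    by case: (Hds) => _ dM dc; rewrite subnn expr0 mul1r (derX _ _ Hds) st mulr0.
  rewrite mulr0 addr0 => H'; refine (eq_ind _ (mpow O n.+1) H' _ _).
  apply: eq_bigr => i _.
  case: (Hds) => _ dM dc; rewrite dM !(derX _ _ Hds) ss st subSn ?leq_ord //= !mulr0 addr0 mulr1.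
  by move: (_%:R) (s ^+ _) (t ^+ _) (c i) => u v w z; ring.
have Ht : mpow O n.+1 (hform s t n (fun i => i.+1%:R * c i.+1)).
  have := lead _ _ _ Hdt dtO Oc H; rewrite big_ord_recl /=.
  have -> : dt (s ^+ (n.+1 - 0) * t ^+ 0) = 0.
    by rewrite expr0 mulr1 (derX _ _ Hdt) ts mulr0.
  rewrite mulr0 add0r => H'; refine (eq_ind _ (mpow O n.+1) H' _ _).
  apply: eq_bigr => i _.
  case: (Hdt) => _ dM dc; rewrite dM !(derX _ _ Hdt) ts tt /bump /= add1n subSS mulr0 mul0r add0r mulr1.
  by move: (_%:R) (s ^+ _) (t ^+ _) (c _) => u v w z; ring.
have unit_mul k a : (0 < k)%N -> O a -> maxid O (k%:R * a) -> maxid O a.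
  move=> k0 Oa mka; have [u0 _ Oi] := unit_nat LO k0.
  by rewrite -[a](mulKf u0); apply: (maxMl LO).
(* The derivative in [s] loses the coefficient of [t ^+ n.+1], which is recovered from the
   derivative in [t]. *)
move=> i; rewrite leq_eqVlt => /orP[/eqP->|lt].
  apply: (unit_mul n.+1) => //; apply: (IH (fun i => i.+1%:R * c i.+1)) => // j.
  by have := Oc j.+1; move=> ?; inO LO.
apply: (unit_mul (n.+1 - i)%N); rewrite ?subn_gt0 //.
apply: (IH (fun i => (n.+1 - i)%:R * c i)) => // j.
by have := Oc j; move=> ?; inO LO.
Qed.

Lemma coord_neq0 : s != 0.
Proof.
have [ds [dt [Hds _ _ _ [ss _ _ _]]]] := regular_partials HO Cst.
apply/eqP => s0; case: Hds => _ _ /(_ 0); rewrite rmorph0.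
by move: ss; rewrite s0 => -> /eqP; rewrite oner_eq0.
Qed.

End Coords.
End OneRing.
End RegularRings.

(** * Dehomogenized forms, Krull's intersection theorem and principal primes *)

Section RegularRings.
Variables (R : realType) (K : fieldType) (iota : {rmorphism R[i] -> K}).
Implicit Types (O W M J : K -> Prop) (a b : K) (P Q : {poly K}).
Notation locring := (locring iota).
Notation regular := (regular iota).

Definition poly_in O P := forall i, O P`_i.

Section Poly.
Variables (O : K -> Prop) (LO : locring O).

Lemma poly_inD P Q : poly_in O P -> poly_in O Q -> poly_in O (P + Q).
Proof. by move=> HP HQ i; rewrite coefD; have := HP i; have := HQ i => *; inO LO. Qed.

Lemma poly_inM P Q : poly_in O P -> poly_in O Q -> poly_in O (P * Q).
Proof.
by move=> HP HQ i; rewrite coefM; apply: (loc_sum LO) => j _; apply: (loc_mul LO).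
Qed.

Lemma poly_inC a : O a -> poly_in O a%:P.
Proof. by move=> Oa i; rewrite coefC; case: eqP => _ //; inO LO. Qed.

Lemma poly_inX : poly_in O 'X.
Proof. by move=> i; rewrite coefX; inO LO. Qed.

Lemma poly_in_exp P n : poly_in O P -> poly_in O (P ^+ n).
Proof.
move=> HP; elim: n => [|n IH]; first by rewrite expr0; apply: poly_inC; inO LO.
by rewrite exprS; apply: poly_inM.
Qed.

Lemma poly_horner P a : poly_in O P -> O a -> O P.[a].
Proof.
move=> HP Oa; rewrite horner_coef; apply: (loc_sum LO) => i _.
by have := HP i => ?; inO LO.
Qed.

Lemma poly_horner0 P a : poly_in O P -> maxid O a -> maxid O (P.[a] - P`_0).
Proof.
move=> HP ma; have Oa := max_loc ma.
rewrite -horner_coef0 !horner_coef -sumrB; apply: (max_sum LO) => i _.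
rewrite -mulrBr; apply: (maxMl LO) => //; case: (nat_of_ord i) => [|n].
  by rewrite !expr0 subrr; exact: max0 LO.
by rewrite expr0n subr0; apply: (max_exp LO).
Qed.

(** As in Gauss's lemma: if both factors had a unit coefficient, the lowest ones would give a unit
    coefficient of the product, since all other terms of that coefficient lie in the maximal
    ideal. *)
Lemma poly_prime P Q : poly_in O P -> poly_in O Q ->
  poly_in (maxid O) (P * Q) -> poly_in (maxid O) P \/ poly_in (maxid O) Q.
Proof.
move=> HP HQ HPQ; apply: contrapT => /not_orP[/existsNP nP /existsNP nQ].
have least S : poly_in O S -> (exists i, ~ maxid O S`_i) ->
    exists i, unit_in O S`_i /\ forall j, (j < i)%N -> maxid O S`_j.
  move=> HS [k]; elim/ltn_ind: k => i IH ni.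
  have [H|/existsNP[j /not_implyP[ji nj]]] := pselect (forall j, (j < i)%N -> maxid O S`_j).
    by exists i; split=> //; apply: (unitP LO).
  exact: IH nj.
have [i [ui Hi]] := least P HP nP; have [j [uj Hj]] := least Q HQ nQ.
apply: (unit_nmax (unitM LO ui uj)).
have lti : (i < (i + j).+1)%N by rewrite ltnS leq_addr.
have := HPQ (i + j)%N; rewrite coefM (bigD1 (Ordinal lti)) //= addKn => H.
rewrite -[X in maxid O X](addrK (\sum_(k < (i + j).+1 | k != Ordinal lti) P`_k * Q`_(i + j - k))).
apply: (loc_maxD LO) => //; apply: (maxN LO); apply: (max_sum LO) => k nk.
have [ki|ik] := ltnP k i; first by apply: (maxM LO) => //; exact: Hi.
apply: (maxMl LO) => //; apply: Hj.
have : (i != k)%N by apply: contraNneq nk => ik'; apply/eqP/val_inj.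
by have := ltn_ord k; lia.
Qed.

End Poly.

Section OneRing.
Variables (O : K -> Prop) (HO : regular O) (s t : K) (Cst : coords O s t).
Let LO : locring O := regular_loc HO.
Let ms : maxid O s. Proof. by case: Cst. Qed.
Let mt : maxid O t. Proof. by case: Cst. Qed.
Let s0 : s != 0 := coord_neq0 HO Cst.
Lemma hform_poly n P : (size P <= n.+1)%N ->
  s ^+ n * P.[t / s] = hform s t n (fun i => P`_i).
Proof.
move=> sP; rewrite (horner_coef_wide _ sP) mulr_sumr; apply: eq_bigr => i _.
rewrite -{1}(subnK (leq_ord i)) exprD exprMn exprVn.
have si0 : s ^+ i != 0 by rewrite expf_neq0.
by field.
Qed.

Lemma mpow_polyP n a : mpow O n a <->
  exists P, [/\ poly_in O P, (size P <= n.+1)%N & a = s ^+ n * P.[t / s]].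
Proof.
split=> [/(mpow_hform HO Cst)[c Oc ->]|[P [HP sP ->]]]; last first.
  by rewrite hform_poly //; apply: (hform_mpow HO Cst).
exists (\poly_(i < n.+1) c i); split.
- by move=> i; rewrite coef_poly; case: ifP => _ //; inO LO.
- exact: size_poly.
- rewrite hform_poly ?size_poly //; apply: eq_bigr => i _.
  by rewrite coef_poly ltn_ord.
Qed.

Lemma mpow_poly n P : poly_in O P -> (size P <= n.+1)%N -> mpow O n (s ^+ n * P.[t / s]).
Proof. by move=> HP sP; apply/mpow_polyP; exists P. Qed.

Lemma poly_mpow_max n P : poly_in O P -> (size P <= n.+1)%N ->
  mpow O n.+1 (s ^+ n * P.[t / s]) -> poly_in (maxid O) P.
Proof.
move=> HP sP; rewrite hform_poly // => /(hform_max HO Cst HP) H i.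
have [/H//|lt] := leqP i n; rewrite nth_default; first exact: max0 LO.
exact: leq_trans lt.
Qed.

Lemma poly_max_mpow n P : poly_in (maxid O) P -> (size P <= n.+1)%N ->
  mpow O n.+1 (s ^+ n * P.[t / s]).
Proof.
move=> HP sP; rewrite hform_poly //; apply: (mpow_sum HO Cst) => i.
by rewrite -mulrA; apply: (mpow_max HO Cst) => //; apply: (mpow_mon HO Cst); rewrite -ltnS.
Qed.

(** The associated graded ring is a domain, so that orders add up. Forms are handled through their
    dehomogenizations, evaluated at [t / s]. *)
Lemma mpow_prime n k a b : mpow O n a -> mpow O k b -> mpow O (n + k).+1 (a * b) ->
  mpow O n.+1 a \/ mpow O k.+1 b.
Proof.
move=> /mpow_polyP[P [HP sP ->]] /mpow_polyP[Q [HQ sQ ->]].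
have -> : s ^+ n * P.[t / s] * (s ^+ k * Q.[t / s]) = s ^+ (n + k) * (P * Q).[t / s].
  by rewrite hornerM exprD mulrACA.
have sPQ : (size (P * Q)%R <= (n + k).+1)%N.
  apply: leq_trans (size_polyMleq _ _) _.
  by move: sP sQ; clear; lia.
move=> /(poly_mpow_max (poly_inM LO HP HQ) sPQ) /(poly_prime LO HP HQ) [H|H].
  by left; apply: poly_max_mpow.
by right; apply: poly_max_mpow.
Qed.

Lemma mpow_split n a : O a -> mpow O n a \/ exists2 k, (k < n)%N & mpow O k a /\ ~ mpow O k.+1 a.
Proof.
move=> Oa; elim: n => [|n [H|[k kn H]]]; [by left| |by right; exists k => //; exact: ltnW].
have [H'|H'] := pselect (mpow O n.+1 a); first by left.
by right; exists n.
Qed.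

Lemma coord_nmpow2 : ~ mpow O 2 t.
Proof.
move=> H; have H1 : mpow O 2 (s ^+ 1 * ('X : {poly K}).[t / s]).
  by rewrite hornerX expr1 mulrC divfK.
have := poly_mpow_max (poly_inX LO) _ H1; rewrite size_polyX => /(_ isT 1%N).
by rewrite coefX; exact: not_max1 LO.
Qed.

Lemma mpow_div_coord n a : O a -> mpow O n.+1 (t * a) -> mpow O n a.
Proof.
move=> Oa H; case: (mpow_split n Oa) => [//|[k kn [Ha nHa]]].
have H2 : mpow O (1 + k).+1 (t * a) by apply: (mpowW HO Cst) H.
by case: (mpow_prime ((mpow1 HO t).2 mt) Ha H2) => // /coord_nmpow2.
Qed.

(* The tangent cone of [t = 0] does not contain the direction [s]. *)
Lemma coord_power_ndvd n a b : O a -> O b -> s ^+ n * a = t * b -> maxid O a.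
Proof.
move=> Oa Ob E.
have Hb : mpow O n.-1 b.
  case: n E => [_|n E] //=; apply: mpow_div_coord => //; rewrite -E mulrC.
  by apply: (mpowZ HO) => //; exact: (mpowX HO Cst).
case: n E Hb => [|n] E Hb; first by rewrite expr0 mul1r in E; rewrite E; apply: (maxM LO).
move: Hb => /mpow_polyP[P [HP sP bE]].
(* After substitution of [b], the relation says that [Q] vanishes at [t / s]. A form equal to zero
   has only nonunit coefficients, and the constant one is [a]. *)
pose Q := a%:P - 'X * P.
have QE : s ^+ n.+1 * Q.[t / s] = 0.
  by rewrite /Q !hornerE bE in E *; rewrite mulrBr E /= exprS; field.
have HQ : poly_in O Q.
  rewrite /Q -mulN1r; apply: (poly_inD LO); first exact: poly_inC.
  apply: (poly_inM LO); last by apply: (poly_inM LO) => //; exact: poly_inX.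
  by rewrite -polyCN; apply: (poly_inC LO); inO LO.
have sQ : (size Q <= n.+2)%N.
  apply: leq_trans (size_polyD _ _) _; rewrite geq_max size_polyN; apply/andP; split.
    by apply: leq_trans (size_polyC_leq1 _) _.
  apply: leq_trans (size_polyMleq _ _) _; rewrite size_polyX /= ; exact: sP.
have : mpow O n.+2 (s ^+ n.+1 * Q.[t / s]) by rewrite QE; exact: (mpow0 HO).
move=> /(poly_mpow_max HQ sQ)/(_ 0%N).
by rewrite /Q coefB coefC eqxx coefXM eqxx subr0.
Qed.

Lemma mpow_coords n a : mpow O n a -> exists b c, [/\ O b, O c & a = t * b + s ^+ n * c].
Proof.
elim: n a => [|n IH] a.
  by move=> Oa; exists 0, a; split=> //; [inO LO|rewrite expr0; ring].
move=> /(mpowS HO Cst)[x [y [/IH[b [c [Ob Oc ->]]] /(mpow_loc HO) Oy ->]]].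
by exists (s * b + y), c; split; [inO LO|inO LO|rewrite exprS; ring].
Qed.

Lemma noeth : noetherian O. Proof. exact: (reg_noeth (regular_reg HO)). Qed.

(** Krull's intersection theorem in [O / t]. Let [N] be the intersection. If [t] divides [s * y],
    then [coord_power_ndvd] puts [y] in [N]; hence every element of [N] is a multiple of [t] plus
    [s] times an element of [N], and Nakayama applies. *)
Lemma cap_coord a :
  (forall n, exists b c, [/\ O b, O c & a = t * b + s ^+ n * c]) -> exists2 b, O b & a = t * b.
Proof.
pose J x := exists2 b, O b & x = t * b.
pose N x := forall n, exists b c, [/\ O b, O c & x = t * b + s ^+ n * c].
have NO x : N x -> O x by move=> /(_ 0%N)[b [c [Ob Oc ->]]]; rewrite expr0; inO LO.
have [l lN Nl] := noeth NO.
have JD : closed_add J.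
  split; first by exists 0; [inO LO|rewrite mulr0].
  by move=> _ _ [b Ob ->] [c Oc ->]; exists (b + c); [inO LO|ring].
have JZ : closed_scale O J.
  by move=> d _ Od [b Ob ->]; exists (d * b); [inO LO|ring].
have JN y : O y -> J (s * y) -> N y.
  move=> Oy [w Ow E] n; elim: n => [|n [p [q [Op Oq yE]]]].
    by exists 0, y; split; [inO LO|by []|rewrite expr0; ring].
  have mq : maxid O q.
    apply: (@coord_power_ndvd n.+1 q (w - s * p)) => //; first by inO LO.
    by rewrite exprS mulrBr -E yE; ring.
  case: (Cst) => _ _ /(_ _ mq)[al [be [Oal Obe qE]]].
  exists (p + s ^+ n * be), al; split; [by inO LO|by []|].
  by rewrite yE qE exprS; ring.
have lJ : forall x, x \in l -> J x.
  apply: (nakayama_loc LO JD JZ) => x /lN Nx.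
  have [b [a1 [Ob Oa1 xE]]] := Nx 1%N; rewrite expr1 in xE.
  exists (t * b), (s * a1); split=> //; first by exists b.
  apply: (lspan_max LO ms); apply: (Nl) => n.
  have [b' [c [Ob' Oc xE']]] := Nx n.+1.
  have Ny : N (a1 - s ^+ n * c).
    apply: JN; first by inO LO.
    exists (b' - b); first by inO LO.
    have -> : s * (a1 - s ^+ n * c) = (x - t * b) - s ^+ n.+1 * c.
      by rewrite {1}xE exprS; ring.
    by rewrite {1}xE'; ring.
  have [p [q [Op Oq E]]] := Ny n; exists p, (q + c); split; [by []|by inO LO|].
  by rewrite -[a1](subrK (s ^+ n * c)) E; ring.
by move=> /Nl; exact: (lspan_sub JD JZ lJ).
Qed.

(** By [coord_power_ndvd], the part of [y] not divisible by [t] can be divided by [s] again and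
    again, and [cap_coord] removes it. *)
Lemma coord_regular y w : O y -> O w -> s * y = t * w -> exists2 b, O b & y = t * b.
Proof.
move=> Oy Ow E; apply: cap_coord; elim=> [|n [p [q [Op Oq yE]]]].
  by exists 0, y; split; [inO LO|by []|rewrite expr0; ring].
have mq : maxid O q.
  apply: (@coord_power_ndvd n.+1 q (w - s * p)) => //; first by inO LO.
  by rewrite exprS mulrBr -E yE; ring.
case: (Cst) => _ _ /(_ _ mq)[al [be [Oal Obe qE]]].
exists (p + s ^+ n * be), al; split; [by inO LO|by []|].
by rewrite yE qE exprS; ring.
Qed.

(** An element of the intersection is divisible by [t] by [cap_coord], and the quotient lies again
    in the intersection since division by [t] lowers the order by one. Nakayama then gives zero. *)
Lemma cap_mpow a : (forall n, mpow O n a) -> a = 0.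
Proof.
pose N x := forall n, mpow O n x; pose J x := x = 0 :> K.
have NO x : N x -> O x by move=> /(_ 0%N).
have [l lN Nl] := noeth NO.
have JD : closed_add J by split=> // _ _ -> ->; rewrite /J addr0.
have JZ : closed_scale O J by move=> d _ _ ->; rewrite /J mulr0.
have lJ : forall x, x \in l -> J x.
  apply: (nakayama_loc LO JD JZ) => x /lN Nx; exists 0, x; split=> //; last by rewrite add0r.
  have [b Ob xE] : exists2 b, O b & x = t * b.
    by apply: cap_coord => n; apply: mpow_coords.
  rewrite xE; apply: (lspan_max LO mt); apply: Nl => n.
  by apply: mpow_div_coord => //; rewrite -xE.
by move=> /Nl; exact: (lspan_sub JD JZ lJ).
Qed.

(** The quotient [O / t] is a discrete valuation ring with uniformizer [s]. *)
Lemma coord_adic a : O a -> (exists2 b, O b & a = t * b) \/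
  exists n e d, [/\ unit_in O e, O d & a = s ^+ n * e + t * d].
Proof.
move=> Oa; have [H|/existsNP H] := pselect
  (forall n, exists b c, [/\ O b, O c & a = t * b + s ^+ n * c]).
  by left; exact: cap_coord.
right; case: H => n nH.
have: exists2 n, (exists b c, [/\ O b, O c & a = t * b + s ^+ n * c]) &
    ~ exists b c, [/\ O b, O c & a = t * b + s ^+ n.+1 * c].
  elim: n nH => [|n IH] nH.
    by case: nH; exists 0, a; split; [inO LO|by []|rewrite expr0; ring].
  have [H|/IH//] := pselect (exists b c, [/\ O b, O c & a = t * b + s ^+ n * c]).
  by exists n.
move=> [{nH} m [b [c [Ob Oc aE]]] nH]; exists m, c, b.
split=> //; last by rewrite aE; ring.
apply: (unitP LO) => // mc; apply: nH.
case: (Cst) => _ _ /(_ _ mc)[al [be [Oal Obe cE]]].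
by exists (b + s ^+ m * be), al; split; [inO LO|by []|rewrite aE cE exprS; ring].
Qed.

Section Prime.
Variable P : K -> Prop.
Hypotheses (PO : forall a, P a -> O a) (P0 : P 0) (PD : forall a b, P a -> P b -> P (a + b))
  (PZ : forall a b, O a -> P b -> P (a * b))
  (Pprime : forall a b, O a -> O b -> P (a * b) -> P a \/ P b).

(** This replaces unique factorization. In the discrete valuation ring [O / t] the image of [P] is
    generated by an element of least order, lifted to [pi]. Every element of [P] is a multiple of
    [pi] plus some [t * c], where [c] is in [P] because [t] is not, and Nakayama applies. *)
Lemma prime_principal_coord : ~ P t ->
  exists2 pi, P pi & forall a, P a -> exists2 b, O b & a = b * pi.
Proof.
move=> nPt.
have tP b : O b -> P (t * b) -> P b by move=> Ob /(Pprime (max_loc mt) Ob)[].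
suff [pi Ppi H] : exists2 pi, P pi &
    forall a, P a -> exists b c, [/\ O b, P c & a = b * pi + t * c].
  exists pi => // a Pa; pose J x := exists2 b, O b & x = b * pi.
  have [l lP Pl] := noeth PO.
  have JD : closed_add J.
    split; first by exists 0; [inO LO|rewrite mul0r].
    by move=> _ _ [b Ob ->] [c Oc ->]; exists (b + c); [inO LO|ring].
  have JZ : closed_scale O J.
    by move=> d _ Od [b Ob ->]; exists (d * b); [inO LO|ring].
  apply: (lspan_sub JD JZ _ (Pl a Pa)); apply: (nakayama_loc LO JD JZ) => x /lP /H.
  move=> [b [c [Ob Pc ->]]]; exists (b * pi), (t * c); split=> //; first by exists b.
  by apply: (lspan_max LO mt); exact: Pl.
pose S n := exists e d, [/\ unit_in O e, O d & P (s ^+ n * e + t * d)].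
have [[n Sn]|nS] := pselect (exists n, S n); last first.
  exists 0 => // a Pa; case: (coord_adic (PO Pa)) => [[b Ob aE]|[n [e [d [ue Od aE]]]]].
    exists 0, b; split; [inO LO|apply: tP => //; by rewrite -aE|rewrite aE; ring].
  by case: nS; exists n, e, d; split=> //; rewrite -aE.
have {n Sn} [n [[e [d [ue Od Ppi]]] nmin]] : exists n, S n /\ forall k, S k -> (n <= k)%N.
  elim/ltn_ind: n Sn => n IH Sn.
  have [H|/existsNP[k /not_implyP[Sk /negP]]] := pselect (forall k, S k -> (n <= k)%N).
    by exists n.
  by rewrite -ltnNge => /IH; apply.
exists (s ^+ n * e + t * d) => // a Pa.
case: (coord_adic (PO Pa)) => [[b Ob aE]|[k [e' [d' [ue' Od' aE]]]]].
  exists 0, b; split; [inO LO|apply: tP => //; by rewrite -aE|rewrite aE; ring].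
have nk : (n <= k)%N by apply: nmin; exists e', d'; split=> //; rewrite -aE.
have [e0 Oe Oei] := ue; have [e'0 Oe' _] := ue'.
pose b := s ^+ (k - n) * e' / e.
have Os := max_loc ms.
have Ob : O b by rewrite /b; inO LO.
exists b, (d' - b * d); split=> //.
  apply: tP; first by inO LO.
  have -> : t * (d' - b * d) = a + (- b) * (s ^+ n * e + t * d).
    by rewrite aE -[in s ^+ k](subnK nk) exprD /b; field.
  by apply: PD => //; apply: PZ => //; inO LO.
by rewrite aE -[in s ^+ k](subnK nk) exprD /b; field.
Qed.
End Prime.

End OneRing.
End RegularRings.

(** * Valuations defined by filtrations *)

Section Filtrations.
Variables (K : fieldType) (O : K -> Prop) (F : nat -> K -> Prop).

Record filtration : Prop := Filtration {
  filt0 : forall a, O a <-> F 0%N a;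
  filtS : forall n a, F n.+1 a -> F n a;
  filt_zero : forall n, F n 0;
  filtD : forall n a b, F n a -> F n b -> F n (a + b);
  filtM : forall n k a b, F n a -> F k b -> F (n + k)%N (a * b);
  filt_prime : forall n k a b, F n a -> F k b -> F (n + k).+1 (a * b) ->
    F n.+1 a \/ F k.+1 b;
  filt_cap : forall a, (forall n, F n a) -> a = 0 }.

Definition exact_filt n a := F n a /\ ~ F n.+1 a.

(** The difference of the orders of numerator and denominator; [filt_valE] shows that it does not
    depend on the fraction. *)
Definition filt_val (a : K) : int :=
  if a == 0 then 0 else epsilon (inhabits 0) (fun m => exists b c n k,
    [/\ O b, O c, a = b / c, exact_filt n b & exact_filt k c /\ m = n%:Z - k%:Z]).

Hypotheses (HF : filtration)
  (Ofrac : forall a, exists b c, [/\ O b, O c, c != 0 & a = b / c])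
  (O1 : O 1) (O_mul : forall a b, O a -> O b -> O (a * b)).

Lemma filtW n k a : (k <= n)%N -> F n a -> F k a.
Proof.
move=> /subnK <-; elim: (n - k)%N => [//|m IH]; rewrite addSn => /(filtS HF); exact: IH.
Qed.

Lemma exact_filt_ex a : O a -> a != 0 -> exists n, exact_filt n a.
Proof.
move=> Oa /eqP a0; apply: contrapT => H; apply/a0/(filt_cap HF).
elim=> [|n IH]; first exact/(filt0 HF).
by apply: contrapT => H'; apply: H; exists n.
Qed.

Lemma exact_filt_uniq n k a : exact_filt n a -> exact_filt k a -> n = k.
Proof.
move=> [Fn Fn'] [Fk Fk']; apply/eqP; rewrite eqn_leq; apply/andP; split.
  by rewrite leqNgt; apply/negP => lt; apply: Fk'; apply: filtW Fn.
by rewrite leqNgt; apply/negP => lt; apply: Fn'; apply: filtW Fk.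
Qed.

Lemma exact_filtM n k a b : exact_filt n a -> exact_filt k b ->
  exact_filt (n + k) (a * b).
Proof.
move=> [Fa Fa'] [Fb Fb']; split; first exact: (filtM HF).
by move=> /(filt_prime HF Fa Fb)[].
Qed.

Lemma exact_filt_neq0 n a : exact_filt n a -> a != 0.
Proof. by move=> [_ nF]; apply/eqP => a0; apply: nF; rewrite a0; exact: filt_zero. Qed.

Lemma exact_filtO n a : exact_filt n a -> O a.
Proof. by move=> [/(filtW (leq0n n)) /(filt0 HF)]. Qed.

Lemma filt_valE b c n k : exact_filt n b -> exact_filt k c ->
  filt_val (b / c) = n%:Z - k%:Z.
Proof.
move=> Eb Ec; have b0 := exact_filt_neq0 Eb; have c0 := exact_filt_neq0 Ec.
rewrite /filt_val mulf_eq0 invr_eq0 (negPf b0) (negPf c0) /=.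
set P := fun m : int => _.
have /(epsilon_spec (inhabits 0)) : exists m, P m.
  exists (n%:Z - k%:Z), b, c, n, k; split=> //; first exact: (exact_filtO Eb).
  exact: (exact_filtO Ec).
case=> b' [c' [n' [k' [Ob' Oc' E Eb' [Ec' ->]]]]].
have c'0 := exact_filt_neq0 Ec'.
have E' : b * c' = b' * c by rewrite -[b](divfK c0) E; field.
have := exact_filt_uniq (exact_filtM Eb Ec'); rewrite E' => /(_ _ (exact_filtM Eb' Ec)).
lia.
Qed.

Lemma filt_val0 : filt_val 0 = 0. Proof. by rewrite /filt_val eqxx. Qed.

Lemma filt_frac a : a != 0 -> exists b c n k,
  [/\ a = b / c, exact_filt n b & exact_filt k c].
Proof.
move=> a0; have [b [c [Ob Oc c0 E]]] := Ofrac a.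
have b0 : b != 0 by apply: contraNneq a0 => b0; rewrite E b0 mul0r.
have [n Eb] := exact_filt_ex Ob b0; have [k Ec] := exact_filt_ex Oc c0.
by exists b, c, n, k.
Qed.

Lemma filt_valM a b : a != 0 -> b != 0 -> filt_val (a * b) = filt_val a + filt_val b.
Proof.
move=> /filt_frac[p [q [n [k [-> Ep Eq]]]]] /filt_frac[p' [q' [n' [k' [-> Ep' Eq']]]]].
rewrite mulf_div !(filt_valE Ep Eq, filt_valE Ep' Eq', filt_valE (exact_filtM Ep Ep') (exact_filtM Eq Eq')).
lia.
Qed.

Lemma one_exact : exact_filt 0 1.
Proof.
split; first exact/(filt0 HF).
have [k [Fk nFk]] := exact_filt_ex O1 (oner_neq0 K).
by move=> F1; apply: nFk; have := filtM HF F1 Fk; rewrite mul1r add1n.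
Qed.

Lemma filt_val_exact n a : exact_filt n a -> filt_val a = n%:Z.
Proof. by move=> Ea; rewrite -[a]divr1 (filt_valE Ea one_exact) subr0. Qed.

Lemma filt_val_ge n a : O a -> a != 0 -> (n%:Z <= filt_val a) <-> F n a.
Proof.
move=> Oa a0; have [k Ek] := exact_filt_ex Oa a0; rewrite (filt_val_exact Ek) lez_nat.
case: (Ek) => Fk nFk; split=> [nk|Fn]; first exact: filtW Fk.
by rewrite leqNgt; apply/negP => lt; apply: nFk; apply: filtW Fn.
Qed.

Lemma filt_val_ge0 a : O a -> 0 <= filt_val a.
Proof.
move=> Oa; have [->|a0] := eqVneq a 0; first by rewrite filt_val0.
by apply/(filt_val_ge 0%N Oa a0)/(filt0 HF).
Qed.

Lemma filt_val_min a b : a != 0 -> b != 0 -> a + b != 0 ->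
  Num.min (filt_val a) (filt_val b) <= filt_val (a + b).
Proof.
move=> a0 b0 ab0; have [p [q [n [k [aE Ep Eq]]]]] := filt_frac a0.
have [p' [q' [n' [k' [bE Ep' Eq']]]]] := filt_frac b0.
have q0 := exact_filt_neq0 Eq; have q'0 := exact_filt_neq0 Eq'.
pose d := q * q'; have d0 : d != 0 by rewrite mulf_neq0.
have Oda : O (a * d).
  by rewrite (_ : a * d = p * q'); [apply: (O_mul (exact_filtO Ep) (exact_filtO Eq'))|by rewrite aE /d; field].
have Odb : O (b * d).
  by rewrite (_ : b * d = p' * q); [apply: (O_mul (exact_filtO Ep') (exact_filtO Eq))|by rewrite bE /d; field].
have Odab : O ((a + b) * d).
  by rewrite mulrDl; apply/(filt0 HF)/(filtD HF); apply/(filt0 HF).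
rewrite -(lerD2r (filt_val d)) -filt_valM // addr_minl -!filt_valM //.
have [m mE] : exists m : nat, Num.min (filt_val (a * d)) (filt_val (b * d)) = m%:Z.
  exists `|Num.min (filt_val (a * d)) (filt_val (b * d))|%N.
  by rewrite gez0_abs // le_min !filt_val_ge0.
rewrite mE; apply/(filt_val_ge _ Odab); first by rewrite mulf_neq0.
have : m%:Z <= Num.min (filt_val (a * d)) (filt_val (b * d)) by rewrite mE.
rewrite le_min => /andP[/(filt_val_ge _ Oda (mulf_neq0 a0 d0)) Fa].
move=> /(filt_val_ge _ Odb (mulf_neq0 b0 d0)) Fb.
by rewrite mulrDl; apply: (filtD HF).
Qed.

Lemma filt_val_normalized s : exact_filt 1 s -> normalized_valuation filt_val.
Proof.
move=> Es; split; [exact: filt_val0|exact: filt_valM|exact: filt_val_min|].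
by exists s; rewrite (filt_val_exact Es).
Qed.

End Filtrations.

(** * Curves through a point *)

Section Primes.
Variables (R : realType) (K : fieldType) (iota : {rmorphism R[i] -> K}).
Implicit Types (O W M J P : K -> Prop) (a b : K).
Notation locring := (locring iota).
Notation regular := (regular iota).

Definition dv O b a := exists2 c, O c & a = c * b.

Record ideal O J : Prop := Ideal {
  idO : forall a, J a -> O a;
  id0 : J 0;
  idD : forall a b, J a -> J b -> J (a + b);
  idZ : forall a b, O a -> J b -> J (a * b) }.

Definition prime_ideal O P := [/\ ideal O P, ~ P 1 &
  forall a b, O a -> O b -> P (a * b) -> P a \/ P b].

Definition prime_elt O p := [/\ maxid O p, p != 0 &
  forall a b, O a -> O b -> dv O p (a * b) -> dv O p a \/ dv O p b].

(* The irreducible curves through the point whose local ring is [O]. *)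
Definition curve_at O (v : K -> int) := [/\ normalized_valuation v,
  forall a, O a -> 0 <= v a & exists a, [/\ maxid O a, a != 0 & v a = 0]].

Definition ordp O p : K -> int := filt_val O (fun n => dv O (p ^+ n)).
(** The multiplicity at the point, which is the order along the exceptional curve of its blowup. *)
Definition ordm O : K -> int := filt_val O (mpow O).

Section OneRing.
Variables (O : K -> Prop) (HO : regular O).
Let LO : locring O := regular_loc HO.

Lemma regular_frac a : exists b c, [/\ O b, O c, c != 0 & a = b / c].
Proof. exact: (reg_frac (regular_reg HO)). Qed.

Lemma dvO b a : O b -> dv O b a -> O a.
Proof. by move=> Ob [c Oc ->]; inO LO. Qed.

Lemma dv_refl b : dv O b b. Proof. by exists 1; [inO LO|rewrite mul1r]. Qed.

Lemma dv_mull a b c : O a -> dv O b c -> dv O b (a * c).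
Proof. by move=> Oa [d Od ->]; exists (a * d); [inO LO|rewrite mulrA]. Qed.

Lemma dv_add b a c : dv O b a -> dv O b c -> dv O b (a + c).
Proof. by move=> [d Od ->] [e Oe ->]; exists (d + e); [inO LO|ring]. Qed.

Lemma dv_trans b a c : dv O c b -> dv O b a -> dv O c a.
Proof. by move=> [d Od ->] [e Oe ->]; exists (e * d); [inO LO|rewrite mulrA]. Qed.

Lemma dv0 b : dv O b 0. Proof. by exists 0; [inO LO|rewrite mul0r]. Qed.

Lemma dv_max p a : maxid O p -> dv O p a -> maxid O a.
Proof. by move=> mp [c Oc ->]; apply: (maxMl LO). Qed.

Lemma ideal_dv p : O p -> ideal O (dv O p).
Proof.
move=> Op; split; [by move=> a; exact: dvO|exact: dv0|by move=> *; exact: dv_add|].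
by move=> *; exact: dv_mull.
Qed.

(** Since [x] is a nonunit outside [P], one of the two coordinates is not in [P], and
    [prime_principal_coord] applies with it. *)
Lemma prime_principal P x a0 : prime_ideal O P -> maxid O x -> ~ P x -> P a0 -> a0 != 0 ->
  exists2 p, prime_elt O p & forall a, P a <-> dv O p a.
Proof.
move=> [[PO P0 PD PZ] P1 Pp] mx nPx Pa0 a00.
have [s [t Cst]] := reg_coords (regular_reg HO).
have [p Pp' H] : exists2 p, P p & forall a, P a -> exists2 b, O b & a = b * p.
  have [nPt|Pt] := pselect (~ P t); first exact: (prime_principal_coord HO Cst).
  apply: (prime_principal_coord HO (coordsC Cst)) => // Ps; apply: nPx.
  case: Cst => _ _ /(_ _ mx)[b [c [Ob Oc ->]]].
  by apply: PD; apply: PZ => //; exact: contrapT.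
have E a : P a <-> dv O p a by split=> [/H//|[b Ob ->]]; exact: PZ.
exists p => //; split.
- case: (unit_or_max LO (PO _ Pp')) => // -[p0 _ Oi]; case: P1.
  by rewrite -(mulVf p0); exact: PZ.
- by apply: contraNneq a00 => p0; have [b _ ->] := H _ Pa0; rewrite p0 mulr0.
- by move=> a b Oa Ob /E /(Pp _ _ Oa Ob)[/E|/E]; [left|right].
Qed.

(** An ideal that contains [J] and is maximal among those without a power of [x] is prime; as it
    does not contain [x], it is principal. *)
Lemma prime_elt_exists J x a0 : ideal O J -> maxid O x -> (forall e, ~ J (x ^+ e)) ->
  J a0 -> a0 != 0 -> exists2 p, prime_elt O p & forall a, J a -> dv O p a.
Proof.
move=> HJ mx nJ Ja0 a00.
pose good (I : K -> Prop) := [/\ forall a, J a -> I a, ideal O I & forall e, ~ I (x ^+ e)].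
pose S : classical_sets.set (classical_sets.set K) := fun I => (forall a, ~ I a) \/ good I.
have [|A [SA Amax]] := @Zorn_bigcup K S.
  move=> F FS Ftot.
  have [[I FI gI]|nF] := pselect (exists2 I, F I & good I); last first.
    left=> a [I FI Ia]; case: (FS _ FI) => [nI|gI]; first exact: (nI a).
    by apply: nF; exists I.
  right; case: (gI) => JI [IO I0 ID IZ] nI; split.
  - by move=> a /JI Ia; exists I.
  - have gF L a : F L -> L a -> good L by move=> FL La; case: (FS _ FL) => // /(_ a).
    split.
    + by move=> a [L FL La]; have [_ [LO' _ _ _] _] := gF _ _ FL La; exact: LO'.
    + by exists I.
    + move=> a b [L FL La] [N FN Nb].
      have [_ [_ _ LD _] _] := gF _ _ FL La; have [_ [_ _ ND _] _] := gF _ _ FN Nb.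
      case: (Ftot _ _ FL FN) => sub; [exists N|exists L] => //.
        by apply: ND => //; exact: sub.
      by apply: LD => //; exact: sub.
    + move=> a b Oa [L FL Lb]; exists L => //.
      by have [_ [_ _ _ LZ] _] := gF _ _ FL Lb; exact: LZ.
  - move=> e [L FL Le]; case: (FS _ FL) => [/(_ (x ^+ e))//|[_ _ /(_ e)//]].
have gJ : good J by split.
case: SA => [A0|gA].
  case: (Amax J); last by right.
  by split=> [a /A0//|sub]; exact: (A0 a0 (sub _ Ja0)).
have [JA idA nA] := gA; have [AO A0 AD AZ] := idA.
have meet a : O a -> ~ A a -> exists e b c, [/\ A b, O c & x ^+ e = b + c * a].
  move=> Oa nAa; apply: contrapT => H.
  pose B : classical_sets.set K := fun y => exists b c, [/\ A b, O c & y = b + c * a].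
  case: (Amax B).
    split=> [y Ay|sub]; first by exists y, 0; split=> //; [inO LO|rewrite mul0r addr0].
    by apply: nAa; apply: sub; exists 0, 1; split=> //; [inO LO|rewrite mul1r add0r].
  right; split.
  - by move=> y /JA Ay; exists y, 0; split=> //; [inO LO|rewrite mul0r addr0].
  - split.
    + by move=> _ [b [c [/AO Ob Oc ->]]]; inO LO.
    + by exists 0, 0; split=> //; [inO LO|rewrite mul0r addr0].
    + move=> _ _ [b [c [Ab Oc ->]]] [b' [c' [Ab' Oc' ->]]].
      by exists (b + b'), (c + c'); split; [exact: AD|inO LO|ring].
    + move=> d _ Od [b [c [Ab Oc ->]]].
      by exists (d * b), (d * c); split; [exact: AZ|inO LO|ring].
  - by move=> e [b [c [Ab Oc E]]]; apply: H; exists e, b, c.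
have Aprime : prime_ideal O A.
  split=> //; first by have := nA 0%N; rewrite expr0.
  move=> a b Oa Ob Aab; apply: contrapT => /not_orP[nAa nAb].
  have [e [p [c [Ap Oc E]]]] := meet _ Oa nAa.
  have [e' [p' [c' [Ap' Oc' E']]]] := meet _ Ob nAb.
  apply: (nA (e + e')%N); rewrite exprD E E'.
  have -> : (p + c * a) * (p' + c' * b) = p' * p + c' * b * p + c * a * p' + c * c' * (a * b).
    by ring.
  have Op' := AO _ Ap'.
  by apply: (AD); [apply: (AD); [apply: (AD)|]|]; apply: (AZ) => //; inO LO.
have [|p pp Ep] := prime_principal Aprime mx _ (JA _ Ja0) a00.
  by have := nA 1%N; rewrite expr1.
by exists p => // a /JA /Ep.
Qed.

Lemma coord_power_regular s t n m y w : coords O s t -> O y -> O w ->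
  s ^+ n * y = t ^+ m * w -> dv O (t ^+ m) y.
Proof.
move=> Cst Oy Ow; have [[Os _] [Ot _] _] := Cst.
have H k z u : O z -> O u -> s ^+ k * z = t * u -> exists2 b, O b & z = t * b.
  elim: k z u => [|k IH] z u Oz Ou; first by rewrite expr0 mul1r => ->; exists u.
  have Osz : O (s * z) by inO LO.
  rewrite exprSr -mulrA => /(IH _ _ Osz Ou)[b Ob E]; exact: (coord_regular HO Cst Oz Ob).
elim: m y w Oy Ow => [|m IH] y w Oy Ow; first by exists y; rewrite ?expr0 ?mulr1.
rewrite exprS -mulrA => E; have [|b Ob yE] := H _ _ _ Oy _ E; first by inO LO.
have [|c Oc bE] := IH b w Ob Ow.
  by apply: (mulfI (coord_neq0 HO (coordsC Cst))); rewrite -E yE; ring.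
by exists c => //; rewrite yE bE; ring.
Qed.

(** Otherwise powers of both coordinates would be multiples of [b], say [s ^+ n = c * b] and
    [t ^+ m = d * b]. Then [s ^+ n * d = t ^+ m * c], so [t ^+ m] divides [d], and [b] is a unit. *)
Lemma prime_factor b : maxid O b -> b != 0 -> exists2 p, prime_elt O p & dv O p b.
Proof.
move=> mb b0; have [s [t Cst]] := reg_coords (regular_reg HO); have [ms mt _] := Cst.
have HJ : ideal O (dv O b) by apply: ideal_dv; case: mb.
have bb : dv O b b := dv_refl b.
have [/existsNP[x /not_implyP[mx nx]]|H] :=
  pselect (~ forall x, maxid O x -> exists e, dv O b (x ^+ e)).
  by have [|p pp H] := prime_elt_exists HJ mx _ bb b0; [exact/forallNP|exists p => //; exact: H].
have {}H : forall x, maxid O x -> exists e, dv O b (x ^+ e) by exact: contrapT.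
have [n [c Oc sE]] := H _ ms; have [m [d Od tE]] := H _ mt.
have [|e Oe dE] := @coord_power_regular s t n m d c Cst Od Oc.
  by rewrite sE tE; ring.
have t0 : t ^+ m != 0 by rewrite expf_neq0 // (coord_neq0 HO (coordsC Cst)).
case: (unit_nmax (unit1 LO)); rewrite (_ : 1 = e * b); first exact: (maxMl LO).
by apply: (mulfI t0); rewrite mulr1 {1}tE dE; ring.
Qed.

Section PrimeElt.
Variables (p : K) (Hp : prime_elt O p).
Let mp : maxid O p. Proof. by case: Hp. Qed.
Let p0 : p != 0. Proof. by case: Hp. Qed.

Lemma prime_ndv1 : ~ dv O p 1.
Proof. by move=> /(dv_max mp); exact: not_max1 LO. Qed.

Lemma dvp_filtration : filtration O (fun n => dv O (p ^+ n)).
Proof.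
have [Op _] := mp; split.
- move=> a; rewrite expr0; split=> [Oa|[c Oc ->]]; last by rewrite mulr1.
  by exists a; rewrite ?mulr1.
- move=> n a [c Oc ->]; exists (c * p); first by inO LO.
  by rewrite exprS mulrA.
- by move=> n; exact: dv0.
- by move=> n a b; exact: dv_add.
- move=> n k _ _ [c Oc ->] [d Od ->]; exists (c * d); first by inO LO.
  by rewrite exprD mulrACA.
- move=> n k _ _ [c Oc ->] [d Od ->] [e Oe E].
  have cdp : dv O p (c * d).
    exists e => //; apply: (mulfI (expf_neq0 (n + k) p0)).
    rewrite exprS in E; rewrite [RHS](_ : _ = e * (p * p ^+ (n + k))); last by ring.
    by rewrite -E exprD; ring.
  case: Hp => _ _ /(_ c d Oc Od cdp)[[f Of cE]|[f Of dE]].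
  + by left; exists f => //; rewrite cE exprS; ring.
  + by right; exists f => //; rewrite dE exprS; ring.
- move=> a H; have [s [t Cst]] := reg_coords (regular_reg HO).
  apply: (cap_mpow HO Cst) => n; have [c Oc ->] := H n.
  by apply: (mpowZ HO) => //; exact: (mpowX HO Cst).
Qed.

Let Ofrac := regular_frac.
Let O1 : O 1. Proof. by inO LO. Qed.
Let Omul a b : O a -> O b -> O (a * b). Proof. by move=> ? ?; inO LO. Qed.

Lemma prime_exact1 : exact_filt (fun n => dv O (p ^+ n)) 1 p.
Proof.
split; first by rewrite expr1; exact: dv_refl.
rewrite expr2 => -[c Oc E]; apply: prime_ndv1; exists c => //.
by apply: (mulfI p0); rewrite mulr1 {1}E; ring.
Qed.

Lemma ordp_normalized : normalized_valuation (ordp O p).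
Proof. exact: (filt_val_normalized dvp_filtration Ofrac O1 Omul prime_exact1). Qed.

Lemma ordp_ge0 a : O a -> 0 <= ordp O p a.
Proof. exact: (filt_val_ge0 dvp_filtration O1). Qed.

Lemma ordp_self : ordp O p p = 1.
Proof. exact: (filt_val_exact dvp_filtration O1 prime_exact1). Qed.

Lemma ordp_gt0 a : O a -> a != 0 -> 0 < ordp O p a <-> dv O p a.
Proof.
by move=> Oa a0; have := filt_val_ge dvp_filtration O1 1 Oa a0; rewrite expr1.
Qed.

(** If [p] divided both coordinates, [s = a * p] and [t = b * p], then [s * b = t * a] would make
    [t] divide [b], and [p] would be a unit. *)
Lemma curve_ordp : curve_at O (ordp O p).
Proof.
split; [exact: ordp_normalized|exact: ordp_ge0|].
have [s [t Cst]] := reg_coords (regular_reg HO); have [ms mt _] := Cst.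
have H x : maxid O x -> x != 0 -> ~ dv O p x -> exists a, [/\ maxid O a, a != 0 & ordp O p a = 0].
  move=> mx x0 nx; exists x; split=> //; apply/eqP; rewrite eq_le ordp_ge0 ?andbT; last by case: mx.
  by rewrite leNgt; apply/negP => /ordp_gt0 H; apply: nx; apply: H => //; case: mx.
have [sp|] := pselect (dv O p s); last by apply: H => //; exact: (coord_neq0 HO Cst).
have [tp|] := pselect (dv O p t); last by apply: H => //; exact: (coord_neq0 HO (coordsC Cst)).
case: sp => a Oa sE; case: tp => b Ob tE.
have [|d Od bE] := @coord_regular _ _ _ _ HO s t Cst b a Ob Oa.
  by rewrite sE tE; ring.
have t0 := coord_neq0 HO (coordsC Cst).
case: prime_ndv1; exists d => //; apply: (mulfI t0).
by rewrite mulr1 {1}tE {1}bE; ring.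
Qed.

Lemma prime_elt_decomp a : O a -> a != 0 -> exists n b, [/\ O b, ~ dv O p b & a = p ^+ n * b].
Proof.
move=> Oa a0; have [n [[b Ob aE] nF]] := exact_filt_ex dvp_filtration Oa a0.
exists n, b; split=> //; last by rewrite aE mulrC.
by move=> [c Oc bE]; apply: nF; exists c => //; rewrite aE bE exprS; ring.
Qed.
End PrimeElt.

End OneRing.
End Primes.

Section Valuations.
Variables (K : fieldType) (v : K -> int) (Hv : normalized_valuation v).

Lemma nval0 : v 0 = 0. Proof. by case: Hv. Qed.

Lemma nvalM a b : a != 0 -> b != 0 -> v (a * b) = v a + v b.
Proof. by case: Hv => _ H _ _; exact: H. Qed.

Lemma nval1 : v 1 = 0.
Proof. by apply: (addrI (v 1)); rewrite addr0 -nvalM ?oner_neq0 // mulr1. Qed.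

Lemma nvalV a : a != 0 -> v a^-1 = - v a.
Proof.
by move=> a0; apply: (addrI (v a)); rewrite -nvalM ?invr_eq0 // mulfV // nval1 subrr.
Qed.

Lemma nval_div a b : a != 0 -> b != 0 -> v (a / b) = v a - v b.
Proof. by move=> a0 b0; rewrite nvalM ?nvalV ?invr_eq0. Qed.

Lemma nvalX a n : a != 0 -> v (a ^+ n) = n%:Z * v a.
Proof.
move=> a0; elim: n => [|n IH]; first by rewrite expr0 nval1 mul0r.
by rewrite exprS nvalM ?expf_neq0 // IH; lia.
Qed.

Lemma nvalXz a (n : int) : a != 0 -> v (a ^ n) = n * v a.
Proof.
move=> a0; case: n => n; first by rewrite -exprnP nvalX.
by rewrite NegzE -exprnN nvalV ?expf_neq0 // nvalX // mulNr.
Qed.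

Lemma nval_N1 : v (-1) = 0.
Proof.
have n0 : (-1 : K) != 0 by rewrite oppr_eq0 oner_eq0.
by have := nvalM n0 n0; rewrite mulrNN mulr1 nval1; lia.
Qed.

Lemma nvalN a : v (- a) = v a.
Proof.
have [->|a0] := eqVneq a 0; first by rewrite oppr0.
by rewrite -mulN1r nvalM ?oppr_eq0 ?oner_eq0 // nval_N1 add0r.
Qed.

Lemma nval_ge_add (m : int) a b : (a != 0 -> m <= v a) -> (b != 0 -> m <= v b) ->
  a + b != 0 -> m <= v (a + b).
Proof.
have [->|a0] := eqVneq a 0; first by rewrite add0r => _ H b0; exact: H.
have [->|b0] := eqVneq b 0; first by rewrite addr0 => H _ _; exact: H.
move=> /(_ isT) Ha /(_ isT) Hb ab0; case: Hv => _ _ /(_ a b a0 b0 ab0) + _.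
by apply: le_trans; rewrite le_min Ha Hb.
Qed.

Lemma nval_neq0 a : v a != 0 -> a != 0.
Proof. by apply: contraNneq => ->; rewrite nval0. Qed.

End Valuations.

Section Primes.
Variables (R : realType) (K : fieldType) (iota : {rmorphism R[i] -> K}).
Implicit Types (O W M J P : K -> Prop) (a b : K).
Notation locring := (locring iota).
Notation regular := (regular iota).

Section OneRing.
Variables (O : K -> Prop) (HO : regular O).
Let LO : locring O := regular_loc HO.

Section Curve.
Variables (v : K -> int) (Hv : curve_at O v).
Let nv : normalized_valuation v. Proof. by case: Hv. Qed.

Lemma curve_ge0 a : O a -> 0 <= v a. Proof. by case: Hv => _ H _ /H. Qed.

Lemma curve_unit a : unit_in O a -> v a = 0.
Proof.
move=> [a0 Oa Oi]; have := curve_ge0 Oi; rewrite (nvalV nv a0).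
by have := curve_ge0 Oa; lia.
Qed.

(** The elements of positive value form a prime ideal, principal because some nonunit has value
    zero. All values are multiples of that of the generator, and the value 1 is attained, so the
    generator has value 1. *)
Lemma curve_prime_elt : exists p, [/\ prime_elt O p, v p = 1 &
  forall a, O a -> a != 0 -> 0 < v a <-> dv O p a].
Proof.
pose P a := O a /\ (a = 0 \/ 0 < v a).
have vgt a b : P a -> b != 0 -> O b -> a * b != 0 -> 0 < v (a * b).
  move=> [_ [->|va]] b0 Ob; rewrite ?mul0r ?eqxx // => ab0.
  rewrite (nvalM nv) //; first by have := curve_ge0 Ob; lia.
  by apply: contraNneq ab0 => ->; rewrite mul0r.
have HP : prime_ideal O P.
  split; first split.
  - by move=> a [].
  - by split; [inO LO|left].
  - move=> a b [Oa Ha] [Ob Hb]; split; first by inO LO.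
    have [->|ab0] := eqVneq (a + b) 0; [by left|right].
    apply: (@nval_ge_add _ _ nv 1) => //.
      by case: Ha => [->|//]; rewrite eqxx.
    by case: Hb => [->|//]; rewrite eqxx.
  - move=> a b Oa Pb; split; first by case: Pb => Ob _; inO LO.
    have [|ab0] := eqVneq (a * b) 0; [by left|right].
    rewrite mulrC in ab0 *; apply: vgt => //.
    by apply: contraNneq ab0 => ->; rewrite mulr0.
  - by move=> [_ []]; [apply/eqP; exact: oner_neq0|rewrite (nval1 nv)].
  - move=> a b Oa Ob [_ [/eqP|]].
      by rewrite mulf_eq0 => /orP[/eqP ->|/eqP ->]; [left|right]; split; [inO LO|left|inO LO|left].
    have [->|a0] := eqVneq a 0; first by left; split; [inO LO|left].
    have [->|b0] := eqVneq b 0; first by right; split; [inO LO|left].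
    rewrite (nvalM nv) // => H; have va := curve_ge0 Oa; have vb := curve_ge0 Ob.
    have [|] := ltP 0 (v a); first by left; split => //; right.
    by move=> ?; right; split=> //; right; lia.
have [x [mx x0 vx]] : exists a, [/\ maxid O a, a != 0 & v a = 0] by case: Hv.
have [w vw] : exists a, v a = 1 by case: nv.
have w0 : w != 0 by apply: (nval_neq0 nv); rewrite vw.
have [b [c [Ob Oc c0 wE]]] := regular_frac HO w.
have b0 : b != 0 by apply: contraNneq w0 => b0; rewrite wE b0 mul0r.
have Pb : P b.
  split=> //; right; have := curve_ge0 Oc.
  by move: vw; rewrite wE (nval_div nv) //; lia.
have nPx : ~ P x by move=> [_ [/eqP|]]; rewrite ?vx // (negPf x0).
have [p pp E] := prime_principal HO HP mx nPx Pb b0.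
have PE a : O a -> a != 0 -> 0 < v a <-> dv O p a.
  move=> Oa a0; split=> [va|/E[_ [/eqP|//]]]; last by rewrite (negPf a0).
  by apply/E; split=> //; right.
have [mp p0 _] := pp; have Op := max_loc mp.
have vp : 0 < v p by apply/PE => //; exact: (dv_refl HO).
have div a : O a -> a != 0 -> exists n : nat, v a = n%:Z * v p.
  move=> Oa a0; have [n [d [Od nd aE]]] := prime_elt_decomp HO pp Oa a0; exists n.
  have d0 : d != 0 by apply: contraNneq a0 => d0; rewrite aE d0 mulr0.
  rewrite aE (nvalM nv) ?expf_neq0 // (nvalX nv) //; suff -> : v d = 0 by rewrite addr0.
  have := curve_ge0 Od; have := PE d Od d0; case: (ltP 0 (v d)) => [_ [/(_ isT)//]|]; lia.
exists p; split=> //.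
have [n vb] := div b Ob b0; have [k vc] := div c Oc c0.
move: vw; rewrite wE (nval_div nv) // vb vc -mulrBl.
move: (n%:Z - k%:Z) (v p) vp => d e e0 de.
have d0 : 0 < d by rewrite -(pmulr_lgt0 _ e0) de.
have : e <= d * e by rewrite ler_peMl //; lia.
by rewrite de; lia.
Qed.

Lemma curve_ordpE p : prime_elt O p -> 0 < v p -> v = ordp O p.
Proof.
move=> pp vp; have [q [qq vq qE]] := curve_prime_elt.
have [mp p0 pprime] := pp; have [mq q0 _] := qq; have Op := max_loc mp; have Oq := max_loc mq.
have [c Oc pE] : dv O q p by apply/qE.
have [d Od qE'] : dv O p q.
  have : dv O p (c * q) by rewrite -pE; exact: (dv_refl HO).
  case/(pprime c q Oc Oq) => // -[d Od cE].
  case: (prime_ndv1 HO qq); exists d => //; apply: (mulfI p0).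
  by rewrite mulr1 {1}pE cE; ring.
have npv := ordp_normalized HO pp.
have dvE a : dv O q a <-> dv O p a.
  by split; apply: (dv_trans HO); [exists d|exists c].
have vp1 : v p = 1.
  suff : v c = 0 by rewrite pE (nvalM nv) ?vq //; [move=> ->|apply: contraNneq p0 => c0; rewrite pE c0 mul0r].
  apply: curve_unit.
  have dc : d * c = 1 by apply: (mulfI q0); rewrite mulr1 {2}qE' {1}pE; ring.
  by have := unit1 LO; rewrite -dc mulrC => /(unitMl LO); apply.
have EO a : O a -> a != 0 -> v a = ordp O p a.
  move=> Oa a0; have [n [b [Ob nb aE]]] := prime_elt_decomp HO pp Oa a0.
  have b0 : b != 0 by apply: contraNneq a0 => b0; rewrite aE b0 mulr0.
  rewrite aE (nvalM nv) ?(nvalM npv) ?expf_neq0 // (nvalX nv) // (nvalX npv) // vp1 (ordp_self HO) //.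
  congr (_ + _).
  have H : ~ 0 < v b by move/(qE b Ob b0)/dvE.
  have H' : ~ 0 < ordp O p b by move/(ordp_gt0 HO pp Ob b0).
  have := curve_ge0 Ob; have := ordp_ge0 HO pp Ob; lia.
apply/funext => a; have [->|a0] := eqVneq a 0; first by rewrite (nval0 nv) (nval0 npv).
have [b [c' [Ob Oc' c'0 aE]]] := regular_frac HO a.
have b0 : b != 0 by apply: contraNneq a0 => b0; rewrite aE b0 mul0r.
by rewrite aE (nval_div nv) // (nval_div npv) // !EO.
Qed.
End Curve.

Lemma curve_eq v u p : curve_at O v -> curve_at O u -> prime_elt O p ->
  0 < v p -> 0 < u p -> v = u.
Proof. by move=> Hv Hu pp /(curve_ordpE Hv pp) -> /(curve_ordpE Hu pp) ->. Qed.

(** A prime factor of the numerator also divides the denominator, because the orders agree along its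
    curve, and can be cancelled; this stops since the numerator has finite order. Once the numerator
    is a unit, so is the denominator. *)
Lemma unit_of_curves a : a != 0 -> (forall v, curve_at O v -> v a = 0) -> unit_in O a.
Proof.
move=> a0 H; have [b [c [Ob Oc c0 aE]]] := regular_frac HO a.
have b0 : b != 0 by apply: contraNneq a0 => b0; rewrite aE b0 mul0r.
have E v : curve_at O v -> v b = v c.
  move=> Hv; have nv : normalized_valuation v by case: Hv.
  by have := H v Hv; rewrite aE (nval_div nv) //; lia.
have [s [t Cst]] := reg_coords (regular_reg HO).
have [n nb] : exists n, ~ mpow O n b.
  by apply/existsNP => /(cap_mpow HO Cst)/eqP; rewrite (negPf b0).
rewrite {}aE {H a0}; elim: n b c Ob Oc b0 c0 E nb => [//|n IH] b c Ob Oc b0 c0 E nb.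
case: (unit_or_max LO Ob) => [ub|mb].
  case: (unit_or_max LO Oc) => [uc|mc]; first by apply: (unitM LO) => //; exact: unitV.
  have [p pp pc] := prime_factor HO mc c0.
  have /E : curve_at O (ordp O p) := curve_ordp HO pp.
  move/(ordp_gt0 HO pp Oc c0): pc => + E'; rewrite -E'.
  by rewrite (curve_unit (curve_ordp HO pp) ub).
have [p pp pb] := prime_factor HO mb b0; have cp := curve_ordp HO pp.
have [mp p0 _] := pp.
have pc : dv O p c.
  by apply/(ordp_gt0 HO pp Oc c0); rewrite -(E _ cp); apply/(ordp_gt0 HO pp Ob b0).
case: pb => b' Ob' bE; case: pc => c' Oc' cE.
have b'0 : b' != 0 by apply: contraNneq b0 => z; rewrite bE z mul0r.
have c'0 : c' != 0 by apply: contraNneq c0 => z; rewrite cE z mul0r.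
rewrite (_ : b / c = b' / c'); last by rewrite bE cE; field; rewrite p0 c'0.
apply: IH => //.
  move=> v Hv; have := E v Hv; have nv : normalized_valuation v by case: Hv.
  by rewrite bE cE !(nvalM nv) //; lia.
by move=> H; apply: nb; rewrite bE mulrC; apply: (mpow_max HO Cst).
Qed.

Lemma mpow_filtration : filtration O (mpow O).
Proof.
have [s [t Cst]] := reg_coords (regular_reg HO); split.
- by [].
- by move=> n a; exact: (mpowSW HO Cst).
- exact: mpow0 HO.
- by move=> n a b; exact: (mpowD HO Cst).
- by move=> n k a b; exact: (mpow_mul HO Cst).
- by move=> n k a b; exact: (mpow_prime HO Cst).
- exact: cap_mpow HO _ _ Cst.
Qed.

Let Ofrac := regular_frac HO.
Let O1 : O 1. Proof. by inO LO. Qed.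
Let Omul a b : O a -> O b -> O (a * b). Proof. by move=> ? ?; inO LO. Qed.

Lemma coord_exact s t : coords O s t -> exact_filt (mpow O) 1 s.
Proof.
move=> Cst; split; first by apply/(mpow1 HO); case: Cst.
exact: (coord_nmpow2 HO (coordsC Cst)).
Qed.

Lemma ordm_normalized : normalized_valuation (ordm O).
Proof.
have [s [t Cst]] := reg_coords (regular_reg HO).
exact: (filt_val_normalized mpow_filtration Ofrac O1 Omul (coord_exact Cst)).
Qed.

Lemma ordm_ge n a : O a -> a != 0 -> (n%:Z <= ordm O a) <-> mpow O n a.
Proof. exact: (filt_val_ge mpow_filtration O1). Qed.

Lemma ordm_ge0 a : O a -> 0 <= ordm O a.
Proof. exact: (filt_val_ge0 mpow_filtration O1). Qed.

Lemma ordm_gt0 a : maxid O a -> a != 0 -> 0 < ordm O a.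
Proof. by move=> ma a0; apply/(ordm_ge 1 (max_loc ma) a0)/(mpow1 HO). Qed.

Lemma ordm_coord s t : coords O s t -> ordm O s = 1.
Proof. by move=> Cst; exact: (filt_val_exact mpow_filtration O1 (coord_exact Cst)). Qed.

Lemma ordm_unit a : unit_in O a -> ordm O a = 0.
Proof.
move=> [a0 Oa Oi]; have := ordm_ge0 Oi; have := ordm_ge0 Oa.
by rewrite (nvalV ordm_normalized a0); lia.
Qed.

End OneRing.
End Primes.

(** * Closed points of a projective model *)

Section Models.
Variables (R : realType) (K : fieldType) (iota : {rmorphism R[i] -> K}).
Notation locring := (locring iota).

Lemma mmap_scale n (A : comNzRingType) (f : {rmorphism R[i] -> A}) (h : 'I_n -> A) c d
    (F : {mpoly R[i][n]}) : F \is d.-homog ->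
  mmap f (fun j => c * h j) F = c ^+ d * mmap f h F.
Proof.
move=> /dhomogP hF; rewrite /mmap mulr_sumr; apply: eq_big_seq => m /hF <-.
rewrite mulrCA; congr (_ * _); rewrite /mmap1.
transitivity ((\prod_(j < n) c ^+ m j) * \prod_(j < n) h j ^+ m j).
  by rewrite -big_split; apply: eq_bigr => j _; rewrite exprMn.
by rewrite prodrXr -mdegE.
Qed.

Lemma rmorph_mmap n (A B : comNzRingType) (f : {rmorphism R[i] -> A})
    (g : {rmorphism A -> B}) (h : 'I_n -> A) (F : {mpoly R[i][n]}) :
  g (mmap f h F) = mmap (g \o f) (g \o h) F.
Proof.
rewrite /mmap rmorph_sum; apply: eq_bigr => m _; rewrite rmorphM; congr (_ * _).
by rewrite /mmap1 rmorph_prod; apply: eq_bigr => j _; rewrite rmorphXn.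
Qed.

Lemma mmap_closed n (B : K -> Prop) (h : 'I_n -> K) : (forall c, B (iota c)) ->
  (forall a b, B a -> B b -> B (a + b)) -> (forall a b, B a -> B b -> B (a * b)) ->
  (forall j, B (h j)) -> forall F, B (mmap iota h F).
Proof.
move=> Bc BD BM Bh F; have B0 : B 0 by rewrite -(rmorph0 iota).
have B1 : B 1 by rewrite -(rmorph1 iota).
apply: (big_ind B B0 BD) => m _; apply: (BM) => //; apply: (big_ind B B1 BM) => j _.
by elim: (m j) => [|k IH]; rewrite ?expr0 ?exprS //; apply: (BM).
Qed.

Lemma res_mmap n (W : K -> Prop) (h : 'I_n -> K) (F : {mpoly R[i][n]}) : locring W ->
  (forall j, W (h j)) -> W (mmap iota h F) /\
  res iota W (mmap iota h F) = F.@[fun j => res iota W (h j)].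
Proof.
move=> LW Wh; rewrite /meval /mmap.
have monom m : W (mmap1 h m) /\ res iota W (mmap1 h m) = mmap1 (fun j => res iota W (h j)) m.
  rewrite /mmap1; apply: (big_ind2 (fun x y => W x /\ res iota W x = y)).
  - by split; [inO LW|rewrite -(rmorph1 iota) (res_const LW)].
  - by move=> x _ y _ [Wx <-] [Wy <-]; split; [inO LW|rewrite (resM LW)].
  - by move=> j _; split; [have := Wh j => ?; inO LW|rewrite (resX LW)].
apply: (big_ind2 (fun x y => W x /\ res iota W x = y)).
- by split; [inO LW|rewrite -(rmorph0 iota) (res_const LW)].
- by move=> x _ y _ [Wx <-] [Wy <-]; split; [inO LW|rewrite (resD LW)].
- move=> m _; have [Wm rm] := monom m; split; first by inO LW.
  by rewrite (resM LW) ?(res_const LW) ?rm //; inO LW.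
Qed.

Section OneModel.
Variable X : model K.
Notation n := (rank X).
Let x (j : 'I_n) : K := gen X 0 j.

Lemma at_gen_morph :
  (forall F G : {mpoly R[i][n]}, at_gen iota (F * G) = at_gen iota F * at_gen iota G) *
  (forall F : {mpoly R[i][n]}, at_gen iota (- F) = - at_gen iota F) *
  (forall F G : {mpoly R[i][n]}, at_gen iota (F + G) = at_gen iota F + at_gen iota G).
Proof.
by split; [split=> *|move=> *]; rewrite /at_gen ?rmorphM ?rmorphN ?rmorphD.
Qed.

Lemma at_pt_morph (p : 'rV[R[i]]_n) :
  (forall F G : {mpoly R[i][n]}, at_pt p (F * G) = at_pt p F * at_pt p G) *
  (forall F : {mpoly R[i][n]}, at_pt p (- F) = - at_pt p F) *
  (forall F G : {mpoly R[i][n]}, at_pt p (F + G) = at_pt p F + at_pt p G).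
Proof.
by split; [split=> *|move=> *]; rewrite /at_pt ?mevalM ?mevalN ?mevalD.
Qed.

Lemma at_genC c : at_gen iota (c%:MP : {mpoly R[i][n]}) = iota c.
Proof. by rewrite /at_gen mmapC. Qed.

Lemma at_ptC (p : 'rV[R[i]]_n) c : at_pt p (c%:MP : {mpoly R[i][n]}) = c.
Proof. by rewrite /at_pt mevalC. Qed.

Lemma at_genX j : at_gen iota ('X_j : {mpoly R[i][n]}) = x j.
Proof. by rewrite /at_gen mmapX mmap1U. Qed.

Lemma at_ptX (p : 'rV[R[i]]_n) j : at_pt p ('X_j : {mpoly R[i][n]}) = p 0 j.
Proof. by rewrite /at_pt mevalXU. Qed.

Lemma homogC c : (c%:MP : {mpoly R[i][n]}) \is 0.-homog.
Proof. by rewrite -[c%:MP]mulr1 mul_mpolyC; apply: dhomogZ; exact: dhomog1. Qed.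

Lemma homogX j : ('X_j : {mpoly R[i][n]}) \is 1.-homog.
Proof. by rewrite dhomogX /= mdeg1. Qed.

Section Point.
Variables (p : 'rV[R[i]]_n) (Hp : point iota X p).
Notation O := (local_ring iota X p).

Lemma at_gen_neq0 d (G : {mpoly R[i][n]}) : G \is d.-homog -> at_pt p G != 0 ->
  at_gen iota G != 0.
Proof. by move=> hG; apply: contraNneq => /(Hp.2 _ _ hG) ->. Qed.

Lemma local_ring_add a b : O a -> O b -> O (a + b).
Proof.
move=> [d [F [G [hF hG G0 ->]]]] [e [F' [G' [hF' hG' G'0 ->]]]].
exists (d + e)%N, (F * G' + F' * G), (G * G'); split.
- by apply: dhomogD; [|rewrite addnC]; exact: dhomogM.
- exact: dhomogM.
- by rewrite at_pt_morph mulf_neq0.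
- have g0 := at_gen_neq0 hG G0; have g'0 := at_gen_neq0 hG' G'0.
  by rewrite !at_gen_morph; field; rewrite g0 g'0.
Qed.

Lemma local_ring_mul a b : O a -> O b -> O (a * b).
Proof.
move=> [d [F [G [hF hG G0 ->]]]] [e [F' [G' [hF' hG' G'0 ->]]]].
exists (d + e)%N, (F * F'), (G * G'); split; [exact: dhomogM|exact: dhomogM| |].
- by rewrite at_pt_morph mulf_neq0.
- have g0 := at_gen_neq0 hG G0; have g'0 := at_gen_neq0 hG' G'0.
  by rewrite !at_gen_morph; field; rewrite g0 g'0.
Qed.

Lemma local_ring_const c : O (iota c).
Proof.
exists 0%N, (c%:MP), (1%:MP); split; [exact: homogC|exact: homogC| |].
- by rewrite at_ptC oner_eq0.
- by rewrite !at_genC rmorph1 divr1.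
Qed.

Lemma local_idealP a : maxid O a <-> local_ideal iota X p a.
Proof.
split=> [[[d [F [G [hF hG G0 aE]]]] Ha]|[d [F [G [hF hG G0 F0 aE]]]]].
  exists d, F, G; split=> //; apply/eqP/negPn/negP => F0.
  have f0 := at_gen_neq0 hF F0; have g0 := at_gen_neq0 hG G0.
  case: Ha => [/eqP|]; first by rewrite aE mulf_eq0 invr_eq0 (negPf f0) (negPf g0).
  by apply; exists d, G, F; split=> //; rewrite aE invf_div.
split; first by exists d, F, G.
have [->|a0] := eqVneq a 0; [by left|right => -[e [F' [G' [hF' hG' G'0 aE']]]]].
have g0 := at_gen_neq0 hG G0; have g'0 := at_gen_neq0 hG' G'0.
have E : at_gen iota (G * G' - F * F') = 0.
  rewrite !at_gen_morph; have : a * a^-1 = 1 by rewrite mulfV.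
  rewrite aE' {1}aE => E; apply/eqP; rewrite subr_eq0 eq_sym; apply/eqP.
  by rewrite -[RHS]mul1r -E; field; rewrite g0 g'0.
have : at_pt p (G * G' - F * F') = 0.
  apply: (Hp.2 (d + e)%N) => //.
  by rewrite -mulN1r; apply: dhomogD; [exact: dhomogM|rewrite mulN1r dhomogN; exact: dhomogM].
rewrite !at_pt_morph F0 mul0r subr0 => /eqP.
by rewrite mulf_eq0 (negPf G0) (negPf G'0).
Qed.

Lemma local_ring_loc : locring O.
Proof.
split; [exact: local_ring_const|exact: local_ring_add|exact: local_ring_mul| |].
  move=> a [d [F [G [hF hG G0 aE]]]]; have g0 := at_gen_neq0 hG G0.
  exists (at_pt p F / at_pt p G); apply/local_idealP.
  exists d, (F - (at_pt p F / at_pt p G)%:MP * G), G; split=> //.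
  - rewrite -mulN1r; apply: dhomogD => //; rewrite mulN1r dhomogN.
    by rewrite mul_mpolyC; apply: dhomogZ.
  - rewrite !at_pt_morph.  by rewrite at_ptC divfK ?subrr.
  - by rewrite !at_gen_morph at_genC aE mulrDl mulNr mulfK.
move=> a b /local_idealP[d [F [G [hF hG G0 F0 ->]]]].
move=> /local_idealP[e [F' [G' [hF' hG' G'0 F'0 ->]]]]; apply/local_idealP.
exists (d + e)%N, (F * G' + F' * G), (G * G'); split.
- by apply: dhomogD; [|rewrite addnC]; exact: dhomogM.
- exact: dhomogM.
- by rewrite at_pt_morph mulf_neq0.
- by rewrite !at_pt_morph F0 F'0 !mul0r addr0.
- have g0 := at_gen_neq0 hG G0; have g'0 := at_gen_neq0 hG' G'0.
  by rewrite !at_gen_morph; field; rewrite g0 g'0.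
Qed.

Lemma coordsP s t : coords O s t <-> local_coordinates iota X p s t.
Proof.
by split=> -[/local_idealP ms /local_idealP mt H]; split=> // a /local_idealP /H.
Qed.

Lemma curve_atP v : curve_at O v <-> curve_through iota X p v.
Proof.
split=> [[nv v0 [a [/local_idealP ma a0 va]]]|[_ nv v0 [a [/local_idealP ma a0 va]]]].
  by split=> //; exists a.
by split=> //; exists a.
Qed.

Section Chart.
Variables (i0 : 'I_n) (pi0 : p 0 i0 != 0).

Let xi0 : x i0 != 0.
Proof. by rewrite -at_genX; apply: (at_gen_neq0 (homogX i0)); rewrite at_ptX. Qed.

Lemma chart_loc j : O (x j / x i0).
Proof.
exists 1%N, 'X_j, 'X_i0; split; [exact: homogX|exact: homogX| |].
- by rewrite at_ptX.
- by rewrite !at_genX.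
Qed.

Lemma chart_res j : res iota O (x j / x i0) = p 0 j / p 0 i0.
Proof.
apply: (res_uniq local_ring_loc); apply/local_idealP.
exists 1%N, ('X_j - (p 0 j / p 0 i0)%:MP * 'X_i0), 'X_i0; split.
- rewrite -mulN1r; apply: dhomogD; first exact: homogX.
  by rewrite mulN1r dhomogN mul_mpolyC; apply: dhomogZ; exact: homogX.
- exact: homogX.
- by rewrite at_ptX.
- by rewrite !at_pt_morph at_ptC !at_ptX divfK ?subrr.
- by rewrite !at_gen_morph at_genC !at_genX mulrDl mulNr mulfK.
Qed.

Lemma at_gen_chart d (F : {mpoly R[i][n]}) : F \is d.-homog ->
  at_gen iota F = x i0 ^+ d * mmap iota (fun j => x j / x i0) F.
Proof.
move=> hF; rewrite -(mmap_scale _ _ _ hF); apply: eq_bigr => m _; congr (_ * _).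
by apply: eq_bigr => j _; rewrite mulrC divfK.
Qed.

Lemma local_ring_chart a : O a -> exists F G : {mpoly R[i][n]},
  unit_in O (mmap iota (fun j => x j / x i0) G) /\
  a = mmap iota (fun j => x j / x i0) F / mmap iota (fun j => x j / x i0) G.
Proof.
move=> [d [F [G [hF hG G0 ->]]]]; exists F, G.
have g0 := at_gen_neq0 hG G0.
have gE := at_gen_chart hG; rewrite gE in g0.
move: (g0); rewrite mulf_eq0 negb_or => /andP[x0 g'0].
split; last by rewrite (at_gen_chart hF) gE; field; rewrite x0 g'0.
have [Oz rz] := res_mmap G local_ring_loc chart_loc.
apply: (unitP local_ring_loc Oz) => /(res_max local_ring_loc) /eqP.
rewrite rz /meval (_ : mmap _ _ _ = (p 0 i0)^-1 ^+ d * at_pt p G).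
  by rewrite mulf_eq0 (negPf G0) orbF expf_eq0 invr_eq0 (negPf pi0) andbF.
rewrite -(mmap_scale _ _ _ hG); apply: eq_bigr => m _; congr (_ * _).
by apply: eq_bigr => j _; rewrite chart_res mulrC.
Qed.

Lemma chart_gen : gen_by iota O [seq x j / x i0 | j <- enum 'I_n].
Proof.
split=> [_ /mapP[j _ ->]|B Bc BD BM BV Bz a]; first exact: chart_loc.
have Bmm F : B (mmap iota (fun j => x j / x i0) F).
  by apply: mmap_closed => // j; apply: Bz; apply/mapP; exists j; rewrite ?mem_enum.
by move=> /local_ring_chart[F [G [uG ->]]]; apply: BM => //; apply: BV.
Qed.

(** Denominators are units, so a family in [O] can be replaced by the polynomials that represent its
    elements up to units, and Hilbert's theorem applies to these. *)
Lemma local_ring_noeth : noetherian O.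
Proof.
pose ev := mmap iota (fun j => x j / x i0) : {mpoly R[i][n]} -> K.
move=> S SO; pose S' F := exists a u, [/\ S a, unit_in O u & ev F = u * a].
have [l lS' lH] := @hilbert_basis (R[i] : fieldType) n S' (fun _ _ => I).
have evMD c F b : ev (c * F + b) = ev c * ev F + ev b by rewrite /ev rmorphD rmorphM.
have evO F : O (ev F) by case: (res_mmap F local_ring_loc chart_loc).
have [l' l'S l'H] : exists2 l', (forall a, a \in l' -> S a) &
    forall F, lspan (fun=> True) l F -> lspan O l' (ev F).
  elim: l lS' {lH} => [|F l IH] lS'.
    by exists [::] => //= F ->; rewrite /ev raddf0.
  have [|l' l'S l'H] := IH; first by move=> G lG; apply: lS'; rewrite inE lG orbT.
  have [a [u [Sa [u0 Ou _] FE]]] := lS' F (mem_head _ _).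
  exists (a :: l') => [b|G [c [b [_ /l'H lb ->]]]]; first by rewrite inE => /orP[/eqP ->|/l'S].
  exists (ev c * u), (ev b); split=> //; first by apply: local_ring_mul.
  by rewrite evMD FE mulrA.
exists l' => // a Sa; have [F [G [uG aE]]] := local_ring_chart (SO a Sa).
have /lH/l'H lF : S' F.
  by exists a, (ev G); split=> //; rewrite aE mulrC divfK //; case: uG.
rewrite aE mulrC; apply: lspanZ => //; last by case: uG.
exact: local_ring_mul.
Qed.

End Chart.

Lemma chart_exists : exists i0, p 0 i0 != 0.
Proof.
apply: contrapT => H; case: Hp => /eqP p0 _; apply: p0; apply/rowP => j; rewrite mxE.
by apply/eqP/negPn/negP => pj; apply: H; exists j.
Qed.

Lemma local_ring_frac : has_function_field iota X ->
  forall a, exists b c, [/\ O b, O c, c != 0 & a = b / c].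
Proof.
move=> HX a; have [d [F [G [hF hG g0 aE]]]] := HX a; have [i0 pi0] := chart_exists.
have gE := at_gen_chart pi0 hG.
exists (mmap iota (fun j => x j / x i0) F), (mmap iota (fun j => x j / x i0) G).
split; [by case: (res_mmap F local_ring_loc (chart_loc pi0))
       |by case: (res_mmap G local_ring_loc (chart_loc pi0))| |].
  by apply: contraNneq g0 => z; rewrite gE z mulr0.
move: g0; rewrite aE (at_gen_chart pi0 hF) gE mulf_eq0 negb_or => /andP[x0 g'0].
by field; rewrite x0 g'0.
Qed.

End Point.

End OneModel.
End Models.

(** * Quasi-compactness, properness and separatedness *)

Section Points.
Variables (R : realType) (K : fieldType) (iota : {rmorphism R[i] -> K}).
Notation locring := (locring iota).
Notation regular := (regular iota).
Implicit Types (O W : K -> Prop) (psi : {rmorphism K -> K}) (X Y : model K).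

(* The closed points of [X], represented by their local rings. *)
Definition pts X : set (set K) := fun O => exists2 p, point iota X p & O = local_ring iota X p.

Definition local_hom psi O W :=
  (forall a, O a -> W (psi a)) /\ (forall a, maxid O a -> maxid W (psi a)).

Definition dominates O W :=
  (forall a, O a -> W a) /\ (forall a, maxid O a -> maxid W a).

Definition over_const psi := forall c, psi (iota c) = iota c.

Lemma pts_loc X O : pts X O -> locring O.
Proof. by move=> [p Hp ->]; exact: local_ring_loc. Qed.

(** Each point has a polynomial [F], nonzero there, such that its functions [A] are regular wherever
    [F] does not vanish. Finitely many of these polynomials generate all of them, so at any point
    one of the finitely many is nonzero. *)
Lemma pts_quasi_compact X (A : set K -> seq K) :
  (forall O, pts X O -> forall a, a \in A O -> O a) ->
  exists L : set (set K), [/\ finite_set L, L `<=` pts X &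
    forall O, pts X O -> exists2 O', L O' & forall a, a \in A O' -> O a].
Proof.
move=> HA.
have den p : point iota X p -> exists F : {mpoly R[i][rank X]}, at_pt p F != 0 /\
    forall q, point iota X q -> at_pt q F != 0 ->
      forall a, a \in A (local_ring iota X p) -> local_ring iota X q a.
  move=> Hp; have : forall a, a \in A (local_ring iota X p) -> local_ring iota X p a.
    by apply: HA; exists p.
  elim: (A _) => [|a l IH] Hl.
    exists 1; split=> //; first by rewrite /at_pt meval1 oner_neq0.
  have [|F [F0 HF]] := IH; first by move=> b lb; apply: Hl; rewrite inE lb orbT.
  have [d [E [G [hE hG G0 aE]]]] := Hl a (mem_head _ _).
  exists (G * F); rewrite at_pt_morph mulf_neq0 //; split=> // q Hq.
  rewrite at_pt_morph mulf_eq0 negb_or => /andP[Gq Fq] b.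
  rewrite inE => /orP[/eqP ->|lb]; last exact: (HF q).
  by exists d, E, G.
pose S (F : {mpoly R[i][rank X]}) := exists2 p, point iota X p &
  at_pt p F != 0 /\ forall q, point iota X q -> at_pt q F != 0 ->
      forall a, a \in A (local_ring iota X p) -> local_ring iota X q a.
have [l lS lH] := @hilbert_basis (R[i] : fieldType) _ S (fun _ _ => I).
have [L [Lfin Lpts LH]] : exists L : set (set K), [/\ finite_set L, L `<=` pts X &
    forall F, F \in l -> exists2 p, point iota X p & L (local_ring iota X p) /\
      forall q, point iota X q -> at_pt q F != 0 ->
      forall a, a \in A (local_ring iota X p) -> local_ring iota X q a].
  elim: l lS {lH} => [|F l IH] lS; first by exists set0; split=> //; exact: finite_set0.
  have [|L [Lfin Lpts LH]] := IH; first by move=> G lG; apply: lS; rewrite inE lG orbT.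
  have [p Hp [Fp HF]] := lS F (mem_head _ _).
  exists (local_ring iota X p |` L); split.
  - by rewrite finite_setU; split=> //; exact: finite_set1.
  - by move=> O [->|/Lpts//]; exists p.
  - move=> G; rewrite inE => /orP[/eqP ->|/LH[q Hq [Lq HG]]].
      by exists p => //; split=> //; left.
    by exists q => //; split=> //; right.
exists L; split=> // O [q Hq ->]; have [F [Fq HF]] := den q Hq.
have /lH : S F by exists q.
have : exists2 G, G \in l & at_pt q G != 0.
  apply: contrapT => H; have {}H G : G \in l -> at_pt q G = 0.
    by move=> lG; apply/eqP/negPn/negP => Gq; apply: H; exists G.
  have lF : lspan (fun=> True) l F by apply: lH; exists q.
  have : forall G, lspan (fun=> True) l G -> at_pt q G = 0.
    elim: (l) H => [|G l' IH] H E /=; first by move=> ->; rewrite /at_pt meval0.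
    move=> [c [b [_ lb ->]]].
    have evq : at_pt q (c * G + b) = at_pt q c * at_pt q G + at_pt q b.
      by rewrite /at_pt mevalD mevalM.
    apply: (etrans evq); rewrite (H G) ?mem_head // mulr0 add0r.
    by apply: IH => // G' lG'; apply: H; rewrite inE lG' orbT.
  by move/(_ _ lF)/eqP; rewrite (negPf Fq).
move=> [G lG Gq] _; have [p Hp [Lp HG]] := LH G lG.
by exists (local_ring iota X p) => //; exact: HG.
Qed.

(* The valuative criterion of properness, for the rational map with comorphism
   [psi] and a local ring with residue field C. *)
Lemma center_exists X W psi (i0 : 'I_(rank X)) : locring W -> over_const psi ->
  gen X 0 i0 != 0 -> (forall j, W (psi (gen X 0 j / gen X 0 i0))) ->
  exists p, [/\ point iota X p, p 0 i0 != 0 & local_hom psi (local_ring iota X p) W].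
Proof.
move=> LW psic x0 Wx; pose w j := psi (gen X 0 j / gen X 0 i0).
pose p : 'rV[R[i]]_(rank X) := \row_j res iota W (w j).
have pi0 : p 0 i0 = 1.
  by rewrite mxE /w mulfV // rmorph1 -(rmorph1 iota) (res_const LW).
have ev d (F : {mpoly R[i][rank X]}) : F \is d.-homog -> W (mmap iota w F) /\
    res iota W (mmap iota w F) = at_pt p F.
  move=> hF; have [H1 ->] := res_mmap F LW Wx; split=> //.
  by apply: meval_eq => j; rewrite mxE.
have genE d (F : {mpoly R[i][rank X]}) : F \is d.-homog ->
    psi (at_gen iota F) = psi (gen X 0 i0) ^+ d * mmap iota w F.
  move=> hF; rewrite -(mmap_scale _ _ _ hF) /at_gen rmorph_mmap.
  apply: eq_bigr => m _; rewrite /= psic; congr (_ * _).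
  by apply: eq_bigr => j _; rewrite /w -rmorphM mulrC divfK.
have px0 : psi (gen X 0 i0) != 0 by rewrite fmorph_eq0.
have Hp : point iota X p.
  split=> [|d F hF F0].
    by apply/eqP => p0; move: pi0; rewrite p0 mxE => /eqP; rewrite eq_sym oner_eq0.
  have [_ <-] := ev d F hF; have := genE d F hF; rewrite F0 rmorph0 => /esym/eqP.
  rewrite mulf_eq0 (negPf (expf_neq0 _ px0)) /= => /eqP ->.
  by rewrite -(rmorph0 iota) (res_const LW).
have quot d (F G : {mpoly R[i][rank X]}) : F \is d.-homog -> G \is d.-homog ->
    at_pt p G != 0 -> unit_in W (mmap iota w G) /\
    psi (at_gen iota F / at_gen iota G) = mmap iota w F / mmap iota w G.
  move=> hF hG G0; have [WG rG] := ev d G hG.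
  have uG : unit_in W (mmap iota w G).
    apply: (unitP LW WG) => mG; move: G0; rewrite -rG.
    by rewrite (res_max LW mG) eqxx.
  split=> //; rewrite fmorph_div (genE d F hF) (genE d G hG).
  case: uG => G'0 _ _; have := expf_neq0 d px0.
  by move: (_ ^+ d) (mmap _ _ G) G'0 => u g g0 u0; field; rewrite g0 u0.
exists p; split=> //; first by rewrite pi0 oner_neq0.
split=> [a [d [F [G [hF hG G0 ->]]]]|a /(local_idealP Hp)[d [F [G [hF hG G0 F0 ->]]]]].
  have [uG ->] := quot d F G hF hG G0; have [WF _] := ev d F hF.
  by inO LW.
have [uG ->] := quot d F G hF hG G0; have [WF rF] := ev d F hF.
apply: (maxM LW); last by case: uG.
by apply: (res_eq0 LW WF); rewrite rF F0.
Qed.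

(** The homogeneous coordinates of both points have the same ratios of residues. The set [W] may be
    a valuation ring with a residue field larger than the constants. The condition on [O'] is weaker
    than domination, so that the lemma also covers a valuation centered at one point and along a
    curve through another. *)
Lemma pts_separated X O O' W : pts X O -> pts X O' ->
  dominates O W -> (forall a, O' a -> W a) -> (forall a, O' a -> maxid W a -> maxid O' a) ->
  O = O'.
Proof.
move=> [p Hp ->] [q Hq ->] [OW mW] O'W m'W.
have [i0 pi0] := chart_exists Hp; have [j1 qj1] := chart_exists Hq.
have x0 : gen X 0 i0 != 0.
  by rewrite -(at_genX iota); apply: (at_gen_neq0 Hp (homogX _ i0)); rewrite at_ptX.
have y0 : gen X 0 j1 != 0.
  by rewrite -(at_genX iota); apply: (at_gen_neq0 Hq (homogX _ j1)); rewrite at_ptX.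
have pj1 : p 0 j1 != 0.
  apply/eqP => pj1; pose a := gen X 0 j1 / gen X 0 i0.
  have a0 : a != 0 by rewrite mulf_neq0 ?invr_eq0.
  have ma : maxid (local_ring iota X p) a.
    apply: (res_eq0 (local_ring_loc Hp)); first exact: (chart_loc iota pi0).
    by rewrite (chart_res Hp pi0) pj1 mul0r.
  have [_ [/eqP|]] := mW _ ma; first by rewrite (negPf a0).
  by apply; rewrite invf_div; apply: O'W; exact: (chart_loc iota qj1).
have Lp := local_ring_loc Hp; have Lq := local_ring_loc Hq.
have E j : q 0 j = (q 0 j1 / p 0 j1) * p 0 j.
  suff : q 0 j / q 0 j1 = p 0 j / p 0 j1 by move=> H; rewrite -[LHS](divfK qj1) H; field.
  rewrite -(chart_res Hq qj1); apply: (res_uniq Lq).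
  apply: m'W; first by have := chart_loc iota qj1 j => ?; inO Lq.
  apply: mW; rewrite -(chart_res Hp pj1); apply: (resP Lp); exact: (chart_loc iota pj1).
set c := q 0 j1 / p 0 j1 in E.
have c0 : c != 0 by rewrite mulf_neq0 ?invr_eq0.
have ptE d (F : {mpoly R[i][rank X]}) : F \is d.-homog -> at_pt q F = c ^+ d * at_pt p F.
  by move=> hF; rewrite -(mmap_scale _ _ _ hF); apply: meval_eq => j; rewrite E.
apply/funext => a; apply/propext; split=> -[d [F [G [hF hG G0 aE]]]]; exists d, F, G; split=> //.
  by rewrite (ptE d) // mulf_neq0 ?expf_neq0.
by apply: contraNneq G0 => z; rewrite (ptE d) // z mulr0.
Qed.

Lemma dominates_refl O : dominates O O. Proof. by []. Qed.

Lemma pts_dominates_eq X O O' W : pts X O -> pts X O' -> dominates O W -> dominates O' W ->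
  O = O'.
Proof.
move=> XO XO' OW [O'W mW']; apply: (pts_separated XO XO' OW O'W) => a O'a mWa.
have [ua|//] := unit_or_max (pts_loc XO') O'a.
case: ua mWa => a0 _ /O'W Wi [_ [a0'|//]]; by rewrite a0' eqxx in a0.
Qed.

Section Smooth.
Variable eta : two_form K.
Hypothesis eta0 : exists D1 D2, [/\ derivation iota D1, derivation iota D2 &
  form_eval eta D1 D2 != 0].
Variables (X : model K) (HX : smooth_surface iota X).

(** The derivations on which [eta] is nonzero provide partial derivatives in all local
    coordinates. *)
Lemma pts_regular O : pts X O -> regular O.
Proof.
move=> [p Hp ->]; have [D1 [D2 [HD1 HD2 theta0]]] := eta0.
have [i0 pi0] := chart_exists Hp; case: HX => HF _ Hc.
have Hreg : reg iota (local_ring iota X p).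
  split.
  - exact: local_ring_loc.
  - exact: local_ring_frac.
  - exact: (local_ring_noeth Hp pi0).
  - by exists [seq gen X 0 j / gen X 0 i0 | j <- enum 'I_(rank X)]; exact: chart_gen.
  - by have [s [t /(coordsP Hp) Cst]] := Hc p Hp; exists s, t.
split=> // s t Cst; exists (dds D1 D2 s t), (ddt D1 D2 s t); split.
- exact: dds_der.
- exact: ddt_der.
- exact: (dds_loc HD1 HD2 theta0 Hreg Cst).
- exact: (ddt_loc HD1 HD2 theta0 Hreg Cst).
- split.
  + exact: (dds_s HD1 HD2 theta0 Hreg Cst).
  + exact: (dds_t HD1 HD2 theta0 Hreg Cst).
  + exact: (ddt_s HD1 HD2 theta0 Hreg Cst).
  + exact: (ddt_t HD1 HD2 theta0 Hreg Cst).
Qed.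
End Smooth.

End Points.

(** * Quadratic transforms *)

Section QuadraticTransforms.
Variables (R : realType) (K : fieldType) (iota : {rmorphism R[i] -> K}).
Notation locring := (locring iota).
Notation regular := (regular iota).
Implicit Types (O W V : K -> Prop) (P Q A B : {poly K}).

(** The local ring of the blowup at the point of the exceptional curve where [t / s] vanishes;
    there, [Q.[t / s]] is a unit exactly when the constant coefficient of [Q] is. *)
Definition QT O s t : K -> Prop := fun a => exists P Q,
  [/\ poly_in O P, poly_in O Q, unit_in O Q`_0 & a = P.[t / s] / Q.[t / s]].

Definition quad O W := exists s t, coords O s t /\ W = QT O s t.

Lemma poly_drop1 P : P = (P`_0)%:P + 'X * drop_poly 1 P.
Proof.
apply/polyP => j; rewrite coefD coefC coefXM coef_drop_poly.
by case: j => [|j]; rewrite /= ?addr0 ?add0r ?addn1.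
Qed.

Section OneRing.
Variables (O : K -> Prop) (HO : regular O).
Let LO : locring O := regular_loc HO.

Section Coords.
Variables (s t : K) (Cst : coords O s t).
Let ms : maxid O s. Proof. by case: Cst. Qed.
Let s0 : s != 0 := coord_neq0 HO Cst.
Notation u := (t / s).
Notation O' := (QT O s t).

(** Multiplied by a power of [s], a relation [P.[u] = 0] would be a vanishing form with a unit
    coefficient, against the structure of the associated graded ring. *)
Lemma poly_nonzero P j : poly_in O P -> unit_in O P`_j -> P.[u] != 0.
Proof.
move=> HP uj; apply/eqP => E; apply: (unit_nmax uj).
apply: (poly_mpow_max HO Cst (n := size P) HP (leqnSn _)).
by rewrite E mulr0; exact: mpow0 HO _.
Qed.

Lemma poly_eq0_max P : poly_in O P -> P.[u] = 0 -> maxid O P`_0.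
Proof.
move=> HP /eqP E; case: (unit_or_max LO (HP 0%N)) => // /(poly_nonzero HP).
by rewrite E.
Qed.

Lemma QT_frac P Q : poly_in O P -> poly_in O Q -> unit_in O Q`_0 -> O' (P.[u] / Q.[u]).
Proof. by move=> *; exists P, Q. Qed.

Lemma poly_in1 : poly_in O 1. Proof. by rewrite -[1]polyC1; apply: (poly_inC LO); inO LO. Qed.

Lemma poly_unit1 : unit_in O (1 : {poly K})`_0.
Proof. by rewrite coefC eqxx; exact: unit1 LO. Qed.

Lemma QT_poly P : poly_in O P -> O' P.[u].
Proof.
move=> HP; exists P, 1; split=> //; [exact: poly_in1|exact: poly_unit1|].
by rewrite hornerC divr1.
Qed.

Lemma maxQT_frac P Q : poly_in O P -> poly_in O Q -> unit_in O Q`_0 ->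
  maxid O' (P.[u] / Q.[u]) <-> maxid O P`_0.
Proof.
move=> HP HQ uQ; have Q0 := poly_nonzero HQ uQ; split=> [[_ H]|mP].
  case: (unit_or_max LO (HP 0%N)) => // uP; have P0 := poly_nonzero HP uP.
  case: H => [/eqP|]; first by rewrite mulf_eq0 invr_eq0 (negPf P0) (negPf Q0).
  by case; rewrite invf_div; exact: QT_frac.
split; first exact: QT_frac.
have [->|a0] := eqVneq (P.[u] / Q.[u]) 0; [by left|right].
move=> [A [B [HA HB uB E]]]; have B0 := poly_nonzero HB uB.
have PE : (P * A - Q * B).[u] = 0.
  rewrite !(hornerD, hornerN, hornerM, hornerC, hornerX); apply/eqP; rewrite subr_eq0; apply/eqP.
  have : (P.[u] / Q.[u]) * (P.[u] / Q.[u])^-1 = 1 by rewrite mulfV.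
  rewrite E => E1; rewrite -[RHS]mulr1 -E1; field.
  by rewrite Q0 B0.
have HPA : poly_in O (P * A - Q * B).
  apply: (poly_inD LO); first exact: (poly_inM LO).
  by move=> j; rewrite coefN; apply: (loc_opp LO); exact: (poly_inM LO).
have := poly_eq0_max HPA PE; rewrite coefB !coefM !big_ord1 subnn => H.
have : maxid O (Q`_0 * B`_0).
  rewrite (_ : _ * _ = P`_0 * A`_0 - (P`_0 * A`_0 - Q`_0 * B`_0)); last by ring.
  by apply: (loc_maxD LO); [exact: (maxM LO)|exact: (maxN LO)].
exact/(unit_nmax (unitM LO uQ uB)).
Qed.

Lemma maxQT_poly P : poly_in O P -> maxid O' P.[u] <-> maxid O P`_0.
Proof.
by move=> HP; have := maxQT_frac HP poly_in1 poly_unit1; rewrite hornerC divr1.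
Qed.

Lemma QT_loc : locring O'.
Proof.
have coefM0 P Q : (P * Q)`_0 = P`_0 * Q`_0 by rewrite coefM big_ord1 subnn.
split.
- by move=> c; rewrite -[iota c](hornerC _ u); apply/QT_poly/(poly_inC LO); inO LO.
- move=> _ _ [P [Q [HP HQ uQ ->]]] [A [B [HA HB uB ->]]].
  exists (P * B + A * Q), (Q * B); split.
  + by apply: (poly_inD LO); exact: (poly_inM LO).
  + exact: (poly_inM LO).
  + by rewrite coefM0; exact: (unitM LO).
  + have := poly_nonzero HQ uQ; have := poly_nonzero HB uB; rewrite !(hornerD, hornerN, hornerM, hornerC, hornerX).
    by move: (Q.[_]) (B.[_]) => q b b0 q0; field; rewrite b0 q0.
- move=> _ _ [P [Q [HP HQ uQ ->]]] [A [B [HA HB uB ->]]].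
  exists (P * A), (Q * B); split; [exact: (poly_inM LO)|exact: (poly_inM LO)| |].
  + by rewrite coefM0; exact: (unitM LO).
  + by rewrite !hornerM invfM mulrACA.
- move=> _ [P [Q [HP HQ uQ ->]]]; pose c := res iota O P`_0 / res iota O Q`_0.
  have Q0 := poly_nonzero HQ uQ.
  have rQ : res iota O Q`_0 != 0.
    by apply/eqP => /(res_eq0 LO (HQ 0%N)); exact: unit_nmax.
  have HcQ : poly_in O (P + (- iota c)%:P * Q).
    by apply: (poly_inD LO) => //; apply: (poly_inM LO) => //; apply: (poly_inC LO); inO LO.
  exists c; rewrite (_ : _ - _ = (P + (- iota c)%:P * Q).[u] / Q.[u]); last first.
    by rewrite !(hornerD, hornerN, hornerM, hornerC, hornerX) mulrDl mulfK.
  apply/(maxQT_frac HcQ HQ uQ); apply: (res_eq0 LO); first exact: HcQ.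
  have := HP 0%N; have := HQ 0%N => OQ OP.
  rewrite coefD coefM0 coefC eqxx (resD LO) //; last by inO LO.
  by rewrite (resM LO) //; [rewrite -rmorphN (res_const LO) /c mulNr divfK ?subrr|inO LO].
- move=> a b ma mb; have [[P [Q [HP HQ uQ aE]]] _] := ma.
  have [[A [B [HA HB uB bE]]] _] := mb.
  have mP : maxid O P`_0 by apply/(maxQT_frac HP HQ uQ); rewrite -aE.
  have mA : maxid O A`_0 by apply/(maxQT_frac HA HB uB); rewrite -bE.
  have -> : a + b = (P * B + A * Q).[u] / (Q * B).[u].
    rewrite aE bE; have := poly_nonzero HQ uQ; have := poly_nonzero HB uB; rewrite !(hornerD, hornerN, hornerM, hornerC, hornerX).
    by move: (Q.[_]) (B.[_]) => q b' b0 q0; field; rewrite b0 q0.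
  apply/maxQT_frac; [|exact: (poly_inM LO)| |].
  + by apply: (poly_inD LO); exact: (poly_inM LO).
  + by rewrite coefM0; exact: (unitM LO).
  + by rewrite coefD !coefM0; apply: (loc_maxD LO); apply: (maxM LO).
Qed.

Lemma QT_dominates : dominates O O'.
Proof.
split=> a Oa; first by rewrite -[a](hornerC _ u); apply/QT_poly/(poly_inC LO).
rewrite -[a](hornerC _ u); apply/maxQT_poly; first by apply: (poly_inC LO); case: Oa.
by rewrite coefC eqxx.
Qed.

Lemma QT_ratio_max : maxid O' u.
Proof.
rewrite -[X in maxid _ X](hornerX u); apply/maxQT_poly; first exact: (poly_inX LO).
by rewrite coefX; exact: max0 LO.
Qed.

Lemma QT_coords : coords O' s u.
Proof.
split; [exact: (QT_dominates.2 _ ms)|exact: QT_ratio_max|].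
move=> a ma; have [[P [Q [HP HQ uQ aE]]] _] := ma.
have mP : maxid O P`_0 by apply/(maxQT_frac HP HQ uQ); rewrite -aE.
have [_ _ /(_ _ mP)[b [c [Ob Oc PE]]]] := Cst.
have HD : poly_in O (drop_poly 1 P) by move=> j; rewrite coef_drop_poly; exact: HP.
exists ((b%:P + c%:P * 'X).[u] / Q.[u]), ((drop_poly 1 P).[u] / Q.[u]); split.
- apply: QT_frac => //; apply: (poly_inD LO); first exact: (poly_inC LO).
  by apply: (poly_inM LO); [exact: (poly_inC LO)|exact: (poly_inX LO)].
- exact: QT_frac.
- rewrite aE {1}(poly_drop1 P) PE !(hornerD, hornerN, hornerM, hornerC, hornerX).
  have := poly_nonzero HQ uQ; move: ((drop_poly 1 P).[_]) (Q.[_]) => d q q0.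
  by field; rewrite s0 q0.
Qed.

Lemma QT_minimal W : locring W -> dominates O W -> maxid W u -> dominates O' W.
Proof.
move=> LW [OW mW] mu.
have HW P : poly_in O P -> poly_in W P by move=> HP j; exact: OW.
have uW a : unit_in O a -> unit_in W a by move=> [a0 Oa Oi]; split=> //; exact: OW.
have Qu Q : poly_in O Q -> unit_in O Q`_0 -> unit_in W Q.[u].
  move=> HQ uQ; rewrite -[Q.[u]](subrK Q`_0) addrC; apply: (unitDmax LW); first exact: uW.
  by apply: (poly_horner0 LW) => //; exact: HW.
split=> a.
  move=> [P [Q [HP HQ uQ ->]]]; have := Qu Q HQ uQ => ?.
  have : W P.[u] by apply: (poly_horner LW); [exact: HW|case: mu].
  by move=> ?; inO LW.
move=> ma; have [[P [Q [HP HQ uQ aE]]] _] := ma.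
have mP : maxid O P`_0 by apply/(maxQT_frac HP HQ uQ); rewrite -aE.
rewrite aE; apply: (maxM LW); last by case: (Qu Q HQ uQ).
rewrite -[P.[u]](subrK P`_0); apply: (loc_maxD LW); last exact: mW.
by apply: (poly_horner0 LW) => //; exact: HW.
Qed.

End Coords.

Lemma dominates_unit V W a : locring V -> dominates V W -> V a -> unit_in W a -> unit_in V a.
Proof.
move=> LV [_ mVW] Va uWa; case: (unit_or_max LV Va) => // /mVW.
by move/(unit_nmax uWa).
Qed.

Lemma dominates_max V W a : locring V -> dominates V W -> V a -> maxid W a -> maxid V a.
Proof.
move=> LV [VW _] Va mWa; case: (unit_or_max LV Va) => // -[a0 _ Vi].
case: mWa => _ [a0'|]; first by rewrite a0' eqxx in a0.
by move/(_ (VW _ Vi)).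
Qed.

Lemma dominates_trans V W U : dominates V W -> dominates W U -> dominates V U.
Proof. by move=> [VW mVW] [WU mWU]; split=> a H; [exact/WU/VW|exact/mWU/mVW]. Qed.

Lemma dominates_antisym V W : dominates V W -> dominates W V -> V = W.
Proof. by move=> [VW _] [WV _]; apply/funext => a; apply/propext; split=> [/VW|/WV]. Qed.

(** Both rings are contained in [W], where [s' / s] is a unit. By domination it is already a unit in
    the ring [QT O s t], which therefore contains [t' / s'] as a nonunit; minimality gives one
    inclusion, and symmetry the other. *)
Lemma QT_uniq s t s' t' W : coords O s t -> coords O s' t' -> locring W ->
  dominates O W -> maxid W (t / s) -> maxid W (t' / s') -> QT O s t = QT O s' t'.
Proof.
have sub a b a' b' : coords O a b -> coords O a' b' -> locring W ->
    dominates O W -> maxid W (b / a) -> maxid W (b' / a') -> dominates (QT O a' b') (QT O a b).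
  move=> Cab Cab' LW OW mba mba'.
  have a0 := coord_neq0 HO Cab; have a'0 := coord_neq0 HO Cab'.
  have LV := QT_loc Cab; have VW := QT_minimal Cab LW OW mba.
  have lin c : maxid O c -> exists x y, [/\ O x, O y & c / a = x + y * (b / a)].
    move=> mc; have [_ _ /(_ _ mc)[x [y [Ox Oy ->]]]] := Cab.
    by exists x, y; split=> //; field.
  have [OV _] := QT_dominates Cab.
  have inV c : maxid O c -> QT O a b (c / a).
    move=> /lin[x [y [/OV Vx /OV Vy ->]]]; have [Vu _] := QT_ratio_max Cab; inO LV.
  have [ma' mb' H'] := Cab'; have [ma _ _] := Cab.
  have uW : unit_in W (a' / a).
    have [x [y [Ox Oy aE]]] := H' _ ma; have [OW' _] := OW.
    have E : (a' / a) * (x + y * (b' / a')) = 1.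
      transitivity ((x * a' + y * b') / a); first by field; rewrite a0 a'0.
      by rewrite -aE divff.
    apply: (unitMl LW (a := a' / a) (b := x + y * (b' / a'))).
    - by have [+ _] := VW; apply; exact: inV.
    - by have := OW' _ Ox; have := OW' _ Oy; have := max_loc mba' => ? ? ?; inO LW.
    - by rewrite E; exact: unit1 LW.
  have uV : unit_in (QT O a b) (a' / a) := dominates_unit LV VW (inV _ ma') uW.
  have Vba' : QT O a b (b' / a').
    rewrite (_ : b' / a' = (b' / a) / (a' / a)); last by field; rewrite a0 a'0.
    by have := inV _ mb' => ?; inO LV.
  apply: (QT_minimal Cab' LV (QT_dominates Cab)).
  exact: (dominates_max LV VW).
move=> C1 C2 LW OW m1 m2; apply: dominates_antisym.
  exact: (sub s' t' s t).
exact: (sub s t s' t').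
Qed.

Lemma coords_shift s t c : coords O s t -> coords O s (t - iota c * s).
Proof.
move=> [ms mt H]; split=> //.
  by apply: (loc_maxD LO) => //; apply: (maxN LO); apply: (maxMl LO) => //; inO LO.
move=> a /H[x [y [Ox Oy ->]]]; exists (x + y * iota c), y; split=> //; first by inO LO.
ring.
Qed.

(* The points infinitely near to [O] in the direction with slope [c] or
   infinity. *)
Lemma direction_exists W s t s' t' : locring W -> dominates O W -> coords O s t ->
  coords O s' t' -> W (t' / s') ->
  (exists c, maxid W ((t - iota c * s) / s)) \/ maxid W (s / t).
Proof.
move=> LW [OW mW] Cst Cst' Wu; have s0 := coord_neq0 HO Cst; have t0 := coord_neq0 HO (coordsC Cst).
have s'0 := coord_neq0 HO Cst'.
have lin c : maxid O c -> W (c / s').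
  move=> mc; have [_ _ /(_ _ mc)[x [y [/OW Wx /OW Wy ->]]]] := Cst'.
  rewrite (_ : _ / s' = x + y * (t' / s')); last by field.
  by inO LW.
have [ms mt H] := Cst; have [ms' _ _] := Cst'.
have Ws := lin _ ms; have Wt := lin _ mt.
case: (unit_or_max LW Ws) => [us|mss].
  left; have Wts : W (t / s).
    by rewrite (_ : t / s = (t / s') / (s / s')); [inO LW|field; rewrite s0 s'0].
  exists (res iota W (t / s)); rewrite mulrBl mulfK //; exact: (resP LW).
right; have ut : unit_in W (t / s').
  apply: (unitP LW) => // mts; have [x [y [/OW Wx /OW Wy sE]]] := H _ ms'.
  apply: (not_max1 LW); rewrite (_ : 1 = x * (s / s') + y * (t / s')).
    by apply: (loc_maxD LW); apply: (maxMl LW).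
  transitivity ((x * s + y * t) / s'); first by rewrite -sE divff.
  by field.
rewrite (_ : s / t = (s / s') * (t / s')^-1); last by field; rewrite t0 s'0.
by apply: (maxM LW) => //; inO LW.
Qed.

Lemma quad_direction W s t : quad O W -> coords O s t ->
  (exists c, W = QT O s (t - iota c * s)) \/ W = QT O t s.
Proof.
move=> [s' [t' [Cst' ->]]] Cst; have LW := QT_loc Cst'.
have OW := QT_dominates Cst'; have mW := QT_ratio_max Cst'.
case: (direction_exists LW OW Cst Cst' (max_loc mW)) => [[c mc]|m].
  by left; exists c; exact: (QT_uniq Cst' (coords_shift c Cst) LW OW).
by right; exact: (QT_uniq Cst' (coordsC Cst) LW OW).
Qed.

End OneRing.
End QuadraticTransforms.

(** * Curves through the points of a blowup *)

Section CurvesOnBlowups.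
Variables (R : realType) (K : fieldType) (iota : {rmorphism R[i] -> K}).
Notation locring := (locring iota).
Notation regular := (regular iota).
Implicit Types (O W V : K -> Prop) (P Q A B : {poly K}).

Lemma poly_nonroot (p : {poly R[i]}) : p != 0 -> exists c, p.[c] != 0.
Proof.
move=> p0; apply: contrapT => H.
have rt c : root p c by apply/negPn/negP => nr; apply: H; exists c.
pose rs := [seq j%:R : R[i] | j <- seq.iota 0 (size p)].
have : (size rs < size p)%N.
  apply: max_poly_roots => //; first by apply/allP => c _.
  by rewrite map_inj_uniq ?iota_uniq // => j k /eqP; rewrite eqr_nat => /eqP.
by rewrite size_map size_iota ltnn.
Qed.

Lemma res_horner W P x : locring W -> poly_in W P -> W x ->
  res iota W P.[x] = (map_poly (res iota W) P).[res iota W x].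
Proof.
move=> LW HP Wx; have r0 : res iota W 0 = 0 by apply: (res_max LW); exact: max0 LW.
rewrite horner_coef (horner_coef_wide _ (size_poly _ _)).
have rs (I : Type) (r : seq I) (F : I -> K) : (forall j, W (F j)) ->
    res iota W (\sum_(j <- r) F j) = \sum_(j <- r) res iota W (F j).
  move=> WF; elim: r => [|j r IH]; first by rewrite !big_nil.
  by rewrite !big_cons (resD LW) ?IH //; apply: (loc_sum LW).
rewrite rs => [|j]; last by have := HP j => ?; inO LW.
apply: eq_bigr => j _; rewrite (resM LW) ?(resX LW) //; last by inO LW.
by rewrite coef_map_id0.
Qed.

(** By [coord_adic], an element not divisible by [s] is a power of [t] times a unit modulo [s], and
    products keep this form. *)
Lemma coord_prime O s t : regular O -> coords O s t -> prime_elt O s.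
Proof.
move=> HO Cst; have LO := regular_loc HO; have Cts := coordsC Cst; split; [by case: Cst|exact: (coord_neq0 HO Cst)|].
have dvC a : (exists2 b, O b & a = s * b) -> dv O s a by move=> [b Ob ->]; exists b; rewrite // mulrC.
move=> a b Oa Ob [c Oc abE]; case: (coord_adic HO Cts Oa) => [/dvC|]; first by left.
case: (coord_adic HO Cts Ob) => [/dvC|]; first by right.
move=> [k [e' [d' [ue' Od' bE]]]] [n [e [d [ue Od aE]]]].
have [Ot _] : maxid O t by case: Cst.
have [Os _] : maxid O s by case: Cst.
have := coord_power_ndvd HO Cts (n := n + k) (a := e * e') (b := c - (d * b + t ^+ n * e * d')).
move=> H; case: (unit_nmax (unitM LO ue ue')); apply: H.
- by inO LO.
- by inO LO.
have : t ^+ n * e * (t ^+ k * e') = a * b - s * (d * b + t ^+ n * e * d').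
  by rewrite aE bE; ring.
by rewrite abE exprD => E; rewrite mulrACA in E; rewrite E; ring.
Qed.

Section OneRing.
Variables (O : K -> Prop) (HO : regular O).
Let LO : locring O := regular_loc HO.

Section Coords.
Variables (s t : K) (Cst : coords O s t).
Let s0 : s != 0 := coord_neq0 HO Cst.
Let t0 : t != 0 := coord_neq0 HO (coordsC Cst).
Notation u := (t / s).
Let nE := ordm_normalized HO.

Lemma ordm_poly_ge0 P : poly_in O P -> P.[u] != 0 -> 0 <= ordm O P.[u].
Proof.
move=> HP P0; have sP : (size P <= (size P).+1)%N by [].
have Hn := mpow_poly HO Cst HP sP.
have nz : s ^+ size P * P.[u] != 0 by rewrite mulf_neq0 ?expf_neq0.
have := (ordm_ge HO (size P) (mpow_loc HO Hn) nz).2 Hn.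
by rewrite (nvalM nE) ?expf_neq0 // (nvalX nE) // (ordm_coord HO Cst); lia.
Qed.

Lemma ordm_poly_unit P j : poly_in O P -> unit_in O P`_j -> ordm O P.[u] = 0.
Proof.
move=> HP uj; have P0 := poly_nonzero HO Cst HP uj.
apply/eqP; rewrite eq_le ordm_poly_ge0 // andbT leNgt; apply/negP => gt.
have sP : (size P <= (size P).+1)%N by [].
have Hn := mpow_poly HO Cst HP sP.
have nz : s ^+ size P * P.[u] != 0 by rewrite mulf_neq0 ?expf_neq0.
have : mpow O (size P).+1 (s ^+ size P * P.[u]).
  apply/(ordm_ge HO _ (mpow_loc HO Hn) nz).
  by rewrite (nvalM nE) ?expf_neq0 // (nvalX nE) // (ordm_coord HO Cst); lia.
by move/(poly_mpow_max HO Cst HP sP)/(_ j); exact: unit_nmax.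
Qed.

Lemma curve_ordm_QT : curve_at (QT O s t) (ordm O).
Proof.
split; [exact: nE| |].
  move=> _ [P [Q [HP HQ uQ ->]]]; have Q0 := poly_nonzero HO Cst HQ uQ.
  have [->|P0] := eqVneq P.[u] 0; first by rewrite mul0r (nval0 nE).
  by rewrite (nval_div nE) // (ordm_poly_unit HQ uQ) subr0 ordm_poly_ge0.
exists u; split; first exact: (QT_ratio_max HO Cst).
  by rewrite mulf_neq0 ?invr_eq0.
by rewrite (nval_div nE) // (ordm_coord HO Cst) (ordm_coord HO (coordsC Cst)) subrr.
Qed.

(** Either some nonunit of [O] has value zero, and the curve passes through the point [O], or [s]
    has positive value; as [s = 0] is the exceptional curve, [v] is then its order. *)
Lemma QT_curves v : regular (QT O s t) -> curve_at (QT O s t) v ->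
  curve_at O v \/ v = ordm O.
Proof.
move=> HW Hv; have [nv v0 _] := Hv; have [OW mW] := QT_dominates HO Cst.
have [[a [ma a0 va]]|H] := pselect (exists a, [/\ maxid O a, a != 0 & v a = 0]).
  by left; split=> // [a' /OW /v0|]; last by exists a.
right; have [ms _ _] := Cst; have CW := QT_coords HO Cst.
have vs : 0 < v s.
  rewrite lt_neqAle v0 ?andbT; last by case: (mW _ ms).
  by apply/eqP => E; apply: H; exists s.
have pW : prime_elt (QT O s t) s := coord_prime HW CW.
apply: (curve_eq HW Hv curve_ordm_QT pW vs).
by rewrite (ordm_coord HO Cst).
Qed.
End Coords.

(** A linear change of coordinates moves the line [s = 0] out of the tangent cone: [mu] is chosen so
    that the leading form does not vanish on the new line, and [a] has the nonzero residue
    [p.[mu]]. *)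
Lemma tangent_form n f : mpow O n.+1 f -> ~ mpow O n.+2 f ->
  exists s t a b, [/\ coords O s t, unit_in O a, mpow O n b & f = a * t ^+ n.+1 + s * b].
Proof.
have [s [t Cst]] := reg_coords (regular_reg HO); have Cts := coordsC Cst.
move=> /(mpow_hform HO Cts)[c Oc fE] nf; have [ms mt _] := Cst; have [Ot _] := mt.
pose p := \poly_(k < n.+2) res iota O (c k).
have p0 : p != 0.
  apply/eqP => p0; apply: nf; rewrite fE; apply: (mpow_sum HO Cst) => k.
  rewrite -mulrA; apply: (mpow_max HO Cst); last by apply: (mpow_mon HO Cts); rewrite -ltnS.
  by apply: (res_eq0 LO) => //; have := congr1 (fun q : {poly R[i]} => q`_k) p0; rewrite coef_poly coef0 ltn_ord.
have [mu pmu] := poly_nonroot p0.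
pose e k := \sum_(j < k) s ^+ (k.-1 - j) * (iota mu * t) ^+ j.
have eE k : s ^+ k = iota mu ^+ k * t ^+ k + (s - iota mu * t) * e k.
  have -> : (s - iota mu * t) * e k = s ^+ k - (iota mu * t) ^+ k.
    by rewrite subrXX; congr (_ * _); apply: eq_bigr => j _; congr (_ ^+ _ * _); lia.
  by rewrite exprMn; ring.
exists (s - iota mu * t), t, (\sum_(k < n.+2) c k * iota mu ^+ k),
  (\sum_(k < n.+2) c k * (t ^+ (n.+1 - k) * e k)); split.
- exact: coordsC (coords_shift HO mu Cts).
- apply: (unitP LO); first by apply: (loc_sum LO) => k _; have := Oc k => ?; inO LO.
  move=> /(res_max LO) E; move/eqP: pmu; apply; rewrite -[RHS]E horner_poly.
  have : forall k, O (c k * iota mu ^+ k) by move=> k; have := Oc k => ?; inO LO.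
  elim: n.+2 => [|k IH] H; first by rewrite !big_ord0 (res_max LO) //; exact: max0 LO.
  rewrite !big_ord_recr /= (resD LO) ?IH //; last by apply: (loc_sum LO).
  congr (_ + _); have := Oc k => ?; rewrite (resM LO) ?(resX LO) ?(res_const LO) //; inO LO.
- apply: (mpow_sum HO Cst) => k; apply: (mpowZ HO) => //.
  rewrite /e mulr_sumr; apply: (mpow_sum HO Cst) => j.
  have le := ltn_ord j; have lk := ltn_ord k.
  apply: (mpowW HO Cst (n := (n.+1 - k) + ((k.-1 - j) + j))).
    by move: (nat_of_ord k) (nat_of_ord j) le lk => k' j'; clear; lia.
  apply: (mpow_mul HO Cst); first exact: (mpowX HO Cst).
  apply: (mpow_mul HO Cst); first exact: (mpowX HO Cst).
  by apply: (mpowX HO Cst); apply: (maxMl LO) => //; inO LO.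
- rewrite fE mulr_suml mulr_sumr -big_split; apply: eq_bigr => k _ /=.
  have lk : (k <= n.+1)%N by rewrite -ltnS.
  by rewrite {1}(eE k) -[in t ^+ n.+1](subnK lk) exprD; ring.
Qed.

(** The local equation [p] is [s ^+ n.+1] times a polynomial [Pi] in [t / s] whose reduction is not
    constant. A root [lam] of this reduction is a tangent direction of the curve, and the strict
    transform passes through the corresponding point. *)
Lemma strict_transform v : curve_at O v -> exists2 W, quad O W & curve_at W v.
Proof.
move=> Hv; have [nv v_ge0 _] := Hv; have [p [pp vp vE]] := curve_prime_elt HO Hv.
have [mp p0 _] := pp; have Op := max_loc mp.
have [n En] := exact_filt_ex (mpow_filtration HO) Op p0.
case: n En => [[_ H]|n En]; first by case: H; apply/(mpow1 HO).
have [s [t [a [b [Cst ua Hb pE]]]]] := tangent_form En.1 En.2.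
have s0 := coord_neq0 HO Cst; have [ms mt _] := Cst; have Os := max_loc ms; have Ot := max_loc mt.
have Oa := unit_loc ua; have Ob := mpow_loc HO Hb.
have vs : v s = 0.
  apply/eqP; rewrite eq_le v_ge0 // andbT leNgt; apply/negP => /(vE s Os s0)[c Oc sE].
  have uc : unit_in O c.
    apply: (unitP LO Oc) => mc; apply: (coord_nmpow2 HO (coordsC Cst)); rewrite sE.
    by apply: (mpow_mul HO (coordsC Cst) (n := 1) (k := 1)); apply/(mpow1 HO).
  have [c0 _ Oci] := uc.
  apply: (unit_nmax ua); apply: (coord_power_ndvd HO (coordsC Cst) (n := n.+1) (b := c^-1 - b)) => //.
    by inO LO.
  have -> : t ^+ n.+1 * a = p - s * b by rewrite pE; ring.
  by rewrite {1}(_ : p = s * c^-1); [ring|rewrite sE; field].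
have [B [HB sB bE]] := (mpow_polyP HO Cst _ _).1 Hb.
pose Pi : {poly K} := a%:P * 'X ^+ n.+1 + B.
have HPi : poly_in O Pi.
  apply: (poly_inD LO) => //; apply: (poly_inM LO); first exact: (poly_inC LO).
  exact/(poly_in_exp LO)/(poly_inX LO).
pose Pb := map_poly (res iota O) Pi.
have r0 : res iota O 0 = 0 by apply: (res_max LO); exact: max0 LO.
have Pbn : Pb`_n.+1 != 0.
  rewrite coef_map_id0 // coefD coefCM coefXn eqxx mulr1.
  rewrite (_ : B`_n.+1 = 0) ?addr0; last by rewrite nth_default.
  by apply/eqP => /(res_eq0 LO Oa); exact: unit_nmax.
have /closed_rootP[lam /eqP lamr] : size Pb != 1%N.
  by apply: contraNneq Pbn => sPb; rewrite nth_default // sPb.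
have Cl := coords_shift HO lam Cst; pose W := QT O s (t - iota lam * s).
have LW : locring W := QT_loc HO Cl; have [OW mW] := QT_dominates HO Cl.
have uE : (t - iota lam * s) / s = t / s - iota lam by field.
have Wu : W (t / s).
  rewrite -[t / s](subrK (iota lam)) -uE; have := QT_ratio_max HO Cl => -[? _]; inO LW.
have ru : res iota W (t / s) = lam.
  by apply: (res_uniq LW); rewrite -uE; exact: (QT_ratio_max HO Cl).
have pPi : p = s ^+ n.+1 * Pi.[t / s].
  rewrite pE bE !(hornerD, hornerM, hornerC, hornerXn) exprMn exprVn exprS.
  have : s ^+ n != 0 by rewrite expf_neq0.
  by rewrite exprS => sn0; field; rewrite s0 sn0.
have mPi : maxid W Pi.[t / s].
  have HPW : poly_in W Pi by move=> j; apply: OW; exact: HPi.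
  apply: (res_eq0 LW); first exact: (poly_horner LW).
  rewrite (res_horner LW) // ru -lamr; congr (_.[_]); apply/polyP => j.
  rewrite !coef_map_id0 //; last by apply: (res_max LW); exact: max0 LW.
  by apply: (res_uniq LW); apply: mW; apply: (resP LO); exact: HPi.
have v_poly P : poly_in O P -> P.[(t - iota lam * s) / s] != 0 ->
    0 <= v P.[(t - iota lam * s) / s].
  move=> HP P0; have Hn := mpow_poly HO Cl HP (leqnSn (size P)).
  have := v_ge0 _ (mpow_loc HO Hn).
  by rewrite (nvalM nv) ?expf_neq0 // (nvalX nv) // vs mulr0 add0r.
exists W; first by exists s, (t - iota lam * s).
split=> //; last by exists s; split=> //; exact: mW.
move=> _ [P [Q [HP HQ uQ ->]]].
have Q0 := poly_nonzero HO Cl HQ uQ.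
have [->|P0] := eqVneq P.[(t - iota lam * s) / s] 0; first by rewrite mul0r (nval0 nv).
rewrite (nval_div nv) //; suff -> : v Q.[(t - iota lam * s) / s] = 0 by rewrite subr0; exact: v_poly.
(* If the denominator [Q] vanished along the curve, [s ^+ k] times [Q] would be a multiple of [p].
   By comparison of orders, [Q] would be [Pi] times an element of [W], hence a nonunit of [W]. *)
apply/eqP; rewrite eq_le v_poly // andbT leNgt; apply/negP => vQ.
set k := size Q; have Hk := mpow_poly HO Cl HQ (leqnSn k).
set q := s ^+ k * _ in Hk.
have q0 : q != 0 by rewrite mulf_neq0 ?expf_neq0.
have [c Oc qE] : dv O p q.
  apply/(vE _ (mpow_loc HO Hk) q0).
  by rewrite (nvalM nv) ?expf_neq0 // (nvalX nv) // vs mulr0 add0r.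
have c0 : c != 0 by apply: contraNneq q0 => c0; rewrite qE c0 mul0r.
have [l El] := exact_filt_ex (mpow_filtration HO) Oc c0.
have [kl|lk] := ltnP (n.+1 + l) k.
  have [_] := exact_filtM (mpow_filtration HO) En El; apply.
  by rewrite mulrC -qE; apply: (mpowW HO Cl kl).
have [C [HC sC cE]] := (mpow_polyP HO Cl _ _).1 El.1.
have WC : W C.[(t - iota lam * s) / s] := QT_poly HO _ _ HC.
have uQW : unit_in W Q.[(t - iota lam * s) / s].
  have WQ : W Q.[(t - iota lam * s) / s] := QT_poly HO _ _ HQ.
  by apply: (unitP LW WQ) => /(maxQT_poly HO Cl HQ); exact: unit_nmax.
apply: (unit_nmax uQW).
have -> : Q.[(t - iota lam * s) / s] =
    Pi.[t / s] * (s ^+ (n.+1 + l - k) * C.[(t - iota lam * s) / s]).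
  apply: (mulfI (expf_neq0 k s0)); rewrite -/q qE {1}pPi {1}cE.
  have E : s ^+ k * s ^+ (n.+1 + l - k) = s ^+ n.+1 * s ^+ l.
    by rewrite -!exprD subnKC.
  move: (s ^+ (n.+1 + l - k)) E => w E.
  rewrite [RHS](_ : _ = (s ^+ k * w) * (Pi.[t / s] * C.[(t - iota lam * s) / s])); last by ring.
  by rewrite E; ring.
apply: (maxM LW) => //; have Ws := OW _ Os; inO LW.
Qed.

End OneRing.
End CurvesOnBlowups.

(** * Blowups *)

Section Blowup.
Variables (R : realType) (K : fieldType) (iota : {rmorphism R[i] -> K}).
Notation locring := (locring iota).
Notation regular := (regular iota).
Notation pts := (pts iota).
Implicit Types (O W V : K -> Prop) (P Q A B : {poly K}) (X Y : model K).

Variable eta : two_form K.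
Hypothesis eta0 : exists D1 D2, [/\ derivation iota D1, derivation iota D2 &
  form_eval eta D1 D2 != 0].

Lemma over_const_id : over_const iota (idfun : {rmorphism K -> K}).
Proof. by []. Qed.

Lemma pts_chart X p i0 j : point iota X p -> p 0 i0 != 0 ->
  gen X 0 i0 != 0 /\ local_ring iota X p (gen X 0 j / gen X 0 i0).
Proof.
move=> Hp pi0; split; last exact: (chart_loc iota pi0).
by rewrite -(at_genX iota); apply: (at_gen_neq0 Hp (homogX _ i0)); rewrite at_ptX.
Qed.

Section OneBlowup.
Variables (X : model K) (HX : smooth_surface iota X) (p : 'rV[R[i]]_(rank X))
  (Hp : point iota X p).
Notation n := (rank X).
Let x (j : 'I_n) : K := gen X 0 j.
Let O := local_ring iota X p.
Let XO : pts X O. Proof. by exists p. Qed.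
Let HO : regular O := pts_regular eta0 HX XO.
Let LO : locring O := regular_loc HO.
Let Y := blowup iota X p.
Let y (i j : 'I_n) : K := iota (p 0 i) * x j - x i * iota (p 0 j).
Let idx k i j : 'I_(rank Y) := mxvec_index k (mxvec_index i j).

Lemma gen_blowup k i j : gen Y 0 (idx k i j) = x k * y i j.
Proof.
rewrite /= mxvecE mxE big_ord1 !mxE; congr (_ * _).
by rewrite mxvecE !mxE !big_ord1 !mxE.
Qed.

Lemma blowup_index (a : 'I_(rank Y)) : exists k i j, a = idx k i j.
Proof.
case/mxvec_indexP: a => k b; case/mxvec_indexP: b => i j; by exists k, i, j.
Qed.

Let ratio_in V k0 i0 j0 : locring V -> (forall k, V (x k / x k0)) ->
  (forall i j, V (y i j / y i0 j0)) -> x k0 != 0 -> y i0 j0 != 0 ->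
  exists2 W, pts Y W & dominates W V.
Proof.
move=> LV Vx Vy x0 y0.
have [||q [Hq _ [H1 H2]]] := @center_exists _ _ iota Y V idfun (idx k0 i0 j0) LV over_const_id.
- by rewrite gen_blowup mulf_neq0.
- move=> a; have [k [i [j ->]]] := blowup_index a; rewrite !gen_blowup /=.
  rewrite (_ : _ / _ = (x k / x k0) * (y i j / y i0 j0)); last by field; rewrite x0 y0.
  by apply: (loc_mul LV).
by exists (local_ring iota Y q); [exists q|].
Qed.

Section Chart.
Variables (k0 : 'I_n) (pk0 : p 0 k0 != 0).
Let x0 : x k0 != 0. Proof. by case: (pts_chart k0 Hp pk0). Qed.

Lemma blowup_eq_max i j : maxid O (y i j / x k0).
Proof.
apply/(local_idealP Hp); exists 1%N, ((p 0 i)%:MP * 'X_j - 'X_i * (p 0 j)%:MP), 'X_k0.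
split.
- rewrite -mulN1r; apply: dhomogD; first by rewrite mul_mpolyC; apply: dhomogZ; exact: homogX.
  by rewrite mulN1r dhomogN mulrC mul_mpolyC; apply: dhomogZ; exact: homogX.
- exact: homogX.
- by rewrite at_ptX.
- by rewrite !at_pt_morph !at_ptC !at_ptX; ring.
- by rewrite !at_gen_morph !at_genC !at_genX.
Qed.

Let l := [seq y k0 j / x k0 | j <- enum 'I_n].

(** Up to a constant factor, [x j / x k0] minus its residue is [y k0 j / x k0]. Being a constant
    plus an element of the span is preserved by all operations that build the local ring from these
    generators. *)
Lemma blowup_max_span a : maxid O a -> lspan O l a.
Proof.
have [c0 c1] : O 0 /\ O 1 by split; inO LO.
have OD : forall a b, O a -> O b -> O (a + b) by move=> *; inO LO.
have OM : forall a b, O a -> O b -> O (a * b) by move=> *; inO LO.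
have lm b : lspan O l b -> maxid O b.
  apply: lspan_sub; [by split; [exact: max0 LO|exact: loc_maxD LO]|exact: closed_scale_max LO|].
  by move=> _ /mapP[j _ ->]; exact: blowup_eq_max.
have [zO zB] := chart_gen Hp pk0.
suff H : forall b, O b -> exists c, lspan O l (b - iota c).
  move=> ma; have [c lc] := H a (max_loc ma).
  have c00 : c = 0.
    by rewrite -(res_uniq LO (lm _ lc)); exact: (res_max LO ma).
  by move: lc; rewrite c00 rmorph0 subr0.
move=> b Ob; suff [] : O b /\ exists c, lspan O l (b - iota c) by [].
apply: (zB (fun b => O b /\ exists c, lspan O l (b - iota c))) => // {b Ob}.
- by move=> c; split; [inO LO|exists c; rewrite subrr; exact: lspan0].
- move=> a1 b [Oa [c lc]] [Ob [d ld]]; split; [inO LO|exists (c + d)].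
  rewrite rmorphD (_ : _ - _ = (a1 - iota c) + (b - iota d)); last by ring.
  exact: lspanD.
- move=> a1 b [Oa [c lc]] [Ob [d ld]]; split; [inO LO|exists (c * d)].
  rewrite rmorphM (_ : _ - _ = b * (a1 - iota c) + iota c * (b - iota d)); last by ring.
  by apply: lspanD => //; apply: lspanZ => //; inO LO.
- move=> b [Ob [c lc]] ub; split; first by case: ub.
  have [c00|c0'] := eqVneq c 0.
    by case: (unit_nmax ub); move: lc; rewrite c00 rmorph0 subr0 => /lm.
  have [b0 _ Oi] := ub; exists c^-1; have ic0 : iota c != 0 by rewrite fmorph_eq0.
  rewrite fmorphV (_ : _ - _ = - (b^-1 * (iota c)^-1) * (b - iota c)); last by field; rewrite b0 ic0.
  apply: lspanZ => //; have : O (iota c)^-1 by rewrite -fmorphV; inO LO.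
  by move=> ?; inO LO.
move=> _ /mapP[j _ ->]; split; first by case: (pts_chart j Hp pk0).
exists (p 0 j / p 0 k0).
have ipk0 : iota (p 0 k0) != 0 by rewrite fmorph_eq0.
rewrite fmorph_div (_ : _ - _ = (iota (p 0 k0))^-1 * (y k0 j / x k0)); last first.
  by rewrite /y -!/(x _); field; rewrite x0 ipk0.
apply: lspanZ => //; first by rewrite -fmorphV; inO LO.
by apply: lspan_mem => //; apply/mapP; exists j; rewrite ?mem_enum.
Qed.

(** The [y k0 j / x k0] generate the maximal ideal, which contains [s], so one of their quotients by
    [s] is a unit of [V]. It serves as denominator for the homogeneous coordinates. *)
Lemma center_QT s t : coords O s t -> exists2 W, pts Y W & dominates W (QT O s t).
Proof.
move=> Cst; have s0 := coord_neq0 HO Cst; set V := QT O s t.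
have LV : locring V := QT_loc HO Cst; have [OV mV] := QT_dominates HO Cst.
have lin a : maxid O a -> V (a / s).
  move=> ma; have [_ _ /(_ _ ma)[b [c [/OV Vb /OV Vc ->]]]] := Cst.
  rewrite (_ : _ / s = b + c * (t / s)); last by field.
  by have [? _] := QT_ratio_max HO Cst; inO LV.
have [j uj] : exists j, unit_in V ((y k0 j / x k0) / s).
  apply: contrapT => H.
  have {}H j : maxid V ((y k0 j / x k0) / s).
    have [uj|//] := unit_or_max LV (lin _ (blowup_eq_max k0 j)); by case: H; exists j.
  have : maxid V (s / s).
    apply: (@lspan_sub _ O (fun a => maxid V (a / s)) l).
    - by split=> [|a b ma mb]; rewrite ?mul0r ?mulrDl; [exact: max0 LV|exact: (loc_maxD LV)].
    - by move=> c a /OV Vc ma; rewrite -mulrA; exact: (maxMl LV).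
    - by move=> _ /mapP[j _ ->]; exact: H.
    - by apply: blowup_max_span; case: Cst.
  by rewrite divff //; exact: not_max1 LV.
have [w0 _ wi] := uj; have y0 : y k0 j != 0 by apply: contraNneq w0 => ->; rewrite !mul0r.
apply: (ratio_in (k0 := k0) (i0 := k0) (j0 := j)) => //.
- by move=> k; apply: OV; case: (pts_chart k Hp pk0).
move=> i' j'.
rewrite (_ : _ / _ = (y i' j' / x k0 / s) * (y k0 j / x k0 / s)^-1); last first.
  by field; rewrite x0 y0 s0.
by apply: (loc_mul LV) => //; apply: lin; exact: blowup_eq_max.
Qed.
End Chart.

Lemma center_other O' : pts X O' -> O' <> O -> exists2 W, pts Y W & dominates W O'.
Proof.
move=> [q Hq ->] ne; have Lq := local_ring_loc Hq.
have [k0 qk0] := chart_exists Hq; have [x0 _] := pts_chart k0 Hq qk0.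
have cm c j : local_ring iota X q (iota c * (x j / x k0)) /\
    res iota (local_ring iota X q) (iota c * (x j / x k0)) = c * (q 0 j / q 0 k0).
  have [_ cj] := pts_chart j Hq qk0; have Oc : local_ring iota X q (iota c) by inO Lq.
  by split; [inO Lq|rewrite (resM Lq) // (res_const Lq) (chart_res Hq)].
have yE' i j : y i j / x k0 = iota (p 0 i) * (x j / x k0) + iota (- p 0 j) * (x i / x k0).
  by rewrite /y rmorphN; field.
have Vy i j : local_ring iota X q (y i j / x k0).
  by rewrite yE'; apply: (loc_add Lq); [case: (cm (p 0 i) j)|case: (cm (- p 0 j) i)].
have yE i j : res iota (local_ring iota X q) (y i j / x k0) =
    (p 0 i * q 0 j - q 0 i * p 0 j) / q 0 k0.
  have [H1 H2] := cm (p 0 i) j; have [H3 H4] := cm (- p 0 j) i.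
  by rewrite yE' (resD Lq) // H2 H4; field.
have [i [j uij]] : exists i j, unit_in (local_ring iota X q) (y i j / x k0).
  apply: contrapT => H; have {}H i j : p 0 i * q 0 j = q 0 i * p 0 j.
    have [uj|/(res_max Lq)] := unit_or_max Lq (Vy i j); first by case: H; exists i, j.
    rewrite yE => /eqP; rewrite mulf_eq0 invr_eq0 (negPf qk0) orbF subr_eq0 => /eqP //.
  have [i1 pi1] := chart_exists Hp; have qi1 : q 0 i1 != 0.
    apply: contraNneq pi1 => qi1; have := H i1 k0; rewrite qi1 mul0r => /eqP.
    by rewrite mulf_eq0 (negPf qk0) orbF.
  case: ne.
  have ptE d (F : {mpoly R[i][n]}) : F \is d.-homog ->
      at_pt q F = (q 0 i1 / p 0 i1) ^+ d * at_pt p F.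
    move=> hF; rewrite -(mmap_scale _ _ _ hF); apply: meval_eq => j.
    by have := H i1 j => E; rewrite mulrAC -E; field.
  have c0 : q 0 i1 / p 0 i1 != 0 by rewrite mulf_neq0 ?invr_eq0.
  apply/funext => a; apply/propext; split=> -[d [F [G [hF hG G0 aE]]]]; exists d, F, G; split=> //.
    by apply: contraNneq G0 => z; rewrite (ptE d) // z mulr0.
  by rewrite (ptE d) // mulf_neq0 ?expf_neq0.
have [w0 _ wi] := uij; have y0 : y i j != 0 by apply: contraNneq w0 => ->; rewrite !mul0r.
apply: (ratio_in (k0 := k0) (i0 := i) (j0 := j)) => //.
- by move=> k; case: (pts_chart k Hq qk0).
move=> i' j'.
rewrite (_ : _ / _ = (y i' j' / x k0) * (y i j / x k0)^-1); last by field; rewrite x0 y0.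
by apply: (loc_mul Lq).
Qed.

(** The center of [W] on [X] is either another point, over which nothing changes, or the center of
    the blowup. In the second case some [y i0 j0 / x k0] divides the maximal ideal in [W]; this
    singles out a coordinate [s'] and the residue of [t' / s'], that is, a quadratic transform
    contained in [W]. Separatedness of the blowup makes it equal to [W]. *)
Lemma blowup_pts W : pts Y W ->
  exists O', [/\ pts X O', dominates O' W & (O' <> O /\ W = O') \/ (O' = O /\ quad O W)].
Proof.
move=> YW; have [q Hq WE] := YW; have LW := pts_loc YW.
have [a qa] := chart_exists Hq; have [k0 [i0 [j0 aE]]] := blowup_index a.
have [ga0 gaW] : gen Y 0 a != 0 /\ forall b, W (gen Y 0 b / gen Y 0 a).
  by split=> [|b]; [case: (pts_chart a Hq qa)|rewrite WE; case: (pts_chart b Hq qa)].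
rewrite aE gen_blowup in ga0; move: (ga0); rewrite mulf_eq0 negb_or => /andP[x0 y0].
have Wx k : W (x k / x k0).
  have := gaW (idx k i0 j0); rewrite aE !gen_blowup.
  by rewrite (_ : _ / _ = x k / x k0) //; field; rewrite x0 y0.
have Wy i j : W (y i j / y i0 j0).
  have := gaW (idx k0 i j); rewrite aE !gen_blowup.
  by rewrite (_ : _ / _ = y i j / y i0 j0) //; field; rewrite x0 y0.
have [q' [Hq' q'k0 OW]] := @center_exists _ _ iota X W idfun k0 LW over_const_id x0 Wx.
have XO' : pts X (local_ring iota X q') by exists q'.
exists (local_ring iota X q'); split=> //.
have [E|ne] := pselect (local_ring iota X q' = O); last first.
  left; split=> //; have [W2 YW2 W2O] := center_other XO' ne.
  have E : W2 = W by apply: (pts_dominates_eq YW2 YW (W := W)) => //; exact: dominates_trans OW.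
  by apply: dominates_antisym => //; rewrite -E.
right; split=> //; rewrite E in OW XO'.
have pk0 : p 0 k0 != 0.
  apply/eqP => pk0; have [k1 pk1] := chart_exists Hp; have [x10 _] := pts_chart k1 Hp pk1.
  have [_ c1] := pts_chart k1 Hq' q'k0; rewrite E in c1.
  have mk : maxid O (x k0 / x k1).
    apply: (res_eq0 LO); first by case: (pts_chart k0 Hp pk1).
    by rewrite (chart_res Hp pk1) pk0 mul0r.
  have [_ [/eqP|]] := mk; first by rewrite mulf_eq0 invr_eq0 (negPf x0) (negPf x10).
  by apply; rewrite invf_div.
have [s [t Cst]] := reg_coords (regular_reg HO); have [ms mt Hst] := Cst.
have [OW' mW'] := OW.
pose Y0 := y i0 j0 / x k0.
have Y00 : Y0 != 0 by rewrite mulf_neq0 ?invr_eq0.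
have lin b : maxid O b -> W (b / Y0).
  move=> mb; apply: (@lspan_sub _ O (fun b => W (b / Y0)) _ _ _ _ _ (blowup_max_span pk0 mb)).
  - by split=> [|c d Wc Wd]; rewrite ?mul0r ?mulrDl; inO LW.
  - by move=> c d /OW' Wc Wd; rewrite -mulrA; inO LW.
  - move=> _ /mapP[j _ ->]; rewrite (_ : _ / Y0 = y k0 j / y i0 j0) //.
    by rewrite /Y0; field; rewrite x0 y0.
have [s' [t' [Cst' us]]] : exists s' t', coords O s' t' /\ unit_in W (s' / Y0).
  have [us|mss] := unit_or_max LW (lin _ ms); first by exists s, t.
  have [ut|mtt] := unit_or_max LW (lin _ mt); first by exists t, s; split=> //; exact: coordsC.
  have [b [c [/OW' Wb /OW' Wc Y0E]]] := Hst _ (blowup_eq_max pk0 i0 j0).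
  case: (not_max1 LW); rewrite (_ : 1 = b * (s / Y0) + c * (t / Y0)).
    by apply: (loc_maxD LW); apply: (maxMl LW).
  transitivity ((b * s + c * t) / Y0); first by rewrite -Y0E divff.
  by field.
have s'0 := coord_neq0 HO Cst'.
have Wu : W (t' / s').
  have [_ mt' _] := Cst'; have := lin _ mt' => ?.
  rewrite (_ : t' / s' = (t' / Y0) * (s' / Y0)^-1); last by field; rewrite s'0 Y00.
  by inO LW.
pose t2 := t' - iota (res iota W (t' / s')) * s'.
have C2 : coords O s' t2 := coords_shift HO _ Cst'.
have mu : maxid W (t2 / s') by rewrite /t2 mulrBl mulfK //; exact: (resP LW).
exists s', t2; split=> //.
have VW := QT_minimal HO C2 LW OW mu.
have [W2 YW2 W2V] := center_QT pk0 C2.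
have E2 : W2 = W by apply: (pts_dominates_eq YW2 YW (W := W)) => //; exact: dominates_trans VW.
by apply: dominates_antisym => //; rewrite -E2.
Qed.

Lemma blowup_pts_other O' : pts X O' -> O' <> O -> pts Y O'.
Proof.
move=> XO' ne; have [W YW WO'] := center_other XO' ne.
have [O2 [XO2 O2W HW]] := blowup_pts YW.
have E : O2 = O' by apply: (pts_dominates_eq XO2 XO' (W := O')) => //; exact: dominates_trans WO'.
by case: HW => [[_ WE]|[E2 _]]; [rewrite -E -WE|case: ne; rewrite -E].
Qed.

Lemma blowup_pts_quad W : quad O W -> pts Y W.
Proof.
move=> [s [t [Cst ->]]]; have [k0 pk0] := chart_exists Hp.
have [W2 YW2 W2V] := center_QT pk0 Cst; have [O2 [XO2 O2W HW]] := blowup_pts YW2.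
have LV := QT_loc HO Cst.
have E : O2 = O.
  apply: (pts_dominates_eq XO2 XO (W := QT O s t)); first exact: dominates_trans W2V.
  exact: (QT_dominates HO Cst).
case: HW => [[ne]|[_ [s' [t' [Cst' W2E]]]]]; first by rewrite E in ne.
rewrite (_ : QT O s t = W2) //; rewrite W2E.
apply: (QT_uniq HO Cst Cst' LV (QT_dominates HO Cst) (QT_ratio_max HO Cst)).
by have [_ m2] := W2V; apply: m2; rewrite W2E; exact: (QT_ratio_max HO Cst').
Qed.

Lemma blowup_smooth : smooth_surface iota Y.
Proof.
have [s [t Cst]] := reg_coords (regular_reg HO); have [HF Htr _] := HX.
split=> //.
  move=> a; have [q Hq WE] : pts Y (QT O s t) by apply: blowup_pts_quad; exists s, t.
  have [b [c [Ob Oc c0 ->]]] := regular_frac HO a.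
  have [OV _] := QT_dominates HO Cst.
  have := OV _ Ob; have := OV _ Oc; rewrite WE.
  move=> [d [F [G [hF hG G0 cE]]]] [e [F' [G' [hF' hG' G'0 bE]]]].
  have g0 := at_gen_neq0 Hq hG G0; have g'0 := at_gen_neq0 Hq hG' G'0.
  have f0 : at_gen iota F != 0 by apply: contraNneq c0 => z; rewrite cE z mul0r.
  exists (e + d)%N, (F' * G), (G' * F); split; [exact: dhomogM|exact: dhomogM| |].
    by rewrite at_gen_morph mulf_neq0.
  by rewrite !at_gen_morph bE cE; field; rewrite f0 g0 g'0.
move=> q Hq; have YW : pts Y (local_ring iota Y q) by exists q.
suff [s' [t' C']] : exists s' t', coords (local_ring iota Y q) s' t'.
  by exists s', t'; apply/(coordsP Hq).
have [O2 [XO2 O2W [[_ ->]|[_ [s' [t' [Cst' ->]]]]]]] := blowup_pts YW.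
  exact: (reg_coords (regular_reg (pts_regular eta0 HX XO2))).
by exists s', (t' / s'); exact: (QT_coords HO Cst').
Qed.

End OneBlowup.
End Blowup.

(** * Modifications, Zariski neighbourhoods and finiteness of divisors *)

Section Surfaces.
Variables (R : realType) (K : fieldType) (iota : {rmorphism R[i] -> K}).
Notation locring := (locring iota).
Notation regular := (regular iota).
Notation pts := (pts iota).
Notation smooth := (smooth_surface iota).
Implicit Types (O W V : K -> Prop) (X Y : model K).

Variable eta : two_form K.
Hypothesis eta0 : exists D1 D2, [/\ derivation iota D1, derivation iota D2 &
  form_eval eta D1 D2 != 0].

Lemma prime_divisorP X v : prime_divisor iota X v <-> exists2 O, pts X O & curve_at O v.
Proof.
split=> [[p Hv]|[_ [p Hp ->] /(curve_atP Hp) Hv]]; last by exists p.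
have [Hp _ _ _] := Hv; exists (local_ring iota X p); first by exists p.
exact/(curve_atP Hp).
Qed.

Lemma modification_trans X Y Z : modification iota X Y -> modification iota Y Z ->
  modification iota X Z.
Proof. by move=> XY; elim=> // Z' p _ XZ' Hp; apply: modification_blowup. Qed.

Lemma modification_smooth X Y : smooth X -> modification iota X Y -> smooth Y.
Proof. by move=> HX; elim=> // Y' p _ HY' Hp; exact: (blowup_smooth eta0 HY' Hp). Qed.

Lemma modification_curves X Y v : smooth X -> modification iota X Y ->
  prime_divisor iota X v -> prime_divisor iota Y v.
Proof.
move=> HX XY Hv; elim: XY => // Y' p XY' /prime_divisorP[O YO HO] Hp.
have HY' := modification_smooth HX XY'; apply/prime_divisorP.
have [E|ne] := pselect (O = local_ring iota Y' p); last first.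
  by exists O => //; exact: (blowup_pts_other eta0 HY' Hp).
have [W qW HW] := strict_transform (pts_regular eta0 HY' YO) HO.
by exists W => //; apply: (blowup_pts_quad eta0 HY' Hp); rewrite -E.
Qed.

(** A basis of Zariski neighbourhoods is given by the points where finitely many functions, regular
    at [O], remain regular. *)
Definition near X O (P : (K -> Prop) -> Prop) := exists A : seq K,
  (forall a, a \in A -> O a) /\ forall O', pts X O' -> (forall a, a \in A -> O' a) -> P O'.

Lemma nearW X O (P Q : (K -> Prop) -> Prop) :
  (forall O', pts X O' -> P O' -> Q O') -> near X O P -> near X O Q.
Proof. by move=> PQ [A [AO H]]; exists A; split=> // O' XO' AO'; apply: PQ => //; exact: H. Qed.

Lemma near_and X O P Q : near X O P -> near X O Q -> near X O (fun O' => P O' /\ Q O').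
Proof.
move=> [A [AO H]] [B [BO H']]; exists (A ++ B); split=> [a|O' XO' H2].
  by rewrite mem_cat => /orP[/AO|/BO].
by split; [apply: H|apply: H'] => // a Aa; apply: H2; rewrite mem_cat Aa ?orbT.
Qed.

Lemma near_mem X O a : O a -> near X O (fun O' => O' a).
Proof.
move=> Oa; exists [:: a]; split=> [b|O' _]; first by rewrite inE => /eqP ->.
by apply; exact: mem_head.
Qed.

Lemma near_unit X O a : unit_in O a -> near X O (fun O' => unit_in O' a).
Proof.
move=> [a0 Oa Oi]; apply: nearW (near_and (near_mem X Oa) (near_mem X Oi)).
by move=> O' _ [].
Qed.

Lemma near_all X O (T : eqType) (l : seq T) (P : T -> (K -> Prop) -> Prop) :
  (forall x, x \in l -> near X O (P x)) -> near X O (fun O' => forall x, x \in l -> P x O').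
Proof.
elim: l => [|x l IH] H; first by exists [::].
have H1 := H x (mem_head _ _); have {}IH : near X O (fun O' => forall x, x \in l -> P x O').
  by apply: IH => y ly; apply: H; rewrite inE ly orbT.
apply: nearW (near_and H1 IH) => O' _ [Px Pl] y; rewrite inE => /orP[/eqP ->|/Pl] //.
Qed.

Lemma pts_compact X (P : (K -> Prop) -> (K -> Prop) -> Prop) :
  (forall O, pts X O -> near X O (P O)) ->
  exists L : set (set K), [/\ finite_set L, L `<=` pts X &
    forall O', pts X O' -> exists2 O, L O & P O O'].
Proof.
move=> H; pose Q (O : set K) (A : seq K) := pts X O -> (forall a, a \in A -> O a) /\
  forall O', pts X O' -> (forall a, a \in A -> O' a) -> P O O'.
have ex O : exists A, Q O A.
  have [XO|nXO] := pselect (pts X O); last by exists [::].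
  by have [A HA] := H O XO; exists A.
have [L [Lfin LX LH]] := @pts_quasi_compact _ _ iota X (fun O => projT1 (cid (ex O)))
  (fun O XO => (projT2 (cid (ex O)) XO).1).
exists L; split=> // O' XO'; have [O LO HO] := LH O' XO'; exists O => //.
by apply: (projT2 (cid (ex O)) (LX _ LO)).2.
Qed.

Definition alg_by (z : seq K) a := exists F : {mpoly R[i][size z]},
  a = mmap iota (fun j => z`_j) F.

Lemma alg_const z c : alg_by z (iota c).
Proof. by exists (c%:MP); rewrite mmapC. Qed.

Lemma alg_add z a b : alg_by z a -> alg_by z b -> alg_by z (a + b).
Proof. by move=> [F ->] [G ->]; exists (F + G); rewrite rmorphD. Qed.

Lemma alg_mul z a b : alg_by z a -> alg_by z b -> alg_by z (a * b).
Proof. by move=> [F ->] [G ->]; exists (F * G); rewrite rmorphM. Qed.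

Lemma alg_gen z a : a \in z -> alg_by z a.
Proof.
move=> az; have lt : (index a z < size z)%N by rewrite index_mem.
by exists ('X_(Ordinal lt)); rewrite mmapX mmap1U /= nth_index.
Qed.

Lemma alg_loc z O a : locring O -> (forall x, x \in z -> O x) -> alg_by z a -> O a.
Proof.
move=> LO zO [F ->]; apply: mmap_closed; [exact: loc_const LO|exact: loc_add LO|exact: loc_mul LO|].
by move=> j; apply: zO; exact: mem_nth.
Qed.

Lemma gen_frac z O a : locring O -> gen_by iota O z -> O a ->
  exists b c, [/\ alg_by z b, alg_by z c, unit_in O c & a = b / c].
Proof.
move=> LO [zO zB]; have A1 : alg_by z 1 by rewrite -(rmorph1 iota); exact: alg_const.
apply: (zB (fun a => exists b c, [/\ alg_by z b, alg_by z c, unit_in O c & a = b / c])).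
- move=> c; exists (iota c), 1; split=> //; [exact: alg_const|exact: unit1 LO|by rewrite divr1].
- move=> _ _ [b [c [Hb Hc uc ->]]] [b' [c' [Hb' Hc' uc' ->]]].
  exists (b * c' + b' * c), (c * c'); split; [|exact: alg_mul|exact: (unitM LO)|].
    by apply: alg_add; exact: alg_mul.
  by case: uc => c0 _ _; case: uc' => c'0 _ _; field; rewrite c0 c'0.
- move=> _ _ [b [c [Hb Hc uc ->]]] [b' [c' [Hb' Hc' uc' ->]]].
  exists (b * b'), (c * c'); split; [exact: alg_mul|exact: alg_mul|exact: (unitM LO)|].
  by case: uc => c0 _ _; case: uc' => c'0 _ _; field; rewrite c0 c'0.
- move=> _ [b [c [Hb Hc uc ->]]] ubc; exists c, b; split=> //; last by rewrite invf_div.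
  have [c0 _ _] := uc; rewrite -[b](divfK c0); exact: (unitM LO).
- by move=> x xz; exists x, 1; split=> //; [exact: alg_gen|exact: unit1 LO|rewrite divr1].
Qed.

Lemma pts_gen X O : pts X O -> exists z, gen_by iota O z /\
  forall O', pts X O' -> (forall x, x \in z -> O' x) -> gen_by iota O' z.
Proof.
move=> [p Hp ->]; have [i0 pi0] := chart_exists Hp; have [x0 _] := pts_chart i0 Hp pi0.
exists [seq gen X 0 j / gen X 0 i0 | j <- enum 'I_(rank X)]; split; first exact: chart_gen.
move=> _ [q Hq ->] H; apply: (chart_gen Hq); have Lq := local_ring_loc Hq.
have [j1 qj1] := chart_exists Hq; have [x1 _] := pts_chart j1 Hq qj1.
have Oj : local_ring iota X q (gen X 0 j1 / gen X 0 i0).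
  by apply: H; apply/mapP; exists j1; rewrite ?mem_enum.
apply/eqP => qi0; have : maxid (local_ring iota X q) (gen X 0 i0 / gen X 0 j1).
  apply: (res_eq0 Lq); first by case: (pts_chart i0 Hq qj1).
  by rewrite (chart_res Hq qj1) qi0 mul0r.
move=> [_ [/eqP|]]; first by rewrite mulf_eq0 invr_eq0 (negPf x0) (negPf x1).
by apply; rewrite invf_div.
Qed.

Section Smooth.
Variables (X : model K) (HX : smooth X).
Let regX O : pts X O -> regular O := pts_regular eta0 HX (O := O).

(** The elements of a finitely generated algebra that [p] divides in [O] form an ideal with finitely
    many generators. Where their quotients by [p] stay regular, all of them vanish along any curve
    on which [p] vanishes, and such a curve coincides with [ordp O p]. *)
Lemma near_prime O p : pts X O -> prime_elt O p ->
  near X O (fun O' => forall v, curve_at O' v -> v p != 0 -> v = ordp O p).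
Proof.
move=> XO pp; have HO := regX XO; have LO := regular_loc HO; have [mp p0 _] := pp.
have [z [zO zO']] := pts_gen XO.
pose S (F : {mpoly R[i][size z]}) := dv O p (mmap iota (fun j => z`_j) F).
have [l lS lH] := @hilbert_basis (R[i] : fieldType) _ S (fun _ _ => I).
pose A := [seq mmap iota (fun j => z`_j) F / p | F <- l].
exists (p :: z ++ A); split=> [a|O' XO' H v Hv vp].
  rewrite inE mem_cat => /or3P[/eqP ->|az|/mapP[F /lS[c Oc E] ->]].
  - by case: mp.
  - by case: zO => H _; exact: H.
  - by rewrite E mulfK.
have HO' := regX XO'; have LO' := regular_loc HO'; have [nv v0 [x [mx x0 vx]]] := Hv.
have O'p : O' p by apply: H; rewrite mem_head.
have zin : forall y, y \in z -> O' y by move=> y yz; apply: H; rewrite inE mem_cat yz orbT.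
have gO' := zO' _ XO' zin.
have {vp}vp : 0 < v p by rewrite lt_neqAle eq_sym vp; exact: v0.
have key a : alg_by z a -> a != 0 -> dv O p a -> 0 < v a.
  move=> [F aE] a0 pa; have /lH lF : S F by rewrite /S -aE.
  have : dv O' p a.
    have evM (c G b : {mpoly R[i][size z]}) : mmap iota (fun j => z`_j) (c * G + b) = mmap iota (fun j => z`_j) c *
      mmap iota (fun j => z`_j) G + mmap iota (fun j => z`_j) b by rewrite rmorphD rmorphM.
    have lA : forall G, G \in l -> dv O' p (mmap iota (fun j => z`_j) G).
      move=> G lG; exists (mmap iota (fun j => z`_j) G / p); last by rewrite divfK.
      have aA : mmap iota (fun j => z`_j) G / p \in A by apply/mapP; exists G.
      by apply: H; rewrite inE mem_cat aA !orbT.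
    rewrite aE; elim: (l) lA F lF {aE} => [|G l' IH] lA F /=.
      by move=> ->; rewrite raddf0; exact: (dv0 HO').
    move=> [c [b [_ lb ->]]]; apply: (eq_ind_r (dv O' p) _ (evM c G b)); apply: (dv_add HO').
      apply: (dv_mull HO'); last exact: (lA G (mem_head _ _)).
      by apply: (alg_loc (z := z) LO') => //; exists c.
    by apply: IH => // G' lG'; apply: lA; rewrite inE lG' orbT.
  move=> [c O'c aE']; have c0 : c != 0 by apply: contraNneq a0 => c0; rewrite aE' c0 mul0r.
  by rewrite aE' (nvalM nv) //; have := v0 _ O'c; lia.
set w := ordp O p; have cw : curve_at O w := curve_ordp HO pp.
have nw : normalized_valuation w by case: cw.
have w_alg a : alg_by z a -> a != 0 -> v a = 0 -> w a = 0.
  move=> Ha a0 va; have Oa : O a by apply: (alg_loc LO) Ha; case: zO.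
  apply/eqP; rewrite eq_le (ordp_ge0 HO pp Oa) andbT leNgt; apply/negP.
  by move=> /(ordp_gt0 HO pp Oa a0)/(key a Ha a0); rewrite va.
have w_ge0 a : alg_by z a -> 0 <= w a.
  by move=> Ha; apply: (ordp_ge0 HO pp); apply: (alg_loc LO) Ha; case: zO.
have cw' : curve_at O' w.
  split=> //.
    move=> a O'a; have [b [c [Hb Hc uc ->]]] := gen_frac LO' gO' O'a.
    have [c0 _ _] := uc; have [->|b0] := eqVneq b 0; first by rewrite mul0r (nval0 nw).
    by rewrite (nval_div nw) // (w_alg c Hc c0 (curve_unit Hv uc)) subr0; exact: w_ge0.
  have [b [c [Hb Hc uc xE]]] := gen_frac LO' gO' (max_loc mx); have [c0 _ _] := uc.
  have b0 : b != 0 by apply: contraNneq x0 => b0; rewrite xE b0 mul0r.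
  exists b; split=> //.
    by rewrite -[b](divfK c0) -xE; apply: (maxM LO') => //; case: uc.
  apply: w_alg => //; move: vx; rewrite xE (nval_div nv) // (curve_unit Hv uc) subr0 //.
have [q [qq wq qE]] := curve_prime_elt HO' cw'; have [mq q0 _] := qq.
apply: (curve_eq HO' Hv cw' qq); last by rewrite wq.
have [b [c [Hb Hc uc qbc]]] := gen_frac LO' gO' (max_loc mq); have [c0 _ _] := uc.
have b0 : b != 0 by apply: contraNneq q0 => b0; rewrite qbc b0 mul0r.
rewrite qbc (nval_div nv) // (curve_unit Hv uc) subr0; apply: key => //.
have Ob : O b by apply: (alg_loc LO) Hb; case: zO.
apply/(ordp_gt0 HO pp Ob b0); rewrite -/w.
by move: wq; rewrite qbc (nval_div nw) // (curve_unit cw' uc) subr0 => ->.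
Qed.

Lemma near_divisor O h : pts X O -> h != 0 -> exists2 L : set (K -> int), finite_set L &
  near X O (fun O' => forall v, curve_at O' v -> v h != 0 -> L v).
Proof.
move=> XO h0; have HO := regX XO; have LO := regular_loc HO.
have [s [t Cst]] := reg_coords (regular_reg HO).
have main b : O b -> b != 0 -> exists2 L : set (K -> int), finite_set L &
    near X O (fun O' => forall v, curve_at O' v -> v b != 0 -> L v).
  move=> Ob b0; have [n nb] : exists n, ~ mpow O n b.
    by apply/existsNP => /(cap_mpow HO Cst)/eqP; rewrite (negPf b0).
  elim: n b Ob b0 nb => [//|n IH] b Ob b0 nb.
  have [ub|mb] := unit_or_max LO Ob.
    exists set0; first exact: finite_set0.
    apply: nearW (near_unit X ub) => O' XO' ub' v Hv.
    by rewrite (curve_unit Hv ub') eqxx.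
  have [p pp [b' Ob' bE]] := prime_factor HO mb b0; have [mp p0 _] := pp.
  have b'0 : b' != 0 by apply: contraNneq b0 => z; rewrite bE z mul0r.
  have [|L Lfin LH] := IH b' Ob' b'0.
    by move=> H; apply: nb; rewrite bE mulrC; apply: (mpow_max HO Cst).
  exists (ordp O p |` L); first by rewrite finite_setU; split=> //; exact: finite_set1.
  apply: nearW (near_and (near_prime XO pp) LH) => O' XO' [H1 H2] v Hv.
  have nv : normalized_valuation v by case: Hv.
  have [vb'|vb' _] := eqVneq (v b') 0; last by right; exact: H2.
  by rewrite bE (nvalM nv) // vb' add0r => /(H1 v Hv) ->; left.
have [b [c [Ob Oc c0 hE]]] := regular_frac HO h.
have b0 : b != 0 by apply: contraNneq h0 => b0; rewrite hE b0 mul0r.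
have [L1 fin1 H1] := main b Ob b0; have [L2 fin2 H2] := main c Oc c0.
exists (L1 `|` L2); first by rewrite finite_setU.
apply: nearW (near_and H1 H2) => O' XO' [H1' H2'] v Hv.
have nv : normalized_valuation v by case: Hv.
have [vb|vb _] := eqVneq (v b) 0; last by left; exact: H1'.
have [vc|vc _] := eqVneq (v c) 0; last by right; exact: H2'.
by rewrite hE (nval_div nv) // vb vc subrr.
Qed.

Lemma finite_divisor h : h != 0 ->
  finite_set (fun v => prime_divisor iota X v /\ v h <> 0).
Proof.
move=> h0; pose Q O (L : set (K -> int)) := pts X O -> finite_set L /\
  near X O (fun O' => forall v, curve_at O' v -> v h != 0 -> L v).
have ex O : exists L, Q O L.
  have [XO|nXO] := pselect (pts X O); last by exists set0.
  by have [L fL HL] := near_divisor XO h0; exists L.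
pose f O := projT1 (cid (ex O)); have fP O : Q O (f O) := projT2 (cid (ex O)).
have [L [Lfin LX LH]] := pts_compact (fun O XO => (fP O XO).2).
apply: (sub_finite_set (B := \bigcup_(O in L) f O)).
  move=> v [/prime_divisorP[O XO HO] /eqP vh]; have [O1 LO1 H] := LH O XO.
  by exists O1 => //; exact: H.
by apply: bigcup_finite => // O LO; exact: (fP O (LX _ LO)).1.
Qed.

End Smooth.
End Surfaces.

(** * Valuations pulled back by a comorphism *)

Section Pullbacks.
Variables (R : realType) (K : fieldType) (iota : {rmorphism R[i] -> K}).
Implicit Types (O W V : K -> Prop) (X Y : model K)
  (psi : {rmorphism K -> K}).

Variable eta : two_form K.
Hypothesis eta0 : exists D1 D2, [/\ derivation iota D1, derivation iota D2 &
  form_eval eta D1 D2 != 0].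

(* A field of transcendence degree two is algebraic over the image of any of
   its C-endomorphisms, so no discrete valuation is trivial on this image. *)
Lemma val_comorphism_nontrivial psi (V : K -> int) : trdeg_two iota ->
  over_const iota psi -> normalized_valuation V -> (forall c, V (iota c) = 0) ->
  exists2 a, a != 0 & V (psi a) <> 0.
Proof.
move=> [[u Hu] H3] psic nV Vc; apply: contrapT => triv.
have V0 a : a != 0 -> V (psi a) = 0 by move=> a0; apply: contrapT => H; apply: triv; exists a.
have [x Vx] : exists x, V x = 1 by case: nV.
have x0 : x != 0 by apply: (nval_neq0 nV); rewrite Vx.
pose wd := widen_ord (leqnSn 2).
(* These three elements are algebraically dependent. A relation between them is sorted by powers of
   [x], with coefficients in the image of [psi]. *)
pose w (j : 'I_3) := if unlift ord_max j is Some k then psi (u k) else x.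
apply: (H3 w) => F F0; apply/eqP/negPn/negP => Fn0.
pose rs (m : 'X_{1..3}) : 'X_{1..2} := [multinom m (wd j) | j < 2].
pose c (k : nat) : {mpoly R[i][2]} := \sum_(m <- msupp F | m ord_max == k) F@_m *: 'X_[rs m].
have rs_inj (m m' : 'X_{1..3}) : m ord_max = m' ord_max -> rs m = rs m' -> m = m'.
  move=> E /mnmP E'; apply/mnmP => j; case: (unliftP ord_max j) => [k ->|-> //].
  by have := E' k; rewrite !mnmE; congr (_ = _); congr (fun_of_multinom _ _); apply/val_inj; rewrite /= /bump leqNgt ltn_ord.
have wl : w ord_max = x by rewrite /w unlift_none.
have ww k : w (wd k) = psi (u k).
  rewrite /w (_ : wd k = lift ord_max k) ?liftK //.
  by apply/val_inj; rewrite /= /bump leqNgt ltn_ord.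
have monE (m : 'X_{1..3}) : mmap1 w m = psi (mmap1 u (rs m)) * x ^+ m ord_max.
  rewrite /mmap1 big_ord_recr /= wl; congr (_ * _); rewrite rmorph_prod.
  by apply: eq_bigr => k _; rewrite -/wd ww rmorphXn mnmE.
pose N := (\sum_(m <- msupp F) (m ord_max)).+1%N.
have ltN (m : 'X_{1..3}) : m \in msupp F -> (m ord_max < N)%N.
  by move=> mF; rewrite ltnS (big_rem m) //= leq_addr.
have mc k : mmap iota u (c k) =
    \sum_(m <- msupp F | m ord_max == k) mmap iota u (F@_m *: 'X_[rs m]).
  by apply: (big_morph (mmap iota u)); [exact: mmapD|exact: mmap0].
have FE : mmap iota w F = \sum_(k < N) psi (mmap iota u (c k)) * x ^+ k.
  rewrite [LHS]/mmap big_seq (partition_big (fun m : 'X_{1..3} => inord (m ord_max) : 'I_N) xpredT) //=.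
  apply: eq_bigr => k _; rewrite mc (rmorph_sum psi) mulr_suml.
  rewrite [RHS]big_seq_cond; apply: eq_big => m.
    have [mF|] := boolP (m \in msupp F); rewrite //= -val_eqE /= inordK //; exact: ltN.
  move=> /andP[mF /eqP kE]; rewrite monE mmapZ mmapX rmorphM psic mulrA; congr (_ * _ ^+ _).
  by rewrite -kE inordK //; exact: ltN.
have ck0 : exists k, c k != 0.
  exists (mlead F ord_max); apply/eqP => /(congr1 (fun G : {mpoly R[i][2]} => G@_(rs (mlead F)))).
  rewrite mcoeff0 /c raddf_sum /= (big_rem (mlead F)) ?mlead_supp //= eqxx big_seq_cond big1.
    by rewrite addr0 mcoeffZ mcoeffX eqxx mulr1 => /eqP; rewrite mleadc_eq0 (negPf Fn0).
  move=> m /andP[mF /eqP mE]; rewrite mcoeffZ mcoeffX; case: eqP => [E|_]; last by rewrite mulr0.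
  by move: mF; rewrite (rs_inj _ _ mE E) mem_rem_uniqF ?msupp_uniq.
have VC k : c k != 0 -> psi (mmap iota u (c k)) != 0 /\ V (psi (mmap iota u (c k))) = 0.
  move=> ck; have nz : mmap iota u (c k) != 0 by apply: contraNneq ck => /Hu ->.
  by rewrite fmorph_eq0 nz V0.
(* The nonzero coefficients have value 0 and [x] has value 1, so the lowest term determines the
   value of the sum, which therefore is not zero. *)
have key n k0 : (forall k, (k < k0)%N -> c k = 0) -> c k0 != 0 -> (k0 < n)%N ->
    (\sum_(k < n) psi (mmap iota u (c k)) * x ^+ k) != 0 /\
    V (\sum_(k < n) psi (mmap iota u (c k)) * x ^+ k) = k0%:Z.
  move=> lt0 ck0'; have [p0 Vp] := VC _ ck0'; elim: n => [//|n IH]; rewrite ltnS leq_eqVlt => /orP[/eqP <-|lt].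
    rewrite big_ord_recr big1 /= ?add0r; last first.
      by move=> k _; rewrite lt0 // raddf0 rmorph0 mul0r.
    by rewrite mulf_neq0 ?expf_neq0 // (nvalM nV) ?expf_neq0 // Vp (nvalX nV) // Vx mulr1 add0r.
  have [S0 VS] := IH lt; rewrite big_ord_recr /=; have [cn|cn] := eqVneq (c n) 0.
    by rewrite cn raddf0 rmorph0 mul0r addr0.
  have [pn Vpn] := VC _ cn; set S := \sum_(k < n) _ in S0 VS *; set T := _ * _.
  have T0 : T != 0 by rewrite mulf_neq0 ?expf_neq0.
  have VT : V T = n%:Z by rewrite (nvalM nV) ?expf_neq0 // Vpn (nvalX nV) // Vx mulr1 add0r.
  have ST0 : S + T != 0.
    apply/eqP => E; have E' : T = - S by apply/eqP; rewrite -addr_eq0 addrC E.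
    by have := nvalN nV S; rewrite -E' VT VS; lia.
  split=> //; apply/eqP; rewrite eq_le; apply/andP; split; last first.
    by apply: (nval_ge_add nV) => // _; rewrite ?VS ?VT //; lia.
  rewrite leNgt; apply/negP => gt; have : k0%:Z + 1 <= V S.
    rewrite -[S](addrK T); apply: (nval_ge_add nV); last by rewrite addrK.
      by move=> _; rewrite lezD1.
    by move=> _; rewrite (nvalN nV) VT lezD1 ltz_nat.
  by rewrite VS; lia.
have [k0 ck0' kmin] : exists2 k0, c k0 != 0 & forall k, (k < k0)%N -> c k = 0.
  case: ck0 => k; elim/ltn_ind: k => k IH ck.
  have [H|/existsNP[j /not_implyP[jk /eqP cj]]] := pselect (forall j, (j < k)%N -> c j = 0).
    by exists k.
  exact: IH cj.
have kN : (k0 < N)%N.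
  rewrite ltnNge; apply/negP => Nk; move: ck0'; rewrite /c big_seq_cond big1 ?eqxx // => m /andP[mF /eqP mk].
  by have := ltN m mF; rewrite mk ltnNge Nk.
by have [] := key N k0 kmin ck0' kN; rewrite -FE F0 eqxx.
Qed.

(** The ramification index [e] is the least positive value; division with remainder shows that it
    divides all others. *)
Lemma val_normalize (w : K -> int) : w 0 = 0 ->
  (forall a b, a != 0 -> b != 0 -> w (a * b) = w a + w b) ->
  (forall a b, a != 0 -> b != 0 -> a + b != 0 -> Num.min (w a) (w b) <= w (a + b)) ->
  (exists2 a, a != 0 & w a <> 0) ->
  exists (e : int) (u : K -> int), [/\ 0 < e, normalized_valuation u & forall a, w a = e * u a].
Proof.
move=> w0 wM wmin [a0 a00 wa0].
have w1 : w 1 = 0 by apply: (addrI (w 1)); rewrite addr0 -wM ?oner_neq0 // mulr1.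
have wV a : a != 0 -> w a^-1 = - w a.
  by move=> an0; apply: (addrI (w a)); rewrite -wM ?invr_eq0 // mulfV // w1 subrr.
have wX a n : a != 0 -> w (a ^+ n) = n%:Z * w a.
  move=> an0; elim: n => [|n IH]; first by rewrite expr0 w1 mul0r.
  by rewrite exprS wM ?expf_neq0 // IH; lia.
have [n [[b b0 wb] nmin]] : exists n : nat, (exists2 b, b != 0 & w b = n.+1%:Z) /\
    forall b (k : nat), b != 0 -> w b = k.+1%:Z -> (n <= k)%N.
  have [n [b b0 wb]] : exists n : nat, exists2 b, b != 0 & w b = n.+1%:Z.
    exists `|w a0|.-1; have [gt|le] := ltP 0 (w a0); first by exists a0 => //; lia.
    by exists a0^-1; rewrite ?invr_eq0 // wV //; lia.
  elim/ltn_ind: n b b0 wb => n IH b b0 wb.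
  have [H|/existsNP[b' /existsNP[k /not_implyP[b'0 /not_implyP[wb' /negP]]]]] :=
    pselect (forall b (k : nat), b != 0 -> w b = k.+1%:Z -> (n <= k)%N).
    by exists n; split=> //; exists b.
  by rewrite -ltnNge => kn; exact: (IH k kn b' b'0 wb').
have dvd a : exists q : int, w a = n.+1%:Z * q.
  have [->|an0] := eqVneq a 0; first by exists 0; rewrite w0 mulr0.
  have posq a' : a' != 0 -> 0 <= w a' -> exists q : int, w a' = n.+1%:Z * q.
    move=> a'0 wa'; pose q := (`|w a'| %/ n.+1)%N; pose r := (`|w a'| %% n.+1)%N.
    have E : w a' = (q * n.+1 + r)%N%:Z by rewrite -divn_eq; lia.
    have wr : w (a' / b ^+ q) = r%:Z.
      by rewrite wM ?invr_eq0 ?expf_neq0 // wV ?expf_neq0 // wX // wb E; lia.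
    exists q%:Z; have rlt : (r < n.+1)%N by rewrite ltn_mod.
    case: (r) wr rlt E => [|r'] wr rlt E; first by rewrite E; lia.
    have := nmin (a' / b ^+ q) r' _ wr; rewrite mulf_neq0 ?invr_eq0 ?expf_neq0 // => /(_ isT).
    by move: rlt; clear; lia.
  have [ge|lt] := leP 0 (w a); first exact: posq.
  have [||q E] := posq a^-1; rewrite ?invr_eq0 //; first by rewrite wV //; lia.
  by exists (- q); move: E; rewrite wV //; lia.
pose u a := projT1 (cid (dvd a)); have uE a : w a = n.+1%:Z * u a := projT2 (cid (dvd a)).
have inj (x y : int) : n.+1%:Z * x = n.+1%:Z * y -> x = y by apply: mulfI.
exists n.+1%:Z, u; split=> //; split.
- by apply: inj; rewrite -uE w0 mulr0.
- by move=> x y x0 y0; apply: inj; rewrite mulrDr -!uE wM.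
- move=> x y x0 y0 xy0; have := wmin x y x0 y0 xy0; rewrite !uE -minr_pMr //.
  by rewrite ler_pM2l.
- by exists b; apply: inj; rewrite -uE wb mulr1.
Qed.

End Pullbacks.

(** * Pullbacks of divisors and algebraic stability *)

Section Stability.
Variables (R : realType) (K : fieldType) (iota : {rmorphism R[i] -> K}).
Notation regular := (regular iota).
Notation pts := (pts iota).
Notation smooth := (smooth_surface iota).
Implicit Types (O W : K -> Prop) (X Y : model K) (D : (K -> int) -> int)
  (psi : {rmorphism K -> K}) (u v V : K -> int).

Variable eta : two_form K.
Hypothesis eta0 : exists d1 d2, [/\ derivation iota d1, derivation iota d2 &
  form_eval eta d1 d2 != 0].

Definition loceq O D h := h != 0 /\ forall v, curve_at O v -> v h = D v.

Lemma loceqP X p D h : point iota X p ->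
  local_equation iota X D p h <-> loceq (local_ring iota X p) D h.
Proof. by move=> Hp; split=> -[h0 H]; split=> // v /(curve_atP Hp) /H. Qed.

Lemma curve_const O v c : regular O -> curve_at O v -> v (iota c) = 0.
Proof.
move=> HO Hv; have [->|c0] := eqVneq c 0.
  by rewrite rmorph0; case: Hv => nv _ _; rewrite (nval0 nv).
by apply: (curve_unit Hv); exact: (unit_const (regular_loc HO)).
Qed.

Lemma loceq_uniq O D h h' : regular O -> loceq O D h -> loceq O D h' -> unit_in O (h / h').
Proof.
move=> HO [h0 H] [h'0 H']; apply: (unit_of_curves HO).
  by rewrite mulf_neq0 ?invr_eq0.
by move=> v Hv; have [nv _ _] := Hv; rewrite (nval_div nv) // H // H' // subrr.
Qed.

Definition resolvable Y (psi : K -> K) :=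
  exists G, modification iota Y G /\ holomorphic iota Y G psi.

Section Surface.
Variables (Y : model K) (HY : smooth Y).
Let regY O : pts Y O -> regular O := pts_regular eta0 HY (O := O).

Lemma loceq_exists O D : pts Y O -> divisor iota Y D -> exists h, loceq O D h.
Proof.
move=> YO [/finite_seqP[s sE] _]; have HO := regY YO.
have [h [h0 H]] : exists h, h != 0 /\ forall u, curve_at O u -> u h = if u \in s then D u else 0.
  elim: s {sE} => [|v s [h [h0 H]]].
    exists 1; split=> [|u [nu _ _]]; first exact: oner_neq0.
    by rewrite (nval1 nu).
  have [vs|vs] := boolP (v \in s).
    exists h; split=> // u Hu; rewrite H // inE; case: eqP => //= ->.
    by rewrite vs.
  have [Hv|nv] := pselect (curve_at O v); last first.
    exists h; split=> // u Hu; rewrite H // inE; case: eqP => //= E.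
    by case: nv; rewrite -E.
  have [q [qq vq qE]] := curve_prime_elt HO Hv; have [mq q0 _] := qq.
  exists (q ^ (D v) * h); split=> [|u Hu]; first by rewrite mulf_neq0 ?expfz_neq0.
  have [nu u_ge0 _] := Hu.
  rewrite (nvalM nu) ?expfz_neq0 // (nvalXz nu) // H // inE; case: eqP => [->|ne] /=.
    by rewrite vq (negPf vs) addr0 mulr1.
  rewrite (_ : u q = 0) ?mulr0 ?add0r //; apply/eqP; rewrite eq_le u_ge0 ?andbT; last by case: mq.
  rewrite leNgt; apply/negP => uq; apply: ne.
  by apply: (curve_eq HO Hu Hv qq uq); rewrite vq.
exists h; split=> // u Hu; rewrite H //; case: ifP => // /negP us.
apply/esym; apply: contrapT => Du; apply: us.
by have : [set` s] u by rewrite -sE.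
Qed.

(** Only the finitely many curves in the supports of [D] and of the divisor of [h] matter. For those
    not through [O], either a function regular at [O] has a pole along them, which excludes them
    nearby, or their order is positive on the whole maximal ideal, and separatedness excludes them
    everywhere. *)
Lemma near_loceq O D h : pts Y O -> divisor iota Y D -> loceq O D h ->
  near iota Y O (fun O' => loceq O' D h).
Proof.
move=> YO [Dfin Dprime] [h0 H]; have HO := regY YO.
have := finite_divisor eta0 HY h0 => hfin.
have /finite_seqP[s sE] : finite_set ([set v | D v <> 0] `|`
    (fun v => prime_divisor iota Y v /\ v h <> 0)) by rewrite finite_setU.
have : near iota Y O (fun O' => forall v, v \in s -> curve_at O' v -> curve_at O v).
  apply: near_all => v _; have [Hv|nv] := pselect (curve_at O v); first by exists [::].
  have [[a [Oa va]]|v_ge0] := pselect (exists a, O a /\ v a < 0).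
    apply: nearW (near_mem iota Y Oa) => O' _ O'a Hv'.
    by have := curve_ge0 Hv' O'a; rewrite leNgt va.
  have {}v_ge0 a : O a -> 0 <= v a.
    by move=> Oa; rewrite leNgt; apply/negP => va; apply: v_ge0; exists a.
  exists [::]; split=> // O' YO' _ Hv'; have [nv' v'_ge0 _] := Hv'.
  have vpos a : maxid O a -> a != 0 -> 0 < v a.
    move=> ma a0; rewrite lt_neqAle eq_sym v_ge0 ?andbT; last by case: ma.
    by apply/eqP => va; apply: nv; split=> //; exists a.
  suff E : O = O' by rewrite E.
  apply: (pts_separated YO YO' (W := fun a => 0 <= v a)) => //.
    split=> // a ma; split; first by apply: v_ge0; case: ma.
    have [->|a0] := eqVneq a 0; [by left|right].
    by have := vpos a ma a0; rewrite (nvalV nv') //; lia.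
  move=> a O'a [_ Ha]; have [ua|//] := unit_or_max (regular_loc (regY YO')) O'a.
  have [a0 _ _] := ua; case: Ha => [a0'|]; first by rewrite a0' eqxx in a0.
  by rewrite (nvalV nv') // (curve_unit Hv' ua) oppr0 lexx.
apply: nearW => O' YO' Hs; split=> // v Hv.
have [vs|vs] := boolP (v \in s); first by apply: H; exact: Hs.
have nU : ~ ([set v | D v <> 0] `|` (fun v => prime_divisor iota Y v /\ v h <> 0)) v.
  by rewrite sE /=; exact/negP.
have -> : D v = 0 by apply: contrapT => Dv; apply: nU; left.
apply: contrapT => vh; apply: nU; right; split=> //.
by apply/(prime_divisorP iota); exists O'.
Qed.

Variables (psi : {rmorphism K -> K}) (psic : over_const iota psi).

(** The center of the valuation [a |-> V (psi a)] is either a closed point, unique by separatedness,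
    or a curve [u] with [V (psi a) = e * u a]; in the latter case both local equations have the
    value [e * D u]. *)
Lemma center_value V O O' D h h' : normalized_valuation V -> (forall c, V (iota c) = 0) ->
  pts Y O -> pts Y O' -> (forall a, O a -> 0 <= V (psi a)) -> (forall a, O' a -> 0 <= V (psi a)) ->
  loceq O D h -> loceq O' D h' -> V (psi h) = V (psi h').
Proof.
move=> nV Vc; wlog : O O' h h' / exists a, [/\ maxid O' a, a != 0 & V (psi a) = 0].
  move=> wl YO YO' VO VO' Hh Hh'.
  have [ex'|nex'] := pselect (exists a, [/\ maxid O' a, a != 0 & V (psi a) = 0]).
    exact: (wl O O').
  have [ex|nex] := pselect (exists a, [/\ maxid O a, a != 0 & V (psi a) = 0]).
    by apply/esym; apply: (wl O' O).
  have pos a : maxid O a -> a != 0 -> 0 < V (psi a).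
    move=> ma a0; rewrite lt_neqAle eq_sym VO ?andbT; last by case: ma.
    by apply/eqP => va; apply: nex; exists a.
  have E : O = O'.
    apply: (pts_separated YO YO' (W := fun a => 0 <= V (psi a))) => //.
      split=> // a ma; split; first by apply: VO; case: ma.
      have [->|a0] := eqVneq a 0; [by left|right].
      by rewrite fmorphV (nvalV nV) ?fmorph_eq0 // oppr_ge0 leNgt (pos a ma a0).
    move=> a O'a [_ Ha]; have [ua|//] := unit_or_max (regular_loc (regY YO')) O'a.
    have [a0 _ Oi] := ua; case: Ha => [a0'|]; first by rewrite a0' eqxx in a0.
    by case; exact: VO'.
  rewrite -E in Hh'; have [u0 Ou Oi] := loceq_uniq (regY YO) Hh Hh'.
  have [h0 _] := Hh; have [h'0 _] := Hh'.
  have pu0 : psi (h / h') != 0 by rewrite fmorph_eq0.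
  have : V (psi (h / h')) = 0.
    apply/eqP; rewrite eq_le (VO _ Ou) andbT -oppr_ge0 -(nvalV nV) //.
    by rewrite -fmorphV; exact: VO.
  by rewrite fmorph_div (nval_div nV) ?fmorph_eq0 // => /eqP; rewrite subr_eq0 => /eqP.
move=> [a [ma a0 Va]] YO YO' VO VO' Hh Hh'.
have [h0 Hh1] := Hh; have [h'0 Hh'1] := Hh'.
have [_ Htr _] := HY.
have [e [u [e0 nu wE]]] : exists (e : int) u, [/\ 0 < e, normalized_valuation u & forall a, V (psi a) = e * u a].
  apply: val_normalize.
  - by rewrite rmorph0 (nval0 nV).
  - by move=> x y x0 y0; rewrite rmorphM (nvalM nV) ?fmorph_eq0.
  - move=> x y x0 y0 xy0; rewrite rmorphD; case: nV => _ _ H _.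
    by apply: H; rewrite -?rmorphD ?fmorph_eq0.
  - exact: (val_comorphism_nontrivial Htr psic nV Vc).
have pos b : 0 <= V (psi b) -> 0 <= u b by rewrite wE pmulr_rge0.
have Hu' : curve_at O' u.
  split=> //; first by move=> b /VO' /pos.
  by exists a; split=> //; apply/eqP; move/eqP: Va; rewrite wE mulf_eq0 gt_eqF.
have Hu : curve_at O u.
  apply: contrapT => nu'.
  have posO b : maxid O b -> b != 0 -> 0 < u b.
    move=> mb b0; rewrite lt_neqAle eq_sym (pos _ (VO _ (max_loc mb))) andbT.
    apply/eqP => ub; apply: nu'; split=> //; first by move=> c /VO /pos.
    by exists b.
  have E : O = O'.
    apply: (pts_separated YO YO' (W := fun a => 0 <= u a)).
    - split=> b mb; first exact: (pos _ (VO _ mb)).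
      split; first exact: (pos _ (VO _ (max_loc mb))).
      have [->|b0] := eqVneq b 0; [by left|right].
      by have := posO b mb b0; rewrite (nvalV nu) //; lia.
    - by move=> b /VO' /pos.
    - move=> b O'b [_ Hb]; have [ub|//] := unit_or_max (regular_loc (regY YO')) O'b.
      have [b0 _ _] := ub; case: Hb => [b0'|]; first by rewrite b0' eqxx in b0.
      by rewrite (nvalV nu) // (curve_unit Hu' ub) oppr0 lexx.
  by apply: nu'; rewrite E.
by rewrite !wE Hh1 // Hh'1.
Qed.

Hypothesis res_psi : resolvable Y psi.

Lemma resolution_spec : modification iota Y (resolution iota Y psi) /\
  holomorphic iota Y (resolution iota Y psi) psi.
Proof. exact: (epsilon_spec (inhabits Y) _ res_psi). Qed.

Lemma center_of_curve V : prime_divisor iota Y V ->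
  exists2 O, pts Y O & forall a, O a -> 0 <= V (psi a).
Proof.
have [mG hG] := resolution_spec.
move=> /(modification_curves eta0 HY mG) /prime_divisorP[W [q Hq ->] HV].
have [p [_ Hp H1 _]] := hG q Hq; exists (local_ring iota Y p); first by exists p.
by move=> a /H1; case: HV => _ H _ /H.
Qed.

(** The chosen resolution only provides one point whose local equation computes the multiplicity; by
    [center_value], every other point containing the center gives the same value. Pullbacks are thus
    computed without reference to a resolution. *)
Lemma rat_pullbackE V O D h : (forall O', pts Y O' -> exists h', loceq O' D h') ->
  prime_divisor iota Y V -> pts Y O -> (forall a, O a -> 0 <= V (psi a)) -> loceq O D h ->
  rat_pullback iota Y psi D V = V (psi h).
Proof.
move=> HD HV YO VO Hh; have [mG hG] := resolution_spec.
have HG := modification_smooth eta0 HY mG.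
have GV := modification_curves eta0 HY mG HV.
have [nV Vc] : normalized_valuation V /\ forall c, V (iota c) = 0.
  have [O1 /regY HO1 HV1] := (prime_divisorP iota _ _).1 HV.
  by split=> [|c]; [case: HV1|exact: (curve_const _ HO1 HV1)].
rewrite /rat_pullback /pushforward (asboolT HV) /pullback (asboolT GV).
set P := pullback_mult _ _ _ _ _ _.
have /(epsilon_spec (inhabits 0)) : exists m, P m.
  have [q Hq] := GV; have [Hq' _ _ _] := Hq; have [p Hp] := hG q Hq'; have [_ Hp' _ _] := Hp.
  have [h' Hh'] := HD (local_ring iota Y p) (ex_intro2 _ _ p Hp' erefl).
  by exists (V (psi h')), q, p, h'; split=> //; exact/(loceqP _ _ Hp').
move=> [q [p [h' [Hq [Hq' Hp H1 H2] /(loceqP _ _ Hp) Hh' ->]]]].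
apply: (center_value nV Vc (O' := O) (O := local_ring iota Y p) (D := D)) => //; first by exists p.
by move=> a /H1; case: Hq => _ _ H _ /H.
Qed.

Lemma rat_pullback_divisor D : divisor iota Y D -> divisor iota Y (rat_pullback iota Y psi D).
Proof.
move=> HD; have HL O : pts Y O -> exists h, loceq O D h := fun YO => loceq_exists YO HD.
have nprime v : rat_pullback iota Y psi D v <> 0 -> prime_divisor iota Y v.
  by rewrite /rat_pullback /pushforward; case: asboolP.
split=> //; pose h O := epsilon (inhabits 0) (loceq O D).
have hP O : pts Y O -> loceq O D (h O).
  by move=> /HL; exact: (epsilon_spec (inhabits 0)).
have [L [Lfin LY LH]] := pts_compact (fun O YO => near_loceq YO HD (hP O YO)).
apply: (sub_finite_set (B := \bigcup_(O in L) (fun v => prime_divisor iota Y v /\ v (psi (h O)) <> 0))).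
  move=> v Hv; have pv := nprime v Hv; have [O YO vO] := center_of_curve pv.
  have [O1 LO1 HO1] := LH O YO; exists O1 => //; split=> //.
  by rewrite -(rat_pullbackE HL pv YO vO HO1).
apply: bigcup_finite => // O LO; apply: (finite_divisor eta0 HY).
by rewrite fmorph_eq0; case: (hP O (LY _ LO)).
Qed.
End Surface.

Lemma iter_comorphism (phi : {rmorphism K -> K}) n : over_const iota phi ->
  exists2 psi : {rmorphism K -> K}, over_const iota psi & psi = iter n phi :> (K -> K).
Proof.
move=> Hc; elim: n => [|n [psi psic E]]; first by exists idfun.
exists (phi \o psi : {rmorphism K -> K}); first by move=> c /=; rewrite psic Hc.
by apply/funext => x /=; rewrite E.
Qed.

(* If the images of the contracted curves never meet an indeterminacy point,
   then the pullback of divisors by the iterates is the iterated pullback. *)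
Theorem stable_criterion Y (phi : {rmorphism K -> K}) (Z : set (set K)) : smooth Y ->
  over_const iota phi -> (forall psi, over_const iota psi -> resolvable Y psi) ->
  (forall V O, prime_divisor iota Y V -> pts Y O -> (forall a, O a -> 0 <= V (phi a)) ->
    (forall a, maxid O a -> a != 0 -> 0 < V (phi a)) -> Z O) ->
  (forall O, Z O -> exists O', [/\ Z O', pts Y O' & local_hom phi O' O]) ->
  algebraically_stable iota Y phi.
Proof.
move=> HY phic Hres Zland Zreg.
have regn psi n O : psi = iter n phi :> (K -> K) -> pts Y O -> Z O ->
    exists2 O', pts Y O' & local_hom psi O' O.
  move=> E YO ZO; suff [O' [YO' ZO' [H1 H2]]] : exists O', [/\ pts Y O', Z O' &
      (forall a, O' a -> O (iter n phi a)) /\ (forall a, maxid O' a -> maxid O (iter n phi a))].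
    by exists O' => //; split=> a; rewrite E; [exact: H1|exact: H2].
  elim: n {E} => [|n [O' [YO' ZO' [H1 H2]]]]; first by exists O.
  have [O'' [ZO'' YO'' [H3 H4]]] := Zreg O' ZO'; exists O''; split=> //.
  by split=> a; rewrite iterSr; [move=> /H3/H1|move=> /H4/H2].
suff main n D : divisor iota Y D -> forall V, prime_divisor iota Y V ->
    rat_pullback iota Y (iter n phi) D V = iter n (rat_pullback iota Y phi) D V.
  move=> n D HD; exists 1; first exact: oner_neq0.
  move=> V HV; rewrite main // subrr; case: ((prime_divisorP iota _ _).1 HV) => O _ [nV _ _].
  by rewrite (nval1 nV).
move=> HD.
have HL O : pts Y O -> exists h, loceq O D h := fun YO => loceq_exists HY YO HD.
have divn k : divisor iota Y (iter k (rat_pullback iota Y phi) D).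
  by elim: k => //= k IH; exact: (rat_pullback_divisor HY phic (Hres _ phic) IH).
elim: n => [|n IH] V HV.
  have [O YO HO] := (prime_divisorP iota _ _).1 HV; have [h Hh] := HL O YO.
  have := rat_pullbackE HY (psi := idfun) (over_const_id iota) (Hres _ (over_const_id iota)) HL HV YO _ Hh.
  by move=> /= ->; [case: Hh => _ ->|move=> a; case: HO => _ H _ /H].
set Dn := iter n (rat_pullback iota Y phi) D in IH *.
have [psi psic psiE] := iter_comorphism n phic.
have [psi' psi'c psi'E] := iter_comorphism n.+1 phic.
have psiS a : psi' a = phi (psi a) by rewrite psi'E psiE.
rewrite [RHS]/= -/Dn -psi'E.
have HLn O : pts Y O -> exists h, loceq O Dn h := fun YO => loceq_exists HY YO (divn n).
have [O YO VO] := center_of_curve HY (Hres _ phic) HV.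
have [nV Vc] : normalized_valuation V /\ forall c, V (iota c) = 0.
  have [O1 /(pts_regular eta0 HY) HO1 HV1] := (prime_divisorP iota _ _).1 HV.
  by split=> [|c]; [case: HV1|exact: (curve_const _ HO1 HV1)].
have pE u O' h : prime_divisor iota Y u -> pts Y O' -> (forall a, O' a -> 0 <= u (psi a)) ->
    loceq O' D h -> u (psi h) = Dn u.
  by move=> Hu YO' uO' Hh; rewrite -IH // -psiE (rat_pullbackE HY psic (Hres _ psic) HL Hu YO' uO' Hh).
have [h Hh] := HLn O YO.
rewrite (rat_pullbackE HY phic (Hres _ phic) HLn HV YO VO Hh).
(* Either [V] is mapped onto a curve [u] through [O], along which the induction hypothesis applies,
   or it is contracted to [O]. In the second case [O] is in [Z], so the iterate is regular there and
   pulls a local equation of [D] back to one of [Dn]. *)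
have [[a [ma a0 Va]]|contr] := pselect (exists a, [/\ maxid O a, a != 0 & V (phi a) = 0]); last first.
  have ZO : Z O.
    apply: (Zland V) => // a ma a0; rewrite lt_neqAle eq_sym VO ?andbT; last by case: ma.
    by apply/eqP => Va; apply: contr; exists a.
  have [O' YO' [H1 H2]] := regn psi n O psiE YO ZO; have [h' Hh'] := HL O' YO'.
  have [h'0 _] := Hh'.
  have Hh'' : loceq O Dn (psi h').
    split=> [|u Hu]; first by rewrite fmorph_eq0.
    apply: (pE u O') => //; first by apply/prime_divisorP; exists O.
    by move=> a /H1; case: Hu => _ H _ /H.
  rewrite (rat_pullbackE HY psi'c (Hres _ psi'c) HL HV YO' _ Hh'); last first.
    by move=> a /H1 /VO; rewrite psiS.
  rewrite psiS; exact: (center_value HY phic nV Vc YO YO VO VO Hh'' Hh).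
have [_ Htr _] := HY.
have [e [u [e0 nu wE]]] : exists (e : int) u, [/\ 0 < e, normalized_valuation u & forall a, V (phi a) = e * u a].
  apply: val_normalize.
  - by rewrite rmorph0 (nval0 nV).
  - by move=> x y x0 y0; rewrite rmorphM (nvalM nV) ?fmorph_eq0.
  - move=> x y x0 y0 xy0; rewrite rmorphD; case: nV => _ _ H _.
    by apply: H; rewrite -?rmorphD ?fmorph_eq0.
  - exact: (val_comorphism_nontrivial Htr phic nV Vc).
have Hu : curve_at O u.
  split=> //; first by move=> b /VO; rewrite wE pmulr_rge0.
  by exists a; split=> //; apply/eqP; move/eqP: Va; rewrite wE mulf_eq0 gt_eqF.
have pu : prime_divisor iota Y u by apply/prime_divisorP; exists O.
have [O' YO' uO'] := center_of_curve HY (Hres _ psic) pu; have [h' Hh'] := HL O' YO'.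
rewrite (rat_pullbackE HY psi'c (Hres _ psi'c) HL HV YO' _ Hh'); last first.
  by move=> b /uO'; rewrite psiS wE pmulr_rge0.
rewrite psiS !wE (pE u O' h' pu YO' uO' Hh'); case: Hh => _ ->//.
Qed.

End Stability.

(** * Resolution of indeterminacies *)

Section Resolution.
Variables (R : realType) (K : fieldType) (iota : {rmorphism R[i] -> K}).
Notation locring := (locring iota).
Notation regular := (regular iota).
Implicit Types (O W : K -> Prop) (X Y : model K) (l : seq K).

(* The rational map with homogeneous coordinates [l] is defined at [O]. *)
Definition defined_at l O := exists2 a, a \in l & a != 0 /\ forall b, b \in l -> O (b / a).

(** The inductive predicate expresses termination: along every branch, the blowing up of points
    where the map is undefined stops. *)
Inductive resolved l O : Prop :=
  Resolved of ~ defined_at l O -> forall W, quad O W -> regular W -> resolved l W.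

Lemma lspan_div O l c a : O 0 -> c != 0 ->
  lspan O [seq b / c | b <- l] (a / c) <-> lspan O l a.
Proof.
move=> O0 c0; elim: l a => [|b l IH] a /=.
  split=> [/eqP|->]; last by rewrite mul0r.
  by rewrite mulf_eq0 invr_eq0 (negPf c0) orbF => /eqP.
split=> [[x [y [Ox ly E]]]|[x [y [Ox ly ->]]]].
  exists x, (y * c); split=> //; first by apply/IH; rewrite mulfK.
  by apply: (mulIf (invr_neq0 c0)); rewrite E mulrDl mulfK // mulrA.
by exists x, (y / c); split=> //; [exact/IH|rewrite mulrDl mulrA].
Qed.

Lemma lspan_ideal O l : locring O -> (forall b, b \in l -> O b) -> ideal O (lspan O l).
Proof.
move=> LO lO; have OD : forall a b, O a -> O b -> O (a + b) by move=> *; inO LO.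
have OM : forall a b, O a -> O b -> O (a * b) by move=> *; inO LO.
split.
- by apply: lspan_sub => //; split; [inO LO|].
- by apply: lspan0; inO LO.
- by move=> a b; exact: lspanD.
- by move=> a b; exact: lspanZ.
Qed.

(* Dividing [l] by a common factor of maximal order. *)
Lemma primary_normalization O l : regular O -> (exists2 a, a \in l & a != 0) ->
  exists c, [/\ c != 0, forall b, b \in l -> O (b / c) &
    forall x, maxid O x -> exists e, lspan O [seq b / c | b <- l] (x ^+ e)].
Proof.
move=> HO [a la a0]; have LO := regular_loc HO.
have [s [t Cst]] := reg_coords (regular_reg HO).
have [c [c0 ci cO]] : exists c, [/\ c != 0, O c^-1 & forall b, b \in l -> O (b / c)].
  elim: (l) => [|b l' [c [c0 ci H]]].
    by exists 1; split=> //; [exact: oner_neq0|rewrite invr1; inO LO].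
  have [x [y [Ox Oy y0 ->]]] := regular_frac HO b.
  exists (c / y); split; first by rewrite mulf_neq0 ?invr_eq0.
    by rewrite invf_div; inO LO.
  move=> d; rewrite inE => /orP[/eqP ->|/H Od].
    have -> : x / y / (c / y) = x / c by field; rewrite c0 y0.
    by inO LO.
  have -> : d / (c / y) = (d / c) * y by field; rewrite c0 y0.
  by inO LO.
have [n na] : exists n, ~ mpow O n (a / c).
  apply/existsNP => /(cap_mpow HO Cst)/eqP.
  by rewrite mulf_eq0 invr_eq0 (negPf a0) (negPf c0).
elim: n c c0 {ci} cO na => [|n IH] c c0 cO na; first by case: na; exact: cO.
pose J := lspan O [seq b / c | b <- l].
have lcO x : x \in [seq b / c | b <- l] -> O x by move=> /mapP[b lb ->]; exact: cO.
have HJ : ideal O J := lspan_ideal LO lcO.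
have inJ b : b \in l -> J (b / c).
  by move=> lb; apply: lspan_mem; [inO LO|inO LO|apply/mapP; exists b].
have ac0 : a / c != 0 by rewrite mulf_neq0 ?invr_eq0.
have [H|/existsNP[x /not_implyP[mx /forallNP nx]]] :=
  pselect (forall x, maxid O x -> exists e, J (x ^+ e)); first by exists c.
have [p pp pJ] := prime_elt_exists HO HJ mx nx (inJ a la) ac0; have [mp p0 _] := pp.
have quot b : b \in l -> exists2 d, O d & b / (c * p) = d /\ b / c = d * p.
  move=> /inJ /pJ[d Od E]; exists d => //; split=> //.
  by rewrite invfM mulrA E mulfK.
apply: (IH (c * p)); first by rewrite mulf_neq0.
  by move=> b /quot[d Od [-> _]].
have [d Od [-> E]] := quot a la; move=> Hd; apply: na; rewrite E mulrC.
exact: (mpow_max HO Cst).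
Qed.

(** Modulo [s], the left-hand side has order at most [j] in [t / s], since a unit coefficient of [G]
    occurs at or before [j], whereas the right-hand side has order at least [j.+1]. *)
Lemma poly_transversal O s t (G : {poly K}) j y w : regular O -> coords O s t ->
  regular (QT O s t) -> poly_in O G -> unit_in O G`_j ->
  QT O s t y -> QT O s t w -> G.[t / s] = y * (t / s) ^+ j.+1 + s * w -> False.
Proof.
move=> HO Cst HW HG uj Wy Ww E; have LO := regular_loc HO; have LW := regular_loc HW.
have [OW mW] := QT_dominates HO Cst; have CW := QT_coords HO Cst.
have s0 := coord_neq0 HO Cst; set u := t / s in E Wy Ww CW *; set W := QT O s t in Wy Ww CW *.
have [mu Wu] : maxid W u /\ W u by case: CW => _ [? ?].
have [i [ui lei Hi]] : exists i, [/\ unit_in O G`_i, (i <= j)%N &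
    forall k, (k < i)%N -> maxid O G`_k].
  elim/ltn_ind: j uj {E} => j IH uj.
  have [H|/existsNP[k /not_implyP[kj nk]]] := pselect (forall k, (k < j)%N -> maxid O G`_k).
    by exists j.
  have [i [ui le Hi]] := IH k kj (unitP LO (HG k) nk).
  by exists i; split=> //; apply: leq_trans le (ltnW kj).
have HT : poly_in (maxid O) (take_poly i G).
  move=> k; rewrite coef_take_poly; case: ifP => [/Hi //|_]; exact: max0 LO.
have HD : poly_in O (drop_poly i G) by move=> k; rewrite coef_drop_poly.
have [w' Ww' TE] : exists2 w', W w' & (take_poly i G).[u] = s * w'.
  have maxs a : maxid O a -> exists2 b, W b & a = s * b.
    move=> ma; have [_ _ /(_ _ ma)[b [c [/OW Wb /OW Wc ->]]]] := Cst.
    by exists (b + c * u); [inO LW|rewrite /u; field].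
  rewrite horner_coef; apply: (big_ind (fun x => exists2 w', W w' & x = s * w')) => [|a b [a' Wa ->] [b' Wb ->]|k _].
  - by exists 0; [inO LW|rewrite mulr0].
  - by exists (a' + b'); [inO LW|rewrite mulrDr].
  - have [b Wb ->] := maxs _ (HT k).
    by exists (b * u ^+ k); [inO LW|rewrite mulrA].
have uD : unit_in W (drop_poly i G).[u].
  have WD : W _ := QT_poly HO s t HD.
  apply: (unitP LW WD) => /(maxQT_poly HO Cst HD); rewrite coef_drop_poly add0n.
  exact: unit_nmax.
have WD := unit_loc uD.
have ud : unit_in W ((drop_poly i G).[u] - y * u ^+ (j.+1 - i)).
  apply: (unitDmax LW uD); apply: (maxN LW); apply: (maxMl LW) => //.
  by apply: (max_exp LW) => //; rewrite subn_gt0 ltnS.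
apply: (unit_nmax ud).
apply: (coord_power_ndvd HW (coordsC CW) (n := i) (b := w - w')).
- by case: ud.
- by inO LW.
rewrite -[G in LHS](poly_take_drop i) hornerD hornerM hornerXn TE in E.
have e : u ^+ j.+1 = u ^+ i * u ^+ (j.+1 - i) by rewrite -exprD subnKC // (leq_trans lei).
rewrite e in E; rewrite mulrBr mulrBr.
have -> : s * w = s * w' + (drop_poly i G).[u] * u ^+ i - y * (u ^+ i * u ^+ (j.+1 - i)).
  by rewrite E; ring.
ring.
Qed.

Section Local.
Variable l : seq K.

Lemma defined_unit O c b1 : locring O -> c != 0 -> (forall b, b \in l -> O (b / c)) ->
  b1 \in l -> unit_in O (b1 / c) -> defined_at l O.
Proof.
move=> LO c0 cO lb1 u1; have [/[!mulf_eq0] + _ _] := u1; rewrite invr_eq0 (negPf c0) orbF => b10.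
exists b1 => //; split=> // b lb.
have -> : b / b1 = (b / c) * (b1 / c)^-1 by field; rewrite c0 b10.
by have := cO b lb => ?; inO LO.
Qed.

Lemma resolved_defined O : defined_at l O -> resolved l O.
Proof. by move=> D; constructor. Qed.

(* If the order of the ideal does not drop at an infinitely near point, then
   that point is on the strict transform of [b1 / c] and the exponent [e]
   drops. *)
Lemma resolved_exponent n b1 : b1 \in l ->
  (forall O c, regular O -> c != 0 -> (forall b, b \in l -> O (b / c)) ->
    (exists2 b, b \in l & ~ mpow O n.+1 (b / c)) -> resolved l O) ->
  forall e O c s t a y, regular O -> coords O s t -> c != 0 ->
    (forall b, b \in l -> mpow O n.+1 (b / c)) -> unit_in O a -> mpow O n y ->
    b1 / c = a * t ^+ n.+1 + s * y -> lspan O [seq b / c | b <- l] (s ^+ e) ->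
  resolved l O.
Proof.
move=> lb1 IHn; elim/ltn_ind => e IHe O c s t a y HO Cst c0 mc ua my E Je.
have LO := regular_loc HO; have Cts := coordsC Cst; have [Os Ot] : O s /\ O t.
  by have [[? _] [? _] _] := Cst.
have s0 := coord_neq0 HO Cst; have t0 := coord_neq0 HO Cts.
have len : (n.+1 <= e)%N.
  have : mpow O n.+1 (s ^+ e).
    apply: (@lspan_sub _ O (mpow O n.+1) [seq b / c | b <- l]) => //.
    - by split=> [|x z]; [exact: (mpow0 HO)|exact: (mpowD HO Cst)].
    - by move=> x z; exact: (mpowZ HO).
    - by move=> x /mapP[b lb ->]; exact: mc.
  move=> /(ordm_ge HO _ (loc_exp LO e Os) (expf_neq0 e s0)).
  by rewrite (nvalX (ordm_normalized HO)) // (ordm_coord HO Cst) mulr1.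
constructor=> _ W qW HW; have LW := regular_loc HW.
case: (quad_direction HO qW Cst) => [[la WE]|WE]; last first.
  (* In this direction [b1 / (c * t ^+ n.+1)] becomes a unit, so the map is defined. *)
  subst W; set W := QT O t s in qW HW LW.
  have [OW mW] := QT_dominates HO Cts; have mu := QT_ratio_max HO Cts.
  have divW k b : mpow O k b -> W (b / t ^+ k).
    move=> /(mpow_polyP HO Cts)[P [HP _ ->]]; rewrite mulrC mulKf ?expf_neq0 //.
    exact: (QT_poly HO).
  have c'0 : c * t ^+ n.+1 != 0 by rewrite mulf_neq0 ?expf_neq0.
  apply: resolved_defined; apply: (defined_unit LW c'0 _ lb1) => [b lb|].
    by rewrite invfM mulrA; apply: divW; apply: mc.
  rewrite invfM mulrA E.
  have -> : (a * t ^+ n.+1 + s * y) / t ^+ n.+1 = a + (s / t) * (y / t ^+ n).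
    by rewrite exprS; field; rewrite t0 expf_neq0.
  apply: (unitDmax LW); last by apply: (maxM LW mu); exact: (divW _ _ my).
  by case: ua => a0 Oa Oai; split=> //; exact: OW.
have {}Cst := coords_shift HO la Cst; set t' := t - iota la * s in Cst WE.
subst W; set W := QT O s t' in qW HW LW *; set u := t' / s.
have [OW mW] := QT_dominates HO Cst; have CW : coords W s u := QT_coords HO Cst.
have divW k b : mpow O k b -> exists B, [/\ poly_in O B, (size B <= k.+1)%N & b / s ^+ k = B.[u]].
  move=> /(mpow_polyP HO Cst)[P [HP sP ->]]; exists P; split=> //.
  by rewrite mulrC mulKf ?expf_neq0.
have c'0 : c * s ^+ n.+1 != 0 by rewrite mulf_neq0 ?expf_neq0.
have c'W b : b \in l -> W (b / (c * s ^+ n.+1)).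
  by move=> /mc/divW[B [HB _ HE]]; rewrite invfM mulrA HE; exact: (QT_poly HO).
have [H|H] := pselect (exists2 b, b \in l & ~ mpow W n.+1 (b / (c * s ^+ n.+1))).
  exact: (IHn W _ HW c'0 c'W H).
have c'm b : b \in l -> mpow W n.+1 (b / (c * s ^+ n.+1)).
  by move=> lb; apply: contrapT => nb; apply: H; exists b.
have [B [HB sB BE]] := divW _ _ my.
have GE : b1 / (c * s ^+ n.+1) = (a%:P * ('X + (iota la)%:P) ^+ n.+1 + B).[u].
  rewrite invfM mulrA E !(hornerD, hornerM, hornerC, hornerX, horner_exp) -BE.
  have -> : u + iota la = t / s by rewrite /u /t'; field.
  by rewrite expr_div_n (exprS s); field; rewrite s0 expf_neq0.
have [al [be [Wal mbe abE]]] : exists al be, [/\ W al, mpow W n be &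
    b1 / (c * s ^+ n.+1) = al * u ^+ n.+1 + s * be].
  have [d Wd ->] := mpow_hform HW CW (c'm _ lb1).
  exists (d n.+1), (hform s u n d); split=> //; first exact: (hform_mpow HW CW).
  rewrite /hform big_ord_recr /= subnn expr0 mulr1 addrC; congr (_ + _).
  rewrite mulr_sumr; apply: eq_bigr => i _.
  by rewrite subSn -1?ltnS // exprS; ring.
have Wu : W u by case: CW => _ [].
have Ws : W s by exact: OW.
(* Otherwise [b1 / (c * s ^+ n.+1)] would have order greater than [n.+1] in [u] modulo [s], although
   it is a polynomial in [u] whose coefficient of degree [n.+1] is the unit [a]. *)
have ual : unit_in W al.
  apply: (unitP LW Wal) => mal; have [_ _ /(_ _ mal)[x [z [Wx Wz alE]]]] := CW.
  pose G := a%:P * ('X + (iota la)%:P) ^+ n.+1 + B.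
  have Oa := unit_loc ua.
  have HG : poly_in O G.
    apply: (poly_inD LO) => //; apply: (poly_inM LO); first exact: (poly_inC LO).
    apply: (poly_in_exp LO); apply: (poly_inD LO); first exact: (poly_inX LO).
    by apply: (poly_inC LO); inO LO.
  have Gm : G`_n.+1 = a.
    rewrite coefD coefCM [B`__]nth_default // addr0.
    have : ('X + (iota la)%:P) ^+ n.+1 \is monic by rewrite monic_exp // monicXaddC.
    move/monicP; rewrite lead_coefE size_exp size_XaddC mul1n => ->; exact: mulr1.
  apply: (@poly_transversal O s t' G n.+1 z (be + x * u ^+ n.+1)) => //.
  - by rewrite Gm.
  - by have := mpow_loc HW mbe => ?; inO LW.
  - by rewrite -/u -/G -GE abE alE (exprS u n.+1); ring.
(* The power of [s] in the ideal gets divided by the new common factor [s ^+ n.+1]. *)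
apply: (IHe (e - n.+1)%N _ W (c * s ^+ n.+1) s u al be) => //; first by rewrite ltn_subrL (leq_trans _ len).
have {}Je : lspan W [seq b / c | b <- l] (s ^+ e).
  elim: (l) (s ^+ e) Je => //= b l' IH x [z [r [Oz lr ->]]].
  by exists z, r; split=> //; [exact: OW|exact: IH].
have W0 : W 0 by inO LW.
have /(lspan_div _ _ W0 (expf_neq0 n.+1 s0)) := Je; rewrite -map_comp.
have -> : s ^+ e / s ^+ n.+1 = s ^+ (e - n.+1) by rewrite -{1}(subnK len) exprD mulfK ?expf_neq0.
by congr (lspan _ _ _); apply: eq_map => b /=; rewrite invfM mulrA.
Qed.

(** Induction on the order of the ideal. Dividing by a common prime factor lowers it; without such a
    factor the ideal contains powers of the coordinates, and [resolved_exponent] applies. *)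
Lemma resolved_order m O c : regular O -> c != 0 -> (forall b, b \in l -> O (b / c)) ->
  (exists2 b, b \in l & ~ mpow O m.+1 (b / c)) -> resolved l O.
Proof.
elim: m O c => [|n IHn] O c HO c0 cO [b1 lb1 nb1]; have LO := regular_loc HO.
  apply: resolved_defined; apply: (defined_unit LO c0 cO lb1).
  by apply: (unitP LO) => [|/(mpow1 HO)]; [exact: cO|].
have [H|H] := pselect (exists2 b, b \in l & ~ mpow O n.+1 (b / c)).
  exact: (IHn _ _ HO c0 cO H).
have mc b : b \in l -> mpow O n.+1 (b / c).
  by move=> lb; apply: contrapT => nb; apply: H; exists b.
have b10 : b1 / c != 0.
  by apply/eqP => b10; apply: nb1; rewrite b10; exact: (mpow0 HO).
have [s [t [a [y [Cst ua my E]]]]] := tangent_form HO (mc _ lb1) nb1.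
have lcO x : x \in [seq b / c | b <- l] -> O x by move=> /mapP[b lb ->]; exact: cO.
have HJ := lspan_ideal LO lcO.
have inJ b : b \in l -> lspan O [seq b / c | b <- l] (b / c).
  by move=> lb; apply: lspan_mem; [inO LO|inO LO|apply/mapP; exists b].
have [K1|/existsNP[x /not_implyP[mx /forallNP nx]]] :=
  pselect (forall x, maxid O x -> exists e, lspan O [seq b / c | b <- l] (x ^+ e)).
  have [ms _ _] := Cst; have [e Je] := K1 s ms.
  exact: (resolved_exponent lb1 IHn HO Cst c0 mc ua my E Je).
have [p pp pJ] := prime_elt_exists HO HJ mx nx (inJ _ lb1) b10; have [mp p0 _] := pp.
have quot b : b \in l -> exists2 d, O d & b / (c * p) = d /\ b / c = d * p.
  move=> /inJ /pJ[d Od dE]; exists d => //; split=> //.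
  by rewrite invfM mulrA dE mulfK.
apply: (IHn _ (c * p) HO); first by rewrite mulf_neq0.
  by move=> b /quot[d Od [-> _]].
exists b1 => //; have [d Od [-> dE]] := quot _ lb1; move=> Hd; apply: nb1; rewrite dE mulrC.
have [s' [t' Cst']] := reg_coords (regular_reg HO).
exact: (mpow_max HO Cst').
Qed.

End Local.

Lemma resolve_local O l : regular O -> (exists2 a, a \in l & a != 0) -> resolved l O.
Proof.
move=> HO ex; have [a la a0] := ex; have [c [c0 cO _]] := primary_normalization HO ex.
have [s [t Cst]] := reg_coords (regular_reg HO).
have [n na] : exists n, ~ mpow O n (a / c).
  apply/existsNP => /(cap_mpow HO Cst)/eqP.
  by rewrite mulf_eq0 invr_eq0 (negPf a0) (negPf c0).
apply: (resolved_order HO c0 cO (m := n)); exists a => // H; apply: na.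
exact: (mpowSW HO Cst).
Qed.
End Resolution.

(** * Elimination of indeterminacies on a surface *)

Section Elimination.
Variables (R : realType) (K : fieldType) (iota : {rmorphism R[i] -> K}).
Notation pts := (pts iota).
Notation smooth := (smooth_surface iota).
Notation modification := (modification iota).
Implicit Types (O W : set K) (X Y : model K) (l : seq K).

Variable eta : two_form K.
Hypothesis eta0 : exists D1 D2, [/\ derivation iota D1, derivation iota D2 &
  form_eval eta D1 D2 != 0].

Lemma near_lspan X O l a : lspan O l a -> near iota X O (fun O' => lspan O' l a).
Proof.
elim: l a => [|x l IH] a /=; first by move=> ->; exists [::].
move=> [c [b [Oc /IH lb ->]]]; apply: nearW (near_and (near_mem iota X Oc) lb).
by move=> O' _ [O'c lb']; exists c, b.
Qed.

(** Each generator of [O] minus its residue is a combination of [s] and [t] with coefficients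
    regular nearby. Where [s] and [t] vanish, all generators have the same residues as at [O], and
    the points agree. *)
Lemma near_isolated X O s t : pts X O -> coords O s t ->
  near iota X O (fun O' => maxid O' s -> maxid O' t -> O' = O).
Proof.
move=> XO Cst; have LO := pts_loc XO; have [z [zO zX]] := pts_gen XO.
have Hz x : x \in z -> near iota X O (fun O' => maxid O' s -> maxid O' t ->
    exists c, maxid O' (x - iota c) /\ maxid O (x - iota c)).
  move=> xz; have mx := resP LO (zO.1 _ xz); have [_ _ /(_ _ mx)[b [c [Ob Oc E]]]] := Cst.
  apply: nearW (near_and (near_mem iota X Ob) (near_mem iota X Oc)) => O' XO' [O'b O'c] ms mt.
  have LO' := pts_loc XO'; exists (res iota O x); split=> //; rewrite E.
  by apply: (loc_maxD LO'); exact: (maxMl LO').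
apply: nearW (near_and (near_all Hz) (near_all (fun x xz => near_mem iota X (zO.1 x xz)))).
move=> O' XO' [H zO'] ms mt; have LO' := pts_loc XO'; have [_ zB] := zO.
suff HB a : O a -> exists c, maxid O' (a - iota c) /\ maxid O (a - iota c).
  apply/esym; apply: (pts_dominates_eq XO XO' (W := O')) => //; split=> a.
    by move=> /HB[c [ma _]]; rewrite -(subrK (iota c) a); have := max_loc ma => ?; inO LO'.
  move=> ma; have [c [ma' mc]] := HB a (max_loc ma).
  suff c0 : c = 0 by rewrite c0 rmorph0 subr0 in ma'.
  by rewrite -(res_max LO ma); apply/esym; exact: (res_uniq LO).
have sub x c : maxid O' (x - iota c) -> O' x.
  by move=> mx; rewrite -(subrK (iota c) x); have := max_loc mx => ?; inO LO'.
move=> Oa; suff [] : O a /\ exists c, maxid O' (a - iota c) /\ maxid O (a - iota c) by [].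
apply: (zB (fun a => O a /\ exists c, maxid O' (a - iota c) /\ maxid O (a - iota c))) => // {a Oa}.
- by move=> c; split; [inO LO|exists c; rewrite subrr; split; [exact: (max0 LO')|exact: (max0 LO)]].
- move=> a b [Oa [c [H1 H2]]] [Ob [d [H3 H4]]]; split; first by inO LO.
  exists (c + d); rewrite rmorphD (_ : _ - _ = (a - iota c) + (b - iota d)); last by ring.
  by split; [exact: (loc_maxD LO')|exact: (loc_maxD LO)].
- move=> a b [Oa [c [H1 H2]]] [Ob [d [H3 H4]]]; split; first by inO LO.
  have O'b := sub _ _ H3; exists (c * d).
  rewrite rmorphM (_ : _ - _ = (a - iota c) * b + iota c * (b - iota d)); last by ring.
  split; [apply: (loc_maxD LO')|apply: (loc_maxD LO)].
  + exact: (maxM LO').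
  + by apply: (maxMl LO') => //; inO LO'.
  + exact: (maxM LO).
  + by apply: (maxMl LO) => //; inO LO.
- move=> a [Oa [c [H1 H2]]] ua; have [a0 _ Oai] := ua; split=> //; exists c^-1.
  have c0 : c != 0.
    by apply: contraPneq H2 => ->; rewrite rmorph0 subr0; exact: unit_nmax.
  have ic0 : iota c != 0 by rewrite fmorph_eq0.
  have E : a^-1 - iota c^-1 = (a - iota c) * (- (a^-1 * (iota c)^-1)).
    by rewrite fmorphV; field; rewrite a0 ic0.
  have ua' : unit_in O' a.
    rewrite -(subrK (iota c) a) addrC.
    by apply: (unitDmax LO') => //; exact: (unit_const LO').
  rewrite E -fmorphV; split; [apply: (maxM LO')|apply: (maxM LO)] => //.
    by inO LO'.
  by inO LO.
- move=> x xz; split; first exact: (zO.1 x xz).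
  exact: (H x xz ms mt).
Qed.

(** After division by [c] the ideal contains powers of [s] and [t], so at a nearby point where no
    generator is a unit both [s] and [t] vanish. *)
Lemma undefined_isolated X O l : smooth X -> (exists2 a, a \in l & a != 0) -> pts X O ->
  near iota X O (fun O' => ~ defined_at l O' -> O' = O).
Proof.
move=> HX ex XO; have HO := pts_regular eta0 HX XO; have LO := regular_loc HO.
have [c [c0 cO prim]] := primary_normalization HO ex; have [a la a0] := ex.
have [s [t Cst]] := reg_coords (regular_reg HO); have [ms mt _] := Cst.
have [e1 J1] := prim s ms; have [e2 J2] := prim t mt.
have cnear b : b \in l -> near iota X O (fun O' => O' (b / c)) by move=> /cO; exact: near_mem.
apply: nearW (near_and (near_and (near_mem iota X (max_loc ms)) (near_mem iota X (max_loc mt)))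
  (near_and (near_and (near_all cnear) (near_isolated XO Cst))
  (near_and (near_lspan X J1) (near_lspan X J2)))).
move=> O' XO' [[O's O't] [[c'O iso] [J1' J2']]] nd; have LO' := pts_loc XO'.
have cm b : b \in l -> maxid O' (b / c).
  move=> lb; have [u|//] := unit_or_max LO' (c'O b lb); case: nd.
  exact: (defined_unit LO' c0 c'O lb u).
have pm x e : O' x -> lspan O' [seq b / c | b <- l] (x ^+ e) -> maxid O' x.
  move=> Ox Jx; have [u|//] := unit_or_max LO' Ox; case: (unit_nmax (unitX LO' e u)).
  apply: (@lspan_sub _ O' (maxid O') _ _ _ _ _ Jx).
  - by split; [exact: (max0 LO')|exact: (loc_maxD LO')].
  - by move=> ? ?; exact: (maxMl LO').
  - by move=> y /mapP[b lb ->]; exact: cm.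
by apply: iso; [apply: pm J1'|apply: pm J2'].
Qed.

Lemma undefined_finite X l : smooth X -> (exists2 a, a \in l & a != 0) ->
  exists L : seq (set K), forall O, pts X O -> ~ defined_at l O -> O \in L.
Proof.
move=> HX ex; have [L [Lfin LX HL]] := pts_compact (fun O => undefined_isolated HX ex (O := O)).
move: Lfin => /finite_seqP[L' LE]; exists L' => O XO nd.
by have [O' LO' H] := HL O XO; rewrite (H nd); move: LO'; rewrite LE.
Qed.

Section Resolve.
Variable l : seq K.
Hypothesis l0 : exists2 a, a \in l & a != 0.

(** Points outside [L] are left untouched, so that the modifications for several points can be
    composed. *)
Let resolves (L : seq (set K)) := forall Y, smooth Y -> exists Y', [/\ modification Y Y',
  forall W, pts Y' W -> ~ defined_at l W -> pts Y W /\ W \notin L &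
  forall W, pts Y W -> W \notin L -> pts Y' W].

Lemma resolves_seq L : (forall O, O \in L -> resolves [:: O]) -> resolves L.
Proof.
elim: L => [|O L IH] HL Y HY.
  by exists Y; split=> //; exact: modification_id.
have IHL : resolves L by apply: IH => O' LO'; apply: HL; rewrite inE LO' orbT.
have [Y1 [M1 U1 P1]] := IHL Y HY.
have [Y2 [M2 U2 P2]] := HL O (mem_head _ _) Y1 (modification_smooth eta0 HY M1).
exists Y2; split.
- exact: modification_trans M2.
- move=> W YW nd; have [Y1W WO] := U2 W YW nd; have [YW' WL] := U1 W Y1W nd.
  by split=> //; rewrite inE negb_or WL andbT; move: WO; rewrite inE.
- move=> W YW; rewrite inE negb_or => /andP[WO WL].
  by apply: P2; [exact: P1|rewrite inE].
Qed.

Lemma resolves_point O : resolved iota l O -> resolves [:: O].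
Proof.
elim=> {}O _ IH Y HY.
have [D|nD] := pselect (defined_at l O).
  exists Y; split=> //; first exact: modification_id.
  by move=> W YW nd; split=> //; rewrite inE; apply/eqP => E; apply: nd; rewrite E.
have [YO|nYO] := pselect (pts Y O); last first.
  exists Y; split=> //; first exact: modification_id.
  by move=> W YW nd; split=> //; rewrite inE; apply/eqP => E; apply: nYO; rewrite -E.
have [p Hp OE] := YO; set Y1 := blowup iota Y p.
have M1 : modification Y Y1 := modification_blowup (modification_id iota Y) Hp.
have HY1 := modification_smooth eta0 HY M1; have HO := pts_regular eta0 HY YO.
have [L HL] := undefined_finite HY1 l0.
pose L1 := [seq W <- L | `[< pts Y1 W /\ quad O W >]].
have HL1 : resolves L1.
  apply: resolves_seq => W; rewrite mem_filter => /andP[/asboolP[YW qW] _].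
  exact: (IH nD W qW (pts_regular eta0 HY1 YW)).
have qdom W : quad O W -> dominates O W by move=> [s [t [Cst ->]]]; exact: (QT_dominates HO Cst).
have [Y2 [M2 U2 P2]] := HL1 Y1 HY1; exists Y2; split.
- exact: modification_trans M2.
- move=> W YW nd; have [Y1W /negP WL] := U2 W YW nd.
  have [O' [YO' O'W]] := blowup_pts eta0 HY Hp Y1W.
  rewrite -OE => -[[ne WE]|[_ qW]].
    by rewrite WE inE; split=> //; apply/eqP.
  by case: WL; rewrite mem_filter HL // andbT; apply/asboolP.
- move=> W YW; rewrite inE => /eqP WO; apply: P2.
    by apply: (blowup_pts_other eta0 HY Hp) => //; rewrite -OE.
  apply/negP; rewrite mem_filter => /andP[/asboolP[_ qW] _]; apply: WO.
  exact: (pts_dominates_eq YW YO (dominates_refl W) (qdom W qW)).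
Qed.

Lemma resolve_all Y : smooth Y ->
  exists Y', modification Y Y' /\ forall W, pts Y' W -> defined_at l W.
Proof.
move=> HY; have [L HL] := undefined_finite HY l0.
pose L1 := [seq W <- L | `[< pts Y W >]].
have HL1 O : O \in L1 -> resolves [:: O].
  rewrite mem_filter => /andP[/asboolP YO _].
  exact: resolves_point (resolve_local (pts_regular eta0 HY YO) l0).
have [Y' [M U _]] := resolves_seq HL1 HY; exists Y'; split=> // W YW.
apply: contrapT => nd; have [YW' /negP] := U W YW nd; apply.
by rewrite mem_filter HL // andbT; apply/asboolP.
Qed.
End Resolve.

(** The functions [psi (gen Y 0 j / gen Y 0 i0)] are homogeneous coordinates of the map. Once these
    define a map to projective space, the valuative criterion provides the image point on [Y]. *)
Lemma map_resolvable Y (psi : {rmorphism K -> K}) : smooth Y -> over_const iota psi ->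
  resolvable iota Y psi.
Proof.
move=> HY psic; have [[O YO]|nY] := pselect (exists O, pts Y O); last first.
  exists Y; split; first exact: modification_id.
  by move=> q Hq; case: nY; exists (local_ring iota Y q); exists q.
have [p Hp _] := YO; have [i0 pi0] := chart_exists Hp; have [x0 _] := pts_chart i0 Hp pi0.
pose l := [seq psi (gen Y 0 j / gen Y 0 i0) | j <- enum 'I_(rank Y)].
have l0 : exists2 a, a \in l & a != 0.
  exists 1; last exact: oner_neq0.
  by apply/mapP; exists i0; rewrite ?mem_enum // divff // rmorph1.
have [G [M HG]] := resolve_all l0 HY; exists G; split=> // q Hq.
have GW : pts G (local_ring iota G q) by exists q.
have [_ /mapP[j0 _ ->] [a0 Ha]] := HG _ GW; have LW := pts_loc GW.
have xj0 : gen Y 0 j0 != 0 by apply: contraNneq a0 => ->; rewrite mul0r rmorph0.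
have [|r [Hr _ [H1 H2]]] := center_exists (i0 := j0) LW psic xj0.
  move=> j; have := Ha (psi (gen Y 0 j / gen Y 0 i0)) (map_f _ (mem_enum _ _)).
  by rewrite -fmorph_div; congr (local_ring _ _ _ (psi _)); field; rewrite x0 xj0.
exists r; split=> //.
by move=> a /(local_idealP Hr)/H2/(local_idealP Hq).
Qed.
End Elimination.

(** * Two-forms and their poles *)

Section Forms.
Variables (R : realType) (K : fieldType) (iota : {rmorphism R[i] -> K}).
Notation regular := (regular iota).
Notation pts := (pts iota).
Notation smooth := (smooth_surface iota).
Implicit Types (O W : set K) (X Y : model K) (V : K -> int).

Variables (eta : two_form K) (D1 D2 : K -> K).
Hypotheses (HD1 : derivation iota D1) (HD2 : derivation iota D2).
Hypothesis theta0 : form_eval eta D1 D2 != 0.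
Notation J := (jac D1 D2).

Lemma eta_neq0 : exists D1 D2, [/\ derivation iota D1, derivation iota D2 &
  form_eval eta D1 D2 != 0].
Proof. by exists D1, D2. Qed.

(* [eta = dens s t * ds /\ dt]. *)
Definition dens s t := form_eval eta D1 D2 / J s t.

Section Curve.
Variables (O : set K) (V : K -> int).
Hypotheses (HO : regular O) (HV : curve_at O V).
Let LO := regular_loc HO.
Let nV : normalized_valuation V. Proof. by case: HV. Qed.

Lemma vringD a b : 0 <= V a -> 0 <= V b -> 0 <= V (a + b).
Proof.
move=> Va Vb; have [->|ab] := eqVneq (a + b) 0; first by rewrite (nval0 nV).
exact: (nval_ge_add nV).
Qed.

Lemma vringM a b : 0 <= V a -> 0 <= V b -> 0 <= V (a * b).
Proof.
move=> Va Vb; have [->|a0] := eqVneq a 0; first by rewrite mul0r (nval0 nV).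
have [->|b0] := eqVneq b 0; first by rewrite mulr0 (nval0 nV).
by rewrite (nvalM nV) // addr_ge0.
Qed.

Lemma vringN a : 0 <= V a -> 0 <= V (- a). Proof. by rewrite (nvalN nV). Qed.

Lemma curve_frac a : 0 <= V a -> exists b c, [/\ O b, O c, c != 0, V c = 0 & a = b / c].
Proof.
have [->|a0 Va] := eqVneq a 0.
  exists 0, 1; rewrite (nval1 nV) divr1; split=> //; [exact: (loc0 LO)|exact: (loc1 LO)|exact: oner_neq0].
have [b [c [Ob Oc c0 E]]] := regular_frac HO a.
have b0 : b != 0 by apply: contraNneq a0 => b0; rewrite E b0 mul0r.
have [p [pp Vp pE]] := curve_prime_elt HO HV; have [mp p0 _] := pp; have Op := max_loc mp.
have [m [b' [Ob' nb bE]]] := prime_elt_decomp HO pp Ob b0.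
have [n [c' [Oc' nc cE]]] := prime_elt_decomp HO pp Oc c0.
have [b'0 c'0] : b' != 0 /\ c' != 0.
  by split; [apply: contraNneq b0 => z|apply: contraNneq c0 => z]; rewrite ?bE ?cE z mulr0.
have Vu x : O x -> x != 0 -> ~ dv O p x -> V x = 0.
  move=> Ox x0 nx; have := curve_ge0 HV Ox; have : ~ 0 < V x by move=> /(pE _ Ox x0).
  by lia.
have le : (n <= m)%N.
  move: Va; rewrite E (nval_div nV) // bE cE !(nvalM nV) ?expf_neq0 // !(nvalX nV) //.
  by rewrite Vp (Vu b') // (Vu c') //; lia.
exists (p ^+ (m - n) * b'), c'; split=> //; [by inO LO|exact: Vu|].
rewrite E bE cE -{1}(subnK le) exprD; have := expf_neq0 n p0.
by move: (p ^+ n) (p ^+ (m - n)) => P Q P0; field; rewrite P0 c'0.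
Qed.

Variables (s t : K) (Cst : coords O s t).
Let Hreg := regular_reg HO.
Let ds := dds D1 D2 s t.
Let dt := ddt D1 D2 s t.
Let ds_der : derivation iota ds := dds_der HD1 HD2 s t.
Let dt_der : derivation iota dt := ddt_der HD1 HD2 s t.

Lemma der_vring d a : derivation iota d -> (forall b, O b -> O (d b)) ->
  0 <= V a -> 0 <= V (d a).
Proof.
move=> [dD dM dc] Od /curve_frac[b [c [Ob Oc c0 Vc ->]]].
have E : d (b / c) = (d b * c - b * d c) / (c * c).
  have : d b = d (b / c) * c + (b / c) * d c by rewrite -dM divfK.
  by move=> ->; field.
have On : O (d b * c - b * d c) by have := Od _ Ob; have := Od _ Oc; move=> ? ?; inO LO.
rewrite E; have [->|n0] := eqVneq (d b * c - b * d c) 0; first by rewrite mul0r (nval0 nV).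
by rewrite (nval_div nV) ?mulf_neq0 // (nvalM nV) // Vc subr0 (curve_ge0 HV).
Qed.

Let dsV a : 0 <= V a -> 0 <= V (ds a).
Proof. apply: der_vring => // b; exact: (dds_loc HD1 HD2 theta0 Hreg Cst). Qed.
Let dtV a : 0 <= V a -> 0 <= V (dt a).
Proof. apply: der_vring => // b; exact: (ddt_loc HD1 HD2 theta0 Hreg Cst). Qed.
Let Jst0 : J s t != 0 := jac_neq0 HD1 HD2 theta0 Hreg Cst.

Let jE a b : J a b / J s t = ds a * dt b - dt a * ds b.
Proof. by rewrite (jacE HD1 HD2 theta0 Hreg Cst) (mulrC (J s t)) mulfK. Qed.

Lemma jac_vring a b : 0 <= V a -> 0 <= V b -> 0 <= V (J a b / J s t).
Proof.
move=> Va Vb; rewrite jE; apply: vringD; last apply: vringN.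
  by apply: vringM; [exact: dsV|exact: dtV].
by apply: vringM; [exact: dtV|exact: dsV].
Qed.

(** With [a = p * a1] and [b = p * b1], the term in [dp /\ dp] of [da /\ db] vanishes and the others
    are divisible by [p]. So pulling back by a map that contracts the curve creates a zero. *)
Lemma jac_vring_gt0 a b : 0 < V a -> 0 < V b -> J a b != 0 -> 0 < V (J a b / J s t).
Proof.
move=> Va Vb Jab; have [p [[mp p0 _] Vp _]] := curve_prime_elt HO HV.
have q x : 0 < V x -> exists2 y, 0 <= V y & x = p * y.
  move=> Vx; have x0 : x != 0 by apply: (nval_neq0 nV); rewrite gt_eqF.
  by exists (x / p); [rewrite (nval_div nV) // Vp; lia|field].
have [a1 Va1 aE] := q a Va; have [b1 Vb1 bE] := q b Vb.
have Vp0 : 0 <= V p by rewrite Vp.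
have [_ dsM _] := ds_der; have [_ dtM _] := dt_der.
have := jE a b; rewrite {2 3}aE {2 3}bE !dsM !dtM.
set X := (X in _ = X) => E; pose Z := a1 * ds p * dt b1 + ds a1 * (b1 * dt p) +
  p * (ds a1 * dt b1) + - (a1 * dt p * ds b1) + - (dt a1 * (b1 * ds p)) + - (p * (dt a1 * ds b1)).
have XE : X = p * Z by rewrite /X /Z; ring.
have VZ : 0 <= V Z.
  have [? ?] := (dsV Va1, dtV Va1); have [? ?] := (dsV Vb1, dtV Vb1).
  have [? ?] := (dsV Vp0, dtV Vp0).
  by rewrite /Z; repeat first [assumption | apply: vringD | apply: vringN | apply: vringM].
have : J a b / J s t != 0 by rewrite mulf_neq0 ?invr_eq0.
rewrite E XE mulf_eq0 negb_or => /andP[_ Z0].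
by rewrite (nvalM nV) // Vp; lia.
Qed.
End Curve.

Lemma dens_neq0 O s t : regular O -> coords O s t -> dens s t != 0.
Proof.
move=> HO Cst; rewrite mulf_neq0 ?invr_eq0 //.
exact: (jac_neq0 HD1 HD2 theta0 (regular_reg HO) Cst).
Qed.

(** By [jac_vring], each of the two Jacobians divided by the other has nonnegative order along
    [V]. *)
Lemma curve_dens O O' V s t s' t' : regular O -> regular O' -> curve_at O V -> curve_at O' V ->
  coords O s t -> coords O' s' t' -> V (dens s t) = V (dens s' t').
Proof.
move=> HO HO' HV HV' Cst Cst'; have nV : normalized_valuation V by case: HV.
have [J0 J0'] := (jac_neq0 HD1 HD2 theta0 (regular_reg HO) Cst,
  jac_neq0 HD1 HD2 theta0 (regular_reg HO') Cst').
have Vc A (HA : curve_at A V) a b : coords A a b -> 0 <= V a /\ 0 <= V b.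
  by move=> [[Aa _] [Ab _] _]; split; exact: (curve_ge0 HA).
have [[Vs Vt] [Vs' Vt']] := (Vc _ HV _ _ Cst, Vc _ HV' _ _ Cst').
have := jac_vring HO HV Cst Vs' Vt'; have := jac_vring HO' HV' Cst' Vs Vt.
by rewrite /dens !(nval_div nV) //; lia.
Qed.

Lemma form_orderE X O V s t m : smooth X -> pts X O -> curve_at O V -> coords O s t ->
  form_order iota X eta V m <-> m = V (dens s t).
Proof.
move=> HX XO HV Cst; have HO := pts_regular eta_neq0 HX XO.
have [p Hp OE] := XO; subst O; split=> [[q [s' [t' [h [Hq Cst' h0 E ->]]]]]|->].
  have [Hq' _ _ _] := Hq; have HO' : regular (local_ring iota X q).
    by apply: (pts_regular eta_neq0 HX); exists q.
  move/(coordsP Hq'): Cst' => Cst'.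
  suff -> : h = dens s' t' by apply: curve_dens Cst' Cst => //; exact/(curve_atP Hq').
  have J0 := jac_neq0 HD1 HD2 theta0 (regular_reg HO') Cst'.
  have := E _ _ HD1 HD2; rewrite /dens => ->; rewrite /form_eval big_cons big_nil addr0.
  by rewrite -/(J s' t') mulfK.
exists p, s, t, (dens s t); split=> //.
- exact/(curve_atP Hp).
- exact/(coordsP Hp).
- exact: (dens_neq0 HO Cst).
move=> d d' Hd Hd'; rewrite (form_evalE HD1 HD2 theta0 (regular_reg HO) Cst eta Hd Hd').
by rewrite [RHS]/form_eval big_cons big_nil addr0 mulrC.
Qed.

Lemma form_divE X O V s t : smooth X -> pts X O -> curve_at O V -> coords O s t ->
  form_div iota X eta V = V (dens s t).
Proof.
move=> HX XO HV Cst; rewrite /form_div; case: asboolP => [_|[]]; last first.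
  by apply/prime_divisorP; exists O.
have H m := form_orderE m HX XO HV Cst.
by apply/H; apply: epsilon_spec; exists (V (dens s t)); apply/H.
Qed.

(* [eta] has no zero or pole at the point, resp. a simple pole along [x = 0]. *)
Definition off O := exists s t, coords O s t /\ unit_in O (dens s t).
Definition on_by O x y := coords O x y /\ unit_in O (x * dens x y).
Definition on O := exists x y, on_by O x y.

Lemma on_off_order O V s t : regular O -> on O \/ off O -> curve_at O V -> coords O s t ->
  V (dens s t) <= 0.
Proof.
move=> HO oo HV Cst; have nV : normalized_valuation V by case: HV.
case: oo => [[x [y [Cxy u]]]|[x [y [Cxy u]]]]; rewrite (curve_dens HO HO HV HV Cst Cxy).
  have x0 := coord_neq0 HO Cxy; have := curve_unit HV u.
  rewrite (nvalM nV) ?(dens_neq0 HO Cxy) //.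
  by have := curve_ge0 HV (max_loc (let: And3 a _ _ := Cxy in a)); lia.
by rewrite (curve_unit HV u).
Qed.
End Forms.

(** * Logarithmic Jacobians of monomials *)

Section Monomials.
Variables (R : realType) (K : fieldType) (iota : {rmorphism R[i] -> K}).
Notation regular := (regular iota).
Implicit Types (O W : set K) (V : K -> int).

Section Coordinates.
Variables (W : set K) (HW : regular W) (x y : K) (Cxy : coords W x y).
Let LW := regular_loc HW.
Let y0 : y != 0 := coord_neq0 HW (coordsC Cxy).

Lemma coord_ndv : ~ dv W x y.
Proof.
have [mx my _] := Cxy; move=> [b Wb E].
apply: (coord_nmpow2 HW (coords_shift HW (res iota W b) Cxy)).
rewrite (_ : _ - _ = (b - iota (res iota W b)) * x); last by rewrite E; ring.
by apply: (mpow_max HW Cxy); [exact: (resP LW)|exact/(mpow1 HW)].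
Qed.

Lemma coord_curve : curve_at W (ordp W x) /\ ordp W x x = 1 /\ ordp W x y = 0.
Proof.
have pp := coord_prime HW Cxy; have [[Wx _] [Wy _] _] := Cxy.
split; first exact: (curve_ordp HW pp); split; first exact: (ordp_self HW pp).
have := ordp_ge0 HW pp Wy; have : ~ 0 < ordp W x y by move/(ordp_gt0 HW pp Wy y0); exact: coord_ndv.
by lia.
Qed.
End Coordinates.

Section Local.
Variables (W : set K) (HW : regular W) (x y : K) (Cxy : coords W x y).
Let x0 : x != 0 := coord_neq0 HW Cxy.
Let y0 : y != 0 := coord_neq0 HW (coordsC Cxy).

Lemma monomial_curves (i j : int) u : unit_in W u ->
  ordp W x (x ^ i * y ^ j * u) = i /\ ordp W y (x ^ i * y ^ j * u) = j.
Proof.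
move=> uu; have [H1 [H1x H1y]] := coord_curve HW Cxy.
have [H2 [H2y H2x]] := coord_curve HW (coordsC Cxy); have [u0 _ _] := uu.
have [n1 _ _] := H1; have [n2 _ _] := H2.
rewrite !(nvalM n1) ?(nvalM n2) ?mulf_neq0 ?expfz_neq0 //.
rewrite !(nvalXz n1) ?(nvalXz n2) // H1x H1y H2x H2y (curve_unit H1 uu) (curve_unit H2 uu).
by split; ring.
Qed.

Lemma monomial_ge0 (i j : int) u : unit_in W u -> W (x ^ i * y ^ j * u) -> 0 <= i /\ 0 <= j.
Proof.
move=> uu Wm; have [E1 E2] := monomial_curves i j uu.
have [H1 _] := coord_curve HW Cxy; have [H2 _] := coord_curve HW (coordsC Cxy).
by split; [rewrite -E1; exact: (curve_ge0 H1)|rewrite -E2; exact: (curve_ge0 H2)].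
Qed.

Lemma monomial_max (i j : int) u : unit_in W u -> maxid W (x ^ i * y ^ j * u) ->
  [/\ 0 <= i, 0 <= j & (i, j) <> (0, 0)].
Proof.
move=> uu mm; have [i0 j0] := monomial_ge0 uu (max_loc mm); split=> // -[ei ej].
by apply: (unit_nmax uu); move: mm; rewrite ei ej !expr0z !mul1r.
Qed.

Lemma monomial_unit (i j : int) u : unit_in W u -> unit_in W (x ^ i * y ^ j * u) -> i = 0 /\ j = 0.
Proof.
move=> uu um; have [E1 E2] := monomial_curves i j uu.
have [H1 _] := coord_curve HW Cxy; have [H2 _] := coord_curve HW (coordsC Cxy).
by split; [rewrite -E1; exact: (curve_unit H1)|rewrite -E2; exact: (curve_unit H2)].
Qed.
End Local.

Variables (eta : two_form K) (D1 D2 : K -> K).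
Hypotheses (HD1 : derivation iota D1) (HD2 : derivation iota D2).
Hypothesis theta0 : form_eval eta D1 D2 != 0.
Notation J := (jac D1 D2).

(** The value on [D1] and [D2] of [dlog f /\ dlog h], which turns products into sums. *)
Definition ljac f h := J f h / f / h.

Lemma jacC f h : J f h = - J h f. Proof. by rewrite /jac; ring. Qed.

Lemma jacMl f g h : J (f * g) h = f * J g h + g * J f h.
Proof. by case: HD1 => _ M1 _; case: HD2 => _ M2 _; rewrite /jac M1 M2; ring. Qed.

Lemma jacMr f g h : J h (f * g) = f * J h g + g * J h f.
Proof. by rewrite jacC jacMl (jacC g) (jacC f); ring. Qed.

Lemma ljacC f h : ljac f h = - ljac h f.
Proof. by rewrite /ljac jacC !mulNr mulrAC. Qed.

Lemma ljacM f g h : f != 0 -> g != 0 -> h != 0 -> ljac (f * g) h = ljac f h + ljac g h.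
Proof. by move=> f0 g0 h0; rewrite /ljac jacMl; field; rewrite f0 g0 h0. Qed.

Lemma ljac1 h : h != 0 -> ljac 1 h = 0.
Proof.
by move=> h0; apply: (addrI (ljac 1 h)); rewrite -ljacM ?oner_neq0 // mulr1 addr0.
Qed.

Lemma ljacX f n h : f != 0 -> h != 0 -> ljac (f ^+ n) h = n%:R * ljac f h.
Proof.
move=> f0 h0; elim: n => [|n IH]; first by rewrite expr0 ljac1 // mul0r.
by rewrite exprS ljacM ?expf_neq0 // IH -addn1 natrD; ring.
Qed.

Lemma ljacXz f (n : int) h : f != 0 -> h != 0 -> ljac (f ^ n) h = n%:~R * ljac f h.
Proof.
move=> f0 h0; case: n => n; first by rewrite -exprnP ljacX.
have fn0 := expf_neq0 n.+1 f0; rewrite NegzE -exprnN; apply: (addrI (ljac (f ^+ n.+1) h)).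
rewrite -ljacM ?invr_eq0 // mulfV // ljac1 // ljacX // mulrNz.
by rewrite -[X in - X]/(n.+1%:R : K); ring.
Qed.

Lemma ljac_self f : ljac f f = 0. Proof. by rewrite /ljac /jac (mulrC (D2 f)) subrr !mul0r. Qed.

Section Local.
Variables (W : set K) (HW : regular W) (x y : K) (Cxy : coords W x y).
Let LW := regular_loc HW.
Let x0 : x != 0 := coord_neq0 HW Cxy.
Let y0 : y != 0 := coord_neq0 HW (coordsC Cxy).
Let Jxy0 : J x y != 0 := jac_neq0 HD1 HD2 theta0 (regular_reg HW) Cxy.
Let Jloc a b : W a -> W b -> W (J a b / J x y).
Proof. exact: (jac_loc HD1 HD2 theta0 (regular_reg HW) Cxy). Qed.

(* The leading term of [dlog f /\ dlog h], for monomials [f] and [h] up to units. *)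
Lemma ljac_monomials (a b c e : int) u w : unit_in W u -> unit_in W w ->
  exists2 m, maxid W m & ljac (x ^ a * y ^ c * u) (x ^ b * y ^ e * w) =
    ((a * e - c * b)%:~R + m) * ljac x y.
Proof.
move=> uu uw; have [u0 Wu Wui] := uu; have [w0 Ww Wwi] := uw.
have [mx my _] := Cxy; have [Wx Wy] := (max_loc mx, max_loc my).
pose A1 := J x w / J x y * w^-1 * y; pose A2 := J y w / J x y * w^-1 * x.
pose A3 := J u x / J x y * u^-1 * y; pose A4 := J u y / J x y * u^-1 * x.
pose A5 := J u w / J x y * u^-1 * w^-1 * x * y.
exists (a%:~R * A1 + c%:~R * A2 + b%:~R * A3 + e%:~R * A4 + A5).
  have Z n : W n%:~R by rewrite -(rmorph_int iota); exact: (loc_const LW).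
  have [J1 J2] := (Jloc Wx Ww, Jloc Wy Ww); have [J3 J4] := (Jloc Wu Wx, Jloc Wu Wy).
  have J5 := Jloc Wu Ww.
  do ![apply: (loc_maxD LW)]; try (apply: (maxMl LW); first exact: Z);
    by apply: (maxMl LW) => //; inO LW.
have px := expfz_neq0 _ x0; have py := expfz_neq0 _ y0.
have [M1 M2] : x ^ a * y ^ c * u != 0 /\ x ^ b * y ^ e * w != 0.
  by rewrite !mulf_neq0 ?px ?py.
have expand f : f != 0 -> ljac f (x ^ b * y ^ e * w) =
    b%:~R * ljac f x + e%:~R * ljac f y + ljac f w.
  move=> f0; rewrite ljacC !ljacM ?mulf_neq0 ?px ?py // !ljacXz //.
  by rewrite (ljacC x f) (ljacC y f) (ljacC w f); ring.
rewrite !ljacM ?mulf_neq0 ?px ?py // !ljacXz // !expand // !ljac_self (ljacC y x).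
rewrite /A1 /A2 /A3 /A4 /A5 /ljac !intrD !mulrNz !intrM.
by move: (a%:~R : K) (b%:~R : K) (c%:~R : K) (e%:~R : K) => a' b' c' e'; field; rewrite ?x0 ?y0 ?u0 ?w0 ?Jxy0.
Qed.

End Local.
End Monomials.

(** * Maps preserving the form *)

Section Pullback.
Variables (R : realType) (K : fieldType) (iota : {rmorphism R[i] -> K}).
Notation locring := (locring iota).
Notation regular := (regular iota).
Implicit Types (O W : set K) (X Y : model K) (V : K -> int).

Variables (eta : two_form K) (D1 D2 : K -> K).
Hypotheses (HD1 : derivation iota D1) (HD2 : derivation iota D2).
Hypothesis theta0 : form_eval eta D1 D2 != 0.
Notation J := (jac D1 D2).
Notation dens := (dens eta D1 D2).
Notation on_by := (on_by eta D1 D2).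
Notation off := (off eta D1 D2).
Notation on := (on eta D1 D2).

Variables (phi : {rmorphism K -> K}) (delta : R[i]).
Hypothesis phic : over_const iota phi.
Hypothesis delta0 : delta != 0.
(** The equality of the pullback of [eta] with [delta * eta], evaluated on [D1] and [D2], with [eta]
    written in coordinates at a target point. *)
Hypothesis key : forall O s t, regular O -> coords O s t ->
  phi (dens s t) * J (phi s) (phi t) = iota delta * form_eval eta D1 D2.

Lemma local_hom_unit O W a : locring O -> local_hom phi O W -> unit_in O a -> unit_in W (phi a).
Proof.
move=> LO [OW _] [a0 Oa Oi]; split; first by rewrite fmorph_eq0.
  exact: OW.
by rewrite -fmorphV; exact: OW.
Qed.

Lemma theta_on W x y : regular W -> on_by W x y ->
  exists2 u, unit_in W u & form_eval eta D1 D2 = u * (J x y / x).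
Proof.
move=> HW [Cxy u]; exists (x * dens x y) => //.
have J0 := jac_neq0 HD1 HD2 theta0 (regular_reg HW) Cxy; have x0 := coord_neq0 HW Cxy.
by rewrite /dens; field; rewrite J0 x0.
Qed.

(** The pullback of a form regular at [O] is regular at [W], whereas [delta * eta] has a pole
    there. *)
Lemma on_not_to_off O W : regular O -> regular W -> on W -> off O -> ~ local_hom phi O W.
Proof.
move=> HO HW [x [y oxy]] [s [t [Cst ud]]] hom; have [Cxy _] := oxy.
have LW := regular_loc HW; have LO := regular_loc HO.
have [u uu thE] := theta_on HW oxy; have x0 := coord_neq0 HW Cxy.
have J0 := jac_neq0 HD1 HD2 theta0 (regular_reg HW) Cxy.
have := key HO Cst; have uphi := local_hom_unit LO hom ud; rewrite thE => E.
have [[[Os _] [Ot _] _] [OW _]] := (Cst, hom).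
have WJ : W (J (phi s) (phi t) / J x y).
  by apply: (jac_loc HD1 HD2 theta0 (regular_reg HW) Cxy); exact: OW.
have [d0 Wd Wdi] := unitM LW (unit_const LW delta0) uu.
have [f0 Wf _] := uphi.
have [[_ nx] _ _] := Cxy; case: nx => [x0'|nx]; first by rewrite x0' eqxx in x0.
apply: nx; have -> : x^-1 = (phi (dens s t) * J (phi s) (phi t)) / J x y * (iota delta * u)^-1.
  rewrite E; move: d0; rewrite mulf_eq0 negb_or => /andP[id0 u0].
  by field; rewrite J0 id0 u0 x0.
by rewrite -mulrA -mulrA; apply: (loc_mul LW) => //; rewrite mulrA; apply: (loc_mul LW).
Qed.

(* A monomial map preserving [dx/x /\ dy] maps the curve [x = 0] to itself and
   is unramified along it. *)
Lemma monomial_exponents O W x' y' x y (a b c e : int) u w :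
  regular O -> regular W -> on_by O x' y' -> on_by W x y -> local_hom phi O W ->
  unit_in W u -> unit_in W w -> phi x' = x ^ a * y ^ c * u -> phi y' = x ^ b * y ^ e * w ->
  [/\ b = 0, e = 1, 1 <= a & 0 <= c].
Proof.
move=> HO HW [C' u'] oxy hom uu uw Ex Ey; have [Cxy _] := oxy; have [Ox Oy _] := C'.
have LW := regular_loc HW; have LO := regular_loc HO.
have [u2 uu2 thE] := theta_on HW oxy; have x0 := coord_neq0 HW Cxy.
have y0 := coord_neq0 HW (coordsC Cxy).
have J0 := jac_neq0 HD1 HD2 theta0 (regular_reg HW) Cxy.
have [_ homm] := hom.
have Mx : maxid W (x ^ a * y ^ c * u) by rewrite -Ex; exact: homm.
have My : maxid W (x ^ b * y ^ e * w) by rewrite -Ey; exact: homm.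
have [m mm lE] := ljac_monomials HD1 HD2 theta0 HW Cxy a b c e uu uw.
have U1 := local_hom_unit LO hom u'; have U3 := unit_const LW delta0.
have [U10 _ _] := U1; have [u20 _ _] := uu2; have [U30 _ _] := U3.
have [px' py'] : phi x' != 0 /\ phi y' != 0.
  by rewrite !fmorph_eq0; split; [exact: (coord_neq0 HO C')|exact: (coord_neq0 HO (coordsC C'))].
have [w0 _ _] := uw.
have E1 : phi (x' * dens x' y') * (J (phi x') (phi y') / phi x') = iota delta * (u2 * (J x y / x)).
  by rewrite -thE -(key HO C') rmorphM; field.
move: E1 U1 U10; move: (phi (x' * dens x' y')) => U E1 U1 U10.
(* Up to units, [dlog x' /\ dy'] pulls back to [phi y'] times the logarithmic Jacobian of
   [ljac_monomials], and has to agree with [dlog x /\ dy]. The quotient [y / phi y'] is the monomial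
   on the left, up to a unit. *)
have E2 : x ^ (- b) * y ^ (1 - e) * 1 =
    ((a * e - c * b)%:~R + m) * (U * (iota delta)^-1 * u2^-1 * w).
  have l0 : ljac D1 D2 x y != 0 by rewrite /ljac !mulf_neq0 ?invr_eq0.
  apply: (mulfI l0); rewrite !mulrA [X in _ = X * _ * _ * _ * _]mulrC -lE -Ex -Ey /ljac.
  have Ey' : y ^ (1 - e) * x ^ (- b) = y * w / phi y'.
    by rewrite Ey expfzDr // expr1z -!invr_expz; field; rewrite w0 !expfz_neq0.
  rewrite mulr1 -mulrA (mulrC (x ^ _)) Ey'.
  have F1 d v j p : d != 0 -> v != 0 -> p != 0 ->
      j / x / y * (y * w / p) = d * (v * (j / x)) / p * d^-1 * v^-1 * w :> K.
    by move=> d0 v0 p0; field; rewrite x0 y0 d0 v0 p0.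
  rewrite (F1 (iota delta) u2) // -E1.
  have F2 f j p q d v : p != 0 -> q != 0 -> f * (j / p) / q / d / v * w = j / p / q * f / d / v * w :> K.
    by move=> p0 q0; rewrite -!mulrA; ring.
  exact: F2.
have Uf : unit_in W (U * (iota delta)^-1 * u2^-1 * w).
  exact: (unitM LW (unitM LW (unitM LW U1 (unitV U3)) (unitV uu2)) uw).
have u1 := unit1 LW.
have [a0 c0 nac] := monomial_max HW Cxy uu Mx; have [b0 e0 nbe] := monomial_max HW Cxy uw My.
have Zm (n : int) : n != 0 -> unit_in W (n%:~R : K).
  move=> n0; rewrite -(rmorph_int iota); apply: (unit_const LW).
  by rewrite intr_eq0.
(* If the determinant is nonzero, the right-hand side is a unit and both exponents on the left
   vanish. If it is zero, the right-hand side is a nonunit, which the signs of the exponents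
   exclude. *)
have [N0|N0] := eqVneq (a * e - c * b) 0; last first.
  have : unit_in W (x ^ (- b) * y ^ (1 - e) * 1).
    by rewrite E2; apply: (unitM LW) => //; apply: (unitDmax LW) => //; exact: Zm.
  move=> /(monomial_unit HW Cxy u1)[Eb Ee]; have Eb' : b = 0 by clear -Eb; lia.
  have Ee' : e = 1 by clear -Ee; lia.
  split=> //; move: N0; rewrite Eb' Ee' mulr1 mulr0 subr0 => a1; clear -a0 a1; lia.
have : maxid W (x ^ (- b) * y ^ (1 - e) * 1).
  by rewrite E2 N0 add0r; apply: (maxM LW) => //; exact: unit_loc.
move=> /(monomial_max HW Cxy u1)[Hb He Hbe]; exfalso.
have Eb : b = 0 by clear -b0 Hb; lia.
have ne : e <> 0 by move=> z; apply: nbe; rewrite Eb z.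
have Ee : e = 1 by clear -ne e0 He; lia.
by apply: Hbe; rewrite Eb Ee.
Qed.

(* A curve contracted by a map preserving [eta] lands on the polar curve:
   otherwise [eta] would vanish along it. *)
Lemma contracted_not_off O O1 V : regular O -> regular O1 -> on O1 \/ off O1 ->
  curve_at O1 V -> off O -> ~ (forall a, maxid O a -> a != 0 -> 0 < V (phi a)).
Proof.
move=> HO HO1 oo HV [s [t [Cst ud]]] H; have LO := regular_loc HO.
have nV : normalized_valuation V by case: HV.
have [x [y Cxy]] := reg_coords (regular_reg HO1).
have [ms mt _] := Cst.
have [Vs Vt] := (H s ms (coord_neq0 HO Cst), H t mt (coord_neq0 HO (coordsC Cst))).
have E := key HO Cst.
have id0 : iota delta * form_eval eta D1 D2 != 0 by rewrite mulf_neq0 ?fmorph_eq0.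
have J0 : J (phi s) (phi t) != 0 by apply: contraNneq id0 => z; rewrite -E z mulr0.
have p0 : phi (dens s t) != 0 by rewrite fmorph_eq0; case: ud.
have Jxy0 := jac_neq0 HD1 HD2 theta0 (regular_reg HO1) Cxy.
have := jac_vring_gt0 HD1 HD2 theta0 HO1 HV Cxy Vs Vt J0.
have := on_off_order HD1 HD2 theta0 HO1 oo HV Cxy.
have Vc : V (iota delta) = 0 by rewrite (curve_const _ HO1 HV).
have : V (phi (dens s t)) = 0.
  have [d0 Od Odi] := ud; have Vge a : O a -> 0 <= V (phi a).
    move=> Oa; have [u|m] := unit_or_max LO Oa.
      have Hc := resP LO Oa; rewrite -(subrK (iota (res iota O a)) a) rmorphD phic.
      apply: (vringD HV); last by rewrite (curve_const _ HO1 HV).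
      have [->|n0] := eqVneq (a - iota (res iota O a)) 0; first by rewrite rmorph0 (nval0 nV).
      exact: (ltW (H _ Hc n0)).
    have [->|n0] := eqVneq a 0; first by rewrite rmorph0 (nval0 nV).
    exact: (ltW (H _ m n0)).
  by move: (Vge _ Od) (Vge _ Odi); rewrite fmorphV (nvalV nV) //; move: (V _) => k; clear; lia.
have := congr1 V E; rewrite (nvalM nV) // (nvalM nV) ?fmorph_eq0 // Vc /dens.
rewrite !(nval_div nV) //; move: (V _) (V _) (V _) (V _) => k1 k2 k3 k4; lia.
Qed.
End Pullback.

(** * Elaborations *)

Section Types.
Variables (R : realType) (K : fieldType) (iota : {rmorphism R[i] -> K}).
Notation regular := (regular iota).
Notation pts := (pts iota).
Notation smooth := (smooth_surface iota).
Notation modification := (modification iota).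
Implicit Types (O W q : set K) (X Y S : model K) (V : K -> int).

(** Each step takes the point where the equation of the strict transform of [x = 0] vanishes, so the
    tower follows this curve. *)
Fixpoint tow O x y k : set K :=
  if k is k'.+1 then QT (tow O x y k') y (x / y ^+ k') else O.

Variables (eta : two_form K) (D1 D2 : K -> K).
Hypotheses (HD1 : derivation iota D1) (HD2 : derivation iota D2).
Hypothesis theta0 : form_eval eta D1 D2 != 0.
Let eta0 := eta_neq0 HD1 HD2 theta0.
Notation J := (jac D1 D2).
Notation dens := (dens eta D1 D2).
Notation on_by := (on_by eta D1 D2).
Notation off := (off eta D1 D2).
Notation on := (on eta D1 D2).

Lemma tow_spec X O x y k : smooth X -> pts X O -> coords O x y -> exists Y,
  [/\ smooth Y, pts Y (tow O x y k), coords (tow O x y k) (x / y ^+ k) y &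
      dominates O (tow O x y k)].
Proof.
move=> HX XO Cxy; elim: k => [|k [Y [HY YO Ck Dk]]].
  by exists X; rewrite expr0 divr1; split.
have HO := pts_regular eta0 HY YO; have [p Hp OE] := YO; exists (blowup iota Y p).
have y0 := coord_neq0 HO (coordsC Ck).
have [Y'O D'] : quad (tow O x y k) (tow O x y k.+1) /\ dominates (tow O x y k) (tow O x y k.+1).
  split; first by exists y, (x / y ^+ k); split=> //; exact: coordsC.
  exact: (QT_dominates HO (coordsC Ck)).
split; first exact: (blowup_smooth eta0 HY Hp).
- by apply: (blowup_pts_quad eta0 HY Hp); rewrite -OE.
- have := coordsC (QT_coords HO (coordsC Ck)); congr coords.
  by rewrite exprSr invfM mulrA.
- exact: dominates_trans D'.
Qed.

(** From [ds /\ dt = s ds /\ d(t / s)]: the factor [s] is the zero acquired on the exceptional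
    curve. In [dens_divl] it is absorbed by the simple pole. *)
Lemma dens_div s t : s != 0 -> J s t != 0 -> dens s (t / s) = s * dens s t.
Proof.
move=> s0 J0; have := jacMr HD1 HD2 (t / s) s s; rewrite divfK // {2}/jac (mulrC (D2 s)) subrr mulr0 add0r.
rewrite /dens => E; have Js0 : J s (t / s) != 0 by apply: contraNneq J0 => z; rewrite E z mulr0.
by rewrite E; field; rewrite Js0 s0.
Qed.

Lemma dens_divl x y : y != 0 -> J x y != 0 -> (x / y) * dens (x / y) y = x * dens x y.
Proof.
move=> y0 J0; have := jacMl HD1 HD2 (x / y) y y; rewrite divfK // {2}/jac (mulrC (D2 y)) subrr mulr0 add0r.
rewrite /dens => E; have Jy0 : J (x / y) y != 0 by apply: contraNneq J0 => z; rewrite E z mulr0.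
by rewrite E; field; rewrite Jy0 y0.
Qed.

Lemma tow_on X O x y k : smooth X -> pts X O -> on_by O x y ->
  on_by (tow O x y k) (x / y ^+ k) y.
Proof.
move=> HX XO [Cxy u]; have LO := pts_loc XO.
have y0 := coord_neq0 (pts_regular eta0 HX XO) (coordsC Cxy).
suff E j : (x / y ^+ j) * dens (x / y ^+ j) y = x * dens x y.
  have [Y [HY YO Ck [Dk Mk]]] := tow_spec k HX XO Cxy; split=> //; rewrite E.
  by case: u => u0 Ou Oui; split=> //; exact: Dk.
elim: j => [|j IH]; first by rewrite expr0 divr1.
have [Y [HY YO Cj _]] := tow_spec j HX XO Cxy.
have J0 := jac_neq0 HD1 HD2 theta0 (regular_reg (pts_regular eta0 HY YO)) Cj.
have -> : x / y ^+ j.+1 = x / y ^+ j / y by rewrite exprSr invfM mulrA.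
by rewrite dens_divl.
Qed.

Lemma blowup_off Y O : smooth Y -> pts Y O -> off O -> forall p, point iota Y p ->
  O = local_ring iota Y p -> exists V O' s t,
  [/\ pts (blowup iota Y p) O', curve_at O' V, coords O' s t & 0 < V (dens s t)].
Proof.
move=> HY YO [s [t [Cst ud]]] p Hp OE; have HO := pts_regular eta0 HY YO.
have s0 := coord_neq0 HO Cst; have J0 := jac_neq0 HD1 HD2 theta0 (regular_reg HO) Cst.
exists (ordm O), (QT O s t), s, (t / s); split.
- by apply: (blowup_pts_quad eta0 HY Hp); rewrite -OE; exists s, t.
- exact: (curve_ordm_QT HO Cst).
- exact: (QT_coords HO Cst).
have n := ordm_normalized HO; have [d0 _ _] := ud.
by rewrite dens_div // (nvalM n) // (ordm_coord HO Cst) (ordm_unit HO ud).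
Qed.

(** Away from the direction of the strict transform, the coordinates are [x] and [y' / x], and the
    factor [x] produced by the blowup cancels the pole. *)
Lemma quad_on O W x y : regular O -> on_by O x y -> quad O W -> W = QT O y x \/ off W.
Proof.
move=> HO [Cxy u] qW; have LO := regular_loc HO.
have x0 := coord_neq0 HO Cxy.
case: (quad_direction HO qW Cxy) => [[c ->]|]; [right|by left].
have C' := coords_shift HO c Cxy; set y' := y - iota c * x in C' *.
have J0 := jac_neq0 HD1 HD2 theta0 (regular_reg HO) Cxy.
have J0' := jac_neq0 HD1 HD2 theta0 (regular_reg HO) C'.
exists x, (y' / x); split; first exact: (QT_coords HO C').
have -> : dens x (y' / x) = x * dens x y.
  rewrite dens_div // /dens; congr (_ * (_ / _)).
  have [[D1D M1 c1] [D2D M2 c2]] := (HD1, HD2).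
  have DN d : derivation iota d -> d (- (iota c * x)) = - (iota c * d x).
    move=> [dD dM dc]; apply: (addrI (d (iota c * x))); rewrite -dD subrr.
    have d00 : d 0 = 0 by rewrite -[in LHS](rmorph0 iota) dc.
    by rewrite d00 dM dc mul0r add0r subrr.
  by rewrite /jac /y' D1D D2D !DN //; ring.
have [OW _] := QT_dominates HO C'.
by case: u => u0 Ou Oui; split=> //; exact: OW.
Qed.

Variables (S : model K) (HS : smooth S).
Hypothesis Soo : forall O, pts S O -> off O \/ on O.

Definition oncoords q : K * K :=
  epsilon (inhabits (0, 0)) (fun z => on_by q z.1 z.2).
Notation xc q := (oncoords q).1.
Notation yc q := (oncoords q).2.
Definition tower q k := tow q (xc q) (yc q) k.
Definition pole q := pts S q /\ on q.

Lemma oncoordsP q : pole q -> on_by q (xc q) (yc q).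
Proof. by move=> [_ [x [y H]]]; apply: (epsilon_spec _ (fun z => on_by q z.1 z.2)); exists (x, y). Qed.

Lemma towerP q k : pole q -> [/\ regular (tower q k), on_by (tower q k) (xc q / yc q ^+ k) (yc q) &
  dominates q (tower q k)].
Proof.
move=> Qq; have [Sq _] := Qq; have H := oncoordsP Qq; have [Cxy _] := H.
have [Y [HY YO Ck Dk]] := tow_spec k HS Sq Cxy; split=> //.
- exact: (pts_regular eta0 HY YO).
- exact: (tow_on _ HS Sq H).
Qed.

Lemma tower_inj q q' k k' : pole q -> pole q' -> tower q k = tower q' k' -> q = q'.
Proof.
move=> Qq Qq' E; have [[_ _ Dq] [_ _ Dq']] := (towerP k Qq, towerP k' Qq').
by rewrite E in Dq; exact: (pts_dominates_eq Qq.1 Qq'.1 Dq Dq').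
Qed.

(* The surface obtained from [S] by blowing up [k q] times the point [q] of the
   polar curve, always on the strict transform of this curve. *)
Definition blown Y (k : set K -> nat) := [/\ smooth Y, modification S Y,
  forall q, pole q -> pts Y (tower q (k q)),
  forall O, pts Y O -> off O \/ exists2 q, pole q & O = tower q (k q) &
  forall V, prime_divisor iota Y V -> prime_divisor iota S V \/
    exists q j, [/\ pole q, (j < k q)%N & V = ordm (tower q j)]].

Lemma blown_S : blown S (fun=> 0%N).
Proof.
split=> //; [exact: modification_id|by move=> q []| |by left].
move=> O SO; case: (Soo SO) => H; [by left|right; exists O => //; by split].
Qed.

Lemma blown_blowup Y k q p : blown Y k -> pole q -> point iota Y p ->
  tower q (k q) = local_ring iota Y p -> blown (blowup iota Y p) (fun q' => k q' + (q' == q))%N.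
Proof.
move=> [HY SY Ya Yb Yc] Qq Hp OE; have YO := Ya q Qq.
have HO := pts_regular eta0 HY YO; have [_ onO _] := towerP (k q) Qq.
have M : modification Y (blowup iota Y p) := modification_blowup (modification_id iota Y) Hp.
have HY' := modification_smooth eta0 HY M.
have SY' := modification_trans SY M; have qT : quad (tower q (k q)) (tower q (k q).+1).
  by exists (yc q), (xc q / yc q ^+ k q); split=> //; apply: coordsC; case: onO.
split=> //.
- move=> q' Qq'; have [->|ne] := eqVneq q' q.
    by rewrite addn1; apply: (blowup_pts_quad eta0 HY Hp); rewrite -OE.
  rewrite addn0; apply: (blowup_pts_other eta0 HY Hp); first exact: Ya.
  rewrite -OE => /(tower_inj Qq' Qq) E; by rewrite E eqxx in ne.
- move=> W /(blowup_pts eta0 HY Hp)[O' [YO' _]]; rewrite -OE => -[[ne ->]|[_ qW]].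
    case: (Yb O' YO') => [|[q' Qq' E]]; [by left|right; exists q' => //].
    have [qq|_] := eqVneq q' q; last by rewrite addn0.
    by case: ne; rewrite E qq.
  case: (quad_on HO onO qW) => [->|]; [right; exists q => //|by left].
  by rewrite eqxx addn1.
- move=> V /prime_divisorP[W Y'W HV].
  have HW := pts_regular eta0 HY' Y'W.
  have old : prime_divisor iota Y V -> prime_divisor iota S V \/
      exists q' j, [/\ pole q', (j < k q' + (q' == q))%N & V = ordm (tower q' j)].
    move=> /Yc[|[q' [j [Qq' jk E]]]]; first by left.
    by right; exists q', j; split=> //; exact: ltn_addr.
  have [O' [YO' _]] := blowup_pts eta0 HY Hp Y'W; rewrite -OE => -[[_ WE]|[_ qW]].
    by apply: old; apply/prime_divisorP; exists O' => //; rewrite -WE.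
  have [s [t [Cst WE]]] := qW; rewrite WE in HV HW.
  case: (QT_curves HO Cst HW HV) => [HV'|->].
    by apply: old; apply/prime_divisorP; exists (tower q (k q)).
  by right; exists q, (k q); split=> //; rewrite eqxx addn1.
Qed.

Lemma blown_seq Y k (l : seq (set K)) : blown Y k -> (forall q, q \in l -> pole q) ->
  exists2 Y', modification Y Y' & blown Y' (fun q => k q + count_mem q l)%N.
Proof.
elim: l Y k => [|q l IH] Y k HY lQ.
  exists Y; first exact: modification_id.
  by rewrite (_ : (fun _ => _) = k) //; apply/funext => q; rewrite addn0.
have Qq := lQ q (mem_head _ _); have [_ _ Ya _ _] := HY; have [p Hp OE] := Ya q Qq.
have M1 : modification Y (blowup iota Y p) := modification_blowup (modification_id iota Y) Hp.
set Y1 := blowup iota Y p in M1; have B1 := blown_blowup HY Qq Hp OE.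
have [Y2 M2 B2] : exists2 Y', modification Y1 Y' &
    blown Y' (fun q' => k q' + (q' == q) + count_mem q' l)%N.
  by apply: IH => // q' lq'; apply: lQ; rewrite inE lq' orbT.
exists Y2; first exact: modification_trans M2.
by congr blown: B2; apply/funext => q' /=; rewrite addnA eq_sym.
Qed.

Lemma blown_no_zeros Y k : blown Y k -> no_zeros iota Y eta.
Proof.
move=> [HY _ _ Yb _] V; have [HV|nV] := pselect (prime_divisor iota Y V); last first.
  by rewrite /form_div; case: asboolP.
have [O YO HO] := (prime_divisorP iota Y V).1 HV; have RO := pts_regular eta0 HY YO.
have [s [t Cst]] := reg_coords (regular_reg RO).
rewrite (form_divE HD1 HD2 theta0 HY YO HO Cst); apply: (on_off_order HD1 HD2 theta0 RO) => //.
case: (Yb O YO) => [|[q Qq ->]]; [by right|left].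
by have [_ H _] := towerP (k q) Qq; exists (xc q / yc q ^+ k q), (yc q).
Qed.

(* The blowup of a point off the polar curve creates a zero of [eta]. *)
Lemma elaboration_blown X : elaboration iota S eta X ->
  exists2 l : seq (set K), (forall q, q \in l -> pole q) & blown X (fun q => count_mem q l).
Proof.
move=> [SX nz].
suff [//|[V [O [s [t [XO HV Cst Vd]]]]]] : (exists2 l : seq (set K), (forall q, q \in l -> pole q) &
    blown X (fun q => count_mem q l)) \/ exists V O s t,
    [/\ pts X O, curve_at O V, coords O s t & 0 < V (dens s t)].
  have := nz V; rewrite (form_divE HD1 HD2 theta0 (modification_smooth eta0 HS SX) XO HV Cst).
  by rewrite leNgt Vd.
elim: SX {nz} => [|Y p SY IH Hp]; first by left; exists [::] => //; exact: blown_S.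
have HY := modification_smooth eta0 HS SY.
have M : modification Y (blowup iota Y p) := modification_blowup (modification_id iota Y) Hp.
have HY' := modification_smooth eta0 HY M.
case: IH => [[l lQ B]|[V [O [s [t [YO HV Cst Vd]]]]]]; last first.
  right; have : prime_divisor iota Y V by apply/prime_divisorP; exists O.
  move=> /(modification_curves eta0 HY M)/prime_divisorP[O' Y'O' HV'].
  have HO' := pts_regular eta0 HY' Y'O'; have [s' [t' Cst']] := reg_coords (regular_reg HO').
  exists V, O', s', t'; split=> //.
  by rewrite -(curve_dens HD1 HD2 theta0 (pts_regular eta0 HY YO) HO' HV HV' Cst Cst').
have [_ _ _ Yb _] := B; have YO : pts Y (local_ring iota Y p) by exists p.
case: (Yb _ YO) => [offO|[q Qq OE]]; first by right; exact: (blowup_off HY YO offO Hp).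
left; exists (q :: l); first by move=> q'; rewrite inE => /orP[/eqP ->|/lQ].
have := blown_blowup B Qq Hp (esym OE).
by congr blown; apply/funext => q' /=; rewrite addnC eq_sym.
Qed.

End Types.

(** * Towers over a point of the polar curve *)

Section Towers.
Variables (R : realType) (K : fieldType) (iota : {rmorphism R[i] -> K}).
Notation locring := (locring iota).
Notation regular := (regular iota).
Notation smooth := (smooth_surface iota).
Implicit Types (O W q : set K) (X Y S : model K) (V : K -> int).

Section Preimage.
Variables (phi : {rmorphism K -> K}).
Hypothesis phic : over_const iota phi.

Lemma maxid_preim W a : maxid (fun x => W (phi x)) a <-> maxid W (phi a).
Proof.
rewrite /maxid -fmorphV; split=> -[Wa [a0|]]; split=> //; try by right.
  by left; rewrite a0 rmorph0.
by left; apply/eqP; rewrite -(fmorph_eq0 phi) a0.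
Qed.

Lemma locring_preim W : locring W -> locring (fun x => W (phi x)).
Proof.
move=> LW; split=> [c|a b Wa Wb|a b Wa Wb|a /(loc_res LW)[c mc]|a b /maxid_preim ma /maxid_preim mb].
- by rewrite phic; exact: (loc_const LW).
- by rewrite rmorphD; inO LW.
- by rewrite rmorphM; inO LW.
- by exists c; apply/maxid_preim; rewrite rmorphB phic.
- by apply/maxid_preim; rewrite rmorphD; exact: (loc_maxD LW).
Qed.

(** Pulling [W] back by [phi] turns local homomorphisms into inclusions, so that the universal
    property [QT_minimal] also applies to maps. *)
Lemma local_hom_preim O W : local_hom phi O W <-> dominates O (fun x => W (phi x)).
Proof.
by split=> -[H1 H2]; split=> // a ma; [apply/maxid_preim|apply/(maxid_preim W)]; exact: H2.
Qed.
End Preimage.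

Variables (eta : two_form K) (D1 D2 : K -> K).
Hypotheses (HD1 : derivation iota D1) (HD2 : derivation iota D2).
Hypothesis theta0 : form_eval eta D1 D2 != 0.
Notation xc q := (oncoords eta D1 D2 q).1.
Notation yc q := (oncoords eta D1 D2 q).2.
Notation tower := (tower eta D1 D2).

Variables (S : model K) (HS : smooth S).
Notation pole := (pole iota eta D1 D2 S).
Let towerP := towerP HD1 HD2 theta0 HS.

Section OneTower.
Variables (q : set K) (Qq : pole q).
Notation x := (xc q).
Notation y := (yc q).

Lemma tower_regular k : regular (tower q k). Proof. by case: (towerP k Qq). Qed.

Lemma tower_coords k : coords (tower q k) (x / y ^+ k) y.
Proof. by case: (towerP k Qq) => _ []. Qed.

Lemma pole_coords : coords q x y.
Proof. by have := tower_coords 0; rewrite expr0 divr1. Qed.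

Lemma pole_regular : regular q. Proof. exact: (tower_regular 0). Qed.

Lemma pole_x0 : x != 0. Proof. exact: (coord_neq0 pole_regular pole_coords). Qed.

Lemma pole_y0 : y != 0. Proof. exact: (coord_neq0 pole_regular (coordsC pole_coords)). Qed.

Lemma tower_le j k : (j <= k)%N -> dominates (tower q j) (tower q k).
Proof.
move=> /subnK <-; elim: (k - j)%N => [|n IH]; first exact: dominates_refl.
apply: dominates_trans IH _.
exact: (QT_dominates (tower_regular _) (coordsC (tower_coords _))).
Qed.

Lemma tower_hom (phi : {rmorphism K -> K}) W k : over_const iota phi -> locring W ->
  local_hom phi q W -> maxid W (phi (x / y ^+ k)) -> local_hom phi (tower q k) W.
Proof.
move=> phic LW hom; elim: k => [//|k IH] mk.
have y0 := pole_y0; have [_ my _] := pole_coords.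
have E : phi (x / y ^+ k) = phi (x / y ^+ k.+1) * phi y.
  by rewrite -rmorphM exprSr; congr (phi _); have := expf_neq0 k y0 => ?; field; rewrite y0.
have {IH} : local_hom phi (tower q k) W.
  by apply: IH; rewrite E; apply: (maxM LW) => //; apply: max_loc; apply hom.2.
move/local_hom_preim => D; apply/local_hom_preim.
apply: (QT_minimal (tower_regular k) (coordsC (tower_coords k)) (locring_preim phic LW) D).
apply/maxid_preim; congr maxid: mk.
by rewrite exprSr invfM mulrA.
Qed.

(** Blowing up the level [j] gives the exceptional curve [V], along which both coordinates
    [x / y ^+ j] and [y] of that level have order 1; hence [j.+1] for [x]. *)
Lemma tower_V j : let V := ordm (tower q j) in
  [/\ curve_at (tower q j.+1) V, V x = j.+1 & V y = 1].
Proof.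
move=> V; have HO := tower_regular j; have C := tower_coords j; have n : normalized_valuation V := ordm_normalized HO.
have Vy : V y = 1 by exact: (ordm_coord HO (coordsC C)).
split=> //; first exact: (curve_ordm_QT HO (coordsC C)).
have y0 := pole_y0; have x0 := pole_x0.
have := ordm_coord HO C; rewrite -/V (nval_div n) ?expf_neq0 // (nvalX n) // Vy; lia.
Qed.

(** After division by a power of [x], an element of [q] has the form [y ^+ j * e + x * d] with [e] a
    unit. From level [j] on, [x * d / y ^+ j] is a nonunit, so [y ^+ j] can be factored out. *)
Lemma tower_monomial a : a != 0 ->
  exists (i j : int) k0, forall k, (k0 <= k)%N -> unit_in (tower q k) (a / (x ^ i * y ^ j)).
Proof.
have HO := pole_regular; have C := pole_coords; have LO := regular_loc HO.
have [y0 x0] := (pole_y0, pole_x0).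
have main b : q b -> b != 0 -> exists (i j : int) k0,
    forall k, (k0 <= k)%N -> unit_in (tower q k) (b / (x ^ i * y ^ j)).
  move=> Ob b0; have px := coord_prime HO C.
  have [n [b' [Ob' nb' ->]]] := prime_elt_decomp HO px Ob b0.
  case: (coord_adic HO (coordsC C) Ob') => [[d Od E]|[j [e [d [ue Od ->]]]]].
    by case: nb'; exists d => //; rewrite E mulrC.
  exists n, j, j => k jk; have Lk := regular_loc (tower_regular k).
  have [qk mk] := tower_le (leq0n k).
  have yj0 := expf_neq0 j y0; have xn0 := expf_neq0 n x0.
  rewrite -!exprnP (_ : _ / _ = e + x / y ^+ k * (y ^+ (k - j) * d)); last first.
    rewrite -{1}(subnK jk) exprD; have := expf_neq0 (k - j) y0.
    move: (y ^+ (k - j)) (y ^+ j) yj0 (x ^+ n) xn0 => Y1 Y2 Y20 X1 X10 Y10.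
    by field; rewrite X10 Y20 Y10.
  apply: (unitDmax Lk); first by case: ue => ? ? ?; split=> //; exact: qk.
  have [mx [ty _] _] := tower_coords k; apply: (maxM Lk) => //.
  by have := qk _ Od => ?; inO Lk.
move=> a0; have [b [c [Ob Oc c0 E]]] := regular_frac HO a.
have b0 : b != 0 by apply: contraNneq a0 => z; rewrite E z mul0r.
have [i [j [k1 H1]]] := main b Ob b0; have [i' [j' [k2 H2]]] := main c Oc c0.
exists (i - i'), (j - j'), (maxn k1 k2) => k; rewrite geq_max => /andP[/H1 u1 /H2 u2].
have Lk := regular_loc (tower_regular k).
rewrite (_ : _ / _ = (b / (x ^ i * y ^ j)) * (c / (x ^ i' * y ^ j'))^-1).
  by apply: (unitM Lk) => //; exact: unitV.
rewrite E !expfzDr // -!invr_expz.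
have := expfz_neq0 i x0; have := expfz_neq0 i' x0; have := expfz_neq0 j y0; have := expfz_neq0 j' y0.
move: (x ^ i) (x ^ i') (y ^ j) (y ^ j') => X1 X2 Y1 Y2 Y20 Y10 X20 X10.
by field; rewrite X10 X20 Y10 Y20 c0.
Qed.

Lemma monomial_rebase (n : nat) (j : int) k :
  x ^+ n * y ^ j = (x / y ^+ k) ^+ n * y ^ (j + n%:Z * k%:Z).
Proof.
have y0 := pole_y0; rewrite expfzDr // -PoszM -exprnP expr_div_n -exprM mulnC.
by have := expf_neq0 (n * k) y0; move: (_ ^+ (n * k)) => Y Y0; field.
Qed.

Lemma monomial_mem (n : nat) (j : int) k : 0 <= j + n%:Z * k%:Z -> tower q k (x ^+ n * y ^ j).
Proof.
rewrite (monomial_rebase n j k); case: (j + _) => // m _; rewrite -exprnP.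
have [[Tx _] [Ty _] _] := tower_coords k; have Lk := regular_loc (tower_regular k).
by inO Lk.
Qed.

(* The union of the tower is the lexicographic valuation ring of the flag
   formed by the polar curve and [q]. *)
Lemma tower_valuation a : a != 0 -> exists k0, (forall k, (k0 <= k)%N -> tower q k a) \/
  (forall k, (k0 <= k)%N -> tower q k a^-1).
Proof.
move=> a0; have [i [j [k0 H]]] := tower_monomial a0.
have [y0 x0] := (pole_y0, pole_x0).
have [xi0 yj0] := (expfz_neq0 i x0, expfz_neq0 j y0).
have pos (n : nat) (l : int) : (0 < n)%N \/ 0 <= l -> exists k1, forall k, (k1 <= k)%N ->
    tower q k (x ^+ n * y ^ l).
  move=> nl; exists `|l|%N => k lk; apply: monomial_mem.
  by case: nl => [n0|l0]; [nia|lia].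
case: (boolP ((0 < i) || (i == 0) && (0 <= j))) => [le|nle].
  have [|k1 H1] := pos `|i|%N j; first by lia.
  exists (maxn k0 k1); left=> k; rewrite geq_max => /andP[/H u /H1 Tm].
  have Lk := regular_loc (tower_regular k); have := unit_loc u.
  move: Tm; rewrite exprnP gez0_abs; last by lia.
  move=> Tm Tu; rewrite (_ : a = a / (x ^ i * y ^ j) * (x ^ i * y ^ j)); first by inO Lk.
  by rewrite divfK // mulf_neq0.
have [|k1 H1] := pos `|i|%N (- j); first by lia.
exists (maxn k0 k1); right=> k; rewrite geq_max => /andP[/H u /H1 Tm].
have Lk := regular_loc (tower_regular k); have := unit_locV u.
move: Tm; rewrite exprnP (_ : Posz `|i|%N = - i); last by lia.
rewrite -!invr_expz => Tm Tu.
rewrite (_ : a^-1 = (a / (x ^ i * y ^ j))^-1 * ((x ^ i)^-1 * (y ^ j)^-1)); first by inO Lk.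
by field; rewrite a0 xi0 yj0.
Qed.

(** In a valuation ring one of finitely many elements divides the others, and [tower_valuation]
    turns this into a statement at finite level. It will extend a rational map to the tower. *)
Lemma tower_divides (l : seq K) : (exists2 a, a \in l & a != 0) ->
  exists a k0, [/\ a \in l, a != 0 & forall k, (k0 <= k)%N -> forall b, b \in l -> tower q k (b / a)].
Proof.
elim: l => [[? //]|b l IH] [a]; rewrite inE.
have T0 k : tower q k 0 by exact: (loc0 (regular_loc (tower_regular k))).
have T1 k : tower q k 1 by exact: (loc1 (regular_loc (tower_regular k))).
have [[a' la' a'0]|none] := pselect (exists2 a, a \in l & a != 0); last first.
  move=> /orP[/eqP -> b0|la a0]; last by case: none; exists a.
  exists b, 0%N; split=> //; first exact: mem_head.
  move=> k _ d; rewrite inE => /orP[/eqP ->|ld]; first by rewrite divff.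
  have [->|d0] := eqVneq d 0; first by rewrite mul0r.
  by case: none; exists d.
move=> _ _; have [c [k0 [lc c0 Hc]]] := IH (ex_intro2 _ _ a' la' a'0).
have [->|b0] := eqVneq b 0.
  exists c, k0; split=> //; first by rewrite inE lc orbT.
  by move=> k lk d; rewrite inE => /orP[/eqP ->|/(Hc k lk)//]; rewrite mul0r.
have [|k1 [H|H]] := tower_valuation (a := b / c); first by rewrite mulf_neq0 ?invr_eq0.
  exists c, (maxn k0 k1); split=> //; first by rewrite inE lc orbT.
  move=> k; rewrite geq_max => /andP[lk0 lk1] d; rewrite inE => /orP[/eqP ->|/(Hc k lk0)//].
  exact: H.
exists b, (maxn k0 k1); split=> //; first exact: mem_head.
move=> k; rewrite geq_max => /andP[lk0 lk1] d; rewrite inE => /orP[/eqP ->|ld].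
  by rewrite divff.
have := H k lk1; have := Hc k lk0 d ld; rewrite invf_div => T2 T3.
have Lk := regular_loc (tower_regular k); rewrite (_ : d / b = (d / c) * (c / b)); first by inO Lk.
by field; rewrite b0 c0.
Qed.
End OneTower.
End Towers.

(** * Action on the polar curve *)

Section Action.
Variables (R : realType) (K : fieldType) (iota : {rmorphism R[i] -> K}).
Notation regular := (regular iota).
Notation pts := (pts iota).
Notation smooth := (smooth_surface iota).
Implicit Types (O W q : set K) (X Y S : model K) (V : K -> int).

Variables (eta : two_form K) (D1 D2 : K -> K).
Hypotheses (HD1 : derivation iota D1) (HD2 : derivation iota D2).
Hypothesis theta0 : form_eval eta D1 D2 != 0.
Let eta0 := eta_neq0 HD1 HD2 theta0.
Notation J := (jac D1 D2).
Notation dens := (dens eta D1 D2).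
Notation off := (off eta D1 D2).
Notation on := (on eta D1 D2).
Notation xc q := (oncoords eta D1 D2 q).1.
Notation yc q := (oncoords eta D1 D2 q).2.
Notation tower := (tower eta D1 D2).

Variables (S : model K) (HS : smooth S).
Notation pole := (pole iota eta D1 D2 S).
Hypothesis Soo : forall O, pts S O -> off O \/ on O.

Variables (phi : {rmorphism K -> K}) (delta : R[i]).
Hypothesis phic : over_const iota phi.
Hypothesis delta0 : delta != 0.
Hypothesis key : forall O s t, regular O -> coords O s t ->
  phi (dens s t) * J (phi s) (phi t) = iota delta * form_eval eta D1 D2.

Let tower_regular := tower_regular HD1 HD2 theta0 HS.
Let tower_coords := tower_coords HD1 HD2 theta0 HS.
Let tower_le := tower_le HD1 HD2 theta0 HS.
Let pole_x0 := pole_x0 HD1 HD2 theta0 HS.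
Let pole_y0 := pole_y0 HD1 HD2 theta0 HS.
Let pole_regular := pole_regular HD1 HD2 theta0 HS.

Lemma tower_on q k : pole q -> on (tower q k).
Proof. by move=> Qq; case: (towerP HD1 HD2 theta0 HS k Qq) => _ H _; exists (xc q / yc q ^+ k), (yc q). Qed.

Lemma pole_image O W : pts S O -> regular W -> on W -> local_hom phi O W -> pole O.
Proof.
move=> SO HW oW hom; split=> //; case: (Soo SO) => // /(on_not_to_off HD1 HD2 theta0 delta0 key) H.
by case: (H _ (pts_regular eta0 HS SO) HW oW hom).
Qed.

(* [phi] maps the tower of [q'] into that of [q] by
   [(x, y) -> (x ^ a y ^ c, y)] up to units, from the level [k0] on. *)
Record acts q q' (a : nat) (c : int) (k0 : nat) : Prop := Acts {
  acts_pole : pole q';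
  acts_gt0 : (0 < a)%N;
  (* At level 0 the image of the second coordinate may involve [x], so [acts_y] only speaks of
     positive levels. Starting at level 0 is therefore tied to [c = 0], where level 0 only has to
     reach level 0. *)
  acts_start : (0 < k0)%N \/ c = 0;
  acts_hom : forall k, (k0 <= k)%N -> local_hom phi q' (tower q k);
  acts_x : forall k, (k0 <= k)%N -> unit_in (tower q k) (phi (xc q') / (xc q ^+ a * yc q ^ c));
  acts_y : forall k, (k0 <= k)%N -> (0 < k)%N -> unit_in (tower q k) (phi (yc q') / yc q) }.

Lemma local_hom_dom O W W' : local_hom phi O W -> dominates W W' -> local_hom phi O W'.
Proof. by move=> [H1 H2] [H3 H4]; split=> a /[dup] ? Ha; [apply: H3; exact: H1|apply: H4; exact: H2]. Qed.

(** By [tower_divides], the homogeneous coordinates of the map define an image point [q'] from some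
    level on, and [pole_image] puts it on the polar curve. Both coordinates of [q'] pull back to
    monomials up to units, whose exponents are restricted by [monomial_exponents]. *)
Lemma pole_acts q : pole q -> exists q' a c k0, acts q q' a c k0.
Proof.
move=> Qq; have [Sq _] := Qq; have [p Hp _] := Sq.
have [i0 pi0] := chart_exists Hp; have [g0 _] := pts_chart i0 Hp pi0.
pose l := [seq phi (gen S 0 j / gen S 0 i0) | j <- enum 'I_(rank S)].
have l0 : exists2 a, a \in l & a != 0.
  exists 1; last exact: oner_neq0.
  by apply/mapP; exists i0; rewrite ?mem_enum // divff // rmorph1.
have [_ [k0 [/mapP[j0 _ ->] a0 H]]] := tower_divides HD1 HD2 theta0 HS Qq l0.
have gj0 : gen S 0 j0 != 0 by apply: contraNneq a0 => ->; rewrite mul0r rmorph0.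
have L0 := regular_loc (tower_regular Qq k0).
have [|r [Hr _ hom]] := center_exists (i0 := j0) L0 phic gj0.
  move=> j; have := H k0 (leqnn _) (phi (gen S 0 j / gen S 0 i0)) (map_f _ (mem_enum _ _)).
  by rewrite -fmorph_div; congr (tower _ _ (phi _)); field; rewrite g0 gj0.
set q' := local_ring iota S r in hom.
have Qq' : pole q'.
  by apply: (pole_image _ (tower_regular Qq k0) (tower_on k0 Qq) hom); exists r.
have [x'0 y'0] := (pole_x0 Qq', pole_y0 Qq'); have [x0 y0] := (pole_x0 Qq, pole_y0 Qq).
have [|a [c [k1 H1]]] := tower_monomial HD1 HD2 theta0 HS Qq (a := phi (xc q')).
  by rewrite fmorph_eq0.
have [|b [e [k2 H2]]] := tower_monomial HD1 HD2 theta0 HS Qq (a := phi (yc q')).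
  by rewrite fmorph_eq0.
(* The successor makes the starting level positive, so that [acts_start] holds whatever [c] is. *)
pose k := (maxn (maxn k0 k1) k2).+1; set x := xc q in x0 H1 H2 *; set y := yc q in y0 H1 H2 *.
have kP m : (k <= m)%N -> [/\ (k0 <= m)%N, (k1 <= m)%N & (k2 <= m)%N].
  by rewrite /k => km; split; clear -km; lia.
have [l1 l2 l3] := kP k (leqnn _).
have rebase (i j : int) : x ^ i * y ^ j = (x / y ^+ k) ^ i * y ^ (j + k%:Z * i).
  have yk0 := expf_neq0 k y0; rewrite expfzDr // -exprz_exp -exprnP expfzMl exprz_inv -invr_expz.
  have := expfz_neq0 i yk0.
  by move: ((y ^+ k) ^ i) => Y Y0; field.
have hom' m : (k <= m)%N -> local_hom phi q' (tower q m).
  by move=> /kP[l0m _ _]; apply: local_hom_dom hom _; exact: tower_le.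
have [_ on' _] := towerP HD1 HD2 theta0 HS k Qq.
have xy0 (i j : int) : x ^ i * y ^ j != 0 by rewrite mulf_neq0 ?expfz_neq0.
have [] := monomial_exponents HD1 HD2 theta0 delta0 key (pole_regular Qq') (tower_regular Qq k)
  (oncoordsP Qq') on' (hom' k (leqnn _)) (H1 k l2) (H2 k l3)
  (a := a) (c := c + k%:Z * a) (b := b) (e := e + k%:Z * b).
- by rewrite -rebase mulrC divfK.
- by rewrite -rebase mulrC divfK.
move=> b0 e1 a1 _; exists q', `|a|%N, c, k.
have aE : x ^+ `|a|%N = x ^ a by rewrite exprnP gez0_abs //; lia.
split=> //; first by lia.
- by left.
- by move=> m /kP[_ lm _]; rewrite aE; exact: H1.
- move=> m /kP[_ _ lm] _; have := H2 m lm; rewrite b0 (_ : e = 1) ?expr0z ?mul1r //.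
  by rewrite b0 mulr0 addr0 in e1.
Qed.

Section Acts.
Variables (q q' : set K) (a : nat) (c : int) (k0 : nat).
Hypotheses (Qq : pole q) (A : acts q q' a c k0).
Let Qq' := acts_pole A.
Let x'0 := pole_x0 Qq'.
Let y'0 := pole_y0 Qq'.
Let x0 := pole_x0 Qq.
Let y0 := pole_y0 Qq.

(** Up to units, [x' / y' ^+ k'] pulls back to [(x / y ^+ k) ^+ a * y ^ (a k + c - k')], which
    vanishes at the point because [a] is positive and the last exponent is nonnegative. *)
Lemma acts_regular k k' : (k0 <= k)%N -> k'%:Z <= a%:Z * k%:Z + c ->
  local_hom phi (tower q' k') (tower q k).
Proof.
move=> lk le; have Lk := regular_loc (tower_regular Qq k).
have [k0'|k'0] := posnP k'; first by rewrite k0'; exact: (acts_hom A lk).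
have kp : (0 < k)%N.
  rewrite lt0n; apply/eqP => kz; rewrite kz leqn0 in lk; move/eqP: lk => lk.
  by move: (acts_start A) le k'0; rewrite kz lk mulr0 add0r; clear; lia.
apply: (tower_hom HD1 HD2 theta0 HS Qq' phic Lk (acts_hom A lk)).
have u1 := acts_x A lk; have u2 := acts_y A lk kp.
set u := phi (xc q') / _ in u1; set w := phi (yc q') / _ in u2.
have [u10 _ _] := u1; have [u20 _ _] := u2.
have [m m0] : exists m : nat, a%:Z * k%:Z + c - k'%:Z = m%:Z.
  by exists `|(a%:Z * k%:Z + c - k'%:Z)%R|%N; clear -le; lia.
have Ea : a = a.-1.+1 by rewrite prednK // (acts_gt0 A).
have xa0 := expf_neq0 a x0; have yc0 := expfz_neq0 c y0; have yk0 := expf_neq0 k' y0.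
rewrite (_ : phi _ = (xc q / yc q ^+ k) * ((xc q / yc q ^+ k) ^+ a.-1 * yc q ^+ m * u / w ^+ k')).
  have [mx [Ty _] _] := tower_coords Qq k; have Tx := max_loc mx.
  have Tu := unit_loc u1; have := unit_locV (unitX Lk k' u2) => Tw.
  by apply: (maxM Lk) => //; inO Lk.
transitivity (u * (xc q ^+ a * yc q ^ c) / (w * yc q) ^+ k').
  by rewrite fmorph_div rmorphXn /u /w !divfK // mulf_neq0.
have E := monomial_rebase HD1 HD2 theta0 HS Qq a c k.
rewrite E (_ : c + _ = m%:Z + k'%:Z); last by clear -m0; lia.
have Ex : (xc q / yc q ^+ k) ^+ a = (xc q / yc q ^+ k) * (xc q / yc q ^+ k) ^+ a.-1.
  by rewrite -exprS -Ea.
rewrite Ex expfzDr // -!exprnP (exprMn _ w).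
have := expf_neq0 k' u20; move: (w ^+ k') (yc q ^+ k') yk0 => W Y Y0 W0.
by move: ((xc q / yc q ^+ k) ^+ a.-1) (yc q ^+ m) (xc q / yc q ^+ k) => P Q X; field; rewrite W0 Y0.
Qed.

(** These values show where the exceptional curve lands: it can be contracted to the point of level
    [k'] over [q'] only if [k'] is less than the first value. *)
Lemma acts_landing j (V := ordm (tower q j)) : (k0 <= j.+1)%N ->
  [/\ V (phi (xc q')) = a%:Z * j.+1%:Z + c, V (phi (yc q')) = 1 & forall b, q' b -> 0 <= V (phi b)].
Proof.
move=> lj; have [HV Vx Vy] := tower_V HD1 HD2 theta0 HS Qq j; have [n _ _] := HV.
have u1 := acts_x A lj; have u2 := acts_y A lj (ltn0Sn _).
have [xa0 yc0] := (expf_neq0 a x0, expfz_neq0 c y0).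
have := curve_unit HV u1; have := curve_unit HV u2.
rewrite !(nval_div n) ?mulf_neq0 ?fmorph_eq0 // (nvalM n) // (nvalX n) // (nvalXz n) // Vx Vy.
rewrite -/V => E2 E1; split; last by move=> b q'b; apply: (curve_ge0 HV); exact: (acts_hom A lj).1.
  by move: E1; move: (V _) => X1; clear; lia.
by move: E2; move: (V _) => X1; clear; lia.
Qed.
End Acts.
End Action.

(** * Almost all points of the polar curve *)

Section Simple.
Variables (R : realType) (K : fieldType) (iota : {rmorphism R[i] -> K}).
Notation regular := (regular iota).
Notation pts := (pts iota).
Notation smooth := (smooth_surface iota).
Notation near := (near iota).
Implicit Types (O W q : set K) (X Y S : model K) (V : K -> int).

Variables (eta : two_form K) (D1 D2 : K -> K).
Hypotheses (HD1 : derivation iota D1) (HD2 : derivation iota D2).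
Hypothesis theta0 : form_eval eta D1 D2 != 0.
Let eta0 := eta_neq0 HD1 HD2 theta0.
Notation J := (jac D1 D2).
Notation dens := (dens eta D1 D2).
Notation on_by := (on_by eta D1 D2).
Notation off := (off eta D1 D2).
Notation on := (on eta D1 D2).
Notation xc q := (oncoords eta D1 D2 q).1.
Notation yc q := (oncoords eta D1 D2 q).2.
Notation tower := (tower eta D1 D2).

Variables (S : model K) (HS : smooth S).
Notation pole := (pole iota eta D1 D2 S).
Hypothesis Soo : forall O, pts S O -> off O \/ on O.

Variables (phi : {rmorphism K -> K}) (delta : R[i]).
Hypothesis phic : over_const iota phi.
Hypothesis delta0 : delta != 0.
Hypothesis key : forall O s t, regular O -> coords O s t ->
  phi (dens s t) * J (phi s) (phi t) = iota delta * form_eval eta D1 D2.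

Let tower_regular := tower_regular HD1 HD2 theta0 HS.
Let tower_coords := tower_coords HD1 HD2 theta0 HS.
Let tower_le := tower_le HD1 HD2 theta0 HS.
Let pole_x0 := pole_x0 HD1 HD2 theta0 HS.
Let pole_y0 := pole_y0 HD1 HD2 theta0 HS.
Let pole_coords := pole_coords HD1 HD2 theta0 HS.
Let pole_regular := pole_regular HD1 HD2 theta0 HS.

Notation acts := (acts iota eta D1 D2 S phi).

Variable C : (K -> int) -> int.
Hypothesis divC : divisor iota S C.
Hypothesis Cdens : forall O V s t, pts S O -> curve_at O V -> coords O s t -> C V = - V (dens s t).

Lemma pole_loceq q : pole q -> loceq q C (xc q).
Proof.
move=> Qq; have [Sq _] := Qq; split; first exact: pole_x0.
move=> V HV; have [n _ _] := HV; have [Cq u] := oncoordsP Qq.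
have := curve_unit HV u; rewrite (Cdens Sq HV Cq).
rewrite (nvalM n) ?(pole_x0 Qq) // ?(dens_neq0 HD1 HD2 theta0 (pole_regular Qq) Cq) //.
by move: (V _) (V _) => a b; clear; lia.
Qed.

Lemma off_loceq O : pts S O -> off O -> loceq O C 1.
Proof.
move=> SO [s [t [Cst u]]]; split; first exact: oner_neq0.
move=> V HV; have [n _ _] := HV.
by rewrite (Cdens SO HV Cst) (curve_unit HV u) oppr0 (nval1 n).
Qed.

Lemma pole_equation q O : pole q -> loceq O C (xc q) -> pole O -> unit_in O (xc O / xc q).
Proof. by move=> Qq L QO; exact: (loceq_uniq (pole_regular QO) (pole_loceq QO) L). Qed.

Lemma pole_equation_max q O : pole q -> loceq O C (xc q) -> pole O -> maxid O (xc q).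
Proof.
move=> Qq L QO; have u := pole_equation Qq L QO; have LO := regular_loc (pole_regular QO).
have [mx _ _] := pole_coords QO; rewrite (_ : xc q = xc O * (xc O / xc q)^-1).
  by apply: (maxM LO) => //; exact: unit_locV.
by field; rewrite pole_x0 // pole_x0.
Qed.

(** At a nearby point of the polar curve other than [q], [yc q] is a unit and [xc q] vanishes. So
    [xc q / yc q ^+ k] vanishes as well, and the fractions that define the tower stay regular. *)
Lemma near_tower q k a : pole q -> tower q k a ->
  near S q (fun O => maxid O (xc q) -> O <> q -> O a).
Proof.
move=> Qq; have [Sq _] := Qq; elim: k a => [|k IH] a.
  by move=> qa; apply: nearW (near_mem iota S qa).
move=> [P [Q [HP HQ [Q0 Q0T Q0i] ->]]].
have npoly (A : {poly K}) : poly_in (tower q k) A ->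
    near S q (fun O => maxid O (xc q) -> O <> q -> poly_in O A).
  move=> HA; have H i : i \in seq.iota 0 (size A) -> near S q (fun O => maxid O (xc q) -> O <> q -> O A`_i).
    by move=> _; exact: IH (HA i).
  apply: nearW (near_all H) => O SO HO mx ne i; have LO := pts_loc SO.
  have [lt|le] := ltnP i (size A); last by rewrite nth_default //; inO LO.
  by apply: HO; rewrite // mem_iota.
have Cq := pole_coords Qq; have [_ [qy _] _] := Cq.
apply: nearW (near_and (near_and (near_mem iota S qy) (near_isolated Sq Cq))
  (near_and (near_and (npoly P HP) (npoly Q HQ)) (near_and (IH _ Q0T) (IH _ Q0i)))).
move=> O SO [[Oy iso] [[OP OQ] [OQ0 OQi]]] mx ne; have LO := pts_loc SO.
have uy : unit_in O (yc q) by apply: (unitP LO Oy) => my; apply: ne; exact: iso.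
have [y0 _ Oyi] := uy.
have mu : maxid O (xc q / yc q ^+ k / yc q).
  by rewrite -mulrA; apply: (maxM LO) => //; apply: (loc_mul LO) => //; rewrite -exprVn; inO LO.
have uQ : unit_in O Q.[xc q / yc q ^+ k / yc q].
  have mQ := poly_horner0 LO (OQ mx ne) mu.
  by rewrite -(subrK Q`_0 Q.[_]) addrC; apply: (unitDmax LO) => //; split=> //; [exact: OQ0|exact: OQi].
apply: (loc_mul LO); last by case: uQ.
by apply: (poly_horner LO (OP mx ne)); exact: max_loc.
Qed.

Lemma near_tower_unit q k a : pole q -> unit_in (tower q k) a ->
  near S q (fun O => maxid O (xc q) -> O <> q -> unit_in O a).
Proof.
move=> Qq [a0 Ta Tai]; apply: nearW (near_and (near_tower Qq Ta) (near_tower Qq Tai)).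
by move=> O _ [H1 H2] mx ne; split=> //; [exact: H1|exact: H2].
Qed.

(* Where [phi x' = x ^ a] up to a unit, [phi] is transversally unramified. *)
Lemma unramified O O' x y x' y' (a : nat) u : regular O -> regular O' -> (0 < a)%N ->
  on_by O x y -> on_by O' x' y' -> local_hom phi O' O -> unit_in O u -> phi x' = x ^+ a * u ->
  exists al be, [/\ O al, unit_in O be & phi y' = al * x + be * y].
Proof.
move=> HO HO' a0 oxy [C' u'] hom uu Ex; have [Cxy _] := oxy; have LO := regular_loc HO.
have [_ my' _] := C'; have [_ homm] := hom; have mpy := homm _ my'.
have [[Ox _] [Oy _] span] := Cxy; have [al [be [Oal Obe E]]] := span _ mpy.
exists al, be; split=> //; apply: (unitP LO Obe) => mbe.
have [u2 uu2 thE] := theta_on HD1 HD2 theta0 HO oxy; have x0 := coord_neq0 HO Cxy.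
have J0 := jac_neq0 HD1 HD2 theta0 (regular_reg HO) Cxy.
have U1 := local_hom_unit (regular_loc HO') hom u'; have U3 := unit_const LO delta0.
have U4 := unitM LO U3 uu2; apply: (unit_nmax U4).
have px' : phi x' != 0 by rewrite fmorph_eq0; exact: (coord_neq0 HO' C').
have [u0 Ou Oui] := uu.
have E1 : phi (x' * dens x' y') * (J (phi x') (phi y') / phi x') = iota delta * (u2 * (J x y / x)).
  by rewrite -thE -(key HO' C') rmorphM; field.
have Oj f g : O f -> O g -> O (J f g / J x y).
  exact: (jac_loc HD1 HD2 theta0 (regular_reg HO) Cxy).
have mpyO := max_loc mpy.
(* The equation divided by [dx /\ dy / x]. The derivative of the unit [u] comes with a factor [x],
   and a nonunit [be] would put the other term in the maximal ideal too, although the left-hand side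
   is a unit. *)
have E2 : iota delta * u2 = phi (x' * dens x' y') *
    (x * (J u (phi y') / J x y * u^-1) + a%:R * (J x (phi y') / J x y)).
  have xa0 := expf_neq0 a x0.
  have -> : iota delta * u2 = iota delta * (u2 * (J x y / x)) * (x / J x y).
    by field; rewrite J0 x0.
  rewrite -E1 -(mulrA (phi _)); congr (_ * _).
  have -> : J (phi x') (phi y') = x ^+ a * J u (phi y') + u * (a%:R * x ^+ a.-1 * J x (phi y')).
    have [[A1 M1 _] [A2 M2 _]] := (HD1, HD2).
    by rewrite Ex /jac M1 M2 !(derX _ _ HD1) !(derX _ _ HD2); ring.
  rewrite Ex; have -> : x ^+ a = x * x ^+ a.-1 by rewrite -exprS prednK.
  have := expf_neq0 a.-1 x0; move: (x ^+ a.-1) => P P0.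
  by field; rewrite J0 x0 u0 P0.
rewrite E2; apply: (maxMl LO); first by case: U1.
have [mx my _] := Cxy; apply: (loc_maxD LO).
  by apply: (maxM LO) => //; apply: (loc_mul LO) => //; exact: Oj.
apply: (maxMl LO); first by inO LO.
have -> : J x (phi y') / J x y = x * (J x al / J x y) + y * (J x be / J x y) + be.
  have -> : J x (phi y') = x * J x al + y * J x be + be * J x y.
    rewrite E /jac; have [[A1 M1 _] [A2 M2 _]] := (HD1, HD2).
    by rewrite A1 A2 !M1 !M2; ring.
  by field.
apply: (loc_maxD LO) => //; apply: (loc_maxD LO); apply: (maxM LO) => //; exact: Oj.
Qed.

(** On the polar curve near [q], the factor [yc q ^ c] is a unit. The monomial form over [q]
    therefore makes the map regular at the nearby points, without blowups, and gives
    [phi x' = x ^+ a] up to a unit; [unramified] controls the other coordinate. *)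
Lemma near_simple q : pole q -> near S q (fun O => pole O -> O <> q ->
  exists q' a, acts O q' a 0 0).
Proof.
move=> Qq; have [p' [a [c [k0 A]]]] := pole_acts HD1 HD2 theta0 HS Soo phic delta0 key Qq.
have Qp' := acts_pole A; have [Sp' _] := Qp'; pose k := k0.+1.
have hom := acts_hom A (leqnSn k0); have ux := acts_x A (leqnSn k0).
have [r Hr p'E] := Sp'; have [i0 ri0] := chart_exists Hr; have [g0 _] := pts_chart i0 Hr ri0.
pose z := [seq gen S 0 j / gen S 0 i0 | j <- enum 'I_(rank S)].
have zgen : gen_by iota p' z by rewrite p'E; exact: (chart_gen Hr ri0).
have Lp' := pts_loc Sp'.
have [B [Bp' HB]] := near_loceq eta0 HS Sp' divC (pole_loceq Qp').
(* The equation [xc p'] of [C] is valid only where the functions in [B] are regular. Their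
   denominators pull back to units over [q], hence also near [q], so the image point [O'] lies in
   this neighbourhood. *)
pose P b := fun O => maxid O (xc q) -> O <> q -> forall O', pts S O' -> (forall x, x \in z -> O' x) ->
  local_hom phi O' O -> O' b.
have nearB b : b \in B -> near S q (P b).
  move=> /Bp' p'b; have [f [g [zf zg ug ->]]] := gen_frac Lp' zgen p'b.
  have ug' := local_hom_unit Lp' hom ug.
  apply: nearW (near_tower_unit Qq ug') => O SO H mx ne O' SO' zO' [hO' mO'].
  have LO' := pts_loc SO'; have O'f := alg_loc LO' zO' zf; have O'g := alg_loc LO' zO' zg.
  have [|_ _ O'gi] := unitP LO' O'g; last by inO LO'.
  by move=> /mO'; apply: unit_nmax; exact: H.
have nearz x : x \in z -> near S q (fun O => maxid O (xc q) -> O <> q -> O (phi x)).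
  by move=> xz; apply: (near_tower Qq (k := k)); apply: hom.1; exact: zgen.1.
have [_ [Oy _] _] := pole_coords Qq; have [Sq _] := Qq.
apply: nearW (near_and (near_and (near_all nearB) (near_all nearz))
  (near_and (near_and (near_loceq eta0 HS Sq divC (pole_loceq Qq)) (near_tower_unit Qq ux))
     (near_and (near_mem iota S Oy) (near_isolated Sq (pole_coords Qq))))).
move=> O SO [[HB1 Hz] [[HC Hx] [Oyq iso]]] QO ne.
have LO := pts_loc SO; have mx := pole_equation_max Qq HC QO; have HO := pole_regular QO.
have uy : unit_in O (yc q) by apply: (unitP LO Oyq) => my; apply: ne; exact: iso.
have [|r2 [Hr2 r2i0 hom2]] := center_exists (i0 := i0) LO phic g0.
  by move=> j; apply: Hz => //; apply/mapP; exists j; rewrite ?mem_enum.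
set O' := local_ring iota S r2 in hom2; have SO' : pts S O' by exists r2.
have zO' x : x \in z -> O' x by move=> /mapP[j _ ->]; case: (pts_chart j Hr2 r2i0).
have onO : on O by case: QO.
have QO' : pole O' := pole_image HD1 HD2 theta0 HS Soo delta0 key SO' HO onO hom2.
have L' : loceq O' C (xc p').
  by apply: HB => // b Bb; exact: (HB1 b Bb mx ne O' SO' zO' hom2).
have v1 := pole_equation Qp' L' QO'; have v2 := pole_equation Qq HC QO.
have w1 := local_hom_unit (pts_loc SO') hom2 v1; have w2 := Hx mx ne.
have [x'0 xp'0] := (pole_x0 QO', pole_x0 Qp'); have [xO0 xq0] := (pole_x0 QO, pole_x0 Qq).
pose u := phi (xc O' / xc p') * (phi (xc p') / (xc q ^+ a * yc q ^ c)) *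
  yc q ^ c * ((xc O / xc q) ^+ a)^-1.
have uu : unit_in O u.
  apply: (unitM LO); last by apply: unitV; exact: (unitX LO).
  by apply: (unitM LO); [exact: (unitM LO)|exact: (unitXz LO)].
have y0 := pole_y0 Qq; have Ex : phi (xc O') = xc O ^+ a * u.
  rewrite /u fmorph_div expr_div_n; have := expf_neq0 a xO0; have := expf_neq0 a xq0.
  have := expfz_neq0 c y0; have : phi (xc p') != 0 by rewrite fmorph_eq0.
  move: (phi (xc p')) (phi (xc O')) (xc O ^+ a) (xc q ^+ a) (yc q ^ c) => X1 X2 X3 X4 X5 *.
  by field; do ![apply/andP; split] => //.
have [al [be [Oal ube Ey]]] := unramified HO (pole_regular QO') (acts_gt0 A)
  (oncoordsP QO) (oncoordsP QO') hom2 uu Ex.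
have yO0 := pole_y0 QO.
exists O', a; split=> //; first exact: (acts_gt0 A).
- by right.
- by move=> m _; apply: local_hom_dom hom2 _; exact: (tower_le QO (leq0n m)).
- move=> m _; have [Om _] := tower_le QO (leq0n m).
  rewrite expr0z mulr1 Ex mulrC mulKf ?expf_neq0 //.
  by case: uu => ? ? ?; split=> //; exact: Om.
move=> m _ m0; have [Om _] := tower_le QO (leq0n m); have Lm := regular_loc (tower_regular QO m).
rewrite Ey (_ : _ / _ = be + (xc O / yc O ^+ m) * (yc O ^+ m.-1 * al)); last first.
  rewrite -{1}(prednK m0) exprS; have := expf_neq0 m.-1 yO0.
  by move: (yc O ^+ m.-1) => Y Y0; field; rewrite Y0 yO0.
have [mxm [Tym _] _] := tower_coords QO m; have := Om _ Oal => ?.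
apply: (unitDmax Lm); first by case: ube => ? ? ?; split=> //; exact: Om.
by apply: (maxM Lm) => //; inO Lm.
Qed.

Lemma simple_cofinite : exists L : seq (set K), forall q, pole q -> q \notin L ->
  exists q' a, acts q q' a 0 0.
Proof.
pose P p O := pole O -> O <> p -> exists q' a, acts O q' a 0 0.
have [|L [Lfin LS HL]] := @pts_compact _ _ iota S P.
  move=> O SO; case: (Soo SO) => HO; last exact: near_simple.
  apply: nearW (near_loceq eta0 HS SO divC (off_loceq SO HO)) => O' SO' L1 QO' _.
  have HO' := pole_regular QO'; have := loceq_uniq HO' (pole_loceq QO') L1.
  rewrite divr1 => u; have [mx _ _] := pole_coords QO'.
  by case: (unit_nmax u mx).
move: Lfin => /finite_seqP[l LE]; exists l => q Qq ql.
have [O LO H] := HL q Qq.1; apply: H => // E; move: ql.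
by rewrite E; move: LO; rewrite LE /= => ->.
Qed.
End Simple.

(** * Choice of the number of blowups *)

Section Levels.
(** Here [g] is the action on the polar curve, [a] and [c] are the exponents, [b q] is the level
    from which the monomial form holds, [kX q] counts the blowups already made, and [beta q]
    suffices to detach finitely many given curves. The relevant orbits start in [Bs]. *)
Variables (T : eqType) (g : T -> T) (a : T -> nat) (c : T -> int) (b kX beta : T -> nat).
Variables (L Bs : seq T).
Hypothesis a_gt0 : forall q, (0 < a q)%N.
Hypothesis simple : forall q, q \notin L -> c q = 0 /\ b q = 0%N.
Hypothesis kX_supp : forall q, kX q <> 0%N -> q \in Bs.

Let step q (k : int) := (a q)%:Z * k + c q.
Let b' q := maxn (b q) (kX q).

(** The largest level over [iter n g q] compatible with regularity along an orbit that starts at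
    level [k]; it may be negative. *)
Fixpoint orbit_level n q (k : int) : int :=
  if n is m.+1 then orbit_level m (g q) (step q k) else k.
Notation tau := orbit_level.

Lemma levelD m n q k : tau (m + n) q k = tau n (iter m g q) (tau m q k).
Proof. by elim: m q k => //= m IH q k; rewrite IH -iterSr. Qed.

Lemma levelS n q k : tau n.+1 q k = step (iter n g q) (tau n q k).
Proof. by rewrite -addn1 levelD. Qed.

Lemma level_mono n q k k' : k <= k' -> tau n q k <= tau n q k'.
Proof.
elim: n q k k' => //= n IH q k k' le; apply: IH; rewrite /step lerD2r.
by rewrite ler_wpM2l.
Qed.

Lemma level_large n q (m : int) : exists k0 : int, forall k, k0 <= k ->
  forall i, (i <= n)%N -> m <= tau i q k.
Proof.
elim: n q => [|n IH] q; first by exists m => k le [|].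
have [k0 H] := IH (g q); exists (Num.max m (Num.max 0 (Num.max 0 k0 + `|c q|))) => k.
rewrite !ge_max => /andP[le /andP[k_ge0 lek]] [|i] //= ilt; apply: H => //.
have := a_gt0 q; move: lek; rewrite /step; have := ler_norm (- c q); rewrite normrN.
move: (c q) (a q) => c0 [//|a0] nc lek _.
have k0le : k0 <= Num.max 0 k0 by rewrite le_max lexx orbT.
have : 0 <= a0%:Z * k by rewrite mulr_ge0.
have -> : a0.+1%:Z * k = a0%:Z * k + k by rewrite -addn1 PoszD mulrDl mul1r.
by move: (a0%:Z * k) (Num.max 0 k0) `|c0| k0le lek nc => X Y Z; clear; lia.
Qed.

Let L' := L ++ Bs.

Lemma b'_supp q : q \notin L' -> b' q = 0%N /\ c q = 0.
Proof.
rewrite mem_cat negb_or => /andP[/simple[-> bq] qB]; split=> //; rewrite /b' bq max0n.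
by case: (kX q =P 0%N) => // /kX_supp; rewrite (negPf qB).
Qed.

Lemma b'_bound : exists M : nat, forall q, (b' q <= M)%N.
Proof.
exists (\max_(q <- L') b' q) => q; have [qL|/b'_supp[-> //]] := boolP (q \in L').
exact: leq_bigmax_seq.
Qed.

Definition admissible q (k : int) := forall n, (b' (iter n g q))%:Z <= tau n q k.
Definition stable q := exists k, admissible q k.

Lemma admissible_ge0 q k : admissible q k -> 0 <= k.
Proof. by move=> /(_ 0%N) /=; apply: le_trans. Qed.

Lemma admissible_step q k : admissible q k -> admissible (g q) (step q k).
Proof. by move=> H n; have := H n.+1; rewrite iterSr. Qed.

(** As [a] is positive, a large initial level makes the first [n] levels exceed the bound for [b']
    and reaches [iter n g q] above its admissible level. *)
Lemma stable_back n q : stable (iter n g q) -> stable q.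
Proof.
move=> [k1 H1]; have [M HM] := b'_bound.
have [k H] := level_large n q (Num.max M%:Z k1); exists k => m.
have [le|lt] := leqP m n.
  have := H k (lexx _) m le; rewrite ge_max => /andP[h _]; apply: le_trans h.
  by rewrite lez_nat.
rewrite -(subnKC (ltnW lt)) levelD addnC iterD; apply: le_trans (H1 _) _.
by apply: level_mono; have := H k (lexx _) n (leqnn _); rewrite ge_max => /andP[].
Qed.

Lemma stable_simple q n0 : (forall n, (n0 <= n)%N -> iter n g q \notin L') -> stable q.
Proof.
move=> H; apply: (@stable_back n0); exists 0 => n.
have z m : tau m (iter n0 g q) 0 = 0.
  elim: m => // m IH; rewrite levelS IH /step mulr0 add0r -iterD.
  by have [_ ->] := b'_supp (H (m + n0)%N (leq_addl _ _)).
by rewrite z -iterD; have [-> _] := b'_supp (H (n + n0)%N (leq_addl _ _)).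
Qed.

Lemma bounded_prefix (f : nat -> int) n : exists Bd, forall i, (i < n)%N -> f i <= Bd.
Proof.
elim: n => [|n [Bd H]]; first by exists 0.
exists (Num.max Bd (f n)) => i; rewrite ltnS leq_eqVlt le_max => /orP[/eqP->|/H ->//].
by rewrite lexx orbT.
Qed.

(** The return map [tau P q] is nondecreasing. If some large [k] is at most its image, iteration
    never descends below [k]; otherwise every large [k1] is above its image, and the levels stay
    bounded. *)
Lemma periodic_level q P : (0 < P)%N -> iter P g q = q ->
  stable q \/ forall k, exists Bd, forall n, tau n q k <= Bd.
Proof.
move=> P0 per; have [M HM] := b'_bound; have [k0 Hk0] := level_large P q M%:Z.
have iterP m : iter (P * m) g q = q.
  by elim: m => [|m IH]; rewrite ?muln0 // mulnS iterD IH per.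
have split_n n q1 k : iter P g q1 = q1 -> tau n q k = tau (n %% P) q (tau (P * (n %/ P)) q k).
  by move=> _; rewrite {1}(divn_eq n P) mulnC levelD iterP.
have [[k [lek Uk]]|nU] := pselect (exists k, k0 <= k /\ k <= tau P q k).
  left; exists k => n; rewrite (split_n n q k per).
  apply: (@le_trans _ _ M%:Z); first by rewrite lez_nat.
  have up m : k <= tau (P * m) q k.
    elim: m => [|m IH]; first by rewrite muln0.
    by rewrite mulnS levelD per; apply: le_trans IH (level_mono _ _ Uk).
  apply: le_trans (level_mono _ _ (up _)).
  by apply: Hk0 => //; rewrite ltnW // ltn_mod.
right=> k; pose k1 := Num.max k k0.
have Uk1 : tau P q k1 <= k1.
  by rewrite leNgt; apply/negP => lt; apply: nU; exists k1; rewrite le_max lexx orbT ltW.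
have [Bd HBd] := bounded_prefix (fun i => tau i q k1) P; exists Bd => n.
apply: (@le_trans _ _ (tau n q k1)); first by apply: level_mono; rewrite le_max lexx.
rewrite (split_n n q k1 per); apply: le_trans (HBd _ (ltn_pmod n P0)).
apply: level_mono; move: (n %/ P)%N => m; elim: m => [|m IH]; first by rewrite muln0.
by rewrite mulnS levelD per; apply: le_trans (level_mono _ _ Uk1) IH.
Qed.

Lemma infinitely_often (f : nat -> T) (s : seq T) :
  (forall n0, exists2 n, (n0 <= n)%N & f n \in s) ->
  exists x, forall n0, exists2 n, (n0 <= n)%N & f n = x.
Proof.
elim: s => [|x s IH] H; first by have [] := H 0%N.
have [Hx|/existsNP[n1 nx]] := pselect (forall n0, exists2 n, (n0 <= n)%N & f n = x).
  by exists x.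
apply: IH => n0; have [n] := H (maxn n0 n1); rewrite geq_max => /andP[l0 l1].
rewrite inE => /orP[/eqP E|fs]; last by exists n.
by case: nx; exists n.
Qed.

(** An orbit that visits the finite list [L'] infinitely often returns to one of its points, and is
    eventually periodic. *)
Lemma orbit_dichotomy q : (exists n1 P, (0 < P)%N /\ iter P g (iter n1 g q) = iter n1 g q) \/
  exists n0, forall n, (n0 <= n)%N -> iter n g q \notin L'.
Proof.
have [H|/existsNP[n0 H]] :=
  pselect (forall n0, exists2 n, (n0 <= n)%N & iter n g q \in L'); last first.
  by right; exists n0 => n le; apply/negP => qL; apply: H; exists n.
left; have [x Hx] := infinitely_often H.
have [n1 _ E1] := Hx 0%N; have [n2 lt E2] := Hx n1.+1.
exists n1, (n2 - n1)%N; rewrite subn_gt0 lt; split=> //.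
by rewrite -iterD subnK ?E1 // ltnW.
Qed.

Lemma orbit_finite q n1 P : (0 < P)%N -> iter P g (iter n1 g q) = iter n1 g q ->
  forall n, exists2 i, (i < n1 + P)%N & iter n g q = iter i g q.
Proof.
move=> P0 per; elim/ltn_ind => n IH; have [lt|le] := ltnP n (n1 + P); first by exists n.
have [|i ilt E] := IH (n - P)%N; first by clear -P0 le; lia.
exists i => //; rewrite -E; set d := (n - P - n1)%N.
have [E1 E2] : n = (d + (P + n1))%N /\ (n - P)%N = (d + n1)%N by rewrite /d; clear -le; split; lia.
by rewrite E2 {1}E1 !iterD per.
Qed.

Lemma unstable_bounded q : ~ stable q -> forall k, exists Bd, forall n, tau n q k <= Bd.
Proof.
move=> ns k; case: (orbit_dichotomy q) => [[n1 [P [P0 per]]]|[n0 H]]; last first.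
  by case: ns; exact: stable_simple H.
case: (periodic_level P0 per) => [/stable_back //|H].
have [Bd HBd] := H (tau n1 q k); have [Bd' HBd'] := bounded_prefix (fun i => tau i q k) n1.
exists (Num.max Bd Bd') => n; rewrite le_max; have [lt|le] := ltnP n n1.
  by rewrite HBd' ?orbT.
by rewrite -(subnKC le) levelD HBd.
Qed.

Let F q := exists2 p, p \in Bs & exists n, q = iter n g p.
Let beta' q := maxn (beta q) (kX q).
(** The least such [m] is the level of an unstable point. If positive it is attained by some
    starting point, so its image under [step] is again below the bound at [g q]. *)
Let bound q (m : nat) := forall p n, p \in Bs -> ~ stable p -> iter n g p = q ->
  tau n p (beta' p)%:Z <= m%:Z.

Lemma bound_exists q : exists m, bound q m.
Proof.
rewrite /bound; elim: Bs => [|p s [m H]]; first by exists 0%N.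
have [sp|nsp] := pselect (stable p).
  by exists m => p' n; rewrite inE => /orP[/eqP -> /(_ sp)//|/H]; exact.
have [Bd HBd] := unstable_bounded nsp (beta' p)%:Z.
exists (maxn m `|Bd|%N) => p' n; rewrite inE => /orP[/eqP ->|ps] ns E.
  by apply: le_trans (HBd n) _; lia.
by apply: le_trans (H p' n ps ns E) _; lia.
Qed.

Let least (A : nat -> Prop) : nat :=
  if pselect (exists n, `[< A n >]) is left H then ex_minn H else 0%N.

Lemma leastP (A : nat -> Prop) : (exists n, A n) -> A (least A) /\ forall n, A n -> (least A <= n)%N.
Proof.
move=> [n An]; rewrite /least; case: pselect => [H|[]]; last by exists n; apply/asboolP.
by case: ex_minnP => m /asboolP Am Hm; split=> // n' An'; apply: Hm; apply/asboolP.
Qed.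

(** The smallest admissible level is taken at stable points, the largest level transported from an
    unstable starting point at the others, and 0 outside the forward orbits of [Bs]. *)
Let level q : nat := if `[< F q >] then
  if `[< stable q >] then least (fun k => admissible q k%:Z) else least (bound q) else 0%N.

Lemma stable_step q : stable q -> stable (g q).
Proof. by move=> [k Hk]; exists (step q k); exact: admissible_step. Qed.

Lemma stable_nat q : stable q -> exists k : nat, admissible q k%:Z.
Proof. by move=> [k Hk]; have := admissible_ge0 Hk; case: k Hk => // k Hk _; exists k. Qed.

Lemma F_step q : F q -> F (g q).
Proof. by move=> [p pB [n ->]]; exists p => //; exists n.+1. Qed.

Lemma bound_attained q : (0 < least (bound q))%N -> exists p n, [/\ p \in Bs, ~ stable p,
  iter n g p = q & tau n p (beta' p)%:Z = (least (bound q))%:Z].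
Proof.
move=> m0; have [Hm Hmin] := leastP (bound_exists q).
have : ~ bound q (least (bound q)).-1 by move=> /Hmin; rewrite leqNgt ltn_predL m0.
move=> /existsNP[p /existsNP[n /not_implyP[pB /not_implyP[ns /not_implyP[E /negP nle]]]]].
exists p, n; split=> //; have := Hm p n pB ns E; move: nle; rewrite -ltNge.
by move: m0; case: (least (bound q)) => // m _ /=; lia.
Qed.

Lemma choose_levels : exists (k : T -> nat) (Z : T -> Prop) (l : seq T),
  [/\ forall q, k q <> 0%N -> q \in l, forall q, (kX q <= k q)%N,
      forall q, Z q -> [/\ Z (g q), (b q <= k q)%N & (k (g q))%:Z <= (a q)%:Z * (k q)%:Z + c q],
      forall q, q \in Bs -> ~ Z q -> (beta q <= k q)%N &
      forall q, (0 < k q)%N -> ~ Z (g q) -> (a q)%:Z * (k q)%:Z + c q <= (k (g q))%:Z].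
Proof.
have FB q : q \in Bs -> F q by move=> qB; exists q => //; exists 0%N.
have levelZ q : F q -> stable q -> admissible q (level q)%:Z /\
    forall n : nat, admissible q n%:Z -> (level q <= n)%N.
  move=> Fq sq; rewrite /level (asboolT Fq) (asboolT sq).
  exact: (leastP (stable_nat sq)).
have levelN q : F q -> ~ stable q -> level q = least (bound q).
  by move=> Fq nsq; rewrite /level (asboolT Fq) (asboolF nsq).
have b'0 q : F q -> stable q -> (b' q <= level q)%N.
  by move=> Fq sq; have [/(_ 0%N)] := levelZ q Fq sq.
have beta'0 q : q \in Bs -> ~ stable q -> (beta' q <= level q)%N.
  move=> qB nsq; rewrite levelN //; last exact: FB.
  by have [H _] := leastP (bound_exists q); have := H q 0%N qB nsq (erefl _).
have pos q : (0 < level q)%N -> F q.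
  by rewrite /level; case: asboolP.
have [l Hl] : exists l : seq T, forall q, level q <> 0%N -> q \in l.
  suff [l Hl] : exists l : seq T, forall p n, p \in Bs -> level (iter n g p) <> 0%N -> iter n g p \in l.
    exists l => q lq; have [|p pB [n E]] := pos q; first by rewrite lt0n; exact/eqP.
    by rewrite E in lq *; exact: Hl.
  have FB' p n : p \in Bs -> F (iter n g p) by move=> pB; exists p => //; exists n.
  elim: {1 3}(Bs) (fun p (H : p \in Bs) => H) => [|p s IH] sB; first by exists [::].
  have [l Hl] : exists l : seq T, forall p n, p \in s -> level (iter n g p) <> 0%N -> iter n g p \in l.
    by apply: IH => p' sp'; apply: sB; rewrite inE sp' orbT.
  have pB := sB p (mem_head _ _).
  have [N HN] : exists N, forall n, level (iter n g p) <> 0%N ->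
      exists2 i, (i < N)%N & iter n g p = iter i g p.
    case: (orbit_dichotomy p) => [[n1 [P [P0 per]]]|[n0 H]].
      by exists (n1 + P)%N => n _; exact: orbit_finite.
    exists n0 => n ln; have [lt|le] := ltnP n n0; first by exists n.
    case: ln; apply/eqP; rewrite -leqn0.
    have H' m : iter m g (iter n g p) \notin L'.
      by rewrite -iterD; apply: H; apply: leq_trans le (leq_addl _ _).
    have sq : stable (iter n g p) by apply: (stable_simple (n0 := 0)).
    have [_ Hmin] := levelZ _ (FB' p n pB) sq; apply: Hmin => m.
    have z j : tau j (iter n g p) 0 = 0.
      elim: j => // j IHj; rewrite levelS IHj /step mulr0 add0r.
      by have [_ ->] := b'_supp (H' j).
    by rewrite z; have [-> _] := b'_supp (H' m).
  exists ([seq iter i g p | i <- seq.iota 0 N] ++ l) => p' n; rewrite inE mem_cat.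
  move=> /orP[/eqP -> /HN[i iN ->]|sp' ln]; last by rewrite (Hl p' n) ?orbT.
  by apply/orP; left; apply/mapP; exists i => //; rewrite mem_iota.
exists level, (fun q => F q /\ stable q), l; split=> //.
- move=> q; have [-> //|/eqP/kX_supp qB] := eqVneq (kX q) 0%N.
  have [sq|nsq] := pselect (stable q).
    by apply: leq_trans (b'0 q (FB q qB) sq); rewrite leq_maxr.
  by apply: leq_trans (beta'0 q qB nsq); rewrite leq_maxr.
- move=> q [Fq sq]; have [Fg sg] := (F_step Fq, stable_step sq).
  split=> //; first by apply: leq_trans (b'0 q Fq sq); rewrite leq_maxl.
  have [adm _] := levelZ q Fq sq; have adm' := admissible_step adm.
  have := admissible_ge0 adm'; move: adm'; rewrite -/(step q _); case: (step q _) => // n adm' _.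
  by rewrite lez_nat; have [_] := levelZ _ Fg sg; apply.
- move=> q qB nZ; apply: leq_trans (beta'0 q qB _); first by rewrite leq_maxl.
  by move=> sq; apply: nZ; split=> //; exact: FB.
- move=> q lq nZ; have Fq := pos q lq; have nsg : ~ stable (g q).
    by move=> sg; apply: nZ; split=> //; exact: F_step.
  have nsq : ~ stable q by move=> /stable_step.
  rewrite (levelN q Fq nsq) in lq *; rewrite (levelN _ (F_step Fq) nsg).
  have [p [n [pB ns E <-]]] := bound_attained lq.
  have [H _] := leastP (bound_exists (g q)); have := H p n.+1 pB ns.
  by rewrite levelS iterS E; apply.
Qed.
End Levels.

(** * Stability *)

Section Stability.
Variables (R : realType) (K : fieldType) (iota : {rmorphism R[i] -> K}).
Notation regular := (regular iota).
Notation pts := (pts iota).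
Notation smooth := (smooth_surface iota).
Implicit Types (O W q : set K) (X Y S : model K) (V : K -> int).

Variables (eta : two_form K) (D1 D2 : K -> K).
Hypotheses (HD1 : derivation iota D1) (HD2 : derivation iota D2).
Hypothesis theta0 : form_eval eta D1 D2 != 0.
Let eta0 := eta_neq0 HD1 HD2 theta0.
Notation J := (jac D1 D2).
Notation dens := (dens eta D1 D2).
Notation off := (off eta D1 D2).
Notation on := (on eta D1 D2).
Notation xc q := (oncoords eta D1 D2 q).1.
Notation yc q := (oncoords eta D1 D2 q).2.
Notation tower := (tower eta D1 D2).

Variables (S : model K) (HS : smooth S).
Notation pole := (pole iota eta D1 D2 S).
Hypothesis Soo : forall O, pts S O -> off O \/ on O.

Variables (phi : {rmorphism K -> K}) (delta : R[i]).
Hypothesis phic : over_const iota phi.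
Hypothesis delta0 : delta != 0.
Hypothesis key : forall O s t, regular O -> coords O s t ->
  phi (dens s t) * J (phi s) (phi t) = iota delta * form_eval eta D1 D2.

Let tower_regular := tower_regular HD1 HD2 theta0 HS.
Let tower_coords := tower_coords HD1 HD2 theta0 HS.
Let tower_le := tower_le HD1 HD2 theta0 HS.
Let pole_x0 := pole_x0 HD1 HD2 theta0 HS.
Let pole_y0 := pole_y0 HD1 HD2 theta0 HS.
Let pole_coords := pole_coords HD1 HD2 theta0 HS.
Let pole_regular := pole_regular HD1 HD2 theta0 HS.

Notation acts := (acts iota eta D1 D2 S phi).
Notation modification := (modification iota).
Notation blown := (blown iota eta D1 D2 S).

Variable C : (K -> int) -> int.
Hypothesis divC : divisor iota S C.
Hypothesis Cdens : forall O V s t, pts S O -> curve_at O V -> coords O s t -> C V = - V (dens s t).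

(* [phi] maps the curve [V] to the point [O]. *)
Definition contracts V O := (forall b, O b -> 0 <= V (phi b)) /\
  forall b, maxid O b -> b != 0 -> 0 < V (phi b).

Lemma contracts_dominated V O W : contracts V W -> dominates O W -> contracts V O.
Proof. by move=> [H1 H2] [OW mW]; split=> b; [move/OW/H1|move=> /mW/H2]. Qed.

Lemma contracts_uniq V q q' : normalized_valuation V -> pts S q -> pts S q' ->
  contracts V q -> contracts V q' -> q = q'.
Proof.
move=> n Sq Sq' H H'; pose W b := 0 <= V (phi b).
have dom O : contracts V O -> dominates O W.
  move=> [H1 H2]; split=> // b mb; split; first exact: H1 _ (max_loc mb).
  have [->|b0] := eqVneq b 0; [by left|right].
  rewrite /W fmorphV (nvalV n) ?fmorph_eq0 //; have := H2 b mb b0.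
  by move: (V _) => v; clear; lia.
exact: (pts_dominates_eq Sq Sq' (dom _ H) (dom _ H')).
Qed.

(** By compactness, finitely many functions [xc p] serve as equations of the polar curve near all
    its points. A curve contracted to this curve is among the finitely many along which some
    [phi (xc p)] vanishes. *)
Lemma contracted_finite : exists vs : seq (K -> int), forall V q,
  prime_divisor iota S V -> pole q -> contracts V q -> V \in vs.
Proof.
pose P p O := pole O -> pole p /\ maxid O (xc p).
have [|L [Lfin LS HL]] := @pts_compact _ _ iota S P.
  move=> O SO; case: (Soo SO) => HO.
    apply: nearW (near_loceq eta0 HS SO divC (off_loceq Cdens SO HO)) => O' SO' L1 QO'.
    have HO' := pole_regular QO'; have [mx _ _] := pole_coords QO'.
    have := loceq_uniq HO' (pole_loceq HD1 HD2 theta0 HS Cdens QO') L1.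
    by rewrite divr1 => u; case: (unit_nmax u mx).
  have QO : pole O by split.
  apply: nearW (near_loceq eta0 HS SO divC (pole_loceq HD1 HD2 theta0 HS Cdens QO)) => O' SO' L1 QO'.
  by split=> //; exact: (pole_equation_max HD1 HD2 theta0 HS Cdens QO L1 QO').
move: Lfin => /finite_seqP[l LE].
suff [vs Hvs] : exists vs : seq (K -> int), forall p V, p \in l -> pole p ->
    prime_divisor iota S V -> V (phi (xc p)) <> 0 -> V \in vs.
  exists vs => V q HV Qq [_ H]; have [p Lp HP] := HL q Qq.1; have [Qp mx] := HP Qq.
  apply: (Hvs p) => //; first by move: Lp; rewrite LE.
  by have := H _ mx (pole_x0 Qp); move: (V _) => v; clear; lia.
elim: (l) => [|p l' [vs Hvs]]; first by exists [::].
have [Qp|nQp] := pselect (pole p); last first.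
  by exists vs => p' V; rewrite inE => /orP[/eqP -> /nQp//|]; exact: Hvs.
have px0 : phi (xc p) != 0 by rewrite fmorph_eq0; exact: pole_x0.
have /finite_seqP[us usE] := finite_divisor eta0 HS px0.
exists (us ++ vs) => p' V; rewrite inE mem_cat => /orP[/eqP -> _ HV Vx|lp Qp' HV Vx].
  apply/orP; left; have : [set` us] V by rewrite -usE.
  by [].
by rewrite (Hvs p') ?orbT.
Qed.

Lemma choose_acts : exists (g : set K -> set K) (a : set K -> nat) (c : set K -> int)
    (b : set K -> nat) (L : seq (set K)),
  [/\ forall q, (0 < a q)%N, forall q, q \notin L -> c q = 0 /\ b q = 0%N &
      forall q, pole q -> acts q (g q) (a q) (c q) (b q)].
Proof.
have [L HL] := simple_cofinite HD1 HD2 theta0 HS Soo phic delta0 key divC Cdens.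
pose P q (z : set K * nat * int * nat) := [/\ (0 < z.1.1.2)%N,
  q \notin L -> z.1.2 = 0 /\ z.2 = 0%N & pole q -> acts q z.1.1.1 z.1.1.2 z.1.2 z.2].
have /choice[f Hf] q : exists z, P q z.
  have [Qq|nQ] := pselect (pole q); last by exists (q, 1%N, 0, 0%N).
  have [qL|qL] := boolP (q \in L).
    have [q' [a [c [k0 A]]]] := pole_acts HD1 HD2 theta0 HS Soo phic delta0 key Qq.
    by exists (q', a, c, k0); split=> //= [|/negP//]; exact: (acts_gt0 A).
  have [q' [a A]] := HL q Qq qL; exists (q', a, 0, 0%N); split=> //=; exact: (acts_gt0 A).
exists (fun q => (f q).1.1.1), (fun q => (f q).1.1.2), (fun q => (f q).1.2), (fun q => (f q).2), L.
by split=> q; case: (Hf q).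
Qed.

Lemma blown_levels X (lX : seq (set K)) (k : set K -> nat) (l : seq (set K)) :
  blown X (fun q => count_mem q lX) ->
  (forall q, k q <> 0%N -> q \in l) -> (forall q, (count_mem q lX <= k q)%N) ->
  exists Y k', [/\ modification X Y, blown Y k' & forall q, pole q -> k' q = k q].
Proof.
move=> BX kl le; pose m := flatten [seq nseq (k q - count_mem q lX) q | q <- undup l & `[< pole q >]].
have mQ q : q \in m -> pole q.
  move=> /flattenP[_ /mapP[q' + ->]]; rewrite mem_filter => /andP[/asboolP Qq' _].
  by rewrite mem_nseq => /andP[_ /eqP ->].
have [Y M BY] := blown_seq HD1 HD2 theta0 HS BX mQ.
exists Y, (fun q => count_mem q lX + count_mem q m)%N; split=> // q Qq.
suff -> : count_mem q m = (k q - count_mem q lX)%N by rewrite subnKC.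
have E (s : seq (set K)) : uniq s -> count_mem q (flatten [seq nseq (k q - count_mem q lX) q | q <- s]) =
    if q \in s then (k q - count_mem q lX)%N else 0%N.
  elim: s => //= q' s IH /andP[q's us]; rewrite count_cat count_nseq IH // in_cons /=.
  have [E|ne] := eqVneq q q'; last by rewrite mul0n.
  by rewrite -E in q's *; rewrite (negPf q's) mul1n addn0.
rewrite E ?filter_uniq ?undup_uniq // mem_filter asboolT // mem_undup.
case: ifP => // /negP nl; have [->|/eqP/kl//] := eqVneq (k q) 0%N.
by rewrite sub0n.
Qed.

Theorem elaboration_stable X : elaboration iota S eta X ->
  exists2 Y, elaboration iota X eta Y & algebraically_stable iota Y phi.
Proof.
move=> /(elaboration_blown HD1 HD2 theta0 HS Soo)[lX lXQ BX].
have [g [a [c [b [L [a0 cb A]]]]]] := choose_acts.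
have [vs0 Hvs0] := contracted_finite.
(* The exceptional curves below the level [b p] are not covered by the monomial form. Like the
   contracted curves of [S], they are detached by brute force. *)
pose vs := vs0 ++ [seq ordm (tower p j) | p <- L, j <- seq.iota 0 (b p)].
pose land V : set K := epsilon (inhabits set0) (fun q => pole q /\ contracts V q).
have landP V q : normalized_valuation V -> pole q -> contracts V q -> land V = q.
  move=> n Qq H; have [Q1 H1] := epsilon_spec (inhabits set0) (fun q => pole q /\ contracts V q)
    (ex_intro _ q (conj Qq H)).
  exact: (contracts_uniq n Q1.1 Qq.1 H1 H).
pose Bs := lX ++ [seq land V | V <- vs].
pose beta q := (\max_(V <- vs) `|V (phi (xc q))|)%N.
have kXB q : count_mem q lX <> 0%N -> q \in Bs.
  by move=> /eqP; rewrite -lt0n -has_count has_pred1 mem_cat => ->.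
have [k [Z [l [kl leX HZ Hbeta Hlev]]]] := choose_levels g beta a0 cb kXB.
have [Y [k' [M BY k'E]]] := blown_levels BX kl leX.
have nz := blown_no_zeros HD1 HD2 theta0 HS BY; exists Y => //.
have [HY _ Ya Yb Yc] := BY.
apply: (stable_criterion eta0 (Z := fun O => exists q, [/\ pole q, Z q & O = tower q (k' q)]) HY phic).
- by move=> psi psic; exact: (map_resolvable eta0 HY psic).
- move=> V O HV YO H1 H2; have [O1 YO1 HV1] := (prime_divisorP iota Y V).1 HV.
  have [n _ _] := HV1; have HO1 := pts_regular eta0 HY YO1; have HO := pts_regular eta0 HY YO.
  have oo1 : on O1 \/ off O1.
    by case: (Yb O1 YO1) => [|[q Qq ->]]; [right|left; exact: (tower_on HD1 HD2 theta0 HS _ Qq)].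
  case: (Yb O YO) => [offO|[q Qq OE]].
    by case: (contracted_not_off HD1 HD2 theta0 phic delta0 key HO HO1 oo1 HV1 offO H2).
  exists q; split=> //; apply: contrapT => nZ.
  have cT : contracts V (tower q (k' q)) by rewrite -OE; split.
  have cq : contracts V q := contracts_dominated cT (tower_le Qq (leq0n _)).
  have [x0 y0] := (pole_x0 Qq, pole_y0 Qq); have [px0 py0] : phi (xc q) != 0 /\ phi (yc q) != 0.
    by rewrite !fmorph_eq0.
  (* Contraction to level [k' q] makes both [xc q / yc q ^+ k' q] and [yc q] vanish along [V]. This
     is why a level of at least [beta q] detaches the curves in [vs]. *)
  have ltV : (k' q)%:Z < V (phi (xc q)).
    have [mx my _] := tower_coords Qq (k' q); have yk0 := expf_neq0 (k' q) y0.
    have Vy := cT.2 _ my y0; have := cT.2 _ mx; rewrite mulf_neq0 ?invr_eq0 // => /(_ isT).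
    rewrite fmorph_div rmorphXn (nval_div n) ?expf_neq0 // (nvalX n) //.
    by move: (V (phi (xc q))) (V (phi (yc q))) Vy => v w w0; nia.
  have nvs : V \notin vs.
    apply/negP => Vvs; have qB : q \in Bs.
      by rewrite mem_cat -(landP V q n Qq cq) map_f ?orbT.
    have := Hbeta q qB nZ; rewrite -(k'E q Qq) => le.
    have : (`|V (phi (xc q))| <= beta q)%N by exact: (@leq_bigmax_seq _ vs xpredT (fun V => `|V (phi (xc q))|%N) V Vvs isT).
    by move: ltV le; move: (V _) (beta q) (k' q) => v bt kq; clear; lia.
  case: (Yc V HV) => [SV|[p [j [Qp jk VE]]]].
    by case/negP: nvs; rewrite mem_cat (Hvs0 V q).
  have bj : (b p <= j)%N.
    rewrite leqNgt; apply/negP => jb; case/negP: nvs; rewrite mem_cat; apply/orP; right.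
    rewrite VE; apply: allpairs_f_dep; last by rewrite mem_iota.
    by apply: contraT => /cb[_ bp]; rewrite bp in jb.
  have Ap := A p Qp; have Qg := acts_pole Ap.
  have [Vx _ Vge] := acts_landing HD1 HD2 theta0 HS Qp Ap (leqW bj).
  have [hj mj] := acts_hom Ap bj; have HTj := tower_regular Qp j.
  have cg : contracts V (g p).
    split=> [d gd|d md d0]; first by rewrite VE; exact: Vge.
    by rewrite VE; apply: (ordm_gt0 HTj (mj _ md)); rewrite fmorph_eq0.
  have qE := contracts_uniq n Qq.1 Qg.1 cq cg.
  have kp : (0 < k p)%N by rewrite -k'E //; exact: leq_ltn_trans jk.
  have := Hlev p kp; rewrite -qE => /(_ nZ).
  rewrite -(k'E p Qp) -(k'E q Qq); move: ltV; rewrite VE {2}qE Vx => ltV le.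
  (* The exceptional curve lands with order [a * j.+1 + c], at most [a * k' p + c] as [j < k' p],
     hence at most the level of [q]: this contradicts [ltV]. *)
  by have := a0 p; move: ltV le jk; move: (a p) (k' p) (k' q) (c p) => ap kp' kq cp; clear; nia.
- move=> O [q [Qq Zq ->]]; have [Zg bk kg] := HZ q Zq; have Ap := A q Qq.
  have Qg := acts_pole Ap; exists (tower (g q) (k' (g q))); split; [by exists (g q)|exact: Ya|].
  by apply: (acts_regular HD1 HD2 theta0 HS phic Qq Ap); rewrite !k'E.
Qed.
End Stability.

(** The constant [c] is the quotient of [c * G] by [G], for a form [G] that does not vanish at the
    generic point. *)
Lemma comorphism_const (R : realType) (K : fieldType) (iota : {rmorphism R[i] -> K}) (S : model K)
  (f : 'rV[K]_(rank S)) (phi : {rmorphism K -> K}) :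
  has_function_field iota S -> comorphism iota S f phi -> over_const iota phi.
Proof.
move=> HF Hphi c; have [d [F [G [_ hG G0 _]]]] := HF 1.
have hcG : (c%:MP * G)%R \is d.-homog by rewrite mul_mpolyC dhomogZ.
have [iG0 E] := Hphi d _ G hcG hG G0.
have E1 : at_gen iota (c%:MP * G)%R = iota c * at_gen iota G by rewrite /at_gen rmorphM /= mmapC.
have E2 : at_image iota f (c%:MP * G)%R = iota c * at_image iota f G.
  by rewrite /at_image rmorphM /= mmapC.
by move: E; rewrite E1 E2 !mulfK.
Qed.

Theorem corollary8p1 (R : realType) (K : fieldType)
    (iota : {rmorphism R[i] -> K}) (S : model K)
    (hS : smooth_surface iota S)
    (eta : two_form K) (heta : ~ form_eq iota eta [::])
    (C : (K -> int) -> int) (hC : reduced_smooth_curve iota S C)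
    (hdiv : forall v : K -> int, - form_div iota S eta v = C v)
    (f : 'rV[K]_(rank S)) (hf : rational_map iota S f)
    (hpres : preserves iota S eta f) :
  corrigible iota S eta f.
Proof.
have [D1 [D2 [HD1 HD2 theta0]]] : exists D1 D2, [/\ derivation iota D1, derivation iota D2 &
    form_eval eta D1 D2 != 0].
  apply: contrapT => H; apply: heta => d1 d2 Hd1 Hd2; rewrite [RHS]/form_eval big_nil.
  by apply/eqP; apply: contraT => n0; case: H; exists d1, d2.
have eta0 := eta_neq0 HD1 HD2 theta0.
have [phi [delta [Hphi delta0 Hpull]]] := hpres; exists phi => //.
have [hF _ _] := hS; have phic := comorphism_const hF Hphi.
have key O s t : regular iota O -> coords O s t ->
    phi (dens eta D1 D2 s t) * jac D1 D2 (phi s) (phi t) = iota delta * form_eval eta D1 D2.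
  move=> HO Cst; have := Hpull D1 D2 HD1 HD2.
  rewrite (pullback_formE HD1 HD2 theta0 (regular_reg HO) Cst) // => ->.
  rewrite /form_eval /form_scale big_map mulr_sumr; apply: eq_bigr => -[[u v] w] _ /=.
  by rewrite mulrA.
have [divC C01 Csm] := hC.
have Cdens O V s t : pts iota S O -> curve_at O V -> coords O s t -> C V = - V (dens eta D1 D2 s t).
  by move=> SO HV Cst; rewrite -hdiv (form_divE HD1 HD2 theta0 hS SO HV Cst).
(* On the polar curve, the equation of [C] extends to coordinates, and its product with the density
   of [eta] has order 0 along all curves through the point. At other points the density itself has
   this property. *)
have Soo O : pts iota S O -> off eta D1 D2 O \/ on eta D1 D2 O.
  move=> SO; have HO := pts_regular eta0 hS SO; have [p Hp OE] := SO.
  have [[V [HV CV]]|nV] := pselect (exists V, curve_at O V /\ C V = 1); [right|left].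
    have HV' : curve_through iota S p V by apply/(curve_atP Hp); rewrite -OE.
    have [s [t [/(coordsP Hp) Cst /(loceqP C s Hp) [s0 Hs]]]] := Csm p V HV' CV.
    rewrite -OE in Cst Hs; exists s, t; split=> //.
    have d0 := dens_neq0 HD1 HD2 theta0 HO Cst.
    apply: (unit_of_curves HO); first by rewrite mulf_neq0.
    move=> U HU; have [n _ _] := HU.
    by rewrite (nvalM n) // Hs // (Cdens O U s t) // addNr.
  have [s [t Cst]] := reg_coords (regular_reg HO); exists s, t; split=> //.
  apply: (unit_of_curves HO); first exact: (dens_neq0 HD1 HD2 theta0 HO Cst).
  move=> U HU; apply/eqP; rewrite -oppr_eq0 -(Cdens O U s t) //.
  by case: (C01 U) => [->//|C1]; case: nV; exists U.
move=> X; exact: (elaboration_stable HD1 HD2 theta0 hS Soo phic delta0 key divC Cdens).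
Qed.
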